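(* Let $k\ge1$ be an integer. Assume that the exact solution of the Einstein--scalar system described in the context satisfies $$u\in L^\infty(0,T;W^{k+1,\infty}(0,b))\quad\text{and}\quad u_t\in L^\infty(0,T;H^{k+1}(0,b)),$$ and consider the semidiscrete HDG solution on $[0,T]$ with boundary datum $U_b$ and initial data $u_h(0)=\Pi u(0)$. Define the mass aspects $$\mathcal M(t,r):=\frac r2\left(1-\frac{\tilde g(t,r)}{g(t,r)}\right),\qquad m_h(t,r):=\frac r2\left(1-\frac{\tilde g_h(t,r)}{g_h(t,r)}\right),$$ and the Bondi masses $M(t):=\mathcal M(t,b)$, $M_h(t):=m_h(t,b)$. Then there exist $h_0>0$ and a constant $C>0$, independent of $h$, such that for all $0<h\le h_0$, $$\sup_{0\le t\le T}|M(t)-M_h(t)|\le Ch^{k+1}.$$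
   Context: Exact system. Let $b>0$, $T>0$. The exact solution $(u,w,g,z)$ on $[0,T]\times[0,b]$ satisfies $$u_t-\bigl(\tfrac12\tilde g\,u\bigr)_r=-\tfrac12\tilde g_r\,\tilde u,\qquad w_r=u,\qquad g_r=\tfrac1r\,g\,(u-\tilde u)^2,\qquad z_r=g,$$ with $\tilde u=w/r$, $\tilde g=z/r$ for $r>0$, center conditions $w(t,0)=0$, $z(t,0)=0$, and outer conditions $u(t,b)=U_b(t)$, $g(t,b)=1$. Equivalently $\tilde u(r)=\frac1r\int_0^ru\,ds$, $\tilde g(r)=\frac1r\int_0^rg\,ds$, $g(r)=\exp(-\int_r^b\frac1s(u-\tilde u)^2ds)$. Mesh and spaces. Let $0=r_0<r_1<\dots<r_N=b$ be a partition of $[0,b]$, $I_i=(r_{i-1},r_i)$, $h_i=r_i-r_{i-1}$, $h=\max_ih_i$, $\mathcal T_h=\{I_i\}_{i=1}^N$. $P^k(I_i)$ denotes polynomials of degree at most $k$ on $I_i$ and $V_h^k=\{v\in L^2(0,b):v|_{I_i}\in P^k(I_i),\ i=1,\dots,N\}$. The value $v|_{I_i}(r_j)$, $j\in\{i-1,i\}$, is taken from within $I_i$. Write $(v_1,v_2)_{I_i}=\int_{I_i}v_1v_2\,dr$, $\langle\psi,\eta\,n\rangle_{\partial I_i}=\psi(r_i)\eta(r_i)-\psi(r_{i-1})\eta(r_{i-1})$ with values from within $I_i$. $r$-derivatives of broken functions are taken elementwise. Projection. On each $I_i$, $\Pi u\in P^k(I_i)$ is the Gauss--Radau projection defined by $(\Pi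 u-u,v)_{I_i}=0$ for all $v\in P^{k-1}(I_i)$ and $(\Pi u)(r_{i-1})=u(r_{i-1})$. Semidiscrete HDG scheme with boundary datum $U_b$: find $u_h\in C^1([0,T];V_h^k)$ with the prescribed initial value and, for each $t$, trace values $\widehat u_h,\widehat g_h$ at $r_1,\dots,r_N$ and $\widehat w_h,\widehat z_h$ at $r_0,\dots,r_{N-1}$, such that at each $t$: (1) on each $I_i$, $w_h(r)=\widehat w_h(r_{i-1})+\int_{r_{i-1}}^ru_h\,ds$, $g_h(r)=\widehat g_h(r_i)\exp(-\int_r^{r_i}\frac1s(u_h-\tilde u_h)^2ds)$, $z_h(r)=\widehat z_h(r_{i-1})+\int_{r_{i-1}}^rg_h\,ds$, where $\tilde u_h=w_h/r$, $\tilde g_h=z_h/r$ for $r>0$, $\tilde u_h(0):=u_h(0)$, $\tilde g_h(0):=g_h(0)$; (2) for all $i$ and all $\phi_u\in P^k(I_i)$, $$\bigl((u_h)_t,\phi_u\bigr)_{I_i}+\bigl(\tfrac12\tilde g_hu_h,(\phi_u)_r\bigr)_{I_i}-\langle\widehat{\mathcal F}_{u,h},\phi_u\,n\rangle_{\partial I_i}+\bigl(\tfrac12(\tilde g_h)_r\tilde u_h,\phi_u\bigr)_{I_i}=0,$$ with flux on $I_i$: $\widehat{\mathcal F}_{u,h}(r_i)=\tfrac12\tilde g_h(r_i)\widehat u_h(r_i)$, $\widehat{\mathcal F}_{u,h}(r_{i-1})=\tfrac12\tilde g_h(r_{i-1})u_h(r_{i-1})$ (from within $I_i$); (3) for $i=1,\dots,N-1$,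 each of $\widehat{\mathcal F}_{u,h},w_h,z_h,g_h$ takes the same value at $r_i$ from $I_i$ and from $I_{i+1}$; (4) $\widehat u_h(t,b)=U_b(t)$, $\widehat g_h(t,b)=1$, $\widehat w_h(t,0)=0$, $\widehat z_h(t,0)=0$. (This scheme has a unique solution on $[0,T]$ for continuous $U_b$.) *)

(* Defs.v *)
From HB Require Import structures.
From mathcomp Require Import all_boot all_order all_algebra.
From mathcomp Require Import all_classical all_reals all_analysis.

Set Implicit Arguments.
Unset Strict Implicit.
Unset Printing Implicit Defensive.

Import Order.TTheory GRing.Theory Num.Theory.
Import numFieldNormedType.Exports.

Local Open Scope classical_set_scope.
Local Open Scope ring_scope.

(* The derivative of f at x relative to A: one-sided when A is an interval and
   x one of its end points. *)
Definition has_derivative (R : realType) (A : set R) (f : R -> R) (x l : R) :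
    Prop :=
  (y - x)^-1 * (f y - f x) @[y --> within A (x^')] --> l.

Section Sobolev.
Context {R : realType}.
Local Notation mu := (@lebesgue_measure R).

Definition test_function (b : R) (phi : R -> R) : Prop :=
  (forall n x, derivable (derive1n n phi) x 1) /\
  (exists a c, [/\ 0 < a, c < b & forall x, ~~ (a <= x <= c) -> phi x = 0]).

Definition is_weak_derivative (b : R) (j : nat) (v d : R -> R) : Prop :=
  [/\ locally_integrable (`]0, b[%classic : set R) v,
      locally_integrable (`]0, b[%classic : set R) d
    & forall phi, test_function b phi ->
        \int[mu]_(x in `]0, b[) (v x * derive1n j phi x) =
        (-1) ^+ j * \int[mu]_(x in `]0, b[) (d x * phi x)].

(* Weak derivatives are determined only up to null sets; one is selected, and
   it is meaningful only when v has a weak derivative of order j. *)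
Definition weak_derivative (b : R) (j : nat) (v : R -> R) : R -> R :=
  xget (cst 0) [set d | is_weak_derivative b j v d].

Definition Lp_norm (b : R) (p : \bar R) (f : R -> R) : \bar R :=
  Lnorm mu p (EFin \o (f \_ (`]0, b[%classic : set R))).

(* v belongs to W^{m,p}(0,b); H^m(0,b) is the case p = 2. *)
Definition sobolev (b : R) (m : nat) (p : \bar R) (v : R -> R) : Prop :=
  forall j, (j <= m)%N ->
    exists2 d, is_weak_derivative b j v d & (Lp_norm b p d < +oo)%E.

(* For finite p this is the l^1-combination of the L^p norms, equivalent to
   the l^p-combination. *)
Definition sobolev_norm (b : R) (m : nat) (p : \bar R) (v : R -> R) : \bar R :=
  (\sum_(j < m.+1) Lp_norm b p (weak_derivative b j v))%E.

(* Functions of (t, r), seen as functions t |-> s t from (0,T) to W^{m,p}(0,b)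
   with finitely many values on measurable sets. *)
Definition simple_sobolev (T b : R) (m : nat) (p : \bar R) (s : R -> R -> R) :
    Prop :=
  exists n (E : 'I_n -> set R) (x : 'I_n -> R -> R),
    (forall i, measurable (E i) /\ sobolev b m p (x i)) /\
    (forall t, 0 < t < T -> forall r, s t r = \sum_(i < n) \1_(E i) t * x i r).

Definition strongly_measurable (T b : R) (m : nat) (p : \bar R)
    (f : R -> R -> R) : Prop :=
  exists s : nat -> R -> R -> R,
    (forall n, simple_sobolev T b m p (s n)) /\
    {ae mu, forall t, 0 < t < T ->
      sobolev_norm b m p (fun r => s n t r - f t r) @[n --> \oo] --> 0%E}.

(* f belongs to the Bochner space L^oo(0,T;W^{m,p}(0,b)). *)
Definition Linfty_sobolev (T b : R) (m : nat) (p : \bar R) (f : R -> R -> R) :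
    Prop :=
  [/\ {ae mu, forall t, 0 < t < T -> sobolev b m p (f t)},
      strongly_measurable T b m p f
    & exists K : R,
        {ae mu, forall t, 0 < t < T -> (sobolev_norm b m p (f t) <= K%:E)%E}].

End Sobolev.

Section Exact.
Context {R : realType}.

(* ut is the time derivative of u. Joint continuity selects the continuous
   representative of u, so that point values of u are meaningful. *)
Record exact_solution (T b : R) (Ub : R -> R) (u ut w g z : R -> R -> R) :
    Prop := {
  exact_cont : {within [set x : R * R | 0 <= x.1 <= T /\ 0 <= x.2 <= b],
                  continuous (fun x : R * R => u x.1 x.2)};
  exact_ut : forall t r, 0 <= t <= T -> 0 < r <= b ->
    has_derivative `[0, T] (u ^~ r) t (ut t r);
  exact_u : forall t r, 0 <= t <= T -> 0 < r <= b ->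
    exists F' gt',
      [/\ has_derivative `[0, b] (fun s => 2^-1 * (z t s / s) * u t s) r F',
          has_derivative `[0, b] (fun s => z t s / s) r gt'
        & ut t r - F' = - (2^-1 * gt' * (w t r / r))];
  exact_w : forall t r, 0 <= t <= T -> 0 <= r <= b ->
    has_derivative `[0, b] (w t) r (u t r);
  exact_g : forall t r, 0 <= t <= T -> 0 < r <= b ->
    has_derivative `[0, b] (g t) r (r^-1 * g t r * (u t r - w t r / r) ^+ 2);
  exact_z : forall t r, 0 <= t <= T -> 0 <= r <= b ->
    has_derivative `[0, b] (z t) r (g t r);
  exact_w0 : forall t, 0 <= t <= T -> w t 0 = 0;
  exact_z0 : forall t, 0 <= t <= T -> z t 0 = 0;
  exact_ub : forall t, 0 <= t <= T -> u t b = Ub t;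
  exact_gb : forall t, 0 <= t <= T -> g t b = 1
}.

Definition mass_aspect (g z : R -> R -> R) (t r : R) : R :=
  r / 2 * (1 - (z t r / r) / g t r).

End Exact.

Section HDG.
Context {R : realType}.
Local Notation mu := (@lebesgue_measure R).

(* Only the nodes x 0, ..., x N matter. Elements are numbered from 0: the
   element i < N is (x i, x i.+1). *)
Definition mesh (b : R) (N : nat) (x : nat -> R) : Prop :=
  [/\ x 0 = 0, x N = b & forall i, (i < N)%N -> x i < x i.+1].

Definition mesh_size (N : nat) (x : nat -> R) : R :=
  \big[Num.max/0]_(i < N) (x i.+1 - x i).

Definition in_P (k : nat) (p : {poly R}) : Prop := (size p <= k.+1)%N.

Definition gauss_radau (k : nat) (a c : R) (f : R -> R) (p : {poly R}) : Prop :=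
  [/\ in_P k p,
      forall v, in_P k.-1 v ->
        \int[mu]_(s in `]a, c[) ((p.[s] - f s) * v.[s]) = 0
    & p.[a] = f a].

(* Broken functions carry an element index, so that values at a node are taken
   from within the element. Traces are indexed by nodes. *)
Record hdg_fields := HdgFields {
  uh   : R -> nat -> {poly R};
  uh_t : R -> nat -> {poly R};
  wh   : R -> nat -> R -> R;
  gh   : R -> nat -> R -> R;
  zh   : R -> nat -> R -> R;
  uhat : R -> nat -> R;
  ghat : R -> nat -> R;
  what : R -> nat -> R;
  zhat : R -> nat -> R
}.

Definition ut_h (S : hdg_fields) (t : R) (i : nat) (r : R) : R :=
  if r == 0 then (uh S t i).[0] else wh S t i r / r.

Definition gt_h (S : hdg_fields) (t : R) (i : nat) (r : R) : R :=
  if r == 0 then gh S t i 0 else zh S t i r / r.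

Definition flux_right (x : nat -> R) (S : hdg_fields) (t : R) (i : nat) : R :=
  2^-1 * gt_h S t i (x i.+1) * uhat S t i.+1.

Definition flux_left (x : nat -> R) (S : hdg_fields) (t : R) (i : nat) : R :=
  2^-1 * gt_h S t i (x i) * (uh S t i).[x i].

Record hdg_solution (T : R) (k N : nat) (x : nat -> R) (Ub : R -> R)
    (S : hdg_fields) : Prop := {
  hdg_P : forall t i, 0 <= t <= T -> (i < N)%N ->
    in_P k (uh S t i) /\ in_P k (uh_t S t i);
  (* uh is C^1 in time with derivative uh_t, coefficientwise *)
  hdg_C1 : forall i j, (i < N)%N ->
    (forall t, 0 <= t <= T ->
       has_derivative `[0, T] (fun s => (uh S s i)`_j) t (uh_t S t i)`_j) /\
    {within `[0, T], continuous (fun s => (uh_t S s i)`_j)};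
  hdg_w : forall t i r, 0 <= t <= T -> (i < N)%N -> x i <= r <= x i.+1 ->
    wh S t i r = what S t i + \int[mu]_(s in `[x i, r]) (uh S t i).[s];
  hdg_g : forall t i r, 0 <= t <= T -> (i < N)%N -> x i <= r <= x i.+1 ->
    gh S t i r = ghat S t i.+1 *
      expR (- \int[mu]_(s in `[r, x i.+1])
                (s^-1 * ((uh S t i).[s] - ut_h S t i s) ^+ 2));
  hdg_z : forall t i r, 0 <= t <= T -> (i < N)%N -> x i <= r <= x i.+1 ->
    zh S t i r = zhat S t i + \int[mu]_(s in `[x i, r]) gh S t i s;
  hdg_u : forall t i (phi : {poly R}), 0 <= t <= T -> (i < N)%N -> in_P k phi ->
    \int[mu]_(s in `]x i, x i.+1[) ((uh_t S t i).[s] * phi.[s])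
    + \int[mu]_(s in `]x i, x i.+1[)
        (2^-1 * gt_h S t i s * (uh S t i).[s] * (deriv phi).[s])
    - (flux_right x S t i * phi.[x i.+1] - flux_left x S t i * phi.[x i])
    + \int[mu]_(s in `]x i, x i.+1[)
        (2^-1 * derive1 (gt_h S t i) s * ut_h S t i s * phi.[s]) = 0;
  hdg_conforming : forall t i, 0 <= t <= T -> (i.+1 < N)%N ->
    [/\ flux_right x S t i = flux_left x S t i.+1,
        wh S t i (x i.+1) = wh S t i.+1 (x i.+1),
        zh S t i (x i.+1) = zh S t i.+1 (x i.+1)
      & gh S t i (x i.+1) = gh S t i.+1 (x i.+1)];
  hdg_boundary : forall t, 0 <= t <= T ->
    [/\ uhat S t N = Ub t, ghat S t N = 1, what S t 0 = 0 & zhat S t 0 = 0]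
}.

Definition discrete_mass_aspect (S : hdg_fields) (t : R) (i : nat) (r : R) : R :=
  r / 2 * (1 - gt_h S t i r / gh S t i r).

End HDG.
Arguments hdg_fields : clear implicits.

(* Main.v *)
Require Import Defs.
From HB Require Import structures.
From mathcomp Require Import all_boot all_order all_algebra.
From mathcomp Require Import all_classical all_reals all_analysis.
From mathcomp Require Import measurable_realfun ess_sup_inf.
From mathcomp Require Import ring lra.

Set Implicit Arguments.
Unset Strict Implicit.
Unset Printing Implicit Defensive.

Import Order.TTheory GRing.Theory Num.Theory.
Import numFieldNormedType.Exports.

Local Open Scope classical_set_scope.
Local Open Scope ring_scope.

(* The error e = u - u_h solves a transport equation with speed g~_h / 2 whose lower-order
   terms are controlled in L^2 as soon as || (v - v_h) / r || <= 1 with v = u - u~: this bounds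
   g~_h from below, its slope, and |g - g_h| by ||e||. The upwind flux dissipates the jumps, and
   testing with Q u - u_h, where Q is the L^2 projection on the first element and the Gauss-Radau
   projection elsewhere, gives ||e|| = O(h^(k+1)) by Gronwall.

   Hardy's inequality bounds || (v - v_h) / r ||^2 by 32 X, with X the broken H^1 error plus the
   jumps weighted by 1/h_i. As the mesh is arbitrary, X cannot be obtained from ||e|| by an inverse
   inequality. Instead, testing the scheme on one element recovers X from the time derivative of
   P u - u_h (P the L^2 projection), and that derivative is estimated by running the energy argument
   on time differences, which needs X only at lower order: X <= L h exp(lambda t) on [0, t] improves
   to X <= (L h exp(lambda t)) / 2, so a continuity argument keeps X small on [0, T] for small h.

   The regularity of u in time and space used here (Lipschitz bounds, Taylor expansions, polynomial
   approximation) comes from a Peano-type estimate: a combination of point values annihilating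
   polynomials of degree < m is bounded by the m-th weak derivative. The mass error is at most
   b / 2 times sup |g - g_h|. *)

(** The exact and the discrete solution are handled alike: g, g~ and g~_r become functionals of one
    function of r, either u(t) or the broken polynomial u_h(t). The difference of the exponents of g
    and g_h is an integral of (v - v_h) times (v + v_h) / r, so it is linear in the unweighted error
    only while v_h / r is bounded in L^2. That bound is what has to be carried through time; being
    of order one it needs no optimal rate, and X = O(h) suffices.

    Time differences replace a differentiated error equation because u_h is only C^1 in time and
    u_tt is not assumed to exist; the bound on increments is divided by the step, which then tends
    to 0. The squared increments obey a Gronwall inequality forced by h + X, where X is itself being
    estimated. The constants are therefore chosen in the order L, lambda, h: L dominates the data,
    lambda makes the forced part, about (1 + L) h / lambda, no larger than h, and h makes L h
    exp(lambda T) at most 1/32. *)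

(** * Integration of bounded measurable functions on open intervals *)

Section Integral.
Context {R : realType}.
Local Notation mu := (@lebesgue_measure R).
Implicit Types (a b c m r s : R) (f g F : R -> R).

(** Unlike integrable functions, this class is closed under products, so linearity and splitting of
    integrals need no further conditions. The end points are left out because of the quotients by
    r. *)
Definition bmf a c f : Prop :=
  measurable_fun (`]a, c[%classic : set R) f /\
  exists M, forall s, a < s < c -> `|f s| <= M.

Definition I a c f : R := \int[mu]_(s in `]a, c[) f s.

Lemma mu_oo a c : (mu (`]a, c[%classic : set R) < +oo)%E.
Proof.
rewrite lebesgue_measure_itv /=; case: ifP => _ //.
by rewrite -EFinB ltry.
Qed.

Lemma fine_mu_oo a c : a <= c -> fine (mu (`]a, c[%classic : set R)) = c - a.
Proof.
move=> ac; rewrite lebesgue_measure_itv /= lte_fin.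
move: ac; rewrite le_eqVlt => /predU1P[->|->]; last by rewrite -EFinB.
by rewrite ltxx subrr.
Qed.

Lemma bmf_int a c f : bmf a c f -> mu.-integrable `]a, c[ (EFin \o f).
Proof.
move=> [mf [M fM]]; apply: measurable_bounded_integrable => //.
  exact: mu_oo.
exists M; split; first exact: num_real.
move=> x Mx s /=; rewrite in_itv /= => sac.
exact: le_trans (fM _ sac) (ltW Mx).
Qed.

Lemma bmfD a c f g : bmf a c f -> bmf a c g -> bmf a c (fun s => f s + g s).
Proof.
move=> [mf [M fM]] [mg [L gL]]; split; first exact: measurable_funD.
exists (M + L) => s sac; rewrite (le_trans (ler_normD _ _)) // lerD //.
  exact: fM.
exact: gL.
Qed.

Lemma bmfM a c f g : bmf a c f -> bmf a c g -> bmf a c (fun s => f s * g s).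
Proof.
move=> [mf [M fM]] [mg [L gL]]; split; first exact: measurable_funM.
by exists (M * L) => s sac; rewrite normrM ler_pM// ?fM ?gL.
Qed.

Lemma bmf_cst a c k : bmf a c (fun=> k).
Proof. by split; [exact: measurable_cst | exists `|k|]. Qed.

Lemma bmf_eq a c f g : (forall s, a < s < c -> f s = g s) ->
  bmf a c f -> bmf a c g.
Proof.
move=> fg [mf [M fM]]; split.
  apply: (eq_measurable_fun f) => // x; rewrite inE /= in_itv /=; exact: fg.
by exists M => s sac; rewrite -fg// fM.
Qed.

Lemma bmfZ a c k f : bmf a c f -> bmf a c (fun s => k * f s).
Proof. by move=> ?; apply: bmfM => //; exact: bmf_cst. Qed.

Lemma bmfN a c f : bmf a c f -> bmf a c (fun s => - f s).
Proof.
by move=> /(bmfZ (-1)); apply: bmf_eq => s _; rewrite mulN1r.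
Qed.

Lemma bmfB a c f g : bmf a c f -> bmf a c g -> bmf a c (fun s => f s - g s).
Proof. by move=> ? ?; apply: bmfD => //; exact: bmfN. Qed.

Lemma bmfX a c f n : bmf a c f -> bmf a c (fun s => f s ^+ n).
Proof.
move=> bf; elim: n => [|n ih]; first exact: bmf_cst.
by apply: bmf_eq (bmfM bf ih) => s _; rewrite exprS.
Qed.

Lemma bmf_abs a c f : bmf a c f -> bmf a c (fun s => `|f s|).
Proof.
move=> [mf [M fM]]; split; first exact: measurableT_comp.
by exists M => s sac; rewrite normr_id fM.
Qed.

Lemma bmf_sum a c n (f : 'I_n -> R -> R) :
  (forall i, bmf a c (f i)) -> bmf a c (fun s => \sum_(i < n) f i s).
Proof.
elim: n f => [|n ih] f bf.
  by apply: bmf_eq (bmf_cst a c 0) => s _; rewrite big_ord0.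
apply: bmf_eq (bmfD (bf ord0) (ih (fun i => f (lift ord0 i)) _)) => // s _.
by rewrite big_ord_recl.
Qed.

Lemma bmf_sub a c a' c' f : a <= a' -> c' <= c -> bmf a c f -> bmf a' c' f.
Proof.
move=> aa cc [mf [M fM]]; split.
  apply: measurable_funS mf => //.
  by move=> s /=; rewrite !in_itv /= => /andP[/(le_lt_trans aa)-> /lt_le_trans->].
by exists M => s /andP[as_ sc]; rewrite fM// (le_lt_trans aa as_) (lt_le_trans sc cc).
Qed.

Lemma bmf_cont a c f M : (forall s, a < s < c -> {for s, continuous f}) ->
  (forall s, a < s < c -> `|f s| <= M) -> bmf a c f.
Proof.
move=> cf fM; split; last by exists M.
apply: open_continuous_measurable_fun => //.
by move=> s; rewrite inE /= in_itv /=; exact: cf.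
Qed.

Lemma eq_I a c f g : (forall s, a < s < c -> f s = g s) -> I a c f = I a c g.
Proof. by move=> fg; apply: eq_Rintegral => s; rewrite inE /= in_itv; exact: fg. Qed.

Lemma I_D a c f g : bmf a c f -> bmf a c g ->
  I a c (fun s => f s + g s) = I a c f + I a c g.
Proof. by move=> bf bg; rewrite /I RintegralD//; exact: bmf_int. Qed.

Lemma I_Z a c k f : bmf a c f -> I a c (fun s => k * f s) = k * I a c f.
Proof. by move=> bf; rewrite /I RintegralZl//; exact: bmf_int. Qed.

Lemma I_N a c f : bmf a c f -> I a c (fun s => - f s) = - I a c f.
Proof.
by move=> bf; rewrite -mulN1r -I_Z//; apply: eq_I => s _; rewrite mulN1r.
Qed.

Lemma I_B a c f g : bmf a c f -> bmf a c g ->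
  I a c (fun s => f s - g s) = I a c f - I a c g.
Proof. by move=> bf bg; rewrite I_D ?I_N//; exact: bmfN. Qed.

Lemma I_cst a c k : a <= c -> I a c (fun=> k) = k * (c - a).
Proof. by move=> ac; rewrite /I Rintegral_cst// fine_mu_oo. Qed.

Lemma le_I a c f g : bmf a c f -> bmf a c g ->
  (forall s, a < s < c -> f s <= g s) -> I a c f <= I a c g.
Proof.
move=> bf bg fg; apply: le_Rintegral => //; first exact: bmf_int.
exact: bmf_int.
Qed.

Lemma I_ge0 a c f : (forall s, a < s < c -> 0 <= f s) -> 0 <= I a c f.
Proof. by move=> f0; apply: Rintegral_ge0 => s /=; rewrite in_itv; exact: f0. Qed.

Lemma I_abs a c f : bmf a c f -> `|I a c f| <= I a c (fun s => `|f s|).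
Proof. by move=> bf; apply: le_normr_Rintegral => //; exact: bmf_int. Qed.

Lemma I_le_bound a c f M : a <= c -> bmf a c f ->
  (forall s, a < s < c -> `|f s| <= M) -> `|I a c f| <= M * (c - a).
Proof.
move=> ac bf fM; rewrite (le_trans (I_abs bf))// -I_cst//.
by apply: le_I => //; [exact: bmf_abs|exact: bmf_cst].
Qed.

Lemma I_xx a f : I a a f = 0.
Proof. by rewrite /I set_itvoo0 Rintegral_set0. Qed.

Lemma I_sum a c n (f : 'I_n -> R -> R) : (forall i, bmf a c (f i)) ->
  I a c (fun s => \sum_(i < n) f i s) = \sum_(i < n) I a c (f i).
Proof.
elim: n f => [|n ih] f bf.
  rewrite big_ord0 -[RHS](mul0r (I a c (fun=> 1))) -I_Z; last exact: bmf_cst.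
  by apply: eq_I => s _; rewrite big_ord0 mul0r.
rewrite big_ord_recl -ih// -I_D//; last exact: bmf_sum.
by apply: eq_I => s _; rewrite big_ord_recl.
Qed.

Lemma I_split a m c f : a <= m -> m <= c -> bmf a c f ->
  I a c f = I a m f + I m c f.
Proof.
rewrite le_eqVlt => /predU1P[->|am]; first by rewrite I_xx add0r.
rewrite le_eqVlt => /predU1P[->|mc]; first by rewrite I_xx addr0.
move=> bf; have := bmf_int bf => intf.
have := @Rintegral_itvB _ _ _ _ m intf; rewrite !bnd_simp => /(_ (ltW am) mc) h.
rewrite /I -h addrC -(@Rintegral_itv_bndo_bndc _ (BRight a) m f) ?subrK//.
apply: bmf_int; apply: bmf_sub bf => //; exact: ltW.
Qed.

Lemma bmf_int_oc a c f : bmf a c f -> mu.-integrable `]a, c] (EFin \o f).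
Proof.
move=> bf; have [ac|ca] := ltP a c; last first.
  by rewrite set_itv_ge ?bnd_simp -?leNgt//; exact: integrable_set0.
have [mf [M fM]] := bf; apply: measurable_bounded_integrable => //.
- by rewrite /= lebesgue_measure_itv /= lte_fin ac -EFinB ltry.
- rewrite -(@setUitv1 _ _ (BRight a) c true) ?bnd_simp//.
  by apply/measurable_funU => //; split => //; exact: measurable_fun_set1.
(* [bmf] says nothing about the end point [c], whose single value joins the bound. *)
exists (Num.max M `|f c|); split; first exact: num_real.
move=> x; rewrite gt_max => /andP[Mx fx] s /=; rewrite in_itv /= => /andP[as_].
rewrite le_eqVlt => /predU1P[->|sc]; first exact: ltW.
by rewrite (le_trans _ (ltW Mx))// fM// as_.
Qed.

Lemma I_cc a c f : bmf a c f -> \int[mu]_(s in `[a, c]) f s = I a c f.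
Proof.
move=> bf; have [ac|ca|->] := ltgtP a c; last first.
- by rewrite set_itv1 Rintegral_set1 I_xx.
- by rewrite /I !set_itv_ge ?Rintegral_set0 // bnd_simp -?leNgt -?ltNge // ltW.
have ibf := bmf_int bf.
have h1 := bmf_int_oc bf.
rewrite -(@Rintegral_itv_obnd_cbnd _ a (BRight c) f)//.
by rewrite -(@Rintegral_itv_bndo_bndc _ (BRight a) c f).
Qed.

Lemma I_lip a c f M r s : bmf a c f -> (forall s, a < s < c -> `|f s| <= M) ->
  a <= r <= c -> a <= s <= c -> `|I a r f - I a s f| <= M * `|r - s|.
Proof.
move=> bf fM.
wlog rs : r s / r <= s => [H|].
  have [rs|/ltW sr] := leP r s; first exact: H.
  by move=> ? ?; rewrite distrC (distrC r); exact: H.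
move=> /andP[ar rc] /andP[as_ sc].
rewrite (@I_split a r s)//; last exact: bmf_sub bf.
rewrite opprD addNKr normrN distrC (ger0_norm (x := s - r)) ?subr_ge0//.
apply: I_le_bound => //; first exact: bmf_sub bf.
move=> x /andP[rx xs]; rewrite fM//.
by rewrite (le_lt_trans ar rx) (lt_le_trans xs sc).
Qed.

Lemma lip_within a c F M :
  (forall r s, a <= r <= c -> a <= s <= c -> `|F r - F s| <= M * `|r - s|) ->
  {within `[a, c], continuous F}.
Proof.
move=> FM; apply/subspace_continuousP => x; rewrite /= in_itv /= => xac.
apply/cvgrPdist_le => e e0; near=> y.
have yac : a <= y <= c.
  have : (`[a, c]%classic : set R) y by near: y; exact: withinT.
  by rewrite /= in_itv.
rewrite (le_trans (FM _ _ xac yac))//.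
have M0 : 0 < `|M| + 1 by rewrite ltr_pwDr.
apply: (@le_trans _ _ ((`|M| + 1) * `|x - y|)).
  by rewrite ler_wpM2r// (le_trans (ler_norm _))// lerDl.
rewrite mulrC -ler_pdivlMr//; near: y; apply: cvg_within.
have := @cvgr_dist_le _ _ _ (nbhs x) _ id x; apply => //.
by rewrite divr_gt0.
Unshelve. all: by end_near. Qed.

Lemma I_derive a c f M r : bmf a c f -> (forall s, a < s < c -> `|f s| <= M) ->
  a < r < c -> {for r, continuous f} -> is_derive r 1 (fun r => I a r f) (f r).
Proof.
move=> bf fM /andP[ar rc] cf.
have [x /andP[rx xc]] : exists x, r < x < c.
  by exists ((r + c) / 2); apply/andP; split; lra.
have bx : bmf a x f by apply: bmf_sub bf => //; exact: ltW.
have ix : mu.-integrable [set` Interval (BRight a) (BRight x)] (EFin \o f).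
  exact: bmf_int_oc.
have := @continuous_FTC1 _ f (BRight a) r x rx ix.
move=> /(_ ar cf) [] d1 d2.
have e : \forall z \near r, \int[mu]_(t in [set` Interval (BRight a) (BRight z)]) f t = I a z f.
  near=> z; rewrite /I -Rintegral_itv_bndo_bndc//; apply: bmf_int.
  apply: bmf_sub bf => //; apply: ltW; near: z; exact: lt_nbhsl.
apply: DeriveDef.
  by apply: near_eq_derivable e d1.
rewrite -d2 derive1E; apply/esym; apply: near_eq_derive => //.
Unshelve. all: by end_near. Qed.

Lemma is_derive_nincr a c F f : a <= c -> {within `[a, c], continuous F} ->
  (forall s, a < s < c -> is_derive s 1 F (f s)) ->
  (forall s, a < s < c -> f s <= 0) -> F c <= F a.
Proof.
move=> ac cF dF f0; apply: (@ler0_derive1_nincr _ F a c) => //.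
- by move=> x; rewrite in_itv => /dF[].
- move=> x; rewrite in_itv /= => xac; rewrite derive1E.
  by have := dF _ xac => d; rewrite derive_val; exact: f0.
Qed.

Lemma is_derive_const a c F : a <= c -> {within `[a, c], continuous F} ->
  (forall s, a < s < c -> is_derive s 1 F 0) -> F c = F a.
Proof.
move=> ac cF dF; apply/eqP; rewrite eq_le; apply/andP; split.
  exact: (@is_derive_nincr a c F (fun=> 0)).
rewrite -lerN2.
have dN s : a < s < c -> is_derive s 1 (fun x => - F x) 0.
  move=> sac; have := dF _ sac => d.
  by rewrite -oppr0; apply: is_deriveN.
apply: (@is_derive_nincr a c (fun x => - F x) (fun=> 0)) => //.
by move=> x; apply: cvgN; exact: cF.
Qed.

(** The integrand needs no limit at the end points, only a bound: the difference between its
    primitive and [F] is continuous up to the ends and has zero derivative inside. *)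
Lemma I_FTC a c F f M : a <= c -> {within `[a, c], continuous F} ->
  (forall s, a < s < c -> is_derive s 1 F (f s)) ->
  (forall s, a < s < c -> {for s, continuous f}) ->
  (forall s, a < s < c -> `|f s| <= M) -> I a c f = F c - F a.
Proof.
move=> ac cF dF cf fM.
have bf : bmf a c f by exact: bmf_cont fM.
pose G r := I a r f - F r.
suff : G c = G a by rewrite /G I_xx sub0r => h; rewrite -[LHS](subrK (F c)) h addrC.
have cG : {within `[a, c], continuous G}.
  have cI : {within `[a, c], continuous (fun r => I a r f)}.
    by apply: (@lip_within _ _ _ M) => r s rac sac; exact: (I_lip bf fM).
  by move=> x; apply: cvgB; [exact: cI|exact: cF].
apply: is_derive_const => // s sac.
have d1 := I_derive bf fM sac (cf _ sac); have d2 := dF _ sac.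
by rewrite -(subrr (f s)); apply: is_deriveB.
Qed.

Lemma I_CS a c f g : bmf a c f -> bmf a c g ->
  (I a c (fun s => f s * g s)) ^+ 2 <=
  I a c (fun s => f s ^+ 2) * I a c (fun s => g s ^+ 2).
Proof.
move=> bf bg.
set A := I a c (fun s => f s ^+ 2); set C := I a c (fun s => g s ^+ 2).
set B := I a c _.
have h l : 0 <= A - 2 * l * B + l ^+ 2 * C.
  have -> : A - 2 * l * B + l ^+ 2 * C = I a c (fun s => (f s - l * g s) ^+ 2).
    rewrite -!I_Z; [|exact: bmfX|exact: bmfM].
    rewrite -I_B; [|exact: bmfX|by apply: bmfZ; exact: bmfM].
    rewrite -I_D; [|by apply: bmfB; [exact: bmfX|apply: bmfZ; exact: bmfM]|].
      by apply: eq_I => s _; ring.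
    by apply: bmfZ; exact: bmfX.
  by apply: I_ge0 => s _; exact: sqr_ge0.
have C0 : 0 <= C by apply: I_ge0 => s _; exact: sqr_ge0.
have A0 : 0 <= A by apply: I_ge0 => s _; exact: sqr_ge0.
move: C0; rewrite le_eqVlt => /predU1P[C0|C0].
  rewrite -C0 mulr0 in h *.
  have [->|B0] := eqVneq B 0; first by rewrite expr0n.
  (* With [C = 0] the nonnegative expression is affine in [l]; this [l] would give it the value
     -1. *)
  have := h ((A + 1) / (2 * B)); rewrite mulr0 addr0.
  have -> : 2 * ((A + 1) / (2 * B)) * B = A + 1 by field.
  lra.
have := h (B / C).
have -> : A - 2 * (B / C) * B + (B / C) ^+ 2 * C = (A * C - B ^+ 2) / C.
  by field; rewrite gt_eqF.
by rewrite pmulr_lge0 ?invr_gt0// subr_ge0.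
Qed.

Lemma I_young a c f g k : 0 < k -> bmf a c f -> bmf a c g ->
  I a c (fun s => f s * g s) <=
  k * I a c (fun s => f s ^+ 2) + (4 * k)^-1 * I a c (fun s => g s ^+ 2).
Proof.
move=> k0 bf bg; rewrite -!I_Z; [|exact: bmfX..].
rewrite -I_D; [|by apply: bmfZ; exact: bmfX..].
apply: le_I => [||s _]; first exact: bmfM.
  by apply: bmfD; apply: bmfZ; exact: bmfX.
rewrite -subr_ge0.
have -> : k * f s ^+ 2 + (4 * k)^-1 * g s ^+ 2 - f s * g s =
  (4 * k)^-1 * (2 * k * f s - g s) ^+ 2 by field; rewrite gt_eqF.
by rewrite mulr_ge0 ?sqr_ge0// invr_ge0 mulr_ge0// ltW.
Qed.

Lemma I_sqrD a c f g : bmf a c f -> bmf a c g ->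
  I a c (fun s => (f s + g s) ^+ 2) <=
  2 * I a c (fun s => f s ^+ 2) + 2 * I a c (fun s => g s ^+ 2).
Proof.
move=> bf bg; rewrite -!I_Z; [|exact: bmfX..].
rewrite -I_D; [|by apply: bmfZ; exact: bmfX..].
apply: le_I => [||s _]; first by apply: bmfX; exact: bmfD.
  by apply: bmfD; apply: bmfZ; exact: bmfX.
have := sqr_ge0 (f s - g s); lra.
Qed.

Lemma I_le_sqr a c f g : bmf a c f -> bmf a c g ->
  (forall s, a < s < c -> `|f s| <= g s) ->
  I a c (fun s => f s ^+ 2) <= I a c (fun s => g s ^+ 2).
Proof.
move=> bf bg fg; apply: le_I => [||s sac]; [exact: bmfX..|].
by rewrite -real_normK ?num_real// lerXn2r ?nnegrE//; [exact: le_trans (fg _ sac)|exact: fg].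
Qed.

End Integral.

(** * Meshes and elementwise integration *)

Section Mesh.
Context {R : realType}.
Implicit Types (b M : R) (x : nat -> R) (f F : R -> R).

Lemma mesh_mono b N x i j : mesh b N x -> (i <= j)%N -> (j <= N)%N -> x i <= x j.
Proof.
move=> [_ _ xS]; elim: j => [|j ih]; first by rewrite leqn0 => /eqP->.
rewrite leq_eqVlt => /predU1P[->//|ij] jN.
by rewrite (le_trans (ih _ (ltnW jN)))// ltW// xS.
Qed.

Lemma mesh_itv b N x i s : mesh b N x -> (i < N)%N -> x i <= s <= x i.+1 ->
  0 <= s <= b.
Proof.
move=> m iN /andP[xs sx]; have [x0 xN _] := m.
rewrite -{1}x0 -xN (le_trans (mesh_mono m (leq0n i) (ltnW iN)) xs).
by rewrite (le_trans sx)// (mesh_mono m).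
Qed.

Lemma mesh_itv_oo b N x i s : mesh b N x -> (i < N)%N -> x i < s < x i.+1 ->
  0 < s < b.
Proof.
move=> m iN /andP[xs sx]; have [x0 xN _] := m.
rewrite -{1}x0 -xN (le_lt_trans (mesh_mono m (leq0n i) (ltnW iN)) xs).
by rewrite (lt_le_trans sx)// (mesh_mono m).
Qed.

Lemma mesh_ge0 b N x i : mesh b N x -> (i <= N)%N -> 0 <= x i <= b.
Proof.
move=> m iN; have [x0 xN _] := m.
by rewrite -{1}x0 -xN !(mesh_mono m).
Qed.

Lemma I_mesh_part b N x f j : mesh b N x -> bmf 0 b f -> (j <= N)%N ->
  I 0 (x j) f = \sum_(i < j) I (x i) (x i.+1) f.
Proof.
move=> m bf; have [x0 xN xS] := m.
elim: j => [|j ih] jN; first by rewrite big_ord0 x0 I_xx.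
have /andP[xj0 xjb] := mesh_ge0 m (ltnW jN).
have /andP[xj0' xjb'] := mesh_ge0 m jN.
rewrite big_ord_recr /= -ih; last exact: ltnW.
by apply: I_split => //; [exact/ltW/xS|exact: bmf_sub bf].
Qed.

Lemma I_mesh b N x f : mesh b N x -> bmf 0 b f ->
  I 0 b f = \sum_(i < N) I (x i) (x i.+1) f.
Proof. by move=> m bf; have [_ {1}<- _] := m; exact: I_mesh_part m bf _. Qed.

(** The global Lipschitz bound supplies continuity across the nodes, where [F] need not be
    differentiable, so that the elementwise integrals telescope. *)
Lemma mesh_FTC b N x F f M K j : mesh b N x ->
  (forall r s, 0 <= r <= b -> 0 <= s <= b -> `|F r - F s| <= K * `|r - s|) ->
  (forall i s, (i < N)%N -> x i < s < x i.+1 ->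
    is_derive s 1 F (f s) /\ {for s, continuous f}) ->
  bmf 0 b f -> (forall s, 0 < s < b -> `|f s| <= M) ->
  (j <= N)%N -> I 0 (x j) f = F (x j) - F 0.
Proof.
move=> m lF dF bf fM jN; have [x0 xN xS] := m.
rewrite (I_mesh_part m bf jN).
rewrite -[in RHS]x0 -(telescope_sumr (fun i => F (x i)) (leq0n j)) big_mkord.
apply: eq_bigr => -[i /= ij] _; have iN := leq_trans ij jN.
apply: (@I_FTC _ _ _ F f M); first exact/ltW/xS.
- apply: (@lip_within _ _ _ _ K) => r s rx sx.
  by apply: lF; [exact: (mesh_itv m iN rx)|exact: (mesh_itv m iN sx)].
- by move=> s sx; have [] := dF i s iN sx.
- by move=> s sx; have [] := dF i s iN sx.
- by move=> s sx; apply: fM; exact: (mesh_itv_oo m iN sx).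
Qed.

End Mesh.

(** * Rules of differentiation in pointwise form *)

Section Derive.
Context {R : realType}.
Implicit Types (s k l m : R) (f g : R -> R).

Lemma dD s f g l m : is_derive s 1 f l -> is_derive s 1 g m ->
  is_derive s 1 (fun r => f r + g r) (l + m).
Proof. by move=> ? ?; exact: is_deriveD. Qed.

Lemma dN s f l : is_derive s 1 f l -> is_derive s 1 (fun r => - f r) (- l).
Proof. by move=> ?; exact: is_deriveN. Qed.

Lemma dB s f g l m : is_derive s 1 f l -> is_derive s 1 g m ->
  is_derive s 1 (fun r => f r - g r) (l - m).
Proof. by move=> ? ?; exact: is_deriveB. Qed.

Lemma dM s f g l m : is_derive s 1 f l -> is_derive s 1 g m ->
  is_derive s 1 (fun r => f r * g r) (l * g s + f s * m).
Proof.
move=> df dg; have := is_deriveM df dg.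
by rewrite /GRing.scale /= addrC (mulrC (g s)).
Qed.

Lemma dC s k : is_derive s 1 (fun=> k : R) (0 : R).
Proof. exact: is_derive_cst. Qed.

Lemma dZ s k f l : is_derive s 1 f l -> is_derive s 1 (fun r => k * f r) (k * l).
Proof. by move=> df; have := dM (dC s k) df; rewrite mul0r add0r. Qed.

Lemma dV s f l : f s != 0 -> is_derive s 1 f l ->
  is_derive s 1 (fun r => (f r)^-1) (- l / f s ^+ 2).
Proof.
move=> f0 df; have := is_deriveV f0 df; rewrite /GRing.scale /=.
by rewrite mulNr mulrC -mulNr.
Qed.

Lemma dI s : is_derive s 1 (fun r : R => r) (1 : R).
Proof. exact: is_derive_id. Qed.

Lemma d_eq s f l m : is_derive s 1 f l -> l = m -> is_derive s 1 f m.
Proof. by move=> + <-. Qed.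

Lemma d_comp s f g l m : is_derive (g s) 1 f l -> is_derive s 1 g m ->
  is_derive s 1 (fun r => f (g r)) (l * m).
Proof. by move=> ? ?; exact: is_derive1_comp. Qed.

Lemma d_cont s f l : is_derive s 1 f l -> {for s, continuous f}.
Proof. by move=> [df _]; exact/differentiable_continuous/derivable1_diffP. Qed.

Lemma d_near s f g l : is_derive s 1 f l -> (\forall r \near s, f r = g r) ->
  is_derive s 1 g l.
Proof.
move=> [df dl] e; apply: DeriveDef; first by apply: near_eq_derivable e df.
by rewrite -dl; apply/esym; apply: near_eq_derive.
Qed.

End Derive.

(** * Averages over (0, s) and Hardy's inequality *)

Section Hardy.
Context {R : realType}.
Implicit Types (a b c K M : R) (f F : R -> R).

Lemma within_interior a c F s : {within `[a, c], continuous F} -> a < s < c ->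
  {for s, continuous F}.
Proof.
move=> cF sac; have : {within `]a, c[, continuous F}.
  by apply: continuous_subspaceW cF; exact: subset_itv_oo_cc.
have o : open (`]a, c[%classic : set R) by exact: itv_open.
by rewrite (continuous_open_subspace F o); apply; rewrite inE /= in_itv.
Qed.

Lemma lip_continuous a c F M s :
  (forall r s, a <= r <= c -> a <= s <= c -> `|F r - F s| <= M * `|r - s|) ->
  a < s < c -> {for s, continuous F}.
Proof. by move=> /lip_within; exact: within_interior. Qed.

Lemma I0_cont b f s : bmf 0 b f -> 0 < s < b -> {for s, continuous (fun r => I 0 r f)}.
Proof.
move=> bf sb; have [_ [M fM]] := bf.
exact: (lip_continuous (fun r s => @I_lip _ _ _ _ M r s bf fM) sb).
Qed.

Definition avg f s := I 0 s f / s.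

Lemma avg_cont b f s : bmf 0 b f -> 0 < s < b -> {for s, continuous (avg f)}.
Proof.
move=> bf sb; apply: cvgM; first exact: I0_cont sb.
by apply: cvgV; [case/andP: sb => /gt_eqF->|exact: cvg_id].
Qed.

Lemma avg_bound b f M s : bmf 0 b f -> (forall s, 0 < s < b -> `|f s| <= M) ->
  0 < s <= b -> `|avg f s| <= M.
Proof.
move=> bf fM /andP[s0 sb].
rewrite /avg normrM normfV (gtr0_norm s0) ler_pdivrMr//.
rewrite -[X in _ * X]subr0; apply: I_le_bound; first exact: ltW.
  exact: bmf_sub bf.
by move=> r /andP[r0 rs]; rewrite fM// r0 (lt_le_trans rs).
Qed.

Lemma bmf_avg b f : bmf 0 b f -> bmf 0 b (avg f).
Proof.
move=> bf; have [_ [M fM]] := bf; apply: (@bmf_cont _ _ _ _ M).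
  by move=> s sb; exact: avg_cont sb.
by move=> s /andP[s0 sb]; apply: avg_bound (bf) _ _ => //; rewrite s0 ltW.
Qed.

Lemma bmf_bound a c f : bmf a c f ->
  exists2 M, 0 <= M & forall s, a < s < c -> `|f s| <= M.
Proof.
move=> [_ [M fM]]; exists `|M| => // s sac.
exact: le_trans (fM s sac) (ler_norm _).
Qed.

(* (F^2/s)' = 2 f (F/s) - (F/s)^2 with F the primitive of f. *)
Lemma avg_identity b N x f : mesh b N x -> bmf 0 b f ->
  (forall i s, (i < N)%N -> x i < s < x i.+1 -> {for s, continuous f}) ->
  I 0 b (fun s => 2 * (f s * avg f s) - avg f s ^+ 2) = b * avg f b ^+ 2.
Proof.
move=> m bf cf; have [M M0 fM] := bmf_bound bf.
have bfa := bmf_avg bf.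
have [x0 xN xS] := m.
have b0 : 0 <= b by have /andP[_] := mesh_ge0 m (leqnn N); rewrite xN; case/andP: (mesh_ge0 m (leqnn N)) => /le_trans h /h.
have aM s : 0 < s <= b -> `|avg f s| <= M by exact: avg_bound.
pose F s := I 0 s f * I 0 s f / s.
have FE s : F s = s * avg f s ^+ 2.
  rewrite /F /avg; have [->|s0] := eqVneq s 0; first by rewrite invr0 mulr0 mul0r.
  by field.
(* Division by 0 yields 0, so [F 0 = 0], which is also the limit of [F] at the center. *)
have -> : b * avg f b ^+ 2 = F (x N) - F 0 by rewrite /F invr0 mulr0 subr0 -/(F _) FE xN.
rewrite -{1}xN; apply: (mesh_FTC (M := 3 * M ^+ 2) (K := 3 * M ^+ 2) m) => //.
- have H r s : 0 <= s -> s <= r -> r <= b -> `|F r - F s| <= 3 * M ^+ 2 * `|r - s|.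
    rewrite le_eqVlt => /predU1P[<-|s0] sr rb.
      rewrite {2}/F invr0 mulr0 !subr0 FE normrM (ger0_norm sr) mulrC ler_wpM2r//.
      move: sr; rewrite le_eqVlt => /predU1P[<-|r0].
        by rewrite /avg invr0 mulr0 expr0n normr0; have := sqr_ge0 M; lra.
      rewrite normrX; have := aM r; rewrite r0 rb => /(_ isT) h.
      have : `|avg f r| ^+ 2 <= M ^+ 2 by rewrite lerXn2r ?nnegrE.
      have := sqr_ge0 M; lra.
    have r0 := lt_le_trans s0 sr.
    have hr : `|avg f r| <= M by rewrite aM// r0.
    have hs : `|avg f s| <= M by rewrite aM// s0 (le_trans sr).
    have hF : `|I 0 r f - I 0 s f| <= M * (r - s).
      rewrite -[X in M * X]ger0_norm ?subr_ge0//.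
      apply: (I_lip bf fM); first by rewrite (ltW r0).
      by rewrite (ltW s0) (le_trans sr).
    (* Each summand is an increment over [s, r] times factors bounded through [M] and [s / r <= 1];
       hence the Lipschitz constant [3 * M ^+ 2], uniform down to the center. *)
    have -> : F r - F s = (I 0 r f - I 0 s f) * avg f r +
       (s / r * avg f s) * (I 0 r f - I 0 s f) - (s / r) * avg f s ^+ 2 * (r - s).
      by rewrite /F /avg; field; rewrite !gt_eqF.
    have sr1 : `|s / r| <= 1.
      by rewrite ger0_norm ?divr_ge0 ?(ltW s0) ?(ltW r0)// ler_pdivrMr// mul1r.
    rewrite (ger0_norm (x := r - s)) ?subr_ge0//.
    have rs0 : 0 <= r - s by rewrite subr_ge0.
    apply: (le_trans (ler_normB _ _)).
    have -> : 3 * M ^+ 2 * (r - s) = (M * (r - s)) * M + 1 * M * (M * (r - s)) + 1 * M ^+ 2 * (r - s) by ring.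
    apply: lerD.
      apply: (le_trans (ler_normD _ _)); apply: lerD; first by rewrite normrM ler_pM.
      by rewrite normrM ler_pM// normrM ler_pM.
    rewrite normrM (ger0_norm rs0) ler_wpM2r// normrM ler_pM//.
    by rewrite normrX lerXn2r ?nnegrE.
  move=> r s /andP[r0 rb] /andP[s0 sb]; have [sr|/ltW rs] := leP s r; first exact: H.
  by rewrite distrC (distrC r); exact: H.
- move=> i s iN sx; have s0b := mesh_itv_oo m iN sx.
  have /andP[s0 sb] := s0b; have sn0 : s != 0 by rewrite gt_eqF.
  split; last first.
    apply: cvgB.
      by apply: cvgM; [exact: cvg_cst|apply: cvgM; [exact: cf sx|exact: avg_cont s0b]].
    by apply: cvgM; exact: avg_cont s0b.
  have d := I_derive bf fM s0b (cf _ _ iN sx).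
  apply: d_eq (dM (dM d d) (dV sn0 (dI s))) _.
  by rewrite /avg; field.
- by apply: bmfB; [apply: bmfZ; exact: bmfM|exact: bmfX].
- move=> s /andP[s0 sb]; have h1 : `|f s| <= M by rewrite fM// s0.
  have h2 : `|avg f s| <= M by rewrite aM// s0 ltW.
  rewrite (le_trans (ler_normB _ _))// (normrM 2) (ger0_norm (x := 2))// (normrM (f s)).
  have : `|f s| * `|avg f s| <= M * M by rewrite ler_pM.
  have : `|avg f s ^+ 2| <= M * M by rewrite normrX expr2 ler_pM.
  rewrite expr2; lra.
Qed.

(** Only the sign of the boundary term [b * avg f b ^+ 2] is kept; both Hardy inequalities follow
    from this one. *)
Lemma hardy_identity_ge0 b N x f : mesh b N x -> bmf 0 b f ->
  (forall i s, (i < N)%N -> x i < s < x i.+1 -> {for s, continuous f}) ->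
  I 0 b (fun s => avg f s ^+ 2) <= 2 * I 0 b (fun s => f s * avg f s).
Proof.
move=> m bf cf; have ba := bmf_avg bf.
rewrite -subr_ge0 -I_Z; last exact: bmfM.
rewrite -I_B; [|by apply: bmfZ; exact: bmfM|exact: bmfX].
rewrite (avg_identity m bf cf) mulr_ge0 ?sqr_ge0//.
by have [x0 <- _] := m; have /andP[] := mesh_ge0 m (leqnn N).
Qed.

Lemma hardy b N x f : mesh b N x -> bmf 0 b f ->
  (forall i s, (i < N)%N -> x i < s < x i.+1 -> {for s, continuous f}) ->
  I 0 b (fun s => avg f s ^+ 2) <= 4 * I 0 b (fun s => f s ^+ 2).
Proof.
move=> m bf cf; have ba := bmf_avg bf.
have := hardy_identity_ge0 m bf cf.
have := @I_young _ 0 b f (avg f) 1 ltr01 bf ba.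
rewrite !mulr1; lra.
Qed.

(** When the square is expanded, the cross term outweighs the square of the average. The constant is
    therefore 1: passing from u to u - u~ does not increase an L^2 norm. *)
Lemma hardy_sub b N x f : mesh b N x -> bmf 0 b f ->
  (forall i s, (i < N)%N -> x i < s < x i.+1 -> {for s, continuous f}) ->
  I 0 b (fun s => (f s - avg f s) ^+ 2) <= I 0 b (fun s => f s ^+ 2).
Proof.
move=> m bf cf; have ba := bmf_avg bf.
have := hardy_identity_ge0 m bf cf.
suff -> : I 0 b (fun s => (f s - avg f s) ^+ 2) = I 0 b (fun s => f s ^+ 2) -
  2 * I 0 b (fun s => f s * avg f s) + I 0 b (fun s => avg f s ^+ 2) by lra.
rewrite -I_Z; last exact: bmfM.
rewrite -I_B; [|exact: bmfX|by apply: bmfZ; exact: bmfM].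
rewrite -I_D; [|by apply: bmfB; [exact: bmfX|apply: bmfZ; exact: bmfM]|exact: bmfX].
by apply: eq_I => s _; ring.
Qed.

End Hardy.

Lemma expR_lip {R : realType} (x y m : R) : x <= m -> y <= m ->
  `|expR x - expR y| <= expR m * `|x - y|.
Proof.
wlog xy : x y / x <= y => [H xm ym|xm ym].
  have [xy|/ltW yx] := leP x y; first exact: H.
  by rewrite distrC (distrC x); exact: H.
rewrite distrC (distrC x) !ger0_norm ?subr_ge0 ?ler_expR//.
have e1 : 1 + (x - y) <= expR (x - y) by rewrite expR_ge1Dx.
have -> : expR x = expR y * expR (x - y) by rewrite -expRD addrC subrK.
have ey : expR y <= expR m by rewrite ler_expR.
have : expR y * (1 + (x - y)) <= expR y * expR (x - y) by rewrite ler_pM2l ?expR_gt0.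
have : expR y * (y - x) <= expR m * (y - x) by rewrite ler_wpM2r// subr_ge0.
lra.
Qed.

Lemma expRN_lip {R : realType} (x y : R) : 0 <= x -> 0 <= y ->
  `|expR (- x) - expR (- y)| <= `|x - y|.
Proof.
move=> x0 y0; have -> : x - y = - (- x - - y) by ring.
by rewrite normrN -[leRHS]mul1r -expR0; apply: expR_lip; rewrite oppr_le0.
Qed.

(* Second difference of exp(-G): g - h = g (1 - exp x) with x = G - H. *)
Lemma expRN_cmp4 {R : realType} (G G' H H' m c c1 c' : R) : 0 <= G' ->
  `|G - H| <= c -> c <= m -> `|G' - H'| <= m ->
  `|expR (- G') - expR (- G)| <= c1 -> `|(G' - H') - (G - H)| <= c' ->
  `|(expR (- G') - expR (- H')) - (expR (- G) - expR (- H))| <= expR m * (c' + c1 * c).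
Proof.
move=> G0 hc cm hm hc1 hc'.
have -> : expR (- H') = expR (- G') * expR (G' - H').
  by rewrite -expRD; congr expR; ring.
have -> : expR (- H) = expR (- G) * expR (G - H).
  by rewrite -expRD; congr expR; ring.
have gle : `|expR (- G')| <= 1.
  by rewrite ger0_norm ?expR_ge0// -expR0 ler_expR oppr_le0.
move: (expR (- G)) (expR (- G')) (G - H) (G' - H') gle hc1 hc hm hc' => g g' x x' gle hc1 hc hm hc'.
have -> : (g' - g' * expR x') - (g - g * expR x) =
   g' * (expR x - expR x') + (g' - g) * (1 - expR x) by ring.
have xm : x <= m by rewrite (le_trans (ler_norm _))// (le_trans hc).
have xm' : x' <= m by rewrite (le_trans (ler_norm _)).
have m0 : 0 <= m by rewrite (le_trans (normr_ge0 _) hm).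
have e1 := expR_lip xm xm'.
have e2 := expR_lip m0 xm; rewrite expR0 sub0r normrN in e2.
have e0 : 0 <= expR m by exact: expR_ge0.
apply: le_trans (ler_normD _ _) _; rewrite [leRHS]mulrDr; apply: lerD.
  rewrite normrM -[leRHS]mul1r; apply: ler_pM => //.
  by rewrite (le_trans e1)// ler_wpM2l// distrC.
rewrite normrM mulrCA; apply: ler_pM => //.
by rewrite (le_trans e2)// ler_wpM2l.
Qed.

Lemma sqrD2_le {R : realFieldType} (x y A B : R) : x ^+ 2 <= A -> y ^+ 2 <= B ->
  (x + 2 * y) ^+ 2 <= 2 * A + 8 * B.
Proof. by move=> hA hB; have := sqr_ge0 (x - 2 * y); nra. Qed.

(** * The coefficients g, g~ and g~_r as functionals of u, and their stability *)

Section State.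
Context {R : realType}.
Variable b : R.
Hypothesis b0 : 0 < b.
Implicit Types (u : R -> R) (r s : R).

(* With [avg u] for u~: [VV u] = u - u~, [QQ u] = (u - u~)/r, [gg u] = g = exp (- GG u),
   [gt u] = g~ and [gam u] = g~_r. *)
Definition VV u s := u s - avg u s.
Definition QQ u s := VV u s / s.
Definition GG u r := I r b (fun s => VV u s ^+ 2 / s).
Definition gg u r := expR (- GG u r).
Definition gt u := avg (gg u).
Definition gam u r := (gg u r - gt u r) / r.
Definition N2 u := I 0 b (fun s => u s ^+ 2).
(** Boundedness of [QQ] makes the integrand [VV u s ^+ 2 / s] of [GG] bounded at the center; a
    Lipschitz bound on [u] near 0 is enough for it. *)
Definition adm u := bmf 0 b u /\ bmf 0 b (QQ u).

Lemma N2_ge0 u : 0 <= N2 u.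
Proof. by apply: I_ge0 => s _; exact: sqr_ge0. Qed.

Lemma VVE u s : s != 0 -> VV u s = s * QQ u s.
Proof. by move=> s0; rewrite /QQ mulrC divfK. Qed.

Lemma Gint_eq u s : 0 < s -> s * QQ u s ^+ 2 = VV u s ^+ 2 / s.
Proof. by move=> s0; rewrite VVE ?gt_eqF//; field; rewrite gt_eqF. Qed.

Lemma bmf_s : bmf 0 b (fun s => s).
Proof.
apply: (@bmf_cont _ _ _ _ b) => [s _|s /andP[s0 sb]]; first exact: cvg_id.
by rewrite gtr0_norm// ltW.
Qed.

Lemma bmf_Gint u : adm u -> bmf 0 b (fun s => VV u s ^+ 2 / s).
Proof.
move=> [_ bq]; apply: bmf_eq (bmfM bmf_s (bmfX 2 bq)) => s /andP[s0 _].
exact: Gint_eq.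
Qed.

Lemma bmf_VV u : bmf 0 b u -> bmf 0 b (VV u).
Proof. by move=> bu; apply: bmfB => //; exact: bmf_avg. Qed.

Lemma GG_split u r s : adm u -> 0 <= r -> r <= s -> s <= b ->
  GG u r = I r s (fun s => VV u s ^+ 2 / s) + GG u s.
Proof.
by move=> au r0 rs sb; apply: I_split => //; apply: bmf_sub (bmf_Gint au).
Qed.

Lemma GG_ge0 u r : 0 <= r -> 0 <= GG u r.
Proof.
move=> r0; apply: I_ge0 => s /andP[rs _]; rewrite divr_ge0 ?sqr_ge0// ltW//.
exact: le_lt_trans rs.
Qed.

Lemma le_N2 a c u : 0 <= a -> a <= c -> c <= b -> bmf 0 b u ->
  I a c (fun s => u s ^+ 2) <= N2 u.
Proof.
move=> a0 ac cb bu; rewrite /N2 (@I_split _ 0 a b)//; [|exact: le_trans cb|exact: bmfX].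
rewrite (@I_split _ a c b)//; last by apply: bmf_sub (bmfX 2 bu).
have sq x y : 0 <= I x y (fun s => u s ^+ 2) by apply: I_ge0 => s _; exact: sqr_ge0.
by have := sq 0 a; have := sq c b; lra.
Qed.

(** Writing the integrand as [s * QQ u s ^+ 2] gains a factor [s], which later cancels the quotient
    by r in [gam]. *)
Lemma GG_diff u r s : adm u -> 0 <= r -> r <= s -> s <= b ->
  0 <= GG u r - GG u s <= s * N2 (QQ u).
Proof.
move=> au r0 rs sb; rewrite (GG_split au r0 rs sb) addrK; apply/andP; split.
  by apply: I_ge0 => x /andP[rx _]; rewrite divr_ge0 ?sqr_ge0 ?(le_trans r0)// ltW.
have [_ bq] := au.
apply: (@le_trans _ _ (s * I r s (fun x => QQ u x ^+ 2))); last first.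
  by rewrite ler_wpM2l ?(le_trans r0 rs)// le_N2.
have bq2 : bmf r s (fun x => QQ u x ^+ 2) by apply: bmf_sub (bmfX 2 bq).
rewrite -I_Z//; apply: le_I => [||x /andP[rx xs]].
- by apply: bmf_sub (bmf_Gint au).
- exact: bmfZ.
- by rewrite -Gint_eq ?(le_lt_trans r0)// ler_wpM2r ?sqr_ge0// ltW.
Qed.

Lemma GG_bound u r : adm u -> 0 <= r <= b -> GG u r <= b * N2 (QQ u).
Proof.
move=> au /andP[r0 rb]; have := GG_diff au r0 rb (lexx b).
by have -> : GG u b = 0 by [rewrite /GG I_xx]; rewrite subr0 => /andP[].
Qed.

Lemma gg_gt0 u r : 0 < gg u r.
Proof. exact: expR_gt0. Qed.

Lemma gg_le1 u r : 0 <= r -> gg u r <= 1.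
Proof. by move=> r0; rewrite -expR0 ler_expR oppr_le0 GG_ge0. Qed.

Lemma gg_b u : gg u b = 1.
Proof. by rewrite /gg /GG I_xx oppr0 expR0. Qed.

Lemma gg_ge u r : adm u -> 0 <= r <= b -> expR (- (b * N2 (QQ u))) <= gg u r.
Proof. by move=> au rb; rewrite ler_expR lerN2 GG_bound. Qed.

Lemma gg_mono u r s : adm u -> 0 <= r -> r <= s -> s <= b -> gg u r <= gg u s.
Proof.
move=> au r0 rs sb; rewrite ler_expR lerN2.
by have /andP[] := GG_diff au r0 rs sb; rewrite subr_ge0.
Qed.

Lemma gg_diff u r s : adm u -> 0 <= r -> r <= s -> s <= b ->
  gg u s - gg u r <= s * N2 (QQ u).
Proof.
move=> au r0 rs sb; have /andP[h1 h2] := GG_diff au r0 rs sb.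
apply: le_trans (ler_norm _) _.
apply: le_trans (expRN_lip (GG_ge0 u (le_trans r0 rs)) (GG_ge0 u r0)) _.
by rewrite distrC ger0_norm.
Qed.

Lemma gg_lip u : adm u ->
  exists M, forall r s, 0 <= r <= b -> 0 <= s <= b -> `|gg u r - gg u s| <= M * `|r - s|.
Proof.
move=> au; have bG := bmf_Gint au; have [M M0 GM] := bmf_bound bG.
exists M => r s /andP[r0 rb] /andP[s0 sb].
apply: le_trans (expRN_lip (GG_ge0 u r0) (GG_ge0 u s0)) _.
have H x : 0 <= x -> x <= b -> GG u x = I 0 b (fun s => VV u s ^+ 2 / s) - I 0 x (fun s => VV u s ^+ 2 / s).
  by move=> x0 xb; rewrite (@I_split _ 0 x b)// [I 0 x _ + _]addrC addrK.
rewrite !H// opprB addrC addrA subrK distrC.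
by apply: I_lip bG GM _ _; rewrite ?r0 ?s0.
Qed.

Lemma gg_cont u s : adm u -> 0 < s < b -> {for s, continuous (gg u)}.
Proof. by move=> au sb; have [M lM] := gg_lip au; exact: lip_continuous lM sb. Qed.

Lemma gg_abs1 u s : 0 <= s -> `|gg u s| <= 1.
Proof. by move=> s0; rewrite gtr0_norm ?gg_gt0// gg_le1. Qed.

Lemma bmf_gg u : adm u -> bmf 0 b (gg u).
Proof.
move=> au; apply: (@bmf_cont _ _ _ _ 1) => [s|s /andP[s0 sb]].
  exact: gg_cont.
by rewrite gg_abs1// ltW.
Qed.

Lemma avg_B f g r : 0 <= r <= b -> bmf 0 b f -> bmf 0 b g ->
  avg (fun s => f s - g s) r = avg f r - avg g r.
Proof.
move=> /andP[r0 rb] bf bg.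
by rewrite /avg I_B -?mulrBl//; [exact: bmf_sub bf|exact: bmf_sub bg].
Qed.

Lemma avg_le f c r : 0 < r <= b -> bmf 0 b f -> (forall s, 0 < s < r -> f s <= c) ->
  avg f r <= c.
Proof.
move=> /andP[r0 rb] bf fc; rewrite /avg ler_pdivrMr//.
rewrite -[X in _ * X](subr0 r) -I_cst ?(ltW r0)//; apply: le_I => //.
  exact: bmf_sub bf.
exact: bmf_cst.
Qed.

Lemma avg_ge f c r : 0 < r <= b -> bmf 0 b f -> (forall s, 0 < s < r -> c <= f s) ->
  c <= avg f r.
Proof.
move=> /andP[r0 rb] bf fc; rewrite /avg ler_pdivlMr//.
rewrite -[X in _ * X](subr0 r) -I_cst ?(ltW r0)//; apply: le_I => //.
  exact: bmf_cst.
exact: bmf_sub bf.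
Qed.

Lemma gt_lower u r : adm u -> 0 < r <= b -> expR (- (b * N2 (QQ u))) <= gt u r.
Proof.
move=> au rb; apply: avg_ge (bmf_gg au) _ => // s /andP[s0 sr].
by apply: gg_ge => //; rewrite ltW//= ltW// (lt_le_trans sr)//; case/andP: rb.
Qed.

Lemma gt_gt0 u r : adm u -> 0 < r <= b -> 0 < gt u r.
Proof. by move=> au rb; exact: lt_le_trans (expR_gt0 _) (gt_lower au rb). Qed.

Lemma gt_le1 u r : adm u -> 0 < r <= b -> gt u r <= 1.
Proof.
move=> au rb; apply: avg_le (bmf_gg au) _ => // s /andP[s0 sr].
by rewrite gg_le1// ltW.
Qed.

Lemma gam_ge0 u r : adm u -> 0 < r <= b -> 0 <= gam u r.
Proof.
move=> au rb; have /andP[r0 rb'] := rb.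
rewrite divr_ge0 ?(ltW r0)// subr_ge0 /gt; apply: (avg_le rb (bmf_gg au)) => s /andP[s0 sr].
by apply: gg_mono => //; exact: ltW.
Qed.

(** The rise of [gg] on (0, r) is at most r times [N2 (QQ u)]; dividing by r leaves a bound that is
    uniform up to the center. *)
Lemma gam_le u r : adm u -> 0 < r <= b -> gam u r <= N2 (QQ u).
Proof.
move=> au rb; have /andP[r0 rb'] := rb.
rewrite ler_pdivrMr// lerBlDr addrC -lerBlDr mulrC.
apply: avg_ge (bmf_gg au) _ => // s /andP[s0 sr].
by rewrite lerBlDr addrC -lerBlDr gg_diff// ltW.
Qed.

Lemma gt_derive u s : adm u -> 0 < s < b -> is_derive s 1 (gt u) (gam u s).
Proof.
move=> au sb; have /andP[s0 _] := sb; have sn0 : s != 0 by rewrite gt_eqF.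
have d := I_derive (bmf_gg au) (M := 1) _ sb (gg_cont au sb).
have {}d := d (fun r h => gg_abs1 u (ltW (andP h).1)).
by apply: d_eq (dM d (dV sn0 (dI s))) _; rewrite /gam /gt /avg; field.
Qed.

Lemma gt_cont u s : adm u -> 0 < s < b -> {for s, continuous (gt u)}.
Proof. by move=> au sb; exact: avg_cont (bmf_gg au) sb. Qed.

Lemma gam_cont u s : adm u -> 0 < s < b -> {for s, continuous (gam u)}.
Proof.
move=> au sb; apply: cvgM.
  by apply: cvgB; [exact: gg_cont|exact: gt_cont].
by apply: cvgV; [case/andP: sb => /gt_eqF->|exact: cvg_id].
Qed.

Lemma bmf_gt u : adm u -> bmf 0 b (gt u).
Proof. by move=> au; exact/bmf_avg/bmf_gg. Qed.

Lemma bmf_gam u : adm u -> bmf 0 b (gam u).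
Proof.
move=> au; apply: (@bmf_cont _ _ _ _ (N2 (QQ u))) => [s|s /andP[s0 sb]].
  exact: gam_cont.
have rb : 0 < s <= b by rewrite s0 ltW.
by rewrite ger0_norm ?gam_ge0 ?gam_le.
Qed.

Lemma gt_lip u r s : adm u -> 0 < r <= b -> 0 < s <= b ->
  `|gt u r - gt u s| <= N2 (QQ u) * `|r - s|.
Proof.
move=> au.
wlog rs : r s / r <= s => [H rb sb|].
  have [rs|/ltW sr] := leP r s; first exact: H.
  by rewrite distrC (distrC r); exact: H.
move=> /andP[r0 rb] /andP[s0 sb].
pose F x := gt u x.
have -> : gt u r - gt u s = - I r s (gam u).
  suff -> : I r s (gam u) = gt u s - gt u r by rewrite opprB.
  apply: (@I_FTC _ r s (gt u) (gam u) (N2 (QQ u))) => //.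
  - have cI : {within `[r, s], continuous (fun x => I 0 x (gg u))}.
      apply: (@lip_within _ _ _ _ 1) => x y /andP[rx xs] /andP[ry ys].
      apply: I_lip (bmf_gg au) _ _ _.
      + by move=> t /andP[t0 _]; rewrite gg_abs1// ltW.
      + by rewrite (le_trans (ltW r0) rx) (le_trans xs sb).
      + by rewrite (le_trans (ltW r0) ry) (le_trans ys sb).
    have cV : {within `[r, s], continuous (fun x : R => x^-1)}.
      apply: continuous_in_subspaceT => x; rewrite inE /= in_itv /= => /andP[rx _].
      by apply: inv_continuous; rewrite gt_eqF// (lt_le_trans r0).
    by move=> x; apply: cvgM; [exact: cI|exact: cV].
  - by move=> x /andP[rx xs]; apply: gt_derive => //; rewrite (lt_trans r0 rx) (lt_le_trans xs).
  - by move=> x /andP[rx xs]; apply: gam_cont => //; rewrite (lt_trans r0 rx) (lt_le_trans xs).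
  - move=> x /andP[rx xs]; have xb : 0 < x <= b by rewrite (lt_trans r0 rx) (le_trans (ltW xs)).
    by rewrite ger0_norm ?gam_ge0 ?gam_le.
rewrite normrN distrC (ger0_norm (x := s - r)) ?subr_ge0//.
apply: I_le_bound => //; first by apply: bmf_sub (bmf_gam au) => //; exact: ltW.
move=> x /andP[rx xs]; have xb : 0 < x <= b by rewrite (lt_trans r0 rx) (le_trans (ltW xs)).
by rewrite ger0_norm ?gam_ge0 ?gam_le.
Qed.

Opaque gg GG gt gam VV QQ N2.
Lemma sqr_abs_le (x y : R) : 0 <= y -> `|x| <= y -> x ^+ 2 <= y ^+ 2.
Proof. by move=> y0 xy; rewrite -(real_normK (num_real x)) lerXn2r ?nnegrE. Qed.

(** A difference of squares, with the weight 1/s put on the sum: the difference of the [VV] enters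
    unweighted, and the sum of the [QQ] only has to be bounded in L^2. *)
Lemma GG_cmp u1 u2 r : adm u1 -> adm u2 -> 0 <= r <= b ->
  (GG u1 r - GG u2 r) ^+ 2 <=
  N2 (fun s => VV u1 s - VV u2 s) * N2 (fun s => QQ u1 s + QQ u2 s).
Proof.
move=> a1 a2 /andP[r0 rb].
have [[b1 q1] [b2 q2]] := (a1, a2).
have bd : bmf 0 b (fun s => VV u1 s - VV u2 s) by apply: bmfB; exact: bmf_VV.
have bq : bmf 0 b (fun s => QQ u1 s + QQ u2 s) by exact: bmfD.
Transparent GG QQ.
have -> : GG u1 r - GG u2 r =
    I r b (fun s => (VV u1 s - VV u2 s) * (QQ u1 s + QQ u2 s)).
  rewrite -I_B; [|exact: bmf_sub (bmf_Gint a1)|exact: bmf_sub (bmf_Gint a2)].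
  apply: eq_I => s /andP[rs _]; have s0 := le_lt_trans r0 rs.
  by rewrite /QQ; field; rewrite gt_eqF.
apply: le_trans (I_CS _ _) _; [exact: bmf_sub bd|exact: bmf_sub bq|].
by apply: ler_pM; rewrite ?le_N2//; apply: I_ge0 => s _; exact: sqr_ge0.
Qed.

(** In the application [u1], [u1'] are the exact solution at two times and [u2], [u2'] the discrete
    one. The second difference of squares is split as d' p + 2 d q so that, besides the increment
    [d'] of the error, the only small factor needed is [q], which involves the exact solution alone;
    [p] need only be bounded. *)
Lemma GG_cmp4 u1 u1' u2 u2' r : adm u1 -> adm u1' -> adm u2 -> adm u2' -> 0 <= r <= b ->
  ((GG u1' r - GG u2' r) - (GG u1 r - GG u2 r)) ^+ 2 <=
  2 * N2 (fun s => (VV u1' s - VV u2' s) - (VV u1 s - VV u2 s)) *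
    N2 (fun s => QQ u1' s + QQ u2' s - (QQ u1 s - QQ u2 s)) +
  8 * N2 (fun s => VV u1 s - VV u2 s) * N2 (fun s => QQ u1' s - QQ u1 s).
Proof.
move=> a1 a1' a2 a2' /andP[r0 rb].
have [[b1 q1] [b2 q2]] := (a1, a2).
have [[b1' q1'] [b2' q2']] := (a1', a2').
set d := fun s => VV u1 s - VV u2 s.
set d' := fun s => VV u1' s - VV u2' s - (VV u1 s - VV u2 s).
set p := fun s => QQ u1' s + QQ u2' s - (QQ u1 s - QQ u2 s).
set q := fun s => QQ u1' s - QQ u1 s.
have bd : bmf 0 b d by apply: bmfB; exact: bmf_VV.
have bd' : bmf 0 b d' by apply: bmfB => //; apply: bmfB; exact: bmf_VV.
have bp : bmf 0 b p by apply: bmfB; [exact: bmfD|exact: bmfB].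
have bq : bmf 0 b q by exact: bmfB.
have S f : bmf 0 b f -> bmf r b f by apply: bmf_sub.
Transparent GG QQ N2.
have -> : (GG u1' r - GG u2' r) - (GG u1 r - GG u2 r) =
    I r b (fun s => d' s * p s) + 2 * I r b (fun s => d s * q s).
  rewrite -I_Z; last by apply: bmfM; exact: S.
  rewrite -I_D; [|by apply: bmfM; exact: S|by apply: bmfZ; apply: bmfM; exact: S].
  have bG := fun u au => S _ (@bmf_Gint u au).
  rewrite /GG -(I_B (bG _ a1') (bG _ a2')) -(I_B (bG _ a1) (bG _ a2)) -I_B;
    [|by apply: bmfB; exact: bG..].
  apply: eq_I => s /andP[rs _]; have s0 := le_lt_trans r0 rs.
  by rewrite /d' /d /p /q /QQ; field; rewrite gt_eqF.
have h1 := I_CS (S _ bd') (S _ bp).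
have h2 := I_CS (S _ bd) (S _ bq).
have L f : bmf 0 b f -> I r b (fun s => f s ^+ 2) <= N2 f.
  by move=> ?; apply: le_N2.
have P f : 0 <= I r b (fun s => f s ^+ 2) by apply: I_ge0 => s _; exact: sqr_ge0.
have h1' := le_trans h1 (ler_pM (P _) (P _) (L _ bd') (L _ bp)).
have h2' := le_trans h2 (ler_pM (P _) (P _) (L _ bd) (L _ bq)).
by rewrite -!(mulrA _ (N2 _)); apply: sqrD2_le.
Qed.

Lemma gg_cmp u1 u2 r c : adm u1 -> adm u2 -> 0 <= r <= b -> 0 <= c ->
  N2 (fun s => VV u1 s - VV u2 s) * N2 (fun s => QQ u1 s + QQ u2 s) <= c ^+ 2 ->
  `|gg u1 r - gg u2 r| <= c.
Proof.
move=> a1 a2 rb c0 h; have /andP[r0 _] := rb.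
apply: le_trans (expRN_lip (GG_ge0 u1 r0) (GG_ge0 u2 r0)) _.
rewrite -(ler_sqr (x := `|_|)) ?nnegrE// real_normK ?num_real//.
exact: le_trans (GG_cmp a1 a2 rb) h.
Qed.

Transparent gg.
Lemma gg_cmp4 u1 u1' u2 u2' r m c c1 c' : adm u1 -> adm u1' -> adm u2 -> adm u2' ->
  0 <= r <= b ->
  `|GG u1 r - GG u2 r| <= c -> c <= m -> `|GG u1' r - GG u2' r| <= m ->
  `|gg u1' r - gg u1 r| <= c1 ->
  `|(GG u1' r - GG u2' r) - (GG u1 r - GG u2 r)| <= c' ->
  `|(gg u1' r - gg u2' r) - (gg u1 r - gg u2 r)| <= expR m * (c' + c1 * c).
Proof.
by move=> a1 a1' a2 a2' /andP[r0 rb] *; apply: expRN_cmp4 => //; exact: GG_ge0.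
Qed.

End State.

Lemma d_uniq {R : realType} (s l m : R) (f : R -> R) :
  is_derive s 1 f l -> is_derive s 1 f m -> l = m.
Proof. by move=> [_ <-] [_ <-]. Qed.

(** * Polynomials under the integral, and unisolvent functionals *)

Section PolyInt.
Context {R : realType}.
Implicit Types (a c s M : R) (p q v : {poly R}).

Lemma bmf_id a c : bmf a c (fun s : R => s).
Proof.
apply: (@bmf_cont _ _ _ _ (`|a| + `|c|)) => [s _|s /andP[sa sc]]; first exact: cvg_id.
have := ler_norm c; have := ler_norm (- a); rewrite normrN ler_norml.
by have := normr_ge0 a; have := normr_ge0 c; lra.
Qed.

Lemma bmf_poly a c p : bmf a c (fun s => p.[s]).
Proof.
apply: bmf_eq (@bmf_sum _ a c (size p) (fun i s => p`_i * s ^+ i) _).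
  by move=> s _; rewrite horner_coef.
by move=> i; apply: bmfZ; apply: bmfX; exact: bmf_id.
Qed.

Lemma poly_cont p s : {for s, continuous (fun x : R => p.[x])}.
Proof. exact: continuous_horner. Qed.

Lemma poly_derive p s : is_derive s 1 (fun x : R => p.[x]) (p^`()).[s].
Proof. exact: is_derive_poly. Qed.

Lemma I_scale a c (f : R -> R) M : a < c -> (forall s, 0 < s < 1 -> {for s, continuous f}) ->
  (forall s, 0 < s < 1 -> `|f s| <= M) ->
  I a c (fun s => f ((s - a) / (c - a))) = (c - a) * I 0 1 f.
Proof.
move=> ac cf fM; have h0 : 0 < c - a by rewrite subr_gt0.
have hn0 : c - a != 0 by rewrite gt_eqF.
have bf : bmf 0 1 f by apply: bmf_cont cf fM.
pose y s := (s - a) / (c - a).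
have y01 s : a < s < c -> 0 < y s < 1.
  by move=> /andP[as_ sc]; rewrite divr_gt0 ?subr_gt0// ltr_pdivrMr// mul1r ltrD2r.
have y01' s : a <= s <= c -> 0 <= y s <= 1.
  move=> /andP[as_ sc]; rewrite /y; apply/andP; split.
    by rewrite divr_ge0 ?subr_ge0// ltW.
  by rewrite ler_pdivrMr// mul1r lerD2r.
have dy s : is_derive s 1 y (c - a)^-1.
  by apply: d_eq (dM (dB (dI s) (dC s a)) (dC s _)) _; ring.
pose F s := (c - a) * I 0 (y s) f.
have -> : (c - a) * I 0 1 f = F c - F a.
  by rewrite /F /y subrr mul0r I_xx mulr0 subr0 divff.
apply: (@I_FTC _ a c F (fun s => f (y s)) M); first exact: ltW.
- apply: (@lip_within _ _ _ _ M) => r s rac sac; rewrite /F -mulrBr normrM gtr0_norm//.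
  have := I_lip bf fM (y01' _ rac) (y01' _ sac).
  have -> : y r - y s = (c - a)^-1 * (r - s) by rewrite /y; field.
  rewrite normrM gtr0_norm ?invr_gt0// => h.
  have -> : M * `|r - s| = (c - a) * (M * ((c - a)^-1 * `|r - s|)) by field.
  by rewrite ler_pM2l.
- move=> s sac; have dI := I_derive bf fM (y01 _ sac) (cf _ (y01 _ sac)).
  apply: d_eq (dZ (c - a) (d_comp dI (dy s))) _.
  by rewrite mulrCA divff// mulr1.
- move=> s sac; have cy := d_cont (dy s).
  exact: (continuous_comp cy (cf _ (y01 _ sac))).
- by move=> s sac; apply: fM; exact: y01.
Qed.

(** All partial integrals vanish, hence so does their derivative [q.[r] ^+ 2] at every interior
    point, which is more roots than the degree allows. *)
Lemma poly_sqr_int0 q : I 0 1 (fun s => q.[s] ^+ 2) = 0 -> q = 0.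
Proof.
move=> q0; have bq : bmf 0 1 (fun s => q.[s] ^+ 2) by apply: bmfX; exact: bmf_poly.
have pos x y : 0 <= I x y (fun s => q.[s] ^+ 2) by apply: I_ge0 => s _; exact: sqr_ge0.
have z r : 0 < r < 1 -> I 0 r (fun s => q.[s] ^+ 2) = 0.
  move=> /andP[r0 r1]; have := @I_split _ 0 r 1 _ (ltW r0) (ltW r1) bq.
  by rewrite q0; have := pos 0 r; have := pos r 1; lra.
have [M _ qM] := bmf_bound bq.
have qz r : 0 < r < 1 -> root q r.
  move=> r01; have cq : {for r, continuous (fun s => q.[s] ^+ 2)}.
    rewrite (_ : (fun s => q.[s] ^+ 2) = fun x => (q ^+ 2).[x]); first exact: poly_cont.
    by apply/funext => x; rewrite horner_exp.
  have d := I_derive bq qM r01 cq.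
  have d0 : is_derive r 1 (fun r => I 0 r (fun s => q.[s] ^+ 2)) 0.
    apply: d_near (dC r 0) _; near=> x; rewrite z//; apply/andP; split.
      by near: x; apply: lt_nbhsr; case/andP: r01.
    by near: x; apply: lt_nbhsl; case/andP: r01.
  by have /eqP := d_uniq d d0; rewrite sqrf_eq0.
apply/eqP; apply: contraT => qn0.
pose rs := [seq (i.+1%:R / (size q).+1%:R : R) | i <- iota 0 (size q)].
have rsr : all (root q) rs.
  apply/allP => x /mapP[i]; rewrite mem_iota add0n => /andP[_ iq] ->; apply: qz.
  by rewrite divr_gt0// ltr_pdivrMr// mul1r ltr_nat ltnS iq.
have urs : uniq rs.
  rewrite map_inj_uniq ?iota_uniq// => i j /(mulIf _) h.
  have : i.+1%:R = j.+1%:R :> R by apply: h; rewrite invr_eq0 pnatr_eq0.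
  by move=> /eqP; rewrite eqr_nat => /eqP[].
by have := max_poly_roots qn0 rsr urs; rewrite size_map size_iota ltnn.
Unshelve. all: by end_near. Qed.

(** A square linear system: injectivity on polynomials of degree at most k makes the matrix of the
    functionals invertible, and [B] is its inverse. *)
Lemma unisolvent k (L : 'I_k.+1 -> {poly R} -> R) :
  (forall j p, (size p <= k.+1)%N -> L j p = \sum_(i < k.+1) p`_i * L j 'X^i) ->
  (forall p, (size p <= k.+1)%N -> (forall j, L j p = 0) -> p = 0) ->
  exists B : 'I_k.+1 -> 'I_k.+1 -> R,
    (forall p, (size p <= k.+1)%N -> forall i : 'I_k.+1, p`_i = \sum_j B j i * L j p) /\
    (forall m : 'I_k.+1 -> R, forall j,
       L j (\poly_(i < k.+1) \sum_j B j (inord i) * m j) = m j).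
Proof.
move=> linL injL.
pose A : 'M[R]_k.+1 := \matrix_(i, j) L j 'X^i.
have LA p : (size p <= k.+1)%N -> (poly_rV p : 'rV_k.+1) *m A = \row_j L j p.
  move=> sp; apply/rowP => j; rewrite !mxE linL//.
  by apply: eq_bigr => i _; rewrite !mxE.
have uA : A \in unitmx.
  rewrite -row_free_unit -kermx_eq0; apply/eqP/row_matrixP => i.
  rewrite row0; have : row i (kermx A) *m A = 0 by rewrite -row_mul mulmx_ker row0.
  set w := row i _ => wA; have := injL (rVpoly w) (size_poly _ _).
  have := LA (rVpoly w) (size_poly _ _); rewrite rVpolyK wA => e.
  move=> /(_ _)/(congr1 (poly_rV (d := k.+1))); rewrite rVpolyK linear0; apply.
  by move=> j; have /rowP/(_ j) := e; rewrite !mxE.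
exists (fun j i => invmx A j i); split=> [p sp i|m j].
  have := congr1 (fun X => X *m invmx A) (LA p sp); rewrite /= mulmxK//.
  move=> /rowP/(_ i); rewrite !mxE => ->.
  by apply: eq_bigr => j _; rewrite !mxE mulrC.
set p := \poly_(i < k.+1) _; have sp : (size p <= k.+1)%N by exact: size_poly.
have := LA p sp; have -> : (poly_rV p : 'rV_k.+1) = (\row_j m j) *m invmx A.
  apply/rowP => i; rewrite !mxE coef_poly ltn_ord inord_val.
  by apply: eq_bigr => l _; rewrite !mxE mulrC.
by rewrite mulmxKV// => /rowP/(_ j); rewrite !mxE.
Qed.

End PolyInt.

(** * Gauss-Radau and L^2 projections, and inverse inequalities *)

Section Projection.
Context {R : realType}.
Implicit Types (a c s M : R) (p q v : {poly R}) (f : R -> R) (gr : bool).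

Definition inv_rV k (L : 'I_k.+1 -> {poly R} -> R) (B : 'I_k.+1 -> 'I_k.+1 -> R) :=
  (forall p, (size p <= k.+1)%N -> forall i : 'I_k.+1, p`_i = \sum_j B j i * L j p) /\
  (forall m : 'I_k.+1 -> R, forall j,
     L j (\poly_(i < k.+1) \sum_j B j (inord i) * m j) = m j).

(* Degrees of freedom of the Gauss-Radau (gr = true) and L^2 projections: the
   moments up to k - 1, and the left value or the k-th moment. *)
Definition dof gr k a c f (j : nat) : R :=
  if gr && (j == k) then f a
  else (c - a)^-1 * I a c (fun s => f s * ((s - a) / (c - a)) ^+ j).

Lemma bmf_mono a c j : bmf a c (fun s => ((s - a) / (c - a)) ^+ j).
Proof.
apply: bmfX; apply: bmfM; last exact: bmf_cst.
by apply: bmfB; [exact: bmf_id|exact: bmf_cst].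
Qed.

Lemma dofD gr k a c f g j : bmf a c f -> bmf a c g ->
  dof gr k a c (fun s => f s + g s) j = dof gr k a c f j + dof gr k a c g j.
Proof.
move=> bf bg; rewrite /dof; case: ifP => // _.
rewrite -mulrDr -I_D; [|by apply: bmfM => //; exact: bmf_mono..].
by congr (_ * _); apply: eq_I => s _; rewrite mulrDl.
Qed.

Lemma dofZ gr k a c f x j : bmf a c f ->
  dof gr k a c (fun s => x * f s) j = x * dof gr k a c f j.
Proof.
move=> bf; rewrite /dof; case: ifP => // _.
rewrite [RHS]mulrCA -(I_Z x); last by apply: bmfM => //; exact: bmf_mono.
by congr (_ * _); apply: eq_I => s _; rewrite mulrA.
Qed.

Lemma eq_dof gr k a c f g j : a < c -> (forall s, a <= s < c -> f s = g s) ->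
  dof gr k a c f j = dof gr k a c g j.
Proof.
move=> ac fg; rewrite /dof fg ?lexx//; case: ifP => // _; congr (_ * _).
by apply: eq_I => s /andP[as_ sc]; rewrite fg// ltW.
Qed.

Lemma dof_le gr k a c f M j : a < c -> bmf a c f ->
  (forall s, a < s < c -> `|f s| <= M) -> (gr -> `|f a| <= M) ->
  `|dof gr k a c f j| <= M.
Proof.
move=> ac bf fM fa; rewrite /dof; case: ifP => [/andP[/fa]//|_].
have h0 : 0 < c - a by rewrite subr_gt0.
rewrite normrM gtr0_norm ?invr_gt0// mulrC ler_pdivrMr//.
apply: I_le_bound; [exact: ltW|by apply: bmfM => //; exact: bmf_mono|].
move=> s sac; have /andP[as_ sc] := sac.
rewrite normrM -[leRHS]mulr1 ler_pM ?fM// normrX.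
rewrite exprn_ile1// ger0_norm ?divr_ge0 ?subr_ge0 ?ltW//.
by rewrite ltr_pdivrMr// mul1r ltrD2r.
Qed.

Lemma dof_sum gr k n a c (F : 'I_n -> R -> R) j : (forall i, bmf a c (F i)) ->
  dof gr k a c (fun s => \sum_(i < n) F i s) j = \sum_(i < n) dof gr k a c (F i) j.
Proof.
elim: n F => [|n ih] F bF.
  rewrite big_ord0 -[RHS](mul0r (dof gr k a c (fun=> 1) j)) -dofZ; last exact: bmf_cst.
  by rewrite /dof !big_ord0 mul0r; case: ifP => // _; congr (_ * I a c _); apply/funext => s; rewrite big_ord0 !mul0r.
rewrite big_ord_recl -ih// -dofD//; last exact: bmf_sum.
by congr dof; apply/funext => s; rewrite big_ord_recl.
Qed.

Definition refdof gr k (j : 'I_k.+1) p := dof gr k 0 1 (fun s => p.[s]) j.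

Lemma refdof_linear gr k (j : 'I_k.+1) p : (size p <= k.+1)%N ->
  refdof gr j p = \sum_(i < k.+1) p`_i * refdof gr j 'X^i.
Proof.
move=> sp; rewrite /refdof -(@eq_dof _ _ _ _ (fun s => \sum_(i < k.+1) p`_i * ('X^i).[s]))//; last first.
  by move=> s _; rewrite (horner_coef_wide _ sp); apply: eq_bigr => i _; rewrite hornerXn.
rewrite dof_sum; last by move=> i; apply: bmfZ; exact: bmf_poly.
by apply: eq_bigr => i _; rewrite dofZ//; exact: bmf_poly.
Qed.

Lemma dof01 gr k f (j : nat) : ~~ (gr && (j == k)) ->
  dof gr k 0 1 f j = I 0 1 (fun s => f s * s ^+ j).
Proof.
move=> /negbTE e; rewrite /dof e subr0 invr1 mul1r.
by apply: eq_I => s _; rewrite subr0 mulr1.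
Qed.

Lemma I_poly_comb n p q : (forall j, (j < n)%N -> I 0 1 (fun s => p.[s] * s ^+ j) = 0) ->
  (size q <= n)%N -> I 0 1 (fun s => p.[s] * q.[s]) = 0.
Proof.
move=> p0 sq.
rewrite (@eq_I _ _ _ _ (fun s => \sum_(i < n) q`_i * (p.[s] * s ^+ i))); last first.
  move=> s _; rewrite (horner_coef_wide _ sq) mulr_sumr.
  by apply: eq_bigr => i _; rewrite mulrCA.
have bm i : bmf 0 1 (fun s => p.[s] * s ^+ i).
  by apply: bmfM; [exact: bmf_poly|apply: bmfX; exact: bmf_id].
rewrite I_sum; last by move=> i; exact: bmfZ.
by apply: big1 => i _; rewrite I_Z// p0// mulr0.
Qed.

(** For Gauss-Radau, p(0) = 0 gives p = X r with r of degree below k. Combining the moments with the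
    coefficients of r shows that the integral of s r^2 is 0, and s <= 1 turns this into X r = 0. *)
Lemma refdof_inj gr k p : (size p <= k.+1)%N ->
  (forall j : 'I_k.+1, refdof gr j p = 0) -> p = 0.
Proof.
move=> sp p0.
have mom j : (j < k.+1)%N -> ~~ (gr && (j == k)) -> I 0 1 (fun s => p.[s] * s ^+ j) = 0.
  by move=> jk e; rewrite -(dof01 _ e); exact: (p0 (Ordinal jk)).
case: gr p0 mom => p0 mom; last first.
  apply: poly_sqr_int0; rewrite (@eq_I _ _ _ _ (fun s => p.[s] * p.[s])).
    by apply: (@I_poly_comb k.+1) => // j jk; exact: mom.
  by move=> s _; rewrite expr2.
have : root p 0.
  by have := p0 ord_max; rewrite /refdof /dof eqxx => /eqP.
rewrite -polyC0 => /factor_theorem[r pE]; rewrite subr0 in pE.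
have [r0|rn0] := eqVneq r 0; first by rewrite pE r0 mul0r.
have sr : (size r <= k)%N by move: sp; rewrite pE size_mulX.
have e : I 0 1 (fun s => p.[s] * r.[s]) = 0.
  apply: (@I_poly_comb k) => // j jk; apply: mom; first exact: leqW.
  by rewrite ltn_eqF.
have e' : I 0 1 (fun s => s * r.[s] ^+ 2) = 0.
  by rewrite -[RHS]e; apply: eq_I => s _; rewrite pE hornerM hornerX; ring.
have br : bmf 0 1 (fun s => s * r.[s] ^+ 2).
  by apply: bmfM; [exact: bmf_id|apply: bmfX; exact: bmf_poly].
have bX : bmf 0 1 (fun s => ('X * r).[s] ^+ 2) by apply: bmfX; exact: bmf_poly.
have : 'X * r = 0.
  apply: poly_sqr_int0; apply/eqP; rewrite eq_le; apply/andP; split; last first.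
    by apply: I_ge0 => s _; exact: sqr_ge0.
  rewrite -[leRHS]e'; apply: le_I => // s /andP[s0 s1].
  rewrite hornerM hornerX exprMn expr2 -mulrA; apply: ler_piMl; last exact: ltW.
  by apply: mulr_ge0; [exact: ltW|exact: sqr_ge0].
by move=> /eqP; rewrite mulf_eq0 polyX_eq0 (negPf rn0).
Qed.

Lemma refdof_inv gr k : exists B, inv_rV (@refdof gr k) B.
Proof.
have [B [h1 h2]] := unisolvent (@refdof_linear gr k) (@refdof_inj gr k).
by exists B.
Qed.

Definition dofB gr k := sval (cid (refdof_inv gr k)).

Lemma dofBP gr k : inv_rV (@refdof gr k) (@dofB gr k).
Proof. by rewrite /dofB; case: cid. Qed.

(** Pullback from [a, c] to the reference interval [0, 1], with inverse [unhat]; constants obtained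
    on the reference interval do not depend on the mesh. *)
Definition hat a c p : {poly R} := p \Po ((c - a) *: 'X + a%:P).
Definition unhat a c p : {poly R} := p \Po ((c - a)^-1 *: ('X - a%:P)).

Lemma hatE a c p s : (hat a c p).[s] = p.[(c - a) * s + a].
Proof. by rewrite horner_comp !hornerE. Qed.

Lemma unhatE a c p s : (unhat a c p).[s] = p.[(s - a) / (c - a)].
Proof. by rewrite horner_comp !hornerE mulrC. Qed.

Lemma size_lin_comp n p q : (size q <= 2)%N -> (size p <= n.+1)%N ->
  (size (p \Po q) <= n.+1)%N.
Proof.
move=> sq sp; apply: leq_trans (size_comp_poly_leq p q) _; rewrite ltnS.
rewrite -(muln1 n); apply: leq_mul.
  by rewrite -subn1 leq_subLR add1n.
by rewrite -subn1 leq_subLR.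
Qed.

Lemma size_hat n a c p : (size p <= n.+1)%N -> (size (hat a c p) <= n.+1)%N.
Proof.
apply: size_lin_comp; apply: leq_trans (size_polyD _ _) _; rewrite geq_max.
rewrite (leq_trans (size_scale_leq _ _)) ?size_polyX//=.
by rewrite (leq_trans (size_polyC_leq1 _)).
Qed.

Lemma size_unhat n a c p : (size p <= n.+1)%N -> (size (unhat a c p) <= n.+1)%N.
Proof.
by apply: size_lin_comp; apply: leq_trans (size_scale_leq _ _) _; rewrite size_XsubC.
Qed.

Lemma hatK a c p : c - a != 0 -> hat a c (unhat a c p) = p.
Proof.
move=> h; rewrite /hat /unhat -comp_polyA comp_polyZ comp_polyB comp_polyX comp_polyC.
by rewrite addrK scalerA mulVf// scale1r comp_polyXr.
Qed.

Lemma unhatK a c p : c - a != 0 -> unhat a c (hat a c p) = p.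
Proof.
move=> h; rewrite /hat /unhat -comp_polyA comp_polyD comp_polyZ comp_polyX comp_polyC.
by rewrite scalerA mulfV// scale1r subrK comp_polyXr.
Qed.

Lemma refdof_hat gr k a c p (j : 'I_k.+1) : a < c ->
  refdof gr j (hat a c p) = dof gr k a c (fun s => p.[s]) j.
Proof.
move=> ac; have h0 : c - a != 0 by rewrite subr_eq0 gt_eqF.
rewrite /refdof /dof; case: ifP => _; first by rewrite hatE mulr0 add0r.
rewrite subr0 invr1 mul1r.
have bq : bmf 0 1 (fun x => (hat a c p * 'X^j).[x]) by exact: bmf_poly.
have [M _ qM] := bmf_bound bq.
have := @I_scale _ a c (fun x => (hat a c p * 'X^j).[x]) M ac _ qM.
move=> /(_ (fun s _ => @poly_cont _ (hat a c p * 'X^j) s)).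
move=> /(congr1 (fun x => (c - a)^-1 * x)); rewrite [in RHS]mulrA mulVf// mul1r.
rewrite (@eq_I _ 0 1 _ (fun s => (hat a c p).[s] * ((s - 0) * 1) ^+ j)) => [<-|s _]; last first.
  by rewrite hornerM hornerXn subr0 mulr1.
congr (_ * _); apply: eq_I => s _; rewrite hornerM hornerXn hatE; congr (_.[_] * _).
by field.
Qed.

Definition proj gr k a c f : {poly R} :=
  unhat a c (\poly_(i < k.+1) \sum_(j < k.+1) @dofB gr k j (inord i) * dof gr k a c f j).

Lemma size_proj gr k a c f : (size (proj gr k a c f) <= k.+1)%N.
Proof. by apply: size_unhat; exact: size_poly. Qed.

Lemma dof_proj gr k a c f (j : nat) : a < c -> (j <= k)%N ->
  dof gr k a c (fun s => (proj gr k a c f).[s]) j = dof gr k a c f j.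
Proof.
move=> ac jk; have jk' : (j < k.+1)%N by [].
rewrite -(refdof_hat _ _ (Ordinal jk') ac) hatK; last by rewrite subr_eq0 gt_eqF.
by have [_ ->] := dofBP gr k.
Qed.

(** Entrywise l^1 norm of the inverse matrix of the reference degrees of freedom; the extra 1 keeps
    it at least 1 whatever that matrix is. *)
Definition dofC gr k : R := 1 + \sum_(i < k.+1) \sum_(j < k.+1) `|@dofB gr k j i|.

Lemma dofC_gt0 gr k : 0 < dofC gr k.
Proof. by rewrite ltr_pwDl// sumr_ge0// => i _; exact: sumr_ge0. Qed.

Lemma hat_coef gr k a c p M : a < c -> (size p <= k.+1)%N ->
  (forall j, (j <= k)%N -> `|dof gr k a c (fun s => p.[s]) j| <= M) ->
  \sum_(i < k.+1) `|(hat a c p)`_i| <= dofC gr k * M.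
Proof.
move=> ac sp dM; have M0 : 0 <= M by exact: le_trans (normr_ge0 _) (dM 0 _).
have [inv _] := dofBP gr k.
rewrite /dofC mulrDl mul1r (le_trans (y := \sum_(i < k.+1) \sum_(j < k.+1) `|@dofB gr k j i| * M))//; last first.
  rewrite -[leLHS]add0r lerD// mulr_suml.
  by apply: ler_sum => i _; rewrite mulr_suml.
apply: ler_sum => i _; rewrite (inv _ (size_hat a c sp) i).
rewrite (le_trans (ler_norm_sum _ _ _))//; apply: ler_sum => j _.
by rewrite normrM ler_wpM2l// refdof_hat// dM// -ltnS.
Qed.

Lemma poly_bound_coef n a c p s : a < c -> a <= s <= c -> (size p <= n.+1)%N ->
  `|p.[s]| <= \sum_(i < n.+1) `|(hat a c p)`_i|.
Proof.
move=> ac /andP[as_ sc] sp; have h0 : 0 < c - a by rewrite subr_gt0.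
have hn : c - a != 0 by rewrite gt_eqF.
rewrite -{1}(unhatK p hn) unhatE (horner_coef_wide _ (size_hat a c sp)).
rewrite (le_trans (ler_norm_sum _ _ _))//; apply: ler_sum => i _.
rewrite normrM ler_piMr// normrX exprn_ile1// ger0_norm ?divr_ge0 ?subr_ge0 ?(ltW h0)//.
  by rewrite ler_pdivrMr// mul1r lerD2r.
exact: ltW.
Qed.

Lemma deriv_bound_coef n a c p s : a < c -> a <= s <= c -> (size p <= n.+1)%N ->
  `|(p^`()).[s]| <= n%:R / (c - a) * \sum_(i < n.+1) `|(hat a c p)`_i|.
Proof.
move=> ac /andP[as_ sc] sp; have h0 : 0 < c - a by rewrite subr_gt0.
have hn : c - a != 0 by rewrite gt_eqF.
rewrite -{1}(unhatK p hn) /unhat deriv_comp derivZ derivB derivX derivC subr0.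
set q := hat a c p; have sq : (size q <= n.+1)%N by exact: size_hat.
have -> : q^`() = \sum_(i < n.+1) q`_i *: ('X^(i.-1) *+ i).
  rewrite -{1}(coefK q) (poly_def (size q)) -(big_mkord xpredT (fun i => q`_i *: 'X^i)).
  rewrite (big_nat_widen _ _ n.+1)// big_mkcond /= big_mkord raddf_sum /=.
  apply: eq_bigr => i _; case: ltnP => si; first by rewrite derivZ derivXn.
  by rewrite deriv0 nth_default// scale0r.
rewrite hornerM horner_comp 2!hornerZ hornerXsubC hornerC mulr1 horner_sum.
rewrite normrM (gtr0_norm (x := (c - a)^-1)) ?invr_gt0// mulrC.
rewrite [X in _ <= X]mulrAC [X in _ <= X]mulrC ler_pM2l ?invr_gt0// mulr_sumr.
rewrite [_ * (s - a)]mulrC.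
rewrite (le_trans (ler_norm_sum _ _ _))//; apply: ler_sum => i _.
rewrite hornerZ hornerMn hornerXn normrM [leRHS]mulrC ler_wpM2l// normrMn.
have y1 : `|(s - a) / (c - a)| <= 1.
  rewrite ger0_norm ?divr_ge0 ?subr_ge0 ?(ltW ac)//.
  by rewrite ler_pdivrMr// mul1r lerD2r.
apply: (@le_trans _ _ (1 *+ i)); last by rewrite ler_nat -ltnS.
by rewrite lerMn2r; apply/orP; right; rewrite normrX exprn_ile1.
Qed.

Lemma dof_L2_le k a c f (j : nat) : a < c -> bmf a c f ->
  dof false k a c f j ^+ 2 <= (c - a)^-1 * I a c (fun s => f s ^+ 2).
Proof.
move=> ac bf; have h0 : 0 < c - a by rewrite subr_gt0.
rewrite /dof /= exprMn expr2 -mulrA ler_pM2l ?invr_gt0//.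
have bm := bmf_mono a c j; have := I_CS bf bm.
have m1 : I a c (fun s => (((s - a) / (c - a)) ^+ j) ^+ 2) <= c - a.
  rewrite -[leRHS]mul1r -(I_cst 1 (ltW ac)); apply: le_I => [||s /andP[as_ sc]].
  - exact: bmfX.
  - exact: bmf_cst.
  rewrite -exprM exprn_ile1 ?divr_ge0 ?subr_ge0 ?ltW//.
  by rewrite ltr_pdivrMr// mul1r ltrD2r.
have f0 : 0 <= I a c (fun s => f s ^+ 2) by apply: I_ge0 => s _; exact: sqr_ge0.
rewrite ler_pdivrMl//; move=> /le_trans; apply.
by rewrite mulrC ler_wpM2r.
Qed.

(** Common source of the inverse inequalities: the reference coefficients are linear in the moments,
    and Cauchy-Schwarz bounds the moments by the L^2 norm. *)
Lemma inverse_coef n a c p : a < c -> (size p <= n.+1)%N ->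
  (\sum_(i < n.+1) `|(hat a c p)`_i|) ^+ 2 <=
  dofC false n ^+ 2 / (c - a) * I a c (fun s => p.[s] ^+ 2).
Proof.
move=> ac sp; have h0 : 0 < c - a by rewrite subr_gt0.
set E := I a c _; have E0 : 0 <= E by apply: I_ge0 => s _; exact: sqr_ge0.
have h : \sum_(i < n.+1) `|(hat a c p)`_i| <= dofC false n * Num.sqrt ((c - a)^-1 * E).
  apply: (@hat_coef false) => // j jn.
  rewrite -sqrtr_sqr ler_wsqrtr//; apply: dof_L2_le => //; exact: bmf_poly.
apply: le_trans (_ : (dofC false n * Num.sqrt ((c - a)^-1 * E)) ^+ 2 <= _).
  by rewrite lerXn2r ?nnegrE ?sumr_ge0// mulr_ge0 ?sqrtr_ge0// ltW// dofC_gt0.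
by rewrite exprMn sqr_sqrtr ?mulr_ge0 ?invr_ge0 ?(ltW h0)// mulrA.
Qed.

Lemma inverse_sup n a c p s : a < c -> (size p <= n.+1)%N -> a <= s <= c ->
  p.[s] ^+ 2 <= dofC false n ^+ 2 / (c - a) * I a c (fun s => p.[s] ^+ 2).
Proof.
move=> ac sp sac; apply: le_trans (inverse_coef ac sp).
apply: sqr_abs_le; first exact: sumr_ge0.
exact: poly_bound_coef.
Qed.

Lemma inverse_deriv n a c p s : a < c -> (size p <= n.+1)%N -> a <= s <= c ->
  (p^`()).[s] ^+ 2 <=
  (n%:R * dofC false n) ^+ 2 / (c - a) ^+ 3 * I a c (fun s => p.[s] ^+ 2).
Proof.
move=> ac sp sac; have h0 : 0 < c - a by rewrite subr_gt0.
have hn : c - a != 0 by rewrite gt_eqF.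
apply: le_trans (sqr_abs_le _ (deriv_bound_coef ac sac sp)) _.
  by rewrite mulr_ge0 ?divr_ge0 ?ler0n ?(ltW h0)// sumr_ge0.
rewrite exprMn (le_trans (ler_wpM2l _ (inverse_coef ac sp))) ?sqr_ge0//.
by rewrite le_eqVlt; apply/orP; left; apply/eqP; field.
Qed.

Lemma proj_stable gr k a c f p M s : a < c -> (size p <= k.+1)%N -> bmf a c f ->
  (forall j, (j <= k)%N -> dof gr k a c (fun s => p.[s]) j = dof gr k a c f j) ->
  (forall s, a < s < c -> `|f s| <= M) -> (gr -> `|f a| <= M) ->
  a <= s <= c -> `|p.[s]| <= dofC gr k * M.
Proof.
move=> ac sp bf pf fM fa sac; apply: le_trans (poly_bound_coef ac sac sp) _.
by apply: (hat_coef ac sp) => j jk; rewrite pf// dof_le.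
Qed.

(** The projection reproduces polynomials, so [p - q] has the degrees of freedom of [f - q] and
    stability applies to it. *)
Lemma proj_near gr k a c f p q M s : a < c -> (size p <= k.+1)%N -> (size q <= k.+1)%N ->
  bmf a c f ->
  (forall j, (j <= k)%N -> dof gr k a c (fun s => p.[s]) j = dof gr k a c f j) ->
  (forall s, a < s < c -> `|f s - q.[s]| <= M) -> (gr -> `|f a - q.[a]| <= M) ->
  a <= s <= c -> `|p.[s] - q.[s]| <= dofC gr k * M.
Proof.
move=> ac sp sq bf pf fM fa sac; rewrite -hornerN -hornerD.
apply: (@proj_stable gr k a c (fun s => f s - q.[s])) => //.
- by rewrite (leq_trans (size_polyD _ _))// size_polyN geq_max sp.
- by apply: bmfB => //; exact: bmf_poly.
move=> j jk.
have bq : bmf a c (fun s => -1 * q.[s]) by apply: bmfZ; exact: bmf_poly.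
have -> : dof gr k a c (fun s => f s - q.[s]) j = dof gr k a c (fun s => f s + -1 * q.[s]) j.
  by apply: eq_dof => // t _; rewrite mulN1r.
have -> : dof gr k a c (fun s => (p - q).[s]) j = dof gr k a c (fun s => p.[s] + -1 * q.[s]) j.
  by apply: eq_dof => // t _; rewrite hornerD hornerN mulN1r.
by rewrite !dofD ?pf//; exact: bmf_poly.
Qed.

(** In [k.+1 - gr] the boolean counts as 0 or 1: Gauss-Radau trades the moment of order k for its
    node value, so it is orthogonal only to degrees below k. *)
Lemma proj_orth gr k a c f p v : a < c -> (size p <= k.+1)%N -> bmf a c f ->
  (forall j, (j <= k)%N -> dof gr k a c (fun s => p.[s]) j = dof gr k a c f j) ->
  (size v <= k.+1 - gr)%N -> I a c (fun s => (p.[s] - f s) * v.[s]) = 0.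
Proof.
move=> ac sp bf pf sv; have h0 : 0 < c - a by rewrite subr_gt0.
have hn : c - a != 0 by rewrite gt_eqF.
have bd : bmf a c (fun s => p.[s] - f s) by apply: bmfB => //; exact: bmf_poly.
have sh : (size (hat a c v) <= k.+1 - gr)%N.
  case: (k.+1 - gr)%N sv => [|m]; last exact: size_hat.
  by rewrite leqn0 size_poly_eq0 => /eqP->; rewrite /hat comp_poly0 size_poly0.
rewrite (@eq_I _ _ _ _ (fun s => \sum_(i < k.+1 - gr) (hat a c v)`_i *
    ((p.[s] - f s) * ((s - a) / (c - a)) ^+ i))); last first.
  move=> s _; rewrite -{1}(unhatK v hn) unhatE (horner_coef_wide _ sh) mulr_sumr.
  by apply: eq_bigr => i _; rewrite mulrCA.
have bm j : bmf a c (fun s => (p.[s] - f s) * ((s - a) / (c - a)) ^+ j).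
  by apply: bmfM => //; exact: bmf_mono.
rewrite I_sum; last by move=> i; exact: bmfZ.
apply: big1 => i _; rewrite I_Z//.
have ik : (i <= k)%N by rewrite -ltnS (leq_trans (ltn_ord i))// leq_subr.
have e : gr && (nat_of_ord i == k) = false.
  by case: gr i {sv sh pf ik} => //= -[i /=]; rewrite subn1 /= => ik; rewrite ltn_eqF.
have := pf _ ik; rewrite /dof e => /(congr1 (fun x => (c - a) * x)); rewrite !mulrA divff// !mul1r => h.
rewrite (@eq_I _ _ _ _ (fun s => p.[s] * ((s - a) / (c - a)) ^+ i - f s * ((s - a) / (c - a)) ^+ i)) => [|s _]; last by rewrite mulrBl.
have bm' j : bmf a c (fun s => ((s - a) / (c - a)) ^+ j) by exact: bmf_mono.
by rewrite I_B ?h ?subrr ?mulr0//; apply: bmfM => //; exact: bmf_poly.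
Qed.

Lemma proj_left k a c f : a < c -> (proj true k a c f).[a] = f a.
Proof. by move=> ac; have := @dof_proj true k a c f k ac (leqnn k); rewrite /dof eqxx. Qed.

End Projection.

(** * Smooth functions with compact support *)

Section Smooth.
Context {R : realType}.
Implicit Types (f g : R -> R) (x s M C eps : R) (P : {poly R}).

Definition smoothn n f := forall m, (m <= n)%N -> forall x, derivable (derive1n m f) x 1.
Definition smooth f := forall n x, derivable (derive1n n f) x 1.

Lemma smoothnS n f : (forall x, derivable f x 1) -> smoothn n (derive1 f) -> smoothn n.+1 f.
Proof. by move=> df sf [_|m mn] x; [exact: df|rewrite derive1Sn; exact: sf]. Qed.

Lemma smoothnS' n f : smoothn n.+1 f -> (forall x, derivable f x 1) /\ smoothn n (derive1 f).
Proof.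
move=> sf; split=> [x|m mn x]; first exact: (sf 0%N).
by rewrite -derive1Sn; exact: sf.
Qed.

Lemma smoothP f : smooth f <-> forall n, smoothn n f.
Proof. by split=> [sf n m _ x|sf n x]; [exact: sf|exact: (sf n n)]. Qed.

Lemma d_of_derivable f x : derivable f x 1 -> is_derive x 1 f (derive1 f x).
Proof. by move=> df; rewrite derive1E; exact: derivableP. Qed.

Lemma d_derive1 f x l : is_derive x 1 f l -> derive1 f x = l.
Proof. by move=> [_ <-]; rewrite derive1E. Qed.

Lemma smoothnD n f g : smoothn n f -> smoothn n g -> smoothn n (fun x => f x + g x).
Proof.
elim: n f g => [|n ih] f g sf sg.
  move=> m; rewrite leqn0 => /eqP-> x /=.
  by apply: derivableD; [exact: (sf 0%N)|exact: (sg 0%N)].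
have [df sf'] := smoothnS' sf; have [dg sg'] := smoothnS' sg.
have d x : is_derive x 1 (fun x => f x + g x) (derive1 f x + derive1 g x).
  by apply: dD; exact: d_of_derivable.
apply: smoothnS => [x|]; first by have [] := d x.
have -> : derive1 (fun x => f x + g x) = fun x => derive1 f x + derive1 g x.
  by apply/funext => x; exact: d_derive1.
exact: ih.
Qed.

Lemma smoothnM n f g : smoothn n f -> smoothn n g -> smoothn n (fun x => f x * g x).
Proof.
elim: n f g => [|n ih] f g sf sg.
  move=> m; rewrite leqn0 => /eqP-> x /=.
  by apply: derivableM; [exact: (sf 0%N)|exact: (sg 0%N)].
have [df sf'] := smoothnS' sf; have [dg sg'] := smoothnS' sg.
have d x : is_derive x 1 (fun x => f x * g x) (derive1 f x * g x + f x * derive1 g x).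
  by apply: dM; exact: d_of_derivable.
apply: smoothnS => [x|]; first by have [] := d x.
have -> : derive1 (fun x => f x * g x) = fun x => derive1 f x * g x + f x * derive1 g x.
  by apply/funext => x; exact: d_derive1.
have W h : smoothn n.+1 h -> smoothn n h by move=> sh m mn; apply: sh; exact: leqW.
by apply: smoothnD; [exact: ih sf' (W _ sg)|exact: ih (W _ sf) sg'].
Qed.

Lemma smoothD f g : smooth f -> smooth g -> smooth (fun x => f x + g x).
Proof. by move=> /smoothP sf /smoothP sg; apply/smoothP => n; exact: smoothnD. Qed.

Lemma smoothM f g : smooth f -> smooth g -> smooth (fun x => f x * g x).
Proof. by move=> /smoothP sf /smoothP sg; apply/smoothP => n; exact: smoothnM. Qed.

Lemma smooth_of_derive f f' : (forall x, is_derive x 1 f (f' x)) -> smooth f' -> smooth f.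
Proof.
move=> df sf; have e : derive1 f = f' by apply/funext => x; exact: d_derive1.
move=> [|n] x; first by have [] := df x.
by rewrite derive1Sn e; exact: sf.
Qed.

Lemma smooth_cst k : smooth (fun=> k).
Proof.
have d0 m x : derivable (derive1n m (fun=> 0 : R)) x 1.
  elim: m x => [|m ih] x; first exact: derivable_cst.
  by rewrite derive1Sn (_ : derive1 _ = fun=> 0)//; apply/funext => y; exact: d_derive1 (dC y 0).
by apply: (smooth_of_derive (f' := fun=> 0)) => // x; exact: dC.
Qed.

Lemma smooth_affine f k y : smooth f -> smooth (fun x => f (k * x + y)).
Proof.
move=> sf; apply/smoothP => n; elim: n f sf => [|n ih] f sf.
  move=> m; rewrite leqn0 => /eqP-> x /=.
  have dl : is_derive x 1 (fun x => k * x + y) k.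
    by apply: d_eq (dD (dZ k (dI x)) (dC x y)) _; rewrite mulr1 addr0.
  by have [] := @d_comp _ x f (fun x => k * x + y) _ _ (d_of_derivable (sf 0%N (k * x + y))) dl.
have d x : is_derive x 1 (fun x => f (k * x + y)) (derive1 f (k * x + y) * k).
  have dl : is_derive x 1 (fun x => k * x + y) k.
    by apply: d_eq (dD (dZ k (dI x)) (dC x y)) _; rewrite mulr1 addr0.
  exact: (@d_comp _ x f (fun x => k * x + y) _ _ (d_of_derivable (sf 0%N (k * x + y))) dl).
apply: smoothnS => [x|]; first by have [] := d x.
have -> : derive1 (fun x => f (k * x + y)) = fun x => derive1 f (k * x + y) * k.
  by apply/funext => x; exact: d_derive1.
apply: smoothnM; last by move=> m _; exact: smooth_cst.
by apply: ih => m x; rewrite -derive1Sn; exact: sf.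
Qed.

Lemma derive_quad f x l C eps : 0 < eps ->
  (forall y, `|y - x| < eps -> `|f y - f x - (y - x) * l| <= C * (y - x) ^+ 2) ->
  is_derive x 1 f l.
Proof.
move=> e0 H; have C0 : 0 < `|C| + 1 by rewrite ltr_wpDl.
suff h : h^-1 *: (f (h *: 1 + x) - f x) @[h --> (0 : R)^'] --> l.
  by apply: DeriveDef; [apply/cvg_ex; exists l|exact: cvg_lim h].
apply/cvgrPdist_le => d d0; near=> h.
have hn : h != 0 by near: h; exact: nbhs_dnbhs_neq.
have heps : `|h| < eps.
  by near: h; apply: dnbhs0_lt.
have hd : `|h| < d / (`|C| + 1) by near: h; apply: dnbhs0_lt; rewrite divr_gt0.
rewrite /GRing.scale /= mulr1.
have := H (h + x); rewrite addrK => /(_ heps) Hh.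
have -> : l - h^-1 * (f (h + x) - f x) = - (h^-1 * (f (h + x) - f x - h * l)) by field.
rewrite normrN normrM normfV ler_pdivrMl ?normr_gt0//.
apply: le_trans Hh _; rewrite -(real_normK (num_real h)) expr2.
have : `|h| * (`|C| + 1) <= d by rewrite -ler_pdivlMr// ltW.
have := ler_norm C; have := normr_ge0 h => hh hc.
have : C * (`|h| * `|h|) <= (`|C| + 1) * (`|h| * `|h|) by rewrite ler_wpM2r ?mulr_ge0//; lra.
nra.
Unshelve. all: by end_near. Qed.

Lemma poly_expN_bound P : exists C, forall y : R, 0 < y -> `|P.[y]| * expR (- y) <= C.
Proof.
exists (\sum_(i < size P) `|P`_i| * i`!%:R) => y y0.
rewrite horner_coef (le_trans (ler_wpM2r (expR_ge0 _) (ler_norm_sum _ _ _)))//.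
rewrite mulr_suml; apply: ler_sum => -[i /= _] _.
rewrite normrM -mulrA ler_wpM2l// ger0_norm ?exprn_ge0 ?(ltW y0)//.
rewrite expRN ler_pdivrMr ?expR_gt0//.
case: i => [|i]; first by rewrite expr0 mul1r -expR0 ler_expR ltW.
have := @expR_ge1Dxn _ y i (ltW y0).
have f0 : 0 < (i.+1)`!%:R :> R by rewrite ltr0n fact_gt0.
move=> h; rewrite -ler_pdivrMl// mulrC; apply: le_trans h.
by rewrite lerDr.
Qed.

(** The functions P(1/x) exp(-1/x), extended by 0, are stable under differentiation, with P replaced
    by X^2 (P - P'), so their smoothness is an induction on the order. *)
Definition flat P x : R := if 0 < x then P.[x^-1] * expR (- x^-1) else 0.

(** The exponential absorbs two further factors 1/x. A quadratic bound at 0 gives the derivative 0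
    there. *)
Lemma flat_quad P : exists C, forall x, `|flat P x| <= C * x ^+ 2.
Proof.
have [C hC] := poly_expN_bound ('X^2 * P).
exists C => x; rewrite /flat; case: ltP => x0; last first.
  rewrite normr0 mulr_ge0 ?sqr_ge0//.
  by have := hC 1 ltr01; apply: le_trans; rewrite mulr_ge0 ?expR_ge0.
have xi : 0 < x^-1 by rewrite invr_gt0.
have := hC _ xi; rewrite hornerM hornerXn normrM normrX (gtr0_norm xi) => h.
rewrite normrM (ger0_norm (expR_ge0 _)).
have -> : `|P.[x^-1]| * expR (- x^-1) = (x^-1 ^+ 2 * `|P.[x^-1]| * expR (- x^-1)) * x ^+ 2.
  by field; rewrite gt_eqF.
by rewrite ler_wpM2r ?sqr_ge0.
Qed.

Lemma flat_derive P x : is_derive x 1 (flat P) (flat ('X^2 * (P - P^`())) x).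
Proof.
have [x0|x0|->] := ltgtP x 0.
- rewrite {2}/flat (lt_gtF x0); apply: d_near (dC x 0) _.
  by near=> y; rewrite /flat lt_gtF//; near: y; exact: lt_nbhsl.
- rewrite {2}/flat x0.
  have xn : x != 0 by rewrite gt_eqF.
  have dv := dV xn (dI x).
  have h := dM (d_comp (poly_derive P x^-1) dv) (@d_comp _ x expR (fun r => - r^-1) _ _ (is_derive_expR _) (dN dv)).
  apply: d_near (d_eq h _) _.
    by rewrite hornerM hornerXn hornerD hornerN; field.
  by near=> y; rewrite /flat ifT//; near: y; exact: lt_nbhsr.
rewrite {2}/flat ltxx; have [C hC] := flat_quad P.
apply: (@derive_quad _ _ _ C 1) => // y _.
by rewrite {2}/flat ltxx !subr0 mulr0 subr0.
Unshelve. all: by end_near. Qed.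

Lemma smooth_flat P : smooth (flat P).
Proof.
move=> n; elim: n P => [|n ih] P x; first by have [] := flat_derive P x.
rewrite derive1Sn (_ : derive1 _ = flat ('X^2 * (P - P^`()))); first exact: ih.
by apply/funext => y; exact: d_derive1 (flat_derive P y).
Qed.

(** A bump on [-eps, eps], not normalised; its integral [bumpZ] is divided out at the end of the
    Peano estimate. *)
Definition mbump eps x : R := flat 1 (eps + x) * flat 1 (eps - x).

Lemma flat1_ge0 x : 0 <= flat 1 x.
Proof. by rewrite /flat; case: ifP => // _; rewrite hornerC mul1r expR_ge0. Qed.

Lemma bump_ge0 eps x : 0 <= mbump eps x.
Proof. by rewrite mulr_ge0 ?flat1_ge0. Qed.

Lemma bump_out eps x : eps <= `|x| -> mbump eps x = 0.
Proof.
rewrite /mbump /flat ler_normr => /orP[] h.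
  by rewrite [X in _ * X]ifF ?mulr0//; apply/negbTE; rewrite -leNgt; lra.
by rewrite ifF ?mul0r//; apply/negbTE; rewrite -leNgt; lra.
Qed.

Lemma bump_gt0 eps : 0 < eps -> 0 < mbump eps 0.
Proof.
move=> e0; rewrite /mbump addr0 subr0 /flat e0 hornerC mul1r.
by rewrite mulr_gt0 ?expR_gt0.
Qed.

Lemma smooth_bump eps : smooth (mbump eps).
Proof.
apply: smoothM.
  have := @smooth_affine (flat 1) 1 eps (@smooth_flat 1); congr smooth.
  by apply/funext => x; rewrite mul1r addrC.
have := @smooth_affine (flat 1) (-1) eps (@smooth_flat 1); congr smooth.
by apply/funext => x; rewrite mulN1r addrC.
Qed.

Lemma smooth_cont f x : smooth f -> {for x, continuous f}.
Proof. by move=> sf; exact: d_cont (d_of_derivable (sf 0%N x)). Qed.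

Lemma I_0 a c (f : R -> R) : (forall s, a < s < c -> f s = 0) -> I a c f = 0.
Proof.
move=> f0; rewrite (eq_I (g := fun=> 0 * 0)); first by rewrite I_Z ?mul0r//; exact: bmf_cst.
by move=> s sac; rewrite f0// mulr0.
Qed.

Lemma I_shift a c y f M : a <= c -> (forall s, {for s, continuous f}) -> (forall s, `|f s| <= M) ->
  I a c (fun s => f (s - y)) = I (a - y) (c - y) f.
Proof.
move=> ac cf fM.
have bf u v : bmf u v f by apply: (@bmf_cont _ _ _ _ M) => s _; [exact: cf|exact: fM].
have lip : forall r s, a <= r <= c -> a <= s <= c ->
    `|I (a - y) (r - y) f - I (a - y) (s - y) f| <= M * `|r - s|.
  move=> r s rac sac; have -> : r - s = (r - y) - (s - y) by ring.
  by apply: (I_lip (bf (a - y) (c - y))) => //; rewrite !lerD2r.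
pose F x := I (a - y) (x - y) f.
have -> : I (a - y) (c - y) f = F c - F a by rewrite /F I_xx subr0.
apply: (@I_FTC _ a c F (fun s => f (s - y)) M) => //; first exact: lip_within lip.
  move=> s /andP[as_ sc].
  have dsy : is_derive s 1 (fun x => x - y) 1 by apply: d_eq (dB (dI s) (dC s y)) _; rewrite subr0.
  have sI : a - y < s - y < c - y by rewrite !ltrD2r as_.
  have dI := I_derive (bf (a - y) (c - y)) (fun s _ => fM s) sI (cf _).
  by apply: d_eq (@d_comp _ s (fun r => I (a - y) r f) (fun x => x - y) _ _ dI dsy) _; rewrite mulr1.
move=> s _; have cs : {for s, continuous (fun x : R => x - y)}.
  by apply: cvgB; [exact: cvg_id|exact: cvg_cst].
exact: (continuous_comp cs (cf _)).
Qed.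

Lemma bump_bound eps : 0 <= eps -> forall s, `|mbump eps s| <= 1.
Proof.
move=> e0 s; have f1 x : 0 <= flat 1 x <= 1.
  rewrite flat1_ge0 /= /flat; case: ifP => x0; last exact: ler01.
  by rewrite hornerC mul1r -expR0 ler_expR oppr_le0 invr_ge0 ltW.
rewrite ger0_norm ?bump_ge0// /mbump.
have /andP[a0 a1] := f1 (eps + s); have /andP[b0 b1] := f1 (eps - s).
by rewrite -[leRHS]mulr1 ler_pM.
Qed.

End Smooth.

(** * Iterated primitives of functions with vanishing moments *)

Section Primitive.
Context {R : realType}.
Variables (a c a' c' : R).
Hypotheses (aa' : a < a') (ac' : a' <= c') (cc' : c' < c).
Implicit Types (f : R -> R) (M : R).

Definition supp f := forall x, ~~ (a' <= x <= c') -> f x = 0.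

Definition pfun m M f := [/\ smooth f, supp f, forall x, `|f x| <= M &
  forall j, (j < m)%N -> I a c (fun s => f s * s ^+ j) = 0].

Lemma ac_lt : a < c.
Proof. exact: lt_trans aa' (le_lt_trans ac' cc'). Qed.

Lemma prim_derive f M (x : R) : smooth f -> supp f -> (forall x, `|f x| <= M) ->
  is_derive x 1 (fun x => I a x f) (f x).
Proof.
move=> sf f0 fM; have [xa|ax] := ltP x a'.
  rewrite f0; last by rewrite negb_and -ltNge xa.
  apply: d_near (dC x 0) _; near=> y; rewrite I_0// => s /andP[_ sy].
  rewrite f0// negb_and -ltNge (lt_trans sy)//.
  by near: y; exact: lt_nbhsl.
apply: (@I_derive _ a (x + 1) f M).
- by apply: (@bmf_cont _ _ _ _ M) => s _; [exact: smooth_cont|exact: fM].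
- by move=> s _; exact: fM.
- by rewrite (lt_le_trans aa')//= ltrDl.
- exact: smooth_cont.
Unshelve. all: by end_near. Qed.

Lemma smooth_bmf f M u v : smooth f -> (forall x, `|f x| <= M) -> bmf u v f.
Proof. by move=> sf fM; apply: (@bmf_cont _ _ _ _ M) => s _; [exact: smooth_cont|exact: fM]. Qed.

(** The vanishing integral makes the primitive vanish to the right of the support as well.
    Integration by parts turns its moment of order j into a multiple of that of [f] of order j + 1,
    so each primitive uses up one moment. *)
Lemma prim_pfun m M f : pfun m.+1 M f -> pfun m ((c - a) * M) (fun x => I a x f).
Proof.
move=> [sf f0 fM mom]; have ac := ac_lt.
have bf u v : bmf u v f by exact: smooth_bmf sf fM.
have dJ x := prim_derive x sf f0 fM.
have Jout x : c' <= x -> I a x f = 0.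
  move=> cx; have := mom 0%N isT; rewrite (eq_I (g := f)) => [<-|s _]; last by rewrite expr0 mulr1.
  have ac'' : a <= c' by apply: le_trans ac'; exact: ltW.
  have z y : c' <= y -> I a y f = I a c' f.
    move=> cy; rewrite (@I_split _ a c' y)// [X in _ + X]I_0 ?addr0// => s /andP[cs _].
    by rewrite f0// negb_and -!ltNge cs orbT.
  by rewrite !z//; exact: ltW.
have Jlow x : x <= a' -> I a x f = 0.
  move=> xa; rewrite I_0// => s /andP[_ sx].
  by rewrite f0// negb_and -ltNge (lt_le_trans sx).
have JM x : `|I a x f| <= (c - a) * M.
  have M0 : 0 <= M by exact: le_trans (normr_ge0 _) (fM a).
  have [xa|ax] := leP x a'; first by rewrite Jlow// normr0 mulr_ge0// subr_ge0 ltW.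
  have [cx|xc] := leP c' x; first by rewrite Jout// normr0 mulr_ge0// subr_ge0 ltW.
  apply: (@le_trans _ _ (M * (x - a))).
    by apply: I_le_bound => //; apply: ltW; exact: lt_trans ax.
  rewrite mulrC ler_wpM2r// lerD2r ltW//; exact: lt_trans cc'.
have sJ : smooth (fun x => I a x f) by exact: smooth_of_derive dJ sf.
split=> //.
  move=> x; rewrite negb_and -!ltNge => /orP[h|h]; first by rewrite Jlow// ltW.
  by rewrite Jout// ltW.
move=> j jm.
pose F s := I a s f * s ^+ j.+1 / j.+1%:R.
have bm u v i : bmf u v (fun s => s ^+ i) by apply: bmfX; exact: bmf_id.
have bJ u v : bmf u v (fun x => I a x f) by exact: smooth_bmf sJ JM.
pose F' s := f s * s ^+ j.+1 * (j.+1%:R)^-1 + I a s f * s ^+ j.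
have bF : bmf a c F'.
  apply: bmfD; last exact: bmfM.
  by apply: bmfM; [exact: bmfM|exact: bmf_cst].
have [M' _ FM] := bmf_bound bF.
have n0 : j.+1%:R != 0 :> R by rewrite pnatr_eq0.
have dF (s : R) : is_derive s 1 F (F' s).
  have dx : is_derive s 1 (fun s : R => s ^+ j.+1) (j.+1%:R * s ^+ j).
    have := poly_derive ('X^(j.+1)) s; rewrite derivXn hornerMn hornerXn mulr_natl.
    by rewrite (_ : (fun x => ('X^(j.+1)).[x]) = fun s => s ^+ j.+1)//; apply/funext => x; rewrite hornerXn.
  apply: d_eq (dM (dM (dJ s) dx) (dC s (j.+1%:R)^-1)) _.
  by rewrite /F' mulr0 addr0 mulrDl; congr (_ + _); field.
have := @I_FTC _ a c F F' M' (ltW ac).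
have -> : F c = 0 by rewrite /F Jout ?mul0r// ltW.
have -> : F a = 0 by rewrite /F I_xx !mul0r.
rewrite subr0 /F' I_D; [|by apply: bmfM; [exact: bmfM|exact: bmf_cst]|exact: bmfM].
rewrite (eq_I (g := fun s => (j.+1%:R)^-1 * (f s * s ^+ j.+1))) => [|s _]; last by rewrite mulrC.
rewrite I_Z; last exact: bmfM.
rewrite mom ?mulr0 ?add0r//.
apply => //.
- by apply: derivable_within_continuous => s _; have [] := dF s.
- move=> s _; apply: cvgD.
    apply: cvgM; last exact: cvg_cst.
    by apply: cvgM; [exact: smooth_cont|exact: exprn_continuous].
  by apply: cvgM; [exact: smooth_cont|exact: exprn_continuous].
Qed.

Definition primn m f := iter m (fun f x => I a x f) f.

Lemma primn_pfun m M f : pfun m M f ->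
  [/\ smooth (primn m f), supp (primn m f),
   forall x, `|primn m f x| <= (c - a) ^+ m * M & derive1n m (primn m f) = f].
Proof.
elim: m M f => [|m ih] M f pf.
  by have [sf f0 fM _] := pf; split=> // x; rewrite expr0 mul1r.
have [s1 s2 s3 s4] := ih _ _ (prim_pfun pf).
have e : primn m.+1 f = primn m (fun x => I a x f) by rewrite /primn iterSr.
rewrite e; split=> //.
  by move=> x; have := s3 x; rewrite mulrA -exprSr.
rewrite derive1nS s4; apply/funext => x; apply: d_derive1.
by have [sf f0 fM _] := pf; exact: prim_derive fM.
Qed.

End Primitive.

(** * Point functionals bounded by weak derivatives *)

Section Peano.
Context {R : realType}.
Local Notation mu := (@lebesgue_measure R).
Implicit Types (a c b s eps D : R) (v d : R -> R).

Lemma bump_I eps u w (h : R -> R) : 0 < eps -> u <= - eps -> eps <= w -> bmf u w h ->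
  I u w (fun s => mbump eps s * h s) = I (- eps) eps (fun s => mbump eps s * h s).
Proof.
move=> e0 ue ew bh.
have bb : bmf u w (fun s => mbump eps s * h s).
  apply: bmfM => //; exact: smooth_bmf (@smooth_bump _ eps) (bump_bound (ltW e0)).
have mee : - eps <= eps by lra.
rewrite (@I_split _ u (- eps) w)//; last exact: le_trans ew.
rewrite [X in X + _]I_0 ?add0r; last first.
  by move=> s /andP[_ se]; rewrite bump_out ?mul0r// ler_normr; apply/orP; right; lra.
rewrite (@I_split _ (- eps) eps w)//; last exact: bmf_sub bb.
rewrite [X in _ + X]I_0 ?addr0// => s /andP[se _].
by rewrite bump_out ?mul0r// ler_normr ltW.
Qed.

Definition bumpZ eps : R := I (- eps) eps (mbump eps).

Lemma bumpZ_gt0 eps : 0 < eps -> 0 < bumpZ eps.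
Proof.
move=> e0; have bb u w : bmf u w (mbump eps).
  exact: smooth_bmf (@smooth_bump _ eps) (bump_bound (ltW e0)).
have pos x y : 0 <= I x y (mbump eps) by apply: I_ge0 => s _; exact: bump_ge0.
rewrite lt_neqAle pos andbT eq_sym; apply/negP => /eqP z0.
have z r : - eps < r < eps -> I (- eps) r (mbump eps) = 0.
  move=> /andP[r0 r1]; have := @I_split _ (- eps) r eps _ (ltW r0) (ltW r1) (bb _ _).
  by rewrite -/(bumpZ _) z0; have := pos (- eps) r; have := pos r eps; lra.
have e00 : - eps < 0 < eps by rewrite oppr_lt0 e0.
have d := I_derive (bb (- eps) eps) (fun s _ => bump_bound (ltW e0) s) e00 (smooth_cont (x := 0) (@smooth_bump _ eps)).
have d0 : is_derive (0 : R) 1 (fun r => I (- eps) r (mbump eps)) 0.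
  apply: d_near (dC 0 0) _; near=> x; rewrite z//; apply/andP; split.
    by near: x; apply: lt_nbhsr; case/andP: e00.
  by near: x; apply: lt_nbhsl; case/andP: e00.
by have := bump_gt0 e0; rewrite (d_uniq d d0) ltxx.
Unshelve. all: by end_near. Qed.

Lemma smooth_sum n (F : 'I_n -> R -> R) : (forall i, smooth (F i)) ->
  smooth (fun s => \sum_(i < n) F i s).
Proof.
elim: n F => [|n ih] F sF.
  by rewrite (_ : (fun _ => _) = fun=> 0); [exact: smooth_cst|apply/funext => s; rewrite big_ord0].
rewrite (_ : (fun _ => _) = fun s => F ord0 s + \sum_(i < n) F (lift ord0 i) s).
  by apply: smoothD => //; exact: ih.
by apply/funext => s; rewrite big_ord_recl.
Qed.

Lemma bump_shift_I eps a c y (h : R -> R) j : 0 < eps -> a <= y - eps -> y + eps <= c ->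
  I a c (fun s => mbump eps (s - y) * s ^+ j) =
  I (- eps) eps (fun s => mbump eps s * (s + y) ^+ j).
Proof.
move=> e0 ay yc; have ac : a <= c by lra.
pose q : {poly R} := ('X + y%:P) ^+ j.
have qE s : q.[s] = (s + y) ^+ j by rewrite horner_exp !hornerE.
have sb := @smooth_bump _ eps.
rewrite (eq_I (g := fun s => (fun t => mbump eps t * q.[t]) (s - y))); last first.
  by move=> s _; rewrite qE subrK.
have bq : bmf (- eps) eps (fun t => q.[t]) by exact: bmf_poly.
have [M M0 qM] := bmf_bound bq.
rewrite (@I_shift _ a c y (fun t => mbump eps t * q.[t]) M)//.
- rewrite bump_I//; [|lra|lra|exact: bmf_poly].
  by apply: eq_I => s _; rewrite qE.
- by move=> s; apply: cvgM; [exact: smooth_cont|exact: poly_cont].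
- move=> s; have [h1|h1] := leP eps `|s|; first by rewrite bump_out// mul0r normr0.
  rewrite normrM -[leRHS]mul1r ler_pM ?bump_bound ?(ltW e0)// qM//.
  by rewrite -ltr_norml.
Qed.

Lemma abs_I_weak b a' c' d phi D S : 0 < a' -> c' < b ->
  measurable_fun (`]0, b[%classic : set R) d -> (forall s, {for s, continuous phi}) ->
  (forall s, ~~ (a' <= s <= c') -> phi s = 0) -> (forall s, `|phi s| <= S) ->
  (\int[mu]_(x in `[a', c']) `|d x|%:E <= D%:E)%E ->
  `|\int[mu]_(x in `]0, b[) (d x * phi x)| <= S * D.
Proof.
move=> a0 cb md cphi phi0 phiS dD.
have S0 : 0 <= S by exact: le_trans (normr_ge0 _) (phiS 0).
have sub : (`[a', c']%classic : set R) `<=` `]0, b[.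
  by move=> s /=; rewrite !in_itv /= => /andP[h1 h2]; rewrite (lt_le_trans a0) ?(le_lt_trans h2).
have mphi : measurable_fun (`]0, b[%classic : set R) phi.
  by apply: open_continuous_measurable_fun => // s _; exact: cphi.
have mdp : measurable_fun (`]0, b[%classic : set R) (fun x => d x * phi x).
  exact: measurable_funM.
have h : (`|\int[mu]_(x in `]0%R, b[) (d x * phi x)%:E| <= (S * D)%:E)%E.
  apply: le_trans (le_abse_integral _ _ _) _ => //; first exact/measurable_EFinP.
  apply: (@le_trans _ _ (\int[mu]_(x in `]0%R, b[) ((fun x => S%:E * `|d x|%:E) \_ `[a', c']) x)%E).
    apply: ge0_le_integral => //.
    - by apply: measurableT_comp => //; exact/measurable_EFinP.
    - apply/(measurable_restrict _ _ _) => //.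
      rewrite setIC (setIidl sub).
      apply: measurable_funS sub _ => //.
      apply: emeasurable_funM; first exact: measurable_cst.
      by apply/measurable_EFinP; exact: measurableT_comp.
    move=> x _; rewrite patchE; case: ifPn => [_|].
      by rewrite -EFinM abse_EFin lee_fin normrM mulrC ler_wpM2r.
    rewrite notin_setE /= in_itv /= => /negP h; by rewrite phi0// mulr0 normr0.
  rewrite -integral_mkcondr (setIidr sub) ge0_integralZl//.
  - by rewrite EFinM lee_wpmul2l ?lee_fin.
  - apply: measurable_funS sub _ => //.
    by apply/measurable_EFinP; exact: measurableT_comp.
rewrite /Rintegral; move: h; case: (\int[mu]_(x in _) _)%E => [r| |] //=.
Qed.

(** Annihilation of polynomials of low degree is invariant under translation; this lets the smoothed
    functional inherit the vanishing moments. *)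
Lemma sum_shift_pow n m (y c : 'I_n -> R) s :
  (forall i, (i < m)%N -> \sum_j c j * y j ^+ i = 0) ->
  forall i, (i < m)%N -> \sum_j c j * (s + y j) ^+ i = 0.
Proof.
move=> h i im.
rewrite (eq_bigr (fun j => \sum_(l < i.+1) (s ^+ (i - l) *+ 'C(i, l)) * (c j * y j ^+ l))); last first.
  move=> j _; rewrite exprDn mulr_sumr; apply: eq_bigr => l _.
  by rewrite -mulrnAl mulrCA.
rewrite exchange_big /= big1// => l _; rewrite -mulr_sumr h ?mulr0//.
by rewrite (leq_ltn_trans _ im)// -ltnS.
Qed.

(* Peano kernel estimate for a functional annihilating polynomials of degree
   < m, tested against an m-fold primitive of a smoothed functional. *)
Lemma peano_weak b m n (y c : 'I_n -> R) v d a1 c1 D :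
  0 <= a1 -> a1 < c1 -> c1 <= b -> is_weak_derivative b m.+1 v d ->
  (forall s, 0 < s < b -> {for s, continuous v}) -> bmf 0 b v ->
  (forall j, a1 < y j < c1) ->
  (forall i, (i < m.+1)%N -> \sum_j c j * y j ^+ i = 0) ->
  (forall a' c', a1 < a' -> c' < c1 ->
     (\int[mu]_(x in `[a', c']) `|d x|%:E <= D%:E)%E) ->
  `|\sum_j c j * v (y j)| <= (\sum_j `|c j|) * (c1 - a1) ^+ m * D.
Proof.
move=> a10 ac1 c1b [[mv _ _] [md _ _] wd] cv bv hy hc hD.
apply/ler_addgt0Pr => e e0.
set C := \sum_j `|c j|; have C0 : 0 <= C by exact: sumr_ge0.
pose eta := e / (C + 1).
have eta0 : 0 < eta by rewrite divr_gt0// ltr_wpDl.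
have etaC : eta * C <= e.
  by rewrite /eta mulrAC ler_pdivrMr ?ltr_wpDl// ler_pM2l// lerDl.
(* The margin is twice the radius of the bumps, so the smoothed functional is supported in
   [a1 + eps, c1 - eps], strictly inside (a1, c1). *)
have H j : \forall t \near (0 : R)^'+, a1 + 2 * t <= y j /\ y j + 2 * t <= c1 /\
    forall s, `|s - y j| < t -> `|v s - v (y j)| <= eta.
  have /andP[y1 y2] := hy j.
  have yb : 0 < y j < b by rewrite (le_lt_trans a10 y1) (lt_le_trans y2 c1b).
  have := cv _ yb; move=> /cvgrPdist_le/(_ _ eta0)/nbhs_ballP[t0 /= t00 ht0].
  near=> t; split; [|split].
  - have : t <= (y j - a1) / 2 by near: t; apply: nbhs_right_le; rewrite divr_gt0// subr_gt0.
    lra.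
  - have : t <= (c1 - y j) / 2 by near: t; apply: nbhs_right_le; rewrite divr_gt0// subr_gt0.
    lra.
  move=> s st; rewrite distrC; apply: ht0; rewrite /ball /= distrC (lt_le_trans st)//.
  by near: t; exact: nbhs_right_le.
have [eps [eps0 [epsac Heps]]] : exists eps : R, 0 < eps /\ a1 + eps <= c1 - eps /\
   forall j, a1 + 2 * eps <= y j /\ y j + 2 * eps <= c1 /\
    forall s, `|s - y j| < eps -> `|v s - v (y j)| <= eta.
  have F := @filter_forall _ _ _ _ _ (fun j => H j).
  near (0 : R)^'+ => t; exists t; split; [|split].
  - by near: t; exact: nbhs_right_gt.
  - have : t <= (c1 - a1) / 2 by near: t; apply: nbhs_right_le; rewrite divr_gt0// subr_gt0.
    lra.
  by near: t; exact: F.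
have Hin j : a1 <= y j - eps /\ y j + eps <= c1.
  by have [h1 [h2 _]] := Heps j; split; clear - h1 h2 eps0; lra.
pose Z := bumpZ eps; have Z0 : 0 < Z by exact: bumpZ_gt0.
pose f s := \sum_j c j * mbump eps (s - y j).
have sbj j : smooth (fun s => mbump eps (s - y j)).
  have := @smooth_affine _ (mbump eps) 1 (- y j) (@smooth_bump _ eps); congr smooth.
  by apply/funext => s; rewrite mul1r.
have bbj j u w : bmf u w (fun s => mbump eps (s - y j)).
  by apply: (smooth_bmf _ _ (sbj j) (M := 1)) => s; apply: bump_bound; exact: ltW.
have Zj j u w : u <= y j - eps -> y j + eps <= w ->
    I u w (fun s => mbump eps (s - y j)) = Z.
  move=> h1 h2; have := @bump_shift_I eps u w (y j) id 0 eps0 h1 h2.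
  rewrite (eq_I (g := fun s => mbump eps (s - y j))) => [->|s _]; last by rewrite expr0 mulr1.
  by apply: eq_I => s _; rewrite expr0 mulr1.
have bcj j u w : bmf u w (fun s => c j * mbump eps (s - y j)) by exact: bmfZ.
have bf u w : bmf u w f by exact: bmf_sum.
have a1' : a1 < a1 + eps by rewrite ltrDl.
have c1' : c1 - eps < c1 by rewrite ltrBlDr ltrDl.
have ac1' := ltW ac1.
have fout s : ~~ (a1 + eps <= s <= c1 - eps) -> f s = 0.
  move=> sout; apply: big1 => j _; have [h1 [h2 _]] := Heps j.
  rewrite bump_out ?mulr0// ler_normr; move: sout; rewrite negb_and -!ltNge => /orP[] h.
    by apply/orP; right; lra.
  by apply/orP; left; lra.
have pf : pfun a1 c1 (a1 + eps) (c1 - eps) m.+1 C f.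
  split=> //.
  - by apply: smooth_sum => j; apply: smoothM => //; exact: smooth_cst.
  - move=> s; rewrite (le_trans (ler_norm_sum _ _ _))//; apply: ler_sum => j _.
    by rewrite normrM -[leRHS]mulr1 ler_wpM2l// bump_bound// ltW.
  move=> i im.
  rewrite (eq_I (g := fun s => \sum_j c j * (mbump eps (s - y j) * s ^+ i))); last first.
    by move=> s _; rewrite mulr_suml; apply: eq_bigr => j _; rewrite mulrA.
  have bp u w : bmf u w (fun s => s ^+ i) by apply: bmfX; exact: bmf_id.
  rewrite I_sum; last by move=> j; apply: bmfZ; apply: bmfM.
  have bq j : bmf (- eps) eps (fun s => (s + y j) ^+ i).
    by apply: bmfX; apply: bmfD; [exact: bmf_id|exact: bmf_cst].
  have bb u w : bmf u w (mbump eps).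
    by apply: (smooth_bmf _ _ (@smooth_bump _ eps) (M := 1)) => s; apply: bump_bound; exact: ltW.
  rewrite (eq_bigr (fun j => I (- eps) eps (fun s => c j * (mbump eps s * (s + y j) ^+ i)))); last first.
    move=> j _; have [h1 [h2 _]] := Heps j.
    rewrite I_Z; last exact: bmfM.
    rewrite I_Z; last exact: bmfM.
    by rewrite (@bump_shift_I eps a1 c1 (y j) id)//; lra.
  rewrite -I_sum; last by move=> j; apply: bmfZ; apply: bmfM.
  apply: I_0 => s _.
  rewrite (eq_bigr (fun j => mbump eps s * (c j * (s + y j) ^+ i))); last by move=> j _; rewrite mulrCA.
  by rewrite -mulr_sumr (sum_shift_pow s hc im) mulr0.
pose phi := primn a1 m.+1 f.
have [sphi phiout _ dphi] := primn_pfun a1' epsac c1' pf.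
(* The first primitive is bounded by the total mass [C * Z] of the bumps and only the other [m] by
   the length of the interval, so the radius enters through [Z] alone. *)
have phiS s : `|phi s| <= (c1 - a1) ^+ m * (C * Z).
  have [sf1 f1out f1M mom1] := prim_pfun a1' epsac c1' pf.
  have pf1 : pfun a1 c1 (a1 + eps) (c1 - eps) m (C * Z) (fun x => I a1 x f).
    split=> // x.
    have CZ0 : 0 <= C * Z by rewrite mulr_ge0// ltW.
    have [x1|x1] := boolP (a1 + eps <= x <= c1 - eps); last by rewrite f1out// normr0.
    have /andP[x2 x3] := x1.
    have a1x : a1 <= x by lra.
    apply: le_trans (I_abs (bf _ _)) _.
    apply: (@le_trans _ _ (I a1 c1 (fun s => \sum_j `|c j| * mbump eps (s - y j)))).
      have bsum u w : bmf u w (fun s => \sum_j `|c j| * mbump eps (s - y j)).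
        by apply: bmf_sum => j; exact: bmfZ.
      apply: (@le_trans _ _ (I a1 x (fun s => \sum_j `|c j| * mbump eps (s - y j)))).
        apply: le_I => // [|t _]; first exact: bmf_abs.
        rewrite (le_trans (ler_norm_sum _ _ _))//; apply: ler_sum => j _.
        by rewrite normrM (ger0_norm (bump_ge0 _ _)).
      rewrite (@I_split _ a1 x c1)//; last by lra.
      rewrite lerDl; apply: I_ge0 => t _; apply: sumr_ge0 => j _.
      by rewrite mulr_ge0// bump_ge0.
    rewrite I_sum; last by move=> j; exact: bmfZ.
    rewrite /C mulr_suml le_eqVlt; apply/orP; left; apply/eqP; apply: eq_bigr => j _.
    by have [h1 h2] := Hin j; rewrite (I_Z _ (bbj j a1 c1)) (Zj j a1 c1 h1 h2).
  have [_ _ h _] := primn_pfun a1' epsac c1' pf1.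
  by rewrite /phi /primn iterSr; exact: h.
have tphi : test_function b phi.
  by split; [exact: sphi|exists (a1 + eps), (c1 - eps); split; [lra|lra|exact: phiout]].
have := wd _ tphi; rewrite dphi => W.
have RH := @abs_I_weak b (a1 + eps) (c1 - eps) d phi D _ (le_lt_trans a10 a1')
   (lt_le_trans c1' c1b) md (fun s => smooth_cont sphi) phiout phiS (hD _ _ a1' c1').
(* By continuity of [v] at the points [y j], the smoothed functional is [Z] times the point
   functional up to [Z * e]; the weak derivative bounds it by a multiple of [Z], which cancels. *)
have LH : `|\int[mu]_(x in `]0, b[) (v x * f x) - Z * \sum_j c j * v (y j)| <= Z * e.
  rewrite -/(I 0 b (fun x => v x * f x)).
  rewrite (eq_I (g := fun s => \sum_j c j * (mbump eps (s - y j) * v s))); last first.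
    by move=> s _; rewrite /f mulr_sumr; apply: eq_bigr => j _; ring.
  rewrite I_sum; last by move=> j; apply: bmfZ; exact: bmfM.
  rewrite mulr_sumr -sumrB (le_trans (ler_norm_sum _ _ _))//.
  apply: (@le_trans _ _ (\sum_j `|c j| * (eta * Z))); last first.
    by rewrite -mulr_suml -/C mulrA [leLHS]mulrC ler_pM2l// mulrC.
  apply: ler_sum => j _; have [h1 [h2 h3]] := Heps j.
  have Zj' : I 0 b (fun s => mbump eps (s - y j)) = Z by apply: Zj; lra.
  rewrite I_Z; last exact: bmfM.
  rewrite mulrCA -mulrBr normrM ler_wpM2l// -Zj' mulrC.
  rewrite -!I_Z// -I_B; [|exact: bmfM|exact: bmfZ].
  have bd : bmf 0 b (fun s => mbump eps (s - y j) * v s - v (y j) * mbump eps (s - y j)).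
    by apply: bmfB; [exact: bmfM|exact: bmfZ].
  apply: le_trans (I_abs bd) _; apply: le_I; [exact: bmf_abs|exact: bmfZ|].
  move=> s _; have [h|h] := leP eps `|s - y j|; first by rewrite bump_out// mul0r !mulr0 subrr normr0.
  rewrite mulrC -mulrBl normrM (ger0_norm (bump_ge0 _ _)) ler_wpM2r ?bump_ge0//.
  exact: h3.
have {}W : `|\int[mu]_(x in `]0, b[) (v x * f x)| <= (c1 - a1) ^+ m * (C * Z) * D.
  by rewrite W normrM normrX normrN1 expr1n mul1r.
rewrite -(ler_pM2l Z0) -{1}(gtr0_norm Z0) -normrM.
have -> : Z * \sum_j c j * v (y j) = \int[mu]_(x in `]0, b[) (v x * f x) -
   (\int[mu]_(x in `]0, b[) (v x * f x) - Z * \sum_j c j * v (y j)).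
  by rewrite opprB addrC subrK.
apply: le_trans (ler_normB _ _) _; rewrite mulrDr; apply: lerD => //.
by apply: le_trans W _; rewrite le_eqVlt; apply/orP; left; apply/eqP; ring.
Unshelve. all: by end_near. Qed.

End Peano.

(** * Bounds on weak derivatives extracted from Sobolev norms *)

Section SobolevTools.
Context {R : realType}.
Local Notation mu := (@lebesgue_measure R).
Implicit Types (a c b K : R) (v d f : R -> R).

Lemma lebesgue_setT_gt0 : (0 < mu (setT : set R))%E.
Proof.
apply: (@lt_le_trans _ _ (mu (`[0, 1]%classic : set R))).
  by rewrite /= lebesgue_measure_itv /= lte_fin ltr01 -EFinB subr0 lte_fin.
by apply: le_measure; rewrite ?inE//.
Qed.

Lemma ae_imp (P Q : R -> Prop) : {ae mu, forall s, P s} -> (forall s, P s -> Q s) ->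
  {ae mu, forall s, Q s}.
Proof. by move=> aP PQ; apply: negligibleS aP => s /= nQ /PQ. Qed.

Lemma Linfty_ae b d K : (Lp_norm b +oo%E d <= K%:E)%E ->
  {ae mu, forall s, 0 < s < b -> `|d s| <= K}.
Proof.
rewrite /Lp_norm unlock /Lnorm lebesgue_setT_gt0 => /ess_supP.
apply: filterS => s /= + sb; rewrite lee_fin patchE ifT//.
by rewrite inE /= in_itv /= sb.
Qed.

Lemma Linfty_int b d K a' c' : measurable_fun (`]0, b[%classic : set R) d ->
  (Lp_norm b +oo%E d <= K%:E)%E -> 0 <= K -> 0 < a' -> a' <= c' -> c' < b ->
  (\int[mu]_(x in `[a', c']) `|d x|%:E <= (K * (c' - a'))%:E)%E.
Proof.
move=> md dK K0 a0 ac cb.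
have sub : (`[a', c']%classic : set R) `<=` `]0, b[.
  by move=> s /=; rewrite !in_itv /= => /andP[h1 h2]; rewrite (lt_le_trans a0) ?(le_lt_trans h2).
have -> : (K * (c' - a'))%:E = (\int[mu]_(x in `[a', c']) (cst K%:E x))%E.
  rewrite integral_cst//; have := @lebesgue_measure_itv R `[a', c'] => /= ->.
  rewrite lte_fin EFinM; move: ac; rewrite le_eqVlt => /predU1P[->|ac].
    by rewrite ltxx subrr.
  by rewrite ac -EFinB.
apply: ae_ge0_le_integral => //.
- apply: measurable_funS sub _ => //.
  by apply/measurable_EFinP; exact: measurableT_comp.
- by apply: ae_imp (Linfty_ae dK) _ => s h /sub /=; rewrite in_itv /= => /h.
Qed.

Definition En d a c : \bar R := (\int[mu]_(x in `]a, c[) (d x ^+ 2)%:E)%E.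

Lemma En_ge0 d a c : (0 <= En d a c)%E.
Proof. by apply: integral_ge0 => x _; rewrite lee_fin sqr_ge0. Qed.

Lemma L2_En b d K : 0 <= K -> (Lp_norm b 2%:E d <= K%:E)%E -> (En d 0 b <= (K ^+ 2)%:E)%E.
Proof.
move=> K0; rewrite /Lp_norm => dK.
have E : (\int[mu]_x `|(EFin \o d \_ `]0%R, b[) x| `^ 2 = En d 0 b)%E.
  rewrite /En [RHS]integral_mkcond; apply: eq_integral => x _ /=.
  rewrite /= !patchE; case: ifP => _.
    by rewrite powR_mulrn// real_normK// num_real.
  by rewrite normr0 powR0 ?pnatr_eq0.
rewrite -E -poweR_Lnorm ?pnatr_eq0//.
move: dK; have := Lnorm_ge0 mu 2%:E (EFin \o d \_ `]0%R, b[).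
case: (Lnorm _ _ _) => [r| |]//; rewrite !lee_fin => r0 rK.
by rewrite powR_mulrn// lerXn2r  ?nnegrE.
Qed.

Lemma measurable_sqr a c b d : 0 <= a -> c <= b ->
  measurable_fun (`]0, b[%classic : set R) d ->
  measurable_fun (`]a, c[%classic : set R) (fun x => (d x ^+ 2)%:E).
Proof.
move=> a0 cb md; apply/measurable_EFinP; apply: measurable_funX.
apply: measurable_funS md => // s /=; rewrite !in_itv /= => /andP[h1 h2].
by rewrite (le_lt_trans a0 h1) (lt_le_trans h2 cb).
Qed.

Lemma En_split b d a m c : 0 <= a -> a <= m -> m <= c -> c <= b ->
  measurable_fun (`]0, b[%classic : set R) d -> (En d a m + En d m c <= En d a c)%E.
Proof.
move=> a0 am mc cb md.
have sub : (`]a, m[%classic `|` `]m, c[%classic : set R) `<=` `]a, c[.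
  move=> s [] /=; rewrite !in_itv /= => /andP[h1 h2].
    by rewrite h1 (lt_le_trans h2 mc).
  by rewrite h2 (le_lt_trans am h1).
have ms := measurable_sqr a0 cb md.
rewrite /En -ge0_integral_setU//.
- apply: ge0_subset_integral => //; first exact: measurableU.
  by move=> x _; rewrite lee_fin sqr_ge0.
- by apply: measurable_funS sub ms.
- by move=> x _; rewrite lee_fin sqr_ge0.
- apply/disj_setPS => s [] /=; rewrite !in_itv /= => /andP[_ h1] /andP[h2 _].
  by move: (lt_trans h1 h2); rewrite ltxx.
Qed.

(** The optimal [th] is [J / E]; if [E] vanishes, a large [th] contradicts [0 < J]. *)
Lemma quad_le (J E L : R) : 0 <= J -> 0 <= E -> 0 <= L ->
  (forall th, 0 < th -> 2 * th * J <= th ^+ 2 * E + L) -> J ^+ 2 <= E * L.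
Proof.
move=> J0 E0 L0 H; move: J0; rewrite le_eqVlt => /predU1P[<-|J0].
  by rewrite expr0n mulr_ge0.
move: E0; rewrite le_eqVlt => /predU1P[E0|E0].
  have := H ((L + 1) / J); rewrite divr_gt0 ?ltr_wpDl// => /(_ isT).
  rewrite -E0 mulr0 add0r -mulrA divfK ?gt_eqF//; lra.
have := H (J / E); rewrite divr_gt0// => /(_ isT).
have -> : 2 * (J / E) * J = 2 * J ^+ 2 / E by field; rewrite gt_eqF.
have -> : (J / E) ^+ 2 * E = J ^+ 2 / E by field; rewrite gt_eqF.
move=> h; have : J ^+ 2 / E <= L by lra.
by rewrite ler_pdivrMr// mulrC.
Qed.

(** Cauchy-Schwarz, obtained from 2 th |d| <= th^2 d^2 + 1 for every th > 0, an inequality that can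
    be integrated before the integral of |d| is known to be finite. *)
Lemma L2_int b d K a c a' c' : measurable_fun (`]0, b[%classic : set R) d ->
  (En d 0 b <= (K ^+ 2)%:E)%E -> 0 <= a -> a < a' -> a' <= c' -> c' < c -> c <= b ->
  (\int[mu]_(x in `[a', c']) `|d x|%:E <=
   (Num.sqrt (fine (En d a c) * (c - a)))%:E)%E.
Proof.
move=> md dK a0 aa ac cc cb.
have sub : (`[a', c']%classic : set R) `<=` `]a, c[.
  by move=> s /=; rewrite !in_itv /= => /andP[h1 h2]; rewrite (lt_le_trans aa) ?(le_lt_trans h2).
have sub' : (`]a, c[%classic : set R) `<=` `]0, b[.
  move=> s /=; rewrite !in_itv /= => /andP[h1 h2].
  by rewrite (le_lt_trans a0 h1) (lt_le_trans h2 cb).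
have mabs : measurable_fun (`]a, c[%classic : set R) (fun x => `|d x|%:E).
  apply/measurable_EFinP; apply: measurableT_comp => //.
  exact: measurable_funS sub' md.
have msq := measurable_sqr a0 cb md.
have Eac : (En d a c <= (K ^+ 2)%:E)%E.
  apply: le_trans dK; apply: ge0_subset_integral => //.
  - exact: (measurable_sqr (lexx 0) (lexx b) md).
  - by move=> x _; rewrite lee_fin sqr_ge0.
have Efin : En d a c \is a fin_num.
  by rewrite ge0_fin_numE ?En_ge0// (le_lt_trans Eac) ?ltry.
set J := (\int[mu]_(x in `[a', c']) `|d x|%:E)%E.
have J0 : (0 <= J)%E by exact: integral_ge0.
have ac' : a <= c by lra.
have muac : mu (`]a, c[%classic : set R) = (c - a)%:E.
  by rewrite /= lebesgue_measure_itv /= lte_fin ifT ?EFinB//; lra.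
have H th : 0 < th -> ((2 * th)%:E * J <= (th ^+ 2 * fine (En d a c) + (c - a))%:E)%E.
  move=> th0.
  apply: (@le_trans _ _ ((2 * th)%:E * \int[mu]_(x in `]a, c[) `|d x|%:E)%E).
    apply: lee_wpmul2l; first by rewrite lee_fin mulr_ge0// ltW.
    by apply: ge0_subset_integral.
  rewrite -ge0_integralZl//; last by rewrite lee_fin mulr_ge0// ltW.
  have -> : (th ^+ 2 * fine (En d a c) + (c - a))%:E =
     (\int[mu]_(x in `]a, c[) ((th ^+ 2)%:E * (d x ^+ 2)%:E + 1%:E))%E.
    rewrite ge0_integralD//.
    - rewrite ge0_integralZl//; last by rewrite lee_fin sqr_ge0.
        by rewrite integral_cst// EFinD EFinM fineK// mul1e -muac.
      by move=> x _; rewrite lee_fin sqr_ge0.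
    - by move=> x _; rewrite -EFinM lee_fin mulr_ge0 ?sqr_ge0.
    - by apply: emeasurable_funM => //; exact: measurable_cst.
  apply: ge0_le_integral => //.
  - by move=> x _; rewrite -EFinM lee_fin !mulr_ge0// ltW.
  - by apply: emeasurable_funM => //; exact: measurable_cst.
  - apply: emeasurable_funD; last exact: measurable_cst.
    by apply: emeasurable_funM => //; exact: measurable_cst.
  move=> x _; rewrite -!EFinM -EFinD lee_fin -(real_normK (num_real (d x))).
  have := sqr_ge0 (th * `|d x| - 1); move: (`|d x|) => y; nra.
have Jfin : J \is a fin_num.
  rewrite ge0_fin_numE//.
  have := H 1 ltr01; case: (J) J0 => [r| |]//; first by rewrite ltry.
  by rewrite gt0_muley ?lte_fin ?mulr1 ?ltr0n//.
rewrite -(fineK Jfin) lee_fin -(ger0_norm (fine_ge0 J0)) -sqrtr_sqr ler_wsqrtr//.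
apply: quad_le; [exact: fine_ge0|exact/fine_ge0/En_ge0|by rewrite subr_ge0|].
by move=> th th0; rewrite -lee_fin EFinM fineK//; exact: H.
Qed.

(** The norm refers to a selected weak derivative, which is a genuine one because [sobolev] provides
    some candidate. *)
Lemma sobolev_weak b M p f K m : sobolev b M p f -> (sobolev_norm b M p f <= K%:E)%E ->
  (m <= M)%N -> exists2 d, is_weak_derivative b m f d & (Lp_norm b p d <= K%:E)%E.
Proof.
move=> sf nK mM; have [d0 hd0 _] := sf m mM.
exists (weak_derivative b m f).
  by have := @xgetPex _ (cst 0) [set d | is_weak_derivative b m f d]; apply; exists d0.
apply: le_trans nK; rewrite /sobolev_norm.
rewrite (bigD1 (Ordinal (mM : m < M.+1)%N))//= leeDl//.
by apply: sume_ge0 => i _; exact: Lnorm_ge0.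
Qed.

End SobolevTools.

(** * One-sided derivatives, interpolation, and regularity from second differences *)

Section Tools.
Context {R : realType}.
Local Notation mu := (@lebesgue_measure R).
Implicit Types (a b c s t x y l K C M : R) (f : R -> R).

Lemma hd_eps (A : set R) f x l : has_derivative A f x l -> forall e, 0 < e ->
  exists2 d, 0 < d & forall y, A y -> `|y - x| < d -> `|f y - f x - l * (y - x)| <= e * `|y - x|.
Proof.
move=> hd e e0; have /cvgrPdist_le/(_ e e0) := hd.
rewrite /within /= => /nbhs_ballP[d /= d0 H]; exists d => // y Ay yx.
have [->|ynx] := eqVneq y x; first by rewrite !subrr mulr0 subr0 normr0 mulr0.
have := H y; rewrite /ball /= distrC => /(_ yx)/(_ ynx Ay) h.
have yx0 : y - x != 0 by rewrite subr_eq0.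
have -> : f y - f x - l * (y - x) = - ((l - (y - x)^-1 * (f y - f x)) * (y - x)) by field.
by rewrite normrN normrM ler_wpM2r.
Qed.

Lemma eps_is_derive f x l :
  (forall e, 0 < e -> exists2 d, 0 < d & forall y, `|y - x| < d ->
    `|f y - f x - l * (y - x)| <= e * `|y - x|) -> is_derive x 1 f l.
Proof.
move=> H; suff h : h^-1 *: (f (h *: 1 + x) - f x) @[h --> (0 : R)^'] --> l.
  by apply: DeriveDef; [apply/cvg_ex; exists l|exact: cvg_lim h].
apply/cvgrPdist_le => e e0; have [d d0 Hd] := H e e0; near=> h.
have hn : h != 0 by near: h; exact: nbhs_dnbhs_neq.
have hd : `|h| < d by near: h; exact: dnbhs0_lt.
rewrite /GRing.scale /= mulr1.
have := Hd (h + x); rewrite addrK => /(_ hd) Hh.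
have -> : l - h^-1 * (f (h + x) - f x) = - (h^-1 * (f (h + x) - f x - l * h)) by field.
by rewrite normrN normrM normfV ler_pdivrMl ?normr_gt0// [leRHS]mulrC.
Unshelve. all: by end_near. Qed.

Lemma hd_is_derive a c f x l : a < x < c -> has_derivative `[a, c] f x l -> is_derive x 1 f l.
Proof.
move=> /andP[ax xc] /hd_eps H; apply: eps_is_derive => e e0; have [d d0 Hd] := H e e0.
exists (Num.min d (Num.min (x - a) (c - x))); first by rewrite !lt_min d0 !subr_gt0 ax.
move=> y; rewrite !lt_min => /and3P[y1 y2 y3]; apply: Hd => //=.
by rewrite in_itv /=; move: y2 y3; rewrite !ltr_norml; lra.
Qed.

Lemma hd_within a c f (l : R -> R) : (forall x, a <= x <= c -> has_derivative `[a, c] f x (l x)) ->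
  {within `[a, c], continuous f}.
Proof.
move=> H; apply/subspace_continuousP => x; rewrite /= in_itv /= => xac.
apply/cvgrPdist_le => e e0; have [d d0 Hd] := hd_eps (H x xac) (ltr01 (R := R)).
near=> y.
have yac : (`[a, c]%classic : set R) y by near: y; exact: withinT.
have yd : `|y - x| < d.
  near: y; apply: cvg_within; apply/nbhs_ballP; exists d => // y.
  by rewrite /ball /= distrC.
have L0 : 0 < 1 + `|l x| by rewrite ltr_pwDl.
have ye : `|y - x| <= e / (1 + `|l x|).
  near: y; apply: cvg_within; apply/nbhs_ballP; exists (e / (1 + `|l x|)) => /=.
    by rewrite divr_gt0.
  by move=> y; rewrite /ball /= distrC => /ltW.
have h := Hd y yac yd; rewrite mul1r in h.
rewrite distrC; have -> : f y - f x = (f y - f x - l x * (y - x)) + l x * (y - x) by rewrite subrK.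
rewrite (le_trans (ler_normD _ _))// normrM.
move: ye; rewrite ler_pdivlMr// mulrDr mulr1 => ye; apply: le_trans ye.
by rewrite [leRHS]addrC [leLHS]addrC [leRHS]addrC [leLHS]addrC (mulrC `|l x|) lerD2r.
Unshelve. all: by end_near. Qed.

Lemma ae_dense a c (P : R -> Prop) t e : a < c -> {ae mu, forall s, a < s < c -> P s} ->
  a <= t <= c -> 0 < e -> exists s, [/\ a < s < c, P s & `|s - t| < e].
Proof.
move=> ac aP /andP[at_ tc] e0; apply: contrapT => H.
have [N [mN N0 sN]] := aP.
pose lo := Num.max a (t - e); pose hi := Num.min c (t + e).
have lohi : lo < hi by rewrite /lo /hi gt_max !lt_min; apply/andP; split; apply/andP; split; lra.
have sub : (`]lo, hi[%classic : set R) `<=` N.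
  move=> s; rewrite /= in_itv /= gt_max lt_min => /andP[/andP[s1 s2] /andP[s3 s4]].
  apply: sN => /= Ps; apply: H; exists s; split=> //; first by rewrite s1.
    by apply: Ps; rewrite s1.
  by rewrite ltr_norml; lra.
have : (mu (`]lo, hi[%classic : set R) <= mu N)%E by apply: le_measure; rewrite ?inE.
rewrite [leRHS]N0 lebesgue_measure_itv /= lte_fin lohi -EFinB lee_fin.
by rewrite leNgt subr_gt0 lohi.
Qed.

(* Interpolation at equidistant interior points, as functionals annihilating
   polynomials of degree at most k. *)
Lemma interpolation k : exists2 C, 0 < C & forall a c f M, a < c -> 0 <= M ->
  (forall n (y z : 'I_n -> R), (forall j, a < y j < c) ->
    (forall i, (i < k.+1)%N -> \sum_j z j * y j ^+ i = 0) ->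
    `|\sum_j z j * f (y j)| <= (\sum_j `|z j|) * M) ->
  exists p : {poly R}, (size p <= k.+1)%N /\ forall s, a < s < c -> `|f s - p.[s]| <= C * M.
Proof.
pose th (j : nat) : R := j.+1%:R / k.+2%:R.
have th01 (j : 'I_k.+1) : 0 < th j < 1.
  by rewrite divr_gt0// ltr_pdivrMr// mul1r ltr_nat ltnS ltn_ord.
have [B [B1 B2]] : exists B : 'I_k.+1 -> 'I_k.+1 -> R,
    inv_rV (fun (j : 'I_k.+1) (p : {poly R}) => p.[th j]) B.
  apply: unisolvent => [j p sp|p sp p0].
    by rewrite (horner_coef_wide _ sp); apply: eq_bigr => i _; rewrite hornerXn.
  apply/eqP; apply: contraT => pn0.
  pose rs := [seq th i | i <- iota 0 k.+1].
  have rsr : all (root p) rs.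
    apply/allP => x /mapP[i]; rewrite mem_iota add0n => /andP[_ ik] ->.
    by rewrite /root; have := p0 (Ordinal ik) => /= ->.
  have urs : uniq rs.
    rewrite map_inj_uniq ?iota_uniq// => i j /(mulIf _) h.
    have : i.+1%:R = j.+1%:R :> R by apply: h; rewrite invr_eq0 pnatr_eq0.
    by move=> /eqP; rewrite eqr_nat => /eqP[].
  by have := max_poly_roots pn0 rsr urs; rewrite size_map size_iota ltnNge sp.
exists (1 + \sum_(j < k.+1) \sum_(i < k.+1) `|B j i|).
  by rewrite ltr_pwDl// sumr_ge0// => j _; exact: sumr_ge0.
move=> a c f M ac M0 H; have h0 : 0 < c - a by rewrite subr_gt0.
have hn : c - a != 0 by rewrite gt_eqF.
pose yn (j : 'I_k.+1) := a + (c - a) * th j.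
pose q : {poly R} := \poly_(i < k.+1) \sum_(j < k.+1) B j (inord i) * f (yn j).
exists (unhat a c q); split=> [|s /andP[as_ sc]]; first by apply: size_unhat; exact: size_poly.
pose sh := (s - a) / (c - a).
have sh01 : 0 <= sh <= 1.
  rewrite divr_ge0 ?subr_ge0 ?(ltW as_) ?(ltW ac)//=.
  by rewrite ler_pdivrMr// mul1r lerD2r ltW.
(* The point [s] gets weight 1 and the interpolation nodes minus the Lagrange basis at [s]: the
   functional is the interpolation error at [s], which kills polynomials of degree at most k. *)
pose y (j : 'I_k.+2) := if unlift ord0 j is Some j' then yn j' else s.
pose z (j : 'I_k.+2) := if unlift ord0 j is Some j' then - (\sum_(i < k.+1) B j' i * sh ^+ i) else 1.
have yac j : a < y j < c.
  rewrite /y; case: unlift => [j'|]; last by rewrite as_.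
  have /andP[t0 t1] := th01 j'; rewrite /yn ltrDl mulr_gt0//=.
  by rewrite -ltrBrDl -[ltRHS]mulr1 ltr_pM2l.
have val_ (F : R -> R) : \sum_j z j * F (y j) = F s - \sum_(j < k.+1) (\sum_(i < k.+1) B j i * sh ^+ i) * F (yn j).
  rewrite big_ord_recl /z /y unlift_none mul1r; congr (_ + _).
  by rewrite -sumrN; apply: eq_bigr => j _; rewrite liftK mulNr.
have zan i : (i < k.+1)%N -> \sum_j z j * y j ^+ i = 0.
  move=> ik; rewrite (val_ (fun x => x ^+ i)).
  pose p := hat a c ('X^i); have sp : (size p <= k.+1)%N by apply: size_hat; rewrite size_polyXn.
  have -> : s ^+ i = p.[sh].
    by rewrite hatE hornerXn /sh; congr (_ ^+ _); field.
  rewrite (horner_coef_wide _ sp) (eq_bigr (fun l : 'I_k.+1 => \sum_j B j l * p.[th j] * sh ^+ l)); last first.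
    by move=> l _; rewrite (B1 _ sp) mulr_suml.
  rewrite exchange_big /= -sumrB big1// => j _; rewrite mulr_suml -sumrB big1// => l _.
  have -> : p.[th j] = yn j ^+ i by rewrite hatE hornerXn /yn addrC.
  by rewrite mulrAC subrr.
have -> : f s - (unhat a c q).[s] = \sum_j z j * f (y j).
  rewrite val_ unhatE -/sh; congr (_ - _).
  rewrite (horner_coef_wide _ (size_poly _ _)).
  rewrite (eq_bigr (fun i : 'I_k.+1 => \sum_j B j i * f (yn j) * sh ^+ i)); last first.
    by move=> i _; rewrite coef_poly ltn_ord inord_val mulr_suml.
  rewrite exchange_big /=; apply: eq_bigr => j _; rewrite mulr_suml.
  by apply: eq_bigr => i _; rewrite mulrAC.
apply: le_trans (H _ y z yac zan) _; rewrite ler_wpM2r//.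
rewrite big_ord_recl /z unlift_none normr1 lerD2l; apply: ler_sum => j _.
rewrite liftK normrN (le_trans (ler_norm_sum _ _ _))//; apply: ler_sum => i _.
by rewrite normrM -[leRHS]mulr1 ler_wpM2l// normrX exprn_ile1// ger0_norm; case/andP: sh01.
Qed.

Lemma pow2_bracket (s L : R) : 0 < s -> s <= L ->
  exists n, L / 2 < 2 ^+ n * s <= L.
Proof.
move=> s0 sL; pose P n := 2 ^+ n * s <= L.
have exP : exists n, ~~ P n.
  exists (Num.trunc (L / s)).+1; rewrite /P -ltNge -ltr_pdivrMr//.
  apply: lt_le_trans (_ : (Num.trunc (L / s)).+1%:R <= _).
    by rewrite truncnS_gt// divr_ge0// ltW// (lt_le_trans s0).
  by rewrite -natrX ler_nat ltnW// ltn_expl.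
case: (ex_minnP exP) => -[|n]; first by rewrite /P expr0 mul1r sL.
move=> nP min; exists n; apply/andP; split.
  by move: nP; rewrite /P -ltNge exprS -mulrA; lra.
by apply: contraT => h; have := min n h; rewrite ltnn.
Qed.

(* Zygmund-type bound: second differences of order s^(3/2) and boundedness
   give a Lipschitz bound, by comparing the difference quotients at s, 2s, 4s, ... *)
Lemma zygmund_right f y L C S : 0 < L -> 0 <= C ->
  (forall s, 0 < s -> s <= L -> `|f (y + s)| <= S) -> `|f y| <= S ->
  (forall s, 0 < s -> 2 * s <= L -> `|f (y + 2 * s) - 2 * f (y + s) + f y| <= C * (s * Num.sqrt s)) ->
  forall s, 0 < s -> s <= L -> `|f (y + s) - f y| <= (4 * S / L + 2 * C * Num.sqrt L) * s.
Proof.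
move=> L0 C0 fS fyS H.
pose Q s := (f (y + s) - f y) / s.
have step s : 0 < s -> 2 * s <= L -> `|Q s| <= `|Q (2 * s)| + C / 2 * Num.sqrt s.
  move=> s0 sL; have := H s s0 sL.
  have -> : Q s = Q (2 * s) - (f (y + 2 * s) - 2 * f (y + s) + f y) / (2 * s).
    by rewrite /Q; field; rewrite gt_eqF.
  move=> h; rewrite (le_trans (ler_normB _ _))// lerD2l normrM normfV (gtr0_norm (x := 2 * s)) ?mulr_gt0//.
  rewrite ler_pdivrMr ?mulr_gt0//; apply: le_trans h _.
  by rewrite le_eqVlt; apply/orP; left; apply/eqP; field.
have S0 : 0 <= S by exact: le_trans fyS.
have base s : L / 2 < s -> s <= L -> `|Q s| <= 4 * S / L.
  move=> s1 s2; have s0 : 0 < s by apply: lt_trans s1; rewrite divr_gt0.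
  rewrite /Q normrM normfV (gtr0_norm s0) ler_pdivrMr//.
  have := ler_normB (f (y + s)) (f y); have := fS s s0 s2.
  have -> : 4 * S / L * s = 4 * S * (s / L) by field; rewrite gt_eqF.
  have : 2^-1 <= s / L by rewrite ler_pdivlMr//; lra.
  move: (s / L) => q hq; nra.
have claim n : forall s, 0 < s -> L / 2 < 2 ^+ n * s -> 2 ^+ n * s <= L ->
    `|Q s| <= 4 * S / L + 2 * C * (Num.sqrt L - Num.sqrt s).
  elim: n => [|n ih] s s0.
    rewrite expr0 mul1r => h1 h2; rewrite (le_trans (base _ h1 h2))// lerDl.
    by rewrite mulr_ge0 ?mulr_ge0// subr_ge0 ler_wsqrtr.
  rewrite exprSr -mulrA => h1 h2.
  have sL : 2 * s <= L.
    apply: le_trans h2; rewrite ler_peMl ?mulr_ge0 ?(ltW s0)//.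
    by rewrite exprn_ege1// ler1n.
  have := ih (2 * s) _ h1 h2; rewrite mulr_gt0// => /(_ isT) hQ.
  have := step s s0 sL.
  (* Since 5/4 is below the square root of 2, the increment [C / 2 * Num.sqrt s] is absorbed by the
     term with constant [2 * C]. *)
  have : 5 / 4 * Num.sqrt s <= Num.sqrt (2 * s).
    have -> : 5 / 4 = Num.sqrt ((5 / 4) ^+ 2) :> R by rewrite sqrtr_sqr ger0_norm.
    by rewrite -sqrtrM ?sqr_ge0// ler_wsqrtr// ler_wpM2r ?(ltW s0)//; lra.
  have := sqrtr_ge0 s; move: (Num.sqrt s) (Num.sqrt (2 * s)) (Num.sqrt L) hQ => p q r; nra.
move=> s s0 sL; have [n /andP[h1 h2]] := pow2_bracket s0 sL.
have := claim n s s0 h1 h2; rewrite /Q normrM normfV (gtr0_norm s0) ler_pdivrMr//.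
move=> /le_trans; apply; rewrite ler_wpM2r ?(ltW s0)// lerD2l ler_wpM2l ?mulr_ge0//.
by rewrite gerBl sqrtr_ge0.
Qed.

(** From the left half one moves to the right, from the right half to the left by reflection, so a
    range of length [b / 4] is always available; larger distances are covered by the bound [S]. *)
Lemma zygmund b C S : 0 < b -> 0 <= C -> 0 <= S ->
  exists2 K, 0 <= K & forall f, (forall r, 0 < r < b -> `|f r| <= S) ->
  (forall y s, 0 < y -> 0 < s -> y + 2 * s < b ->
    `|f (y + 2 * s) - 2 * f (y + s) + f y| <= C * (s * Num.sqrt s)) ->
  forall r r', 0 < r < b -> 0 < r' < b -> `|f r - f r'| <= K * `|r - r'|.
Proof.
move=> b0 C0 S0; pose L := b / 4; have L0 : 0 < L by rewrite divr_gt0.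
pose K := 4 * S / L + 2 * C * Num.sqrt L.
have K0 : 0 <= K by rewrite addr_ge0// ?mulr_ge0 ?sqrtr_ge0 ?invr_ge0 ?(ltW L0).
exists K => // f fS H r r'.
wlog rr : r r' / r < r' => [W|].
  have [rr|rr|->] := ltgtP r r'; first exact: W.
    by move=> ? ?; rewrite distrC (distrC r); exact: W.
  by rewrite !subrr normr0 mulr0.
move=> /andP[r0 rb] /andP[r0' rb']; rewrite distrC (distrC r) (gtr0_norm (x := r' - r)) ?subr_gt0//.
have [sL|Ls] := leP (r' - r) L; last first.
  apply: (@le_trans _ _ (4 * S / L * (r' - r))); last first.
    by rewrite ler_wpM2r ?subr_ge0 ?(ltW rr)// lerDl !mulr_ge0 ?sqrtr_ge0.
  have h1 := fS r _; have h2 := fS r' _.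
  have := ler_normB (f r') (f r); rewrite r0 rb r0' rb' in h1 h2.
  have := h1 isT; have := h2 isT.
  have -> : 4 * S / L * (r' - r) = 4 * S * ((r' - r) / L) by field; rewrite gt_eqF.
  have : 1 <= (r' - r) / L by rewrite ler_pdivlMr// mul1r ltW.
  by move: ((r' - r) / L) (f r) (f r') => q x y; nra.
have [rh|rh] := leP r (b / 2).
  have := @zygmund_right f r L C S L0 C0; rewrite -/K => W.
  have := W _ _ _ (r' - r); rewrite addrCA subrr addr0; apply.
  - by move=> s s0 sl; apply: fS; rewrite /L in sl; apply/andP; split; lra.
  - by apply: fS; rewrite r0 rb.
  - by move=> s s0 sl; apply: H => //; rewrite /L in sl; lra.
  - by rewrite subr_gt0.
  - exact: sL.
have := @zygmund_right (fun x => f (b - x)) (b - r') L C S L0 C0; rewrite -/K => W.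
have := W _ _ _ (r' - r).
have -> : b - (b - r' + (r' - r)) = r by ring.
have -> : b - (b - r') = r' by ring.
rewrite distrC; apply.
- by move=> s s0 sl; apply: fS; rewrite /L in sl; apply/andP; split; lra.
- by apply: fS; rewrite r0' rb'.
- move=> s s0 sl; have := H (r' - 2 * s) s.
  have -> : b - (b - r' + 2 * s) = r' - 2 * s by ring.
  have -> : b - (b - r' + s) = r' - 2 * s + s by ring.
  have -> : r' - 2 * s + 2 * s = r' by ring.
  have -> : f r' - 2 * f (r' - 2 * s + s) + f (r' - 2 * s) =
     f (r' - 2 * s) - 2 * f (r' - 2 * s + s) + f r' by ring.
  by apply => //; rewrite /L in sl; lra.
- by rewrite subr_gt0.
- exact: sL.
Qed.

(** The difference quotients over s, s/2, s/4, ... tend to the derivative, and consecutive ones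
    differ by a second difference over a step, of order [C] times that step; the steps add up to at
    most s. *)
Lemma C11_right f y l C s : 0 <= C -> 0 < s -> is_derive y 1 f l ->
  (forall x, 0 < x -> 2 * x <= s -> `|f (y + 2 * x) - 2 * f (y + x) + f y| <= C * x ^+ 2) ->
  `|f (y + s) - f y - s * l| <= C * s ^+ 2.
Proof.
move=> C0 s0 df H.
pose Q s := (f (y + s) - f y) / s.
pose hs n := s / 2 ^+ n.
have hs0 n : 0 < hs n by rewrite divr_gt0// exprn_gt0.
have hsS n : hs n = 2 * hs n.+1 by rewrite /hs exprS; field; rewrite expf_neq0.
have hsle n : hs n <= s.
  by rewrite ler_pdivrMr ?exprn_gt0// ler_peMr ?(ltW s0)// exprn_ege1// ler1n.
have claim n : `|Q s - Q (hs n)| <= C / 2 * (s - hs n).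
  elim: n => [|n ih]; first by rewrite /hs expr0 divr1 !subrr normr0 mulr0.
  have -> : Q s - Q (hs n.+1) = (Q s - Q (hs n)) + (Q (hs n) - Q (hs n.+1)) by ring.
  rewrite (le_trans (ler_normD _ _))//.
  have : `|Q (hs n) - Q (hs n.+1)| <= C / 2 * hs n.+1.
    have -> : Q (hs n) - Q (hs n.+1) =
      (f (y + 2 * hs n.+1) - 2 * f (y + hs n.+1) + f y) / (2 * hs n.+1).
      by rewrite /Q hsS; field; rewrite gt_eqF.
    rewrite normrM normfV (gtr0_norm (x := 2 * hs n.+1)) ?mulr_gt0// ler_pdivrMr ?mulr_gt0//.
    apply: le_trans (H _ (hs0 _) _) _; first by rewrite -hsS.
    by rewrite le_eqVlt; apply/orP; left; apply/eqP; field.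
  move=> h2; apply: le_trans (lerD ih h2) _; rewrite -mulrDr ler_wpM2l ?divr_ge0//.
  by rewrite (hsS n); lra.
have lim e : 0 < e -> exists n, `|Q (hs n) - l| <= e.
  move=> e0; have [d0 d1] := df.
  have : h^-1 *: (f (h *: 1 + y) - f y) @[h --> (0 : R)^'] --> l.
    by rewrite -d1; exact: d0.
  move=> /cvgrPdist_le/(_ _ e0)/nbhs_ballP[d /= dd Hd].
  pose n := (Num.trunc (s / d)).+1; exists n.
  have hd : hs n < d.
    rewrite /hs ltr_pdivrMr ?exprn_gt0// -ltr_pdivrMl// mulrC.
    apply: lt_trans (_ : n%:R < _).
      by rewrite truncnS_gt.
    by rewrite -natrX ltr_nat ltn_expl.
  have := Hd (hs n); rewrite /ball /= sub0r normrN gtr0_norm// => /(_ hd).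
  rewrite gt_eqF// => /(_ isT); rewrite distrC /GRing.scale /= mulr1.
  by rewrite /Q [hs n + y]addrC [(f _ - f _) / _]mulrC.
have h : `|Q s - l| <= C / 2 * s.
  apply/ler_addgt0Pr => e e0; have [n hn] := lim e e0.
  have -> : Q s - l = (Q s - Q (hs n)) + (Q (hs n) - l) by ring.
  rewrite (le_trans (ler_normD _ _))// lerD// (le_trans (claim n))//.
  by rewrite ler_wpM2l ?divr_ge0// gerBl ltW.
have -> : f (y + s) - f y - s * l = s * (Q s - l) by rewrite /Q; field; rewrite gt_eqF.
rewrite normrM gtr0_norm// expr2 mulrA [_ * s]mulrC ler_pM2l//.
apply: le_trans h _; rewrite ler_wpM2r ?(ltW s0)//; lra.
Qed.

(** The Lipschitz bound on the derivative comes from adding the Taylor expansions at the two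
    points. *)
Lemma C11 b f f' C : 0 < b -> 0 <= C ->
  (forall y, 0 < y < b -> is_derive y 1 f (f' y)) ->
  (forall y s, 0 < y -> 0 < s -> y + 2 * s < b ->
    `|f (y + 2 * s) - 2 * f (y + s) + f y| <= C * s ^+ 2) ->
  (forall r r', 0 < r < b -> 0 < r' < b -> `|f r' - f r - (r' - r) * f' r| <= C * (r' - r) ^+ 2) /\
  (forall r r', 0 < r < b -> 0 < r' < b -> `|f' r - f' r'| <= 2 * C * `|r - r'|).
Proof.
move=> b0 C0 df H.
have T r r' : 0 < r < b -> 0 < r' < b -> `|f r' - f r - (r' - r) * f' r| <= C * (r' - r) ^+ 2.
  move=> rb rb'; have [rr|rr|<-] := ltgtP r r'; last first.
  - by rewrite !subrr mul0r subrr normr0 mulr_ge0 ?sqr_ge0.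
  - have d : is_derive (b - r) 1 (fun x => f (b - x)) (- f' r).
      have dl : is_derive (b - r) 1 (fun x => b - x) (-1 : R).
        by apply: d_eq (dB (dC (b - r) b) (dI _)) _; rewrite sub0r.
      have dfr : is_derive (b - (b - r)) 1 f (f' r) by rewrite subKr; exact: df.
      by apply: d_eq (@d_comp _ (b - r) f (fun x => b - x) _ _ dfr dl) _; rewrite mulrN1.
    have := @C11_right (fun x => f (b - x)) (b - r) (- f' r) C (r - r') C0 _ d.
    rewrite subr_gt0 rr => /(_ isT).
    have -> : b - (b - r + (r - r')) = r' by ring.
    have -> : b - (b - r) = r by ring.
    have -> : f r' - f r - (r - r') * - f' r = f r' - f r - (r' - r) * f' r by ring.
    rewrite -sqrrN opprB; apply => x x0 xs.
    have := H (r - 2 * x) x.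
    have -> : b - (b - r + 2 * x) = r - 2 * x by ring.
    have -> : b - (b - r + x) = r - 2 * x + x by ring.
    have -> : r - 2 * x + 2 * x = r by ring.
    have -> : f r - 2 * f (r - 2 * x + x) + f (r - 2 * x) =
       f (r - 2 * x) - 2 * f (r - 2 * x + x) + f r by ring.
    by apply => //; lra.
  have := @C11_right f r (f' r) C (r' - r) C0 _ (df _ rb).
  rewrite subr_gt0 rr => /(_ isT); rewrite [r + (r' - r)]addrCA subrr addr0; apply.
  by move=> x x0 xs; apply: H => //; lra.
split=> // r r' rb rb'; have [->|rn] := eqVneq r r'; first by rewrite !subrr normr0 mulr0.
have h1 := T _ _ rb rb'; have h2 := T _ _ rb' rb.
have n0 : 0 < `|r - r'| by rewrite normr_gt0 subr_eq0.
rewrite -(ler_pM2r n0) -[leRHS]mulrA -normrM -expr2 real_normK ?num_real//.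
have -> : (f' r - f' r') * (r - r') = (f r' - f r - (r' - r) * f' r) + (f r - f r' - (r - r') * f' r') by ring.
rewrite (le_trans (ler_normD _ _))//.
have : (r' - r) ^+ 2 = (r - r') ^+ 2 by ring.
by move: h1 h2 => + + e; rewrite e; lra.
Qed.

End Tools.

(** * Extension of bounds by continuity *)

Section Closure.
Context {R : realType}.
Local Notation mu := (@lebesgue_measure R).
Implicit Types (a b c s t K M : R) (f : R -> R).

Lemma within_eps a c f t e : {within `[a, c], continuous f} -> a <= t <= c -> 0 < e ->
  exists2 d, 0 < d & forall s, a <= s <= c -> `|s - t| < d -> `|f s - f t| <= e.
Proof.
move=> /subspace_continuousP cf tac e0; have := cf t; rewrite /= in_itv /= => /(_ tac).
move=> /cvgrPdist_le/(_ e e0)/nbhs_ballP[d /= d0 H]; exists d => // s sac st.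
by rewrite distrC; apply: H; rewrite /= ?in_itv// /ball /= distrC.
Qed.

Lemma within_bounded a c f : a <= c -> {within `[a, c], continuous f} ->
  exists2 M, 0 <= M & forall s, a <= s <= c -> `|f s| <= M.
Proof.
move=> ac cf; have cn : {within `[a, c], continuous (fun s => `|f s|)}.
  by move=> x; apply: cvg_norm; exact: cf.
have [m _ H] := EVT_max ac cn; by exists `|f m| => // s sac; apply: H; rewrite in_itv.
Qed.

(** Hypotheses in Bochner spaces hold at almost every time; continuity in time upgrades the
    resulting bounds to every time. *)
Lemma dense_le a c f (P : R -> Prop) M : a < c -> {within `[a, c], continuous f} ->
  {ae mu, forall s, a < s < c -> P s} -> (forall s, a < s < c -> P s -> `|f s| <= M) ->
  forall t, a <= t <= c -> `|f t| <= M.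
Proof.
move=> ac cf aP H t tac; apply/ler_addgt0Pr => e e0.
have [d d0 Hd] := within_eps cf tac e0.
have [s [sac Ps st]] := ae_dense ac aP tac d0.
have := Hd s; have /andP[/ltW -> /ltW ->] := sac => /(_ isT st) h.
have -> : f t = f s - (f s - f t) by ring.
by rewrite (le_trans (ler_normB _ _))// lerD// H.
Qed.

Lemma near_interior b t e : 0 < b -> 0 <= t <= b -> 0 < e ->
  exists2 s, 0 < s < b & `|s - t| < e.
Proof.
move=> b0 /andP[t0 tb] e0; have [th|th] := leP t (b / 2).
  exists (t + Num.min (e / 2) (b / 4)).
    have : Num.min (e / 2) (b / 4) <= b / 4 by rewrite ge_min lexx orbT.
    have : 0 < Num.min (e / 2) (b / 4) by rewrite lt_min; apply/andP; split; lra.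
    by move=> ? ?; apply/andP; split; lra.
  rewrite addrAC subrr add0r gtr0_norm; last by rewrite lt_min; apply/andP; split; lra.
  by rewrite gt_min; apply/orP; left; lra.
exists (t - Num.min (e / 2) (b / 4)).
  have : Num.min (e / 2) (b / 4) <= b / 4 by rewrite ge_min lexx orbT.
  have : 0 < Num.min (e / 2) (b / 4) by rewrite lt_min; apply/andP; split; lra.
  by move=> ? ?; apply/andP; split; lra.
rewrite addrAC subrr sub0r normrN gtr0_norm; last by rewrite lt_min; apply/andP; split; lra.
by rewrite gt_min; apply/orP; left; lra.
Qed.

Lemma lip_closure b f K : 0 < b -> 0 <= K -> {within `[0, b], continuous f} ->
  (forall r s, 0 < r < b -> 0 < s < b -> `|f r - f s| <= K * `|r - s|) ->
  forall r s, 0 <= r <= b -> 0 <= s <= b -> `|f r - f s| <= K * `|r - s|.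
Proof.
move=> b0 K0 cf H r s rb sb; apply/ler_addgt0Pr => e e0.
have e4 : 0 < e / (4 * (K + 1)) by rewrite divr_gt0// mulr_gt0// ltr_wpDl.
have e2 : 0 < e / 4 by rewrite divr_gt0.
have ap x : 0 <= x <= b -> exists y, [/\ 0 < y < b, `|y - x| <= e / (4 * (K + 1)) & `|f y - f x| <= e / 4].
  move=> xb; have [d d0 Hd] := within_eps cf xb e2.
  have m0 : 0 < Num.min d (e / (4 * (K + 1))) by rewrite lt_min d0.
  have [y yb] := near_interior b0 xb m0; rewrite lt_min => /andP[y1 y2].
  exists y; split=> //; first exact: ltW.
  by apply: Hd => //; case/andP: yb => /ltW -> /ltW ->.
have [r' [rb' r1 r2]] := ap r rb; have [s' [sb' s1 s2]] := ap s sb.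
have h := H _ _ rb' sb'.
have -> : f r - f s = (f r' - f s') - (f r' - f r) + (f s' - f s) by ring.
rewrite (le_trans (ler_normD _ _))//.
have := ler_normB (f r' - f s') (f r' - f r).
have : `|r' - s'| <= `|r - s| + (e / (4 * (K + 1)) + e / (4 * (K + 1))).
  have -> : r' - s' = (r - s) + ((r' - r) - (s' - s)) by ring.
  rewrite (le_trans (ler_normD _ _))// lerD2l (le_trans (ler_normB _ _))//.
  exact: lerD.
have : K * (e / (4 * (K + 1))) <= e / 4.
  rewrite -[e / (4 * _)]/(e * (4 * (K + 1))^-1) mulrA ler_pdivrMr ?mulr_gt0 ?ltr_wpDl//.
  have -> : e / 4 * (4 * (K + 1)) = K * e + e by field.
  by rewrite lerDl ltW.
move: (e / (4 * (K + 1))) h r1 s1 => q h _ _ hq h1 h2.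
have : K * `|r' - s'| <= K * (`|r - s| + (q + q)) by rewrite ler_wpM2l.
rewrite !mulrDr; lra.
Qed.

End Closure.

(** * Mean value bounds and L^2 bounds *)

Section Calculus.
Context {R : realType}.
Implicit Types (a b c s t x l K M : R) (f F : R -> R).

Lemma is_derive_eps f x l : is_derive x 1 f l ->
  forall e, 0 < e -> exists2 d, 0 < d & forall y, `|y - x| < d ->
    `|f y - f x - l * (y - x)| <= e * `|y - x|.
Proof.
move=> df e e0.
have : h^-1 *: (f (h *: 1 + x) - f x) @[h --> (0 : R)^'] --> l.
  by rewrite -(derive_val (is_derive := df)); exact: ex_derive.
move/cvgrPdist_le => /(_ e e0); rewrite /dnbhs /within /= => /nbhs_ballP[d /= d0 H].
exists d => // y yx; have [->|ynx] := eqVneq y x; first by rewrite !subrr mulr0 subr0 normr0 mulr0.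
have y0 : y - x != 0 by rewrite subr_eq0.
have := H (y - x); rewrite /ball /= sub0r normrN => /(_ yx y0).
rewrite /GRing.scale /= mulr1 subrK => h.
have -> : f y - f x - l * (y - x) = - (l - (y - x)^-1 * (f y - f x)) * (y - x) by field.
by rewrite normrM normrN ler_wpM2r.
Qed.

Lemma derive_le_lip a c f s l K : a < s < c -> is_derive s 1 f l ->
  (forall y, a < y < c -> `|f y - f s| <= K * `|y - s|) -> `|l| <= K.
Proof.
move=> /andP[as_ sc] df H; apply/ler_addgt0Pr => e e0.
have [d d0 Hd] := is_derive_eps df e0.
pose m := Num.min (d / 2) ((c - s) / 2).
have m0 : 0 < m by rewrite lt_min !divr_gt0// subr_gt0.
have [m1 m2] : m <= d / 2 /\ m <= (c - s) / 2 by rewrite /m !ge_min !lexx orbT.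
have := Hd (s + m); have := H (s + m).
rewrite addrAC subrr add0r (gtr0_norm m0) => h1 h2.
have {}h1 : `|f (s + m) - f s| <= K * m by apply: h1; apply/andP; split; lra.
have {}h2 : `|f (s + m) - f s - l * m| <= e * m by apply: h2; lra.
rewrite -(ler_pM2r m0) -{1}(gtr0_norm m0) -normrM mulrDl.
have -> : l * m = (f (s + m) - f s) - (f (s + m) - f s - l * m) by ring.
by rewrite (le_trans (ler_normB _ _))// lerD.
Qed.

Lemma mvt_lip a c F f K : {within `[a, c], continuous F} ->
  (forall s, a < s < c -> is_derive s 1 F (f s)) ->
  (forall s, a < s < c -> `|f s| <= K) ->
  forall r s, a <= r <= c -> a <= s <= c -> `|F r - F s| <= K * `|r - s|.
Proof.
move=> cF dF fK.
have H r s : a <= r -> r <= s -> s <= c -> `|F s - F r| <= K * (s - r).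
  move=> ar rs sc.
  have sub : {within `[r, s], continuous F}.
    apply: continuous_subspaceW cF => x; rewrite /= !in_itv /= => /andP[h1 h2].
    by rewrite (le_trans ar h1) (le_trans h2 sc).
  have inn x : r < x < s -> a < x < c.
    by move=> /andP[h1 h2]; rewrite (le_lt_trans ar h1) (lt_le_trans h2 sc).
  have cK : {within `[r, s], continuous (fun x => K * x)}.
    by apply: (@lip_within _ r s _ `|K|) => p q _ _; rewrite -mulrBr normrM.
  have h1 := @is_derive_nincr R r s (fun x => F x - K * x) (fun x => f x - K) rs.
  have h2 := @is_derive_nincr R r s (fun x => - F x - K * x) (fun x => - f x - K) rs.
  rewrite ler_norml; apply/andP; split.
    suff : - F s - K * s <= - F r - K * r by move=> ?; lra.
    apply: h2.
    - move=> x; apply: cvgB; first by apply: cvgN; exact: sub.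
      exact: cK.
    - move=> x /inn xac; apply: dB; first by apply: dN; exact: dF.
      by apply: d_eq (dZ K (dI x)) _; rewrite mulr1.
    - by move=> x /inn/fK; rewrite ler_norml; lra.
  suff : F s - K * s <= F r - K * r by move=> ?; lra.
  apply: h1.
  - move=> x; apply: cvgB; first exact: sub.
    exact: cK.
  - move=> x /inn xac; apply: dB; first exact: dF.
    by apply: d_eq (dZ K (dI x)) _; rewrite mulr1.
  - by move=> x /inn/fK; rewrite ler_norml; lra.
move=> r s /andP[ar rc] /andP[as_ sc]; have [rs|sr] := leP r s.
  by rewrite distrC (distrC r) (ger0_norm (x := s - r)) ?subr_ge0// H.
by rewrite (ger0_norm (x := r - s)) ?subr_ge0 ?(ltW sr)// H// ltW.
Qed.

Lemma mesh_sum b N (x : nat -> R) : mesh b N x -> \sum_(i < N) (x i.+1 - x i) = b.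
Proof.
move=> [x0 xN _]; rewrite -xN; elim: (N) => [|n ih]; first by rewrite big_ord0 x0.
by rewrite big_ord_recr /= ih addrC subrK.
Qed.

Lemma mesh1 b : 0 < b -> mesh b 1 (fun i => if i == 0%N then 0 else b).
Proof. by move=> b0; split=> // -[|i]. Qed.

Lemma N2_VV_le b f : 0 < b -> bmf 0 b f -> (forall s, 0 < s < b -> {for s, continuous f}) ->
  N2 b (VV f) <= N2 b f.
Proof.
move=> b0 bf cf; apply: (hardy_sub (mesh1 b0)) => // -[|i]//= s _; exact: cf.
Qed.

Lemma VV_B f F b s : 0 <= s <= b -> bmf 0 b f -> bmf 0 b F ->
  VV (fun s => f s - F s) s = VV f s - VV F s.
Proof. by move=> sb bf bF; rewrite /VV (avg_B sb bf bF); ring. Qed.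

Lemma N2_bound b f M : 0 < b -> 0 <= M -> bmf 0 b f -> (forall s, 0 < s < b -> `|f s| <= M) ->
  N2 b f <= M ^+ 2 * b.
Proof.
move=> b0 M0 bf fM; rewrite -[X in _ * X]subr0 -(I_cst _ (ltW b0)).
by apply: (I_le_sqr bf (bmf_cst _ _ M)).
Qed.

End Calculus.

(** What the error analysis uses of the exact solution, with a single constant. Mixed and
    second-order information in time appears only as Lipschitz bounds and Taylor remainders. In
    [ef_apt] there is one tolerance per element, with weighted squares that sum up, since the
    highest derivative of u_t is only in L^2. *)
Record exact_facts {R : realType} (k : nat) (b T K : R) (Ub : R -> R) (u ut ur : R -> R -> R)
    : Prop := ExactFacts {
  ef_Ub : forall t, 0 <= t <= T -> u t b = Ub t;
  ef_adm : forall t, 0 <= t <= T -> adm b (u t);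
  ef_lip : forall t r r', 0 <= t <= T -> 0 <= r <= b -> 0 <= r' <= b ->
    `|u t r - u t r'| <= K * `|r - r'|;
  ef_der : forall t r, 0 <= t <= T -> 0 < r < b -> is_derive r 1 (u t) (ur t r);
  ef_urc : forall t r, 0 <= t <= T -> 0 < r < b -> {for r, continuous (ur t)};
  ef_utc : forall t r, 0 <= t <= T -> 0 < r < b -> {for r, continuous (ut t)};
  ef_pde : forall t r, 0 <= t <= T -> 0 < r < b ->
    ut t r = 2^-1 * gt b (u t) r * ur t r + 2^-1 * gam b (u t) r * VV (u t) r;
  ef_ur : forall t r, 0 <= t <= T -> 0 < r < b -> `|ur t r| <= K;
  ef_ut : forall t r, 0 <= t <= T -> 0 < r < b -> `|ut t r| <= K;
  ef_Q : forall t r, 0 <= t <= T -> 0 < r <= b -> `|QQ (u t) r| <= K;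
  ef_C11 : forall t r r', 0 <= t <= T -> 0 < r < b -> 0 < r' < b ->
    `|u t r' - u t r - (r' - r) * ur t r| <= K * (r' - r) ^+ 2;
  ef_url : forall t r r', 0 <= t <= T -> 0 < r < b -> 0 < r' < b ->
    `|ur t r - ur t r'| <= K * `|r - r'|;
  ef_Du : forall t t' r, 0 <= t <= T -> 0 <= t' <= T -> 0 <= r <= b ->
    `|u t r - u t' r| <= K * `|t - t'|;
  ef_Dg : forall t t' r, 0 <= t <= T -> 0 <= t' <= T -> 0 <= r <= b ->
    `|gg b (u t) r - gg b (u t') r| <= K * `|t - t'|;
  ef_mix : forall t t' r r', 0 <= t <= T -> 0 <= t' <= T -> 0 <= r <= b -> 0 <= r' <= b ->
    `|(u t r - u t' r) - (u t r' - u t' r')| <= K * `|t - t'| * `|r - r'|;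
  ef_Dur : forall t t' r, 0 <= t <= T -> 0 <= t' <= T -> 0 < r < b ->
    `|ur t r - ur t' r| <= K * `|t - t'|;
  ef_Dut : forall t t' r, 0 <= t <= T -> 0 <= t' <= T -> 0 < r < b ->
    `|ut t r - ut t' r| <= K * `|t - t'|;
  ef_tt : forall t t' r, 0 <= t <= T -> 0 <= t' <= T -> 0 < r < b ->
    `|u t' r - u t r - (t' - t) * ut t r| <= K * (t' - t) ^+ 2;
  ef_ap : forall t a c, 0 <= t <= T -> 0 <= a -> a < c -> c <= b ->
    exists2 p : {poly R}, (size p <= k.+1)%N &
    forall s, a <= s <= c -> `|u t s - p.[s]| <= K * (c - a) ^+ k.+1;
  ef_apt : forall t N x, 0 <= t <= T -> mesh b N x -> 0 < mesh_size N x ->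
    exists (p : nat -> {poly R}) (sg : nat -> R),
    (forall i, (i < N)%N -> [/\ (size (p i) <= k.+1)%N, 0 <= sg i &
       forall s, x i < s < x i.+1 -> `|ut t s - (p i).[s]| <= sg i]) /\
    \sum_(i < N) (x i.+1 - x i) * sg i ^+ 2 <= K * (mesh_size N x ^+ k.+1) ^+ 2
}.

(** * Regularity of the exact solution *)

Section ExactFacts.
Context {R : realType}.
Local Notation mu := (@lebesgue_measure R).
Variables (k : nat) (b T : R) (Ub : R -> R) (u ut w g z : R -> R -> R).
Hypotheses (k1 : (1 <= k)%N) (b0 : 0 < b) (T0 : 0 < T).
Hypothesis ex : exact_solution T b Ub u ut w g z.
Hypothesis hu : Linfty_sobolev T b k.+1 +oo%E u.
Hypothesis hut : Linfty_sobolev T b k.+1 2%:E ut.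
Implicit Types (r s t : R).

Lemma u_eps t r e : 0 <= t <= T -> 0 <= r <= b -> 0 < e ->
  exists2 d, 0 < d & forall t' r', 0 <= t' <= T -> 0 <= r' <= b ->
    `|t' - t| < d -> `|r' - r| < d -> `|u t' r' - u t r| <= e.
Proof.
move=> tT rb e0; have /subspace_continuousP cu := exact_cont ex.
have := cu (t, r) (conj tT rb) => /cvgrPdist_le/(_ e e0)/nbhs_ballP[d /= d0 H].
exists d => // t' r' tT' rb' td rd; rewrite distrC.
by have := H (t', r'); apply=> //; split; rewrite /ball /= distrC.
Qed.

Lemma u_cont_r t : 0 <= t <= T -> {within `[0, b], continuous (u t)}.
Proof.
move=> tT; apply/subspace_continuousP => r; rewrite /= in_itv /= => rb.
apply/cvgrPdist_le => e e0; have [d d0 H] := u_eps tT rb e0.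
apply/nbhs_ballP; exists d => //= s; rewrite /ball /= distrC in_itv /= => sd sb.
by rewrite distrC; apply: H => //; rewrite subrr normr0.
Qed.

Lemma u_cont_t r : 0 <= r <= b -> {within `[0, T], continuous (u^~ r)}.
Proof.
move=> rb; apply/subspace_continuousP => t; rewrite /= in_itv /= => tT.
apply/cvgrPdist_le => e e0; have [d d0 H] := u_eps tT rb e0.
apply/nbhs_ballP; exists d => //= s; rewrite /ball /= distrC in_itv /= => sd sT.
by rewrite distrC; apply: H => //; rewrite subrr normr0.
Qed.

Lemma u_cont t r : 0 <= t <= T -> 0 < r < b -> {for r, continuous (u t)}.
Proof. by move=> tT rb; exact: within_interior (u_cont_r tT) rb. Qed.

Lemma bmf_u t : 0 <= t <= T -> bmf 0 b (u t).
Proof.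
move=> tT; have [M _ uM] := within_bounded (ltW b0) (u_cont_r tT).
apply: (@bmf_cont _ _ _ _ M) => s /andP[s0 sb]; first by apply: u_cont; rewrite ?s0.
by apply: uM; rewrite !ltW.
Qed.

Lemma within_sum n (F : 'I_n -> R -> R) a c : (forall j, {within `[a, c], continuous (F j)}) ->
  {within `[a, c], continuous (fun t => \sum_j F j t)}.
Proof.
move=> cF; elim: n F cF => [|n ih] F cF.
  rewrite (_ : (fun t => _) = fun=> 0); first by move=> x; exact: cvg_cst.
  by apply/funext => t; rewrite big_ord0.
rewrite (_ : (fun t => _) = fun t => F ord0 t + \sum_(j < n) F (lift ord0 j) t).
  by move=> x; apply: cvgD; [exact: cF|exact: ih].
by apply/funext => t; rewrite big_ord_recl.
Qed.

Lemma within_Z a c y (f : R -> R) : {within `[a, c], continuous f} ->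
  {within `[a, c], continuous (fun t => y * f t)}.
Proof. by move=> cf x; apply: cvgM; [exact: cvg_cst|exact: cf]. Qed.

(** The Peano estimate at almost every time, with the L^oo bound on the weak derivative of order m +
    1, extended to all times by continuity of point values. *)
Lemma u_functional : exists2 K, 0 <= K & forall t m n (y c : 'I_n -> R) a1 c1,
  0 <= t <= T -> (m <= k)%N -> 0 <= a1 -> a1 < c1 -> c1 <= b ->
  (forall j, a1 < y j < c1) -> (forall i, (i < m.+1)%N -> \sum_j c j * y j ^+ i = 0) ->
  `|\sum_j c j * u t (y j)| <= (\sum_j `|c j|) * (K * (c1 - a1) ^+ m.+1).
Proof.
have [h1 _ [K h2]] := hu; pose K' := Num.max K 0; exists K'; first by rewrite le_max lexx orbT.
move=> t m n y c a1 c1 tT mk a10 ac cb yac yan.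
pose P s := sobolev b k.+1 +oo%E (u s) /\ (sobolev_norm b k.+1 +oo%E (u s) <= K%:E)%E.
have aP : {ae mu, forall s, 0 < s < T -> P s}.
  have := negligibleU h1 h2; apply: negligibleS => s /= nP; apply: contrapT => H.
  by apply: nP => sT; split; apply: contrapT => h; apply: H; [left|right] => /(_ sT).
apply: (dense_le (f := fun t => \sum_j c j * u t (y j)) T0 _ aP) => //.
  apply: within_sum => j; apply: within_Z; apply: u_cont_t.
  by have /andP[y1 y2] := yac j; rewrite (le_trans a10 (ltW y1)) (le_trans (ltW y2) cb).
move=> s sT [sb nb].
have sT' : 0 <= s <= T by case/andP: sT => /ltW -> /ltW ->.
have [d wd dK] := sobolev_weak sb nb (mk : (m.+1 <= k.+1)%N).
have dK' : (Lp_norm b +oo%E d <= K'%:E)%E by apply: le_trans dK _; rewrite lee_fin le_max lexx.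
have K0 : 0 <= K' by rewrite le_max lexx orbT.
have -> (x : R) : x * (K' * (c1 - a1) ^+ m.+1) = x * (c1 - a1) ^+ m * (K' * (c1 - a1)).
  by rewrite exprS; ring.
apply: (peano_weak a10 ac cb wd) => //.
- by move=> r rb; exact: u_cont.
- exact: bmf_u.
move=> a' c' aa cc; have [_ [md _ _] _] := wd.
have [ac'|ca'] := leP a' c'; last first.
  rewrite set_itv_ge ?bnd_simp -?ltNge// integral_set0 lee_fin mulr_ge0// subr_ge0 ltW//.
apply: le_trans (Linfty_int md dK' K0 (le_lt_trans a10 aa) ac' (lt_le_trans cc cb)) _.
by rewrite lee_fin ler_wpM2l// lerB// ltW.
Qed.

Lemma u_lip : exists2 K, 0 <= K & forall t r r', 0 <= t <= T -> 0 <= r <= b -> 0 <= r' <= b ->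
  `|u t r - u t r'| <= K * `|r - r'|.
Proof.
have [K K0 HK] := u_functional; exists (6 * K); first by rewrite mulr_ge0.
move=> t r r' tT; apply: lip_closure => //; [by rewrite mulr_ge0|exact: u_cont_r|].
move=> {r r'} r s; wlog rs : r s / r < s => [H|].
  have [rs|rs|->] := ltgtP r s; first exact: H.
    by move=> ? ?; rewrite distrC (distrC r); exact: H.
  by rewrite !subrr normr0 mulr0.
move=> /andP[r0 rb] /andP[s0 sb].
(* The points must be strictly inside the interval of the functional, which is therefore enlarged by
   [d] on each side; its length stays below three times the spacing, up to equality. *)
pose d := Num.min r (Num.min (b - s) (s - r)).
have d0 : 0 < d by rewrite !lt_min r0 !subr_gt0 sb.
have [d1 d2 d3] : [/\ d <= r, d <= b - s & d <= s - r].
  by rewrite /d !ge_min !lexx !orbT.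
pose y (j : 'I_2) := if j == ord0 then r else s.
pose c (j : 'I_2) : R := if j == ord0 then 1 else -1.
have := HK t 0%N 2 y c (r - d) (s + d) tT isT.
have yin j : r - d < y j < s + d.
  by rewrite /y; case: ifP => _; apply/andP; split; lra.
have H1 : \sum_(j < 2) c j * u t (y j) = u t r - u t s.
  by rewrite !big_ord_recl big_ord0 /c /y /= mul1r mulN1r addr0.
have H2 : \sum_(j < 2) `|c j| = 2.
  by rewrite !big_ord_recl big_ord0 /c /= normrN1 normr1 addr0.
rewrite H1 H2 expr1 => H.
have {}H : `|u t r - u t s| <= 2 * (K * (s + d - (r - d))).
  apply: H => //; [lra|lra|lra|].
  by move=> [|i]// _; rewrite !big_ord_recl big_ord0 /c /= !expr0; lra.
apply: le_trans H _; rewrite distrC (gtr0_norm (x := s - r)) ?subr_gt0//.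
have -> : 6 * K * (s - r) = 2 * (K * (3 * (s - r))) by ring.
by rewrite ler_pM2l// ler_wpM2l//; lra.
Qed.

(** Second differences annihilate affine functions. Two weak derivatives of u in L^oo are used,
    which is where [1 <= k] enters. *)
Lemma u_second : exists2 K, 0 <= K & forall t y s, 0 <= t <= T -> 0 < y -> 0 < s -> y + 2 * s < b ->
  `|u t (y + 2 * s) - 2 * u t (y + s) + u t y| <= K * s ^+ 2.
Proof.
have [K K0 HK] := u_functional; exists (64 * K); first by rewrite mulr_ge0.
move=> t y s tT y0 s0 ysb.
pose d := Num.min y (Num.min (b - (y + 2 * s)) s).
have d0 : 0 < d by rewrite !lt_min y0 subr_gt0 ysb.
have [d1 d2 d3] : [/\ d <= y, d <= b - (y + 2 * s) & d <= s].
  by rewrite /d !ge_min !lexx !orbT.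
pose p (j : 'I_3) : R := if j == 0%N :> nat then y else if j == 1%N :> nat then y + s else y + 2 * s.
pose c (j : 'I_3) : R := if j == 1%N :> nat then -2 else 1.
have := HK t 1%N 3 p c (y - d) (y + 2 * s + d) tT k1.
have pin j : y - d < p j < y + 2 * s + d.
  by rewrite /p; case: j => -[|[|[|]]]//= _; apply/andP; split; lra.
have H1 : \sum_(j < 3) c j * u t (p j) = u t (y + 2 * s) - 2 * u t (y + s) + u t y.
  by rewrite !big_ord_recl big_ord0 /c /p /=; ring.
have H2 : \sum_(j < 3) `|c j| = 4.
  by rewrite !big_ord_recl big_ord0 /c /= normrN normr1 ger0_norm// addr0; lra.
rewrite H1 H2 => H.
have {}H : `|u t (y + 2 * s) - 2 * u t (y + s) + u t y| <= 4 * (K * (y + 2 * s + d - (y - d)) ^+ 2).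
  apply: H => //; [lra|lra|lra|].
  by move=> [|[|i]]// _; rewrite !big_ord_recl big_ord0 /c /p /= ?expr0 ?expr1; ring.
apply: le_trans H _.
have -> : 64 * K * s ^+ 2 = 4 * (K * (4 * s) ^+ 2) by ring.
rewrite ler_pM2l// ler_wpM2l// lerXn2r ?nnegrE; lra.
Qed.

Definition KU := sval (cid2 u_lip).
Lemma KU_ge0 : 0 <= KU. Proof. by rewrite /KU; case: cid2. Qed.

Lemma KUP t r r' : 0 <= t <= T -> 0 <= r <= b -> 0 <= r' <= b ->
  `|u t r - u t r'| <= KU * `|r - r'|.
Proof. by rewrite /KU; case: cid2 => K ? /= H; exact: H. Qed.

(** The difference between u(s) and an average over (0, s) inherits the Lipschitz bound, so u - u~
    vanishes linearly at the center. *)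
Lemma VV_u t s : 0 <= t <= T -> 0 < s <= b -> `|VV (u t) s| <= KU * s.
Proof.
move=> tT sb; have /andP[s0 sb'] := sb.
have bu := bmf_u tT.
have H x : 0 < x < s -> `|u t s - u t x| <= KU * s.
  move=> /andP[x0 xs]; apply: le_trans (KUP tT _ _) _; first by rewrite ltW.
    by rewrite !ltW// (lt_le_trans xs).
  by rewrite ler_wpM2l ?KU_ge0// gtr0_norm ?subr_gt0//; lra.
rewrite /VV ler_norml; apply/andP; split.
  rewrite lerNl opprB lerBlDr; apply: (avg_le sb bu) => x /H.
  by rewrite ler_norml; lra.
rewrite lerBlDr addrC -lerBlDr; apply: (avg_ge sb bu) => x /H.
by rewrite ler_norml; lra.
Qed.

Lemma QQ_u t s : 0 <= t <= T -> 0 < s <= b -> `|QQ (u t) s| <= KU.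
Proof.
move=> tT sb; have /andP[s0 _] := sb.
by rewrite /QQ normrM normfV (gtr0_norm s0) ler_pdivrMr// VV_u.
Qed.

Lemma VV_cont t s : 0 <= t <= T -> 0 < s < b -> {for s, continuous (VV (u t))}.
Proof.
move=> tT sb; apply: cvgB; first exact: u_cont.
exact: avg_cont (bmf_u tT) sb.
Qed.

Lemma adm_u t : 0 <= t <= T -> adm b (u t).
Proof.
move=> tT; split; first exact: bmf_u.
apply: (@bmf_cont _ _ _ _ KU) => s sb.
  apply: cvgM; first exact: VV_cont.
  by apply: cvgV; [case/andP: sb => /gt_eqF->|exact: cvg_id].
by apply: QQ_u => //; case/andP: sb => -> /ltW.
Qed.

Lemma w_state t r : 0 <= t <= T -> 0 <= r <= b -> w t r = I 0 r (u t).
Proof.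
move=> tT /andP[r0 rb].
have cw : {within `[0, b], continuous (w t)}.
  by apply: (hd_within (l := u t)) => x xb; exact: (exact_w ex tT xb).
have [M _ uM] := within_bounded (ltW b0) (u_cont_r tT).
suff -> : I 0 r (u t) = w t r - w t 0 by rewrite (exact_w0 ex tT) subr0.
apply: (@I_FTC _ 0 r (w t) (u t) M) => //.
- apply: continuous_subspaceW cw => s; rewrite /= !in_itv /= => /andP[-> h].
  exact: le_trans rb.
- move=> s /andP[s0 sr]; have sb : s < b by exact: lt_le_trans rb.
  by apply: (@hd_is_derive _ 0 b); rewrite ?s0//; apply: (exact_w ex) => //; rewrite !ltW.
- by move=> s /andP[s0 sr]; apply: u_cont => //; rewrite s0 (lt_le_trans sr).
- by move=> s /andP[s0 sr]; apply: uM; rewrite (ltW s0) (ltW (lt_le_trans sr rb)).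
Qed.

Lemma avg_w t r : 0 <= t <= T -> 0 <= r <= b -> w t r / r = avg (u t) r.
Proof. by move=> tT rb; rewrite w_state. Qed.

Lemma GG_derive t r : 0 <= t <= T -> 0 < r < b ->
  is_derive r 1 (GG b (u t)) (- (VV (u t) r ^+ 2 / r)).
Proof.
move=> tT rb; have /andP[r0 rb'] := rb; have au := adm_u tT.
have bG := bmf_Gint au; have [M _ GM] := bmf_bound bG.
have c : {for r, continuous (fun s => VV (u t) s ^+ 2 / s)}.
  apply: cvgM; last by apply: cvgV; [rewrite gt_eqF|exact: cvg_id].
  exact: (cvgM (VV_cont tT rb) (VV_cont tT rb)).
have d := I_derive bG GM rb c.
apply: d_near (d_eq (dB (dC r (I 0 b (fun s => VV (u t) s ^+ 2 / s))) d) (sub0r _)) _.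
near=> x; rewrite (@I_split _ 0 x b)//; last first.
- by apply: ltW; near: x; exact: lt_nbhsl.
- by apply: ltW; near: x; exact: lt_nbhsr.
by rewrite [I 0 x _ + _]addrC addrK.
Unshelve. all: by end_near. Qed.

(** The product of g and [expR (GG b (u t) s)] has zero derivative away from the center and equals 1
    at b. The center is excluded because the equation for g is singular there. *)
Lemma g_state t r : 0 <= t <= T -> 0 < r <= b -> g t r = gg b (u t) r.
Proof.
move=> tT /andP[r0 rb]; have au := adm_u tT.
pose f s := g t s * expR (GG b (u t) s).
suff e : f b = f r.
  move: e; rewrite /f (exact_gb ex tT) /GG I_xx expR0 mul1r => e.
  by rewrite /gg /GG expRN; apply: (mulIf (lt0r_neq0 (expR_gt0 (I r b (fun s => VV (u t) s ^+ 2 / s))))); rewrite mulVf ?gt_eqF ?expR_gt0// -e mulr1 exact_gb.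
have cg : {within `[r, b], continuous (g t)}.
  apply/subspace_continuousP => x; rewrite /= in_itv /= => /andP[rx xb].
  have x0 : 0 < x := lt_le_trans r0 rx.
  apply/cvgrPdist_le => e e0.
  have xr : 0 < x <= b by rewrite x0.
  have [d d0 H] := hd_eps (exact_g ex tT xr) (ltr01 (R := R)).
  set l := x^-1 * _ * _ in H.
  apply/nbhs_ballP; exists (Num.min d (e / (1 + `|l|))) => /=.
    by rewrite lt_min d0 divr_gt0// ltr_pwDl.
  move=> y; rewrite /ball /= distrC lt_min => /andP[y1 y2]; rewrite in_itv /= => /andP[ry yb].
  have yA : (`[0, b]%classic : set R) y by rewrite /= in_itv /= yb (ltW (lt_le_trans r0 ry)).
  have h := H y yA y1.
  rewrite distrC -[from_subspace _ _ y]/(g t y) -[from_subspace _ _ x]/(g t x); have -> : g t y - g t x = (g t y - g t x - l * (y - x)) + l * (y - x) by rewrite subrK.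
  rewrite (le_trans (ler_normD _ _))// normrM.
  move: y2; rewrite ltr_pdivlMr ?ltr_pwDl//; move: (`|y - x|) (`|l|) h => p q; nra.
have [M GM] : exists M, forall r s, 0 <= r <= b -> 0 <= s <= b -> `|GG b (u t) r - GG b (u t) s| <= M * `|r - s|.
  have bG := bmf_Gint au; have [M M0 GM] := bmf_bound bG.
  exists M => x s /andP[x0 xb] /andP[s0 sb].
  have E y : 0 <= y -> y <= b -> GG b (u t) y = I 0 b (fun s => VV (u t) s ^+ 2 / s) - I 0 y (fun s => VV (u t) s ^+ 2 / s).
    by move=> y0 yb; rewrite (@I_split _ 0 y b)// [I 0 y _ + _]addrC addrK.
  rewrite !E// opprB addrC addrA subrK distrC.
  by apply: I_lip bG GM _ _; rewrite ?x0 ?s0.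
have cG : {within `[r, b], continuous (GG b (u t))}.
  apply: (@lip_within _ _ _ _ M) => x y /andP[x1 x2] /andP[y1 y2].
  by apply: GM; rewrite ?x2 ?y2 ?(le_trans (ltW r0)).
apply: (@is_derive_const _ r b f) => //.
  move=> x; apply: cvgM; first exact: cg.
  exact: (@cvg_comp _ _ _ _ expR _ _ _ (cG x) (@continuous_expR R _)).
move=> s /andP[rs sb]; have s0 := lt_trans r0 rs.
have s0b : 0 < s < b by rewrite s0.
have dg : is_derive s 1 (g t) (s^-1 * g t s * (u t s - w t s / s) ^+ 2).
  by apply: (@hd_is_derive _ 0 b) => //; apply: (exact_g ex) => //; rewrite s0 ltW.
have dG := GG_derive tT s0b.
apply: d_eq (dM dg (d_comp (is_derive_expR _) dG)) _.
rewrite avg_w ?(ltW s0) ?(ltW sb)// -/(VV (u t) s).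
by move: (VV (u t) s) (g t s) (expR _) => p q v; field; rewrite gt_eqF.
Qed.

Lemma z_state t r : 0 <= t <= T -> 0 <= r <= b -> z t r = I 0 r (gg b (u t)).
Proof.
move=> tT /andP[r0 rb]; have au := adm_u tT.
have cz : {within `[0, b], continuous (z t)}.
  by apply: (hd_within (l := g t)) => x xb; exact: (exact_z ex tT xb).
suff -> : I 0 r (gg b (u t)) = z t r - z t 0 by rewrite (exact_z0 ex tT) subr0.
apply: (@I_FTC _ 0 r (z t) (gg b (u t)) 1) => //.
- apply: continuous_subspaceW cz => s; rewrite /= !in_itv /= => /andP[-> h].
  exact: le_trans rb.
- move=> s /andP[s0 sr]; have sb : s < b by exact: lt_le_trans rb.
  rewrite -g_state ?s0 ?(ltW sb)//.
  by apply: (@hd_is_derive _ 0 b); rewrite ?s0//; apply: (exact_z ex) => //; rewrite !ltW.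
- by move=> s /andP[s0 sr]; apply: gg_cont => //; rewrite s0 (lt_le_trans sr).
- by move=> s /andP[s0 sr]; rewrite gg_abs1// ltW.
Qed.

Lemma gt_state t r : 0 <= t <= T -> 0 <= r <= b -> z t r / r = gt b (u t) r.
Proof. by move=> tT rb; rewrite z_state. Qed.

Definition ur t r := 'D_1 (u t) r.
Definition cg := expR (- (b * (KU ^+ 2 * b))).

Lemma N2_QQ_u t : 0 <= t <= T -> N2 b (QQ (u t)) <= KU ^+ 2 * b.
Proof.
move=> tT; apply: N2_bound => //; [exact: KU_ge0|exact: (adm_u tT).2|].
by move=> s /andP[s0 sb]; apply: QQ_u => //; rewrite s0 ltW.
Qed.

(** The equation only provides the derivative of the product g~ u / 2. As g~ is positive and
    differentiable, a quotient gives u_r, and the equation becomes a transport equation with source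
    g~_r (u - u~) / 2. *)
Lemma u_derive_pde t r : 0 <= t <= T -> 0 < r < b ->
  is_derive r 1 (u t) (ur t r) /\
  ut t r = 2^-1 * gt b (u t) r * ur t r + 2^-1 * gam b (u t) r * VV (u t) r.
Proof.
move=> tT rb; have /andP[r0 rb1] := rb; have au := adm_u tT.
have rb' : 0 < r <= b by rewrite r0 ltW.
have [F' [gt' [dF dg e]]] := exact_u ex tT rb'.
have {}dF := hd_is_derive rb dF; have {}dg := hd_is_derive rb dg.
have nr : \forall s \near r, 0 < s < b.
  near=> s; apply/andP; split; near: s; [exact: lt_nbhsr|exact: lt_nbhsl].
have nz : \forall s \near r, z t s / s = gt b (u t) s.
  by apply: filterS nr => s /andP[s0 sb]; apply: gt_state => //; rewrite !ltW.
have dgt := gt_derive au rb.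
have eg : gt' = gam b (u t) r := d_uniq (d_near dg nz) dgt.
have g0 : gt b (u t) r != 0 by rewrite gt_eqF// gt_gt0.
have d := dM dF (dZ 2 (dV g0 dgt)).
have {}d : is_derive r 1 (u t) (F' * (2 / gt b (u t) r) +
    2^-1 * (z t r / r) * u t r * (2 * (- gam b (u t) r / gt b (u t) r ^+ 2))).
  apply: (d_near d); apply: filterS nr => s /andP[s0 sb].
  have gs : gt b (u t) s != 0 by rewrite gt_eqF// gt_gt0// s0 ltW.
  by rewrite gt_state ?(ltW s0) ?(ltW sb)//; field.
rewrite /ur (derive_val (is_derive := d)); split=> //.
move: e; rewrite eg avg_w ?(ltW r0) ?(ltW rb1)// gt_state ?(ltW r0) ?(ltW rb1)//.
rewrite /VV => /eqP; rewrite subr_eq => /eqP ->.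
by move: (gt b (u t) r) g0 (gam b (u t) r) (avg (u t) r) (u t r) => G G0 ga av uu; field.
Unshelve. all: by end_near. Qed.

Lemma u_derive t r : 0 <= t <= T -> 0 < r < b -> is_derive r 1 (u t) (ur t r).
Proof. by move=> tT rb; have [] := u_derive_pde tT rb. Qed.

Lemma u_pde t r : 0 <= t <= T -> 0 < r < b ->
  ut t r = 2^-1 * gt b (u t) r * ur t r + 2^-1 * gam b (u t) r * VV (u t) r.
Proof. by move=> tT rb; have [] := u_derive_pde tT rb. Qed.

Lemma ur_bound t r : 0 <= t <= T -> 0 < r < b -> `|ur t r| <= KU.
Proof.
move=> tT rb; apply: (derive_le_lip rb (u_derive tT rb)) => y /andP[y0 yb].
by case/andP: rb => r0 r1; apply: KUP => //; rewrite !ltW.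
Qed.

Lemma gam_le_u t r : 0 <= t <= T -> 0 < r <= b -> 0 <= gam b (u t) r <= KU ^+ 2 * b.
Proof.
move=> tT rb; rewrite gam_ge0//=; last exact: adm_u.
exact: le_trans (gam_le (adm_u tT) rb) (N2_QQ_u tT).
Qed.

Lemma ut_bound : exists2 K, 0 <= K & forall t r, 0 <= t <= T -> 0 < r < b -> `|ut t r| <= K.
Proof.
have K0 := KU_ge0; exists (KU + KU ^+ 2 * b * (KU * b)).
  by rewrite addr_ge0 ?mulr_ge0 ?sqr_ge0 ?(ltW b0).
move=> t r tT rb; have /andP[r0 rb1] := rb.
have rb' : 0 < r <= b by rewrite r0 ltW.
have h1 := ur_bound tT rb; have h2 := VV_u tT rb'; have h3 := gam_le_u tT rb'.
have h4 := gt_le1 (adm_u tT) rb'; have h5 := gt_gt0 (adm_u tT) rb'.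
have i2 : 0 <= (2^-1 : R) by rewrite invr_ge0.
have {}h2 : `|VV (u t) r| <= KU * b by rewrite (le_trans h2)// ler_wpM2l// ltW.
rewrite u_pde//; move: (gt b (u t) r) h4 h5 (gam b (u t) r) h3 (ur t r) h1 (VV (u t) r) h2.
move=> G G1 G0 ga /andP[h6 h7] U h1 V h2.
rewrite (le_trans (ler_normD _ _))// lerD//; rewrite !normrM (ger0_norm i2).
  by rewrite (gtr0_norm G0); move: (`|U|) (normr_ge0 U) h1 => x ? ?; nra.
rewrite (ger0_norm h6); apply: ler_pM => //; first by rewrite mulr_ge0.
by move: (KU ^+ 2 * b) h7 => x ?; lra.
Qed.

(** For r inside (0, b) this is the mean value theorem in time; the end points, in particular the
    center, are reached by continuity in r. *)
Lemma u_time : exists2 K, 0 <= K & forall t t' r, 0 <= t <= T -> 0 <= t' <= T -> 0 <= r <= b ->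
  `|u t r - u t' r| <= K * `|t - t'|.
Proof.
have [K K0 HK] := ut_bound; exists K => // t t' r tT tT'; move: r.
have c : {within `[0, b], continuous (fun r => u t r - u t' r)}.
  by move=> x; apply: cvgB; [exact: (u_cont_r tT)|exact: (u_cont_r tT')].
have aP : {ae mu, forall s : R, 0 < s < b -> True} by apply: aeW.
apply: (dense_le b0 c aP) => r rb _; have /andP[r0 rb1] := rb.
have rb' : 0 < r <= b by rewrite r0 ltW.
apply: (mvt_lip (f := ut^~ r) (u_cont_t _) _ _ tT tT'); first by rewrite !ltW.
  by move=> s sT; apply: (hd_is_derive sT); apply: (exact_ut ex) => //; case/andP: sT => /ltW -> /ltW.
by move=> s sT; apply: HK => //; case/andP: sT => /ltW -> /ltW.
Qed.

Lemma g_time : exists2 K, 0 <= K & forall t t' r, 0 <= t <= T -> 0 <= t' <= T -> 0 <= r <= b ->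
  `|gg b (u t) r - gg b (u t') r| <= K * `|t - t'|.
Proof.
have [K K0 HK] := u_time; exists (2 * b * KU * K).
  by rewrite !mulr_ge0 ?KU_ge0 ?(ltW b0).
move=> t t' r tT tT' rb; have [au au'] := (adm_u tT, adm_u tT').
apply: (gg_cmp au au' rb).
  by rewrite !mulr_ge0 ?KU_ge0 ?(ltW b0).
have -> : (2 * b * KU * K * `|t - t'|) ^+ 2 = ((K * `|t - t'|) ^+ 2 * b) * ((2 * KU) ^+ 2 * b).
  by ring.
have bd : bmf 0 b (fun s => u t s - u t' s) by apply: bmfB; exact: bmf_u.
apply: ler_pM; [exact: N2_ge0|exact: N2_ge0| |].
  have -> : N2 b (fun s => VV (u t) s - VV (u t') s) = N2 b (VV (fun s => u t s - u t' s)).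
    apply: eq_I => s /andP[s0 sb]; rewrite (VV_B (b := b))//; try exact: bmf_u.
    by rewrite !ltW.
  apply: le_trans (N2_VV_le b0 bd _) _.
    by move=> s sb; apply: cvgB; apply: u_cont.
  apply: N2_bound => //; first by rewrite mulr_ge0.
  by move=> s /andP[s0 sb]; apply: HK => //; rewrite !ltW.
apply: N2_bound => //; first by rewrite mulr_ge0// KU_ge0.
  by apply: bmfD; [exact: au.2|exact: au'.2].
move=> s /andP[s0 sb]; rewrite (le_trans (ler_normD _ _))//.
have sb' : 0 < s <= b by rewrite s0 ltW.
by have := QQ_u tT sb'; have := QQ_u tT' sb'; lra.
Qed.

Lemma u_C11 : exists2 C, 0 <= C & forall t, 0 <= t <= T ->
  (forall r r', 0 < r < b -> 0 < r' < b -> `|u t r' - u t r - (r' - r) * ur t r| <= C * (r' - r) ^+ 2) /\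
  (forall r r', 0 < r < b -> 0 < r' < b -> `|ur t r - ur t r'| <= 2 * C * `|r - r'|).
Proof.
have [K K0 HK] := u_second; exists K => // t tT.
by apply: (C11 b0 K0) => [y yb|y s y0 s0 ysb]; [exact: u_derive|exact: HK].
Qed.

Lemma u_time_VV K t t' r : (forall r, 0 <= r <= b -> `|u t r - u t' r| <= K) ->
  0 <= t <= T -> 0 <= t' <= T -> 0 < r <= b -> `|VV (u t) r - VV (u t') r| <= 2 * K.
Proof.
move=> HK tT tT' /andP[r0 rb]; have [bu bu'] := (bmf_u tT, bmf_u tT').
have rb' : 0 <= r <= b by rewrite ltW.
rewrite -(VV_B rb' bu bu') /VV (le_trans (ler_normB _ _))//.
have h2 : `|avg (fun s => u t s - u t' s) r| <= K.
  apply: (avg_bound (bmfB bu bu')); last by rewrite r0.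
  by move=> s /andP[s0 sb]; apply: HK; rewrite !ltW.
by have := HK r rb'; lra.
Qed.

(** A preliminary bound, by Taylor expansion in r with step [s]. It yields continuity in time of u_r
    and hence of u_t, without which almost everywhere bounds on u_t could not be extended to all
    times; Lipschitz bounds in time come only after that. *)
Lemma ur_time : exists2 C, 0 <= C & forall t t' r s, 0 <= t <= T -> 0 <= t' <= T ->
  0 < r -> 0 < s -> r + s < b -> `|ur t r - ur t' r| <= C * (s + `|t - t'| / s).
Proof.
have [C C0 HC] := u_C11; have [K K0 HK] := u_time.
exists (2 * (C + K)); first by rewrite mulr_ge0// addr_ge0.
move=> t t' r s tT tT' r0 s0 rsb.
have rb : 0 < r < b by rewrite r0; lra.
have rb' : 0 < r + s < b by rewrite addr_gt0.
have := (HC t tT).1 r (r + s) rb rb'; have := (HC t' tT').1 r (r + s) rb rb'.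
have h1 : `|u t r - u t' r| <= K * `|t - t'| by apply: HK => //; rewrite !ltW//; lra.
have h2 : `|u t (r + s) - u t' (r + s)| <= K * `|t - t'| by apply: HK => //; rewrite !ltW ?addr_gt0//; lra.
rewrite (addrC r s) addrK => h3 h4; rewrite -(addrC r s) in h3 h4.
rewrite -(ler_pM2r s0) -{1}(gtr0_norm s0) -normrM.
have -> : 2 * (C + K) * (s + `|t - t'| / s) * s = 2 * (C + K) * (s ^+ 2 + `|t - t'|).
  by field; rewrite gt_eqF.
have -> : (ur t r - ur t' r) * s =
   (u t (r + s) - u t' (r + s)) - (u t r - u t' r)
   - (u t (r + s) - u t r - s * ur t r) + (u t' (r + s) - u t' r - s * ur t' r) by ring.
rewrite (le_trans (ler_normD _ _))//.
move: (ler_normB (u t (r + s) - u t' (r + s) - (u t r - u t' r)) (u t (r + s) - u t r - s * ur t r)).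
move: (ler_normB (u t (r + s) - u t' (r + s)) (u t r - u t' r)) => h5 h6.
have : 0 <= `|t - t'| by [].
have : 0 <= s ^+ 2 by exact: sqr_ge0.
move: (`|t - t'|) (s ^+ 2) h1 h2 h3 h4 h5 h6 => p q; nra.
Qed.

Lemma ut_cont_t r : 0 < r < b -> {within `[0, T], continuous (ut^~ r)}.
Proof.
move=> rb; have /andP[r0 rb1] := rb; have rb' : 0 < r <= b by rewrite r0 ltW.
have [Kg Kg0 Hg] := g_time; have [Ku Ku0 Hu] := u_time; have [C C0 HC] := ur_time.
have cgt : {within `[0, T], continuous (fun t => gt b (u t) r)}.
  apply: (@lip_within _ _ _ _ Kg) => t t' tT tT'.
  rewrite /gt -(@avg_B _ b); [|by rewrite ltW ?ltW|exact: (bmf_gg (adm_u tT))|exact: (bmf_gg (adm_u tT'))].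
  apply: (@avg_bound _ b) => //; first by apply: bmfB; apply: bmf_gg; exact: adm_u.
  by move=> s /andP[s0 sb]; apply: Hg => //; rewrite !ltW.
have cgg : {within `[0, T], continuous (fun t => gg b (u t) r)}.
  by apply: (@lip_within _ _ _ _ Kg) => t t' tT tT'; apply: Hg => //; rewrite !ltW.
have cga : {within `[0, T], continuous (fun t => gam b (u t) r)}.
  by move=> x; apply: cvgM; [apply: cvgB; [exact: cgg|exact: cgt]|exact: cvg_cst].
have cV : {within `[0, T], continuous (fun t => VV (u t) r)}.
  apply: (@lip_within _ _ _ _ (2 * Ku)) => t t' tT tT'; rewrite -mulrA.
  by apply: u_time_VV => // s sb; exact: Hu.
have cur : {within `[0, T], continuous (ur^~ r)}.
  apply/subspace_continuousP => t; rewrite /= in_itv /= => tT.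
  apply/cvgrPdist_le => e e0.
  pose s := Num.min (e / (2 * (C + 1))) ((b - r) / 2).
  have C1 : 0 < 2 * (C + 1) by rewrite mulr_gt0// ltr_wpDl.
  have s0 : 0 < s by rewrite lt_min !divr_gt0// subr_gt0.
  have [s1 s2] : s <= e / (2 * (C + 1)) /\ s <= (b - r) / 2 by rewrite /s !ge_min !lexx orbT.
  apply/nbhs_ballP; exists (s ^+ 2) => /=; first by rewrite exprn_gt0.
  move=> t' tt' tT'; rewrite in_itv /= in tT'; move: tt'; rewrite /ball /= => tt'.
  apply: le_trans (HC t t' r s tT tT' r0 s0 _) _; first lra.
  have h : `|t - t'| / s <= s by rewrite ler_pdivrMr// -expr2 ltW.
  move: s1; rewrite ler_pdivlMr// => s1.
  apply: (@le_trans _ _ (C * (s + s))); first by rewrite ler_wpM2l// lerD2l.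
  by clearbody s; nra.
have H : {within `[0, T], continuous (fun t => 2^-1 * gt b (u t) r * ur t r + 2^-1 * gam b (u t) r * VV (u t) r)}.
  move=> x; apply: cvgD; apply: cvgM.
  - by apply: cvgM; [exact: cvg_cst|exact: cgt].
  - exact: cur.
  - by apply: cvgM; [exact: cvg_cst|exact: cga].
  - exact: cV.
apply: subspace_eq_continuous H => t; rewrite inE /= in_itv /= => tT.
by rewrite /= /from_subspace /= -u_pde.
Qed.

Lemma ur_cont t r : 0 <= t <= T -> 0 < r < b -> {for r, continuous (ur t)}.
Proof.
move=> tT rb; have [C C0 HC] := u_C11.
have /andP[r0 rb1] := rb; pose a1 := r / 2; pose c1 := (r + b) / 2.
apply: (@lip_continuous _ a1 c1 _ (2 * C)); last by rewrite /a1 /c1; apply/andP; split; lra.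
move=> x y /andP[x1 x2] /andP[y1 y2]; apply: (HC t tT).2; rewrite /a1 /c1 in x1 x2 y1 y2; apply/andP; split; lra.
Qed.

Lemma ut_cont_r t r : 0 <= t <= T -> 0 < r < b -> {for r, continuous (ut t)}.
Proof.
move=> tT rb.
have H : {for r, continuous (fun r => 2^-1 * gt b (u t) r * ur t r + 2^-1 * gam b (u t) r * VV (u t) r)}.
  apply: cvgD; apply: cvgM.
  - by apply: cvgM; [exact: cvg_cst|exact: (gt_cont (adm_u tT))].
  - exact: ur_cont.
  - by apply: cvgM; [exact: cvg_cst|exact: (gam_cont (adm_u tT))].
  - exact: VV_cont.
have e : \forall s \near r, 2^-1 * gt b (u t) s * ur t s + 2^-1 * gam b (u t) s * VV (u t) s = ut t s.
  have nr : \forall s \near r, 0 < s < b.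
    by case/andP: rb => r0 r1; near=> s; apply/andP; split; near: s; [exact: lt_nbhsr|exact: lt_nbhsl].
  by apply: filterS nr => s sb; rewrite u_pde.
move: H; rewrite /prop_for /continuous_at -(u_pde tT rb); apply: cvg_trans; exact: near_eq_cvg.
Unshelve. all: by end_near. Qed.

Lemma bmf_ut t : 0 <= t <= T -> bmf 0 b (ut t).
Proof.
move=> tT; have [K K0 HK] := ut_bound; apply: (@bmf_cont _ _ _ _ K) => s sb; last exact: HK.
exact: ut_cont_r.
Qed.

(** With a weak derivative in L^2 the bound is local: it involves the energy of [d] on the interval
    of the functional, which later makes element errors square summable. The set of good times is
    explicit because [d] depends on the time. *)
Lemma ut_good : exists2 K, 0 <= K & exists2 P : R -> Prop,
  {ae mu, forall s, 0 < s < T -> P s} &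
  forall t m, 0 < t < T -> P t -> (m <= k)%N ->
  exists2 d, measurable_fun (`]0, b[%classic : set R) d /\ (En d 0 b <= (K ^+ 2)%:E)%E &
  forall n (y c : 'I_n -> R) a1 c1, 0 <= a1 -> a1 < c1 -> c1 <= b ->
  (forall j, a1 < y j < c1) -> (forall i, (i < m.+1)%N -> \sum_j c j * y j ^+ i = 0) ->
  `|\sum_j c j * ut t (y j)| <=
  (\sum_j `|c j|) * ((c1 - a1) ^+ m * Num.sqrt (fine (En d a1 c1) * (c1 - a1))).
Proof.
have [h1 _ [K h2]] := hut; pose K' := Num.max K 0; exists K'; first by rewrite le_max lexx orbT.
have K0 : 0 <= K' by rewrite le_max lexx orbT.
exists (fun s => sobolev b k.+1 2%:E (ut s) /\ (sobolev_norm b k.+1 2%:E (ut s) <= K%:E)%E).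
  have := negligibleU h1 h2; apply: negligibleS => s /= nP; apply: contrapT => H.
  by apply: nP => sT; split; apply: contrapT => h; apply: H; [left|right] => /(_ sT).
move=> t m tT [sb nb] mk.
have tT' : 0 <= t <= T by case/andP: tT => /ltW -> /ltW ->.
have [d wd dK] := sobolev_weak sb nb (mk : (m.+1 <= k.+1)%N).
have dK' : (Lp_norm b 2%:E d <= K'%:E)%E by apply: le_trans dK _; rewrite lee_fin le_max lexx.
have [_ [md _ _] _] := wd; have Ed := L2_En K0 dK'.
exists d => // n y c a1 c1 a10 ac cb yac yan; rewrite mulrA.
apply: (peano_weak a10 ac cb wd) => //.
- by move=> r rb; exact: ut_cont_r.
- exact: bmf_ut.
move=> a' c' aa cc; have [ac'|ca'] := leP a' c'; last first.
  by rewrite set_itv_ge ?bnd_simp -?ltNge// integral_set0 lee_fin sqrtr_ge0.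
exact: (L2_int md Ed).
Qed.

Lemma En_fine d K a c : measurable_fun (`]0, b[%classic : set R) d ->
  (En d 0 b <= (K ^+ 2)%:E)%E -> 0 <= a -> a <= c -> c <= b ->
  En d a c = (fine (En d a c))%:E /\ 0 <= fine (En d a c) <= K ^+ 2.
Proof.
move=> md Ed a0 ac cb.
have E1 : (En d a c <= (K ^+ 2)%:E)%E.
  apply: le_trans Ed; apply: le_trans _ (En_split (lexx 0) (le_trans a0 ac) cb (lexx b) md).
  apply: le_trans _ (leeDl _ (En_ge0 _ _ _)).
  apply: le_trans _ (En_split (lexx 0) a0 ac cb md).
  exact: leeDr (En_ge0 _ _ _).
have E0 := En_ge0 d a c.
have fE : En d a c \is a fin_num by rewrite ge0_fin_numE// (le_lt_trans E1)// ltry.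
by rewrite fineK//; split=> //; rewrite fine_ge0//= -lee_fin fineK.
Qed.

(** Second derivatives in L^2 make second differences of order s^(3/2), which the Zygmund-type bound
    turns into a Lipschitz bound: in effect the embedding of H^2 into W^{1,oo}. *)
Lemma ut_lip : exists2 K, 0 <= K & forall t r r', 0 <= t <= T -> 0 < r < b -> 0 < r' < b ->
  `|ut t r - ut t r'| <= K * `|r - r'|.
Proof.
have [K K0 [P aP HK]] := ut_good; have [S S0 HS] := ut_bound.
have [L L0 HL] := @zygmund _ b (32 * K) S b0 (mulr_ge0 (ler0n _ 32) K0) S0.
exists L => // t r r' tT; apply: HL => [x xb|y s y0 s0 ysb]; first exact: HS.
pose d := Num.min y (Num.min (b - (y + 2 * s)) s).
have d0 : 0 < d by rewrite !lt_min y0 subr_gt0 ysb.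
have [d1 d2 d3] : [/\ d <= y, d <= b - (y + 2 * s) & d <= s].
  by rewrite /d !ge_min !lexx !orbT.
pose p (j : 'I_3) : R := if j == 0%N :> nat then y else if j == 1%N :> nat then y + s else y + 2 * s.
pose c (j : 'I_3) : R := if j == 1%N :> nat then -2 else 1.
have pin j : y - d < p j < y + 2 * s + d.
  by rewrite /p; case: j => -[|[|[|]]]//= _; apply/andP; split; lra.
have pb j : 0 < p j < b.
  by have := pin j; move=> /andP[? ?]; apply/andP; split; lra.
have H1 t1 : \sum_(j < 3) c j * ut t1 (p j) = ut t1 (y + 2 * s) - 2 * ut t1 (y + s) + ut t1 y.
  by rewrite !big_ord_recl big_ord0 /c /p /=; ring.
have H2 : \sum_(j < 3) `|c j| = 4.
  by rewrite !big_ord_recl big_ord0 /c /= normrN normr1 ger0_norm// addr0; lra.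
rewrite -H1; have cF : {within `[0, T], continuous (fun t => \sum_(j < 3) c j * ut t (p j))}.
  by apply: within_sum => j; apply: within_Z; exact: ut_cont_t.
apply: (dense_le T0 cF aP) => // {}t {}tT Pt.
have [dd [md Ed] H] := HK _ 1%N tT Pt k1.
apply: le_trans (H 3 p c (y - d) (y + 2 * s + d) _ _ _ pin _) _; try lra.
  by move=> [|[|i]]// _; rewrite !big_ord_recl big_ord0 /c /p /= ?expr0 ?expr1; ring.
rewrite H2 expr1.
have ad0 : 0 <= y - d by lra.
have adb : y + 2 * s + d <= b by lra.
have adc : y - d <= y + 2 * s + d by lra.
have [_ /andP[e0 e1]] := En_fine md Ed ad0 adc adb.
have -> : 32 * K * (s * Num.sqrt s) = 4 * (4 * s * (K * (2 * Num.sqrt s))) by ring.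
rewrite ler_pM2l//; apply: ler_pM; [lra|exact: sqrtr_ge0|lra|].
have -> : K * (2 * Num.sqrt s) = Num.sqrt (K ^+ 2 * (4 * s)).
  have s4 : Num.sqrt (4 : R) = 2.
    have e4 : (4 : R) = 2 ^+ 2 by ring.
    by rewrite e4 sqrtr_sqr ger0_norm.
  by rewrite sqrtrM ?sqr_ge0// sqrtr_sqr (ger0_norm K0) sqrtrM// s4.
by rewrite ler_sqrt ?mulr_ge0 ?sqr_ge0 ?(ltW s0)// ler_pM//; lra.
Qed.

Lemma u_mixed : exists2 K, 0 <= K & forall t t' r r', 0 <= t <= T -> 0 <= t' <= T ->
  0 <= r <= b -> 0 <= r' <= b ->
  `|(u t r - u t' r) - (u t r' - u t' r')| <= K * `|t - t'| * `|r - r'|.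
Proof.
have [K K0 HK] := ut_lip; exists K => // t t' r r' tT tT'.
have c : {within `[0, b], continuous (fun r => u t r - u t' r)}.
  by move=> x; apply: cvgB; [exact: (u_cont_r tT)|exact: (u_cont_r tT')].
apply: (lip_closure b0 _ c); first by rewrite mulr_ge0.
move=> {}r {}r' rb rb'.
have -> : u t r - u t' r - (u t r' - u t' r') = (u t r - u t r') - (u t' r - u t' r') by ring.
have -> : K * `|t - t'| * `|r - r'| = K * `|r - r'| * `|t - t'| by ring.
have [/andP[r0 r1] /andP[r0' r1']] := (rb, rb').
apply: (@mvt_lip _ 0 T (fun t => u t r - u t r') (fun t => ut t r - ut t r')) => //.
- by move=> x; apply: cvgB; apply: u_cont_t; rewrite !ltW.
- move=> s sT; have sT' : 0 <= s <= T by case/andP: sT => /ltW -> /ltW.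
  by apply: dB; apply: (hd_is_derive sT); apply: (exact_ut ex) => //; rewrite ?r0 ?r0' ltW.
- by move=> s /andP[s0 sT]; apply: HK => //; rewrite !ltW.
Qed.

Lemma ur_lip_t : exists2 K, 0 <= K & forall t t' r, 0 <= t <= T -> 0 <= t' <= T ->
  0 < r < b -> `|ur t r - ur t' r| <= K * `|t - t'|.
Proof.
have [K K0 HK] := u_mixed; exists K => // t t' r tT tT' rb.
apply: (derive_le_lip rb (dB (u_derive tT rb) (u_derive tT' rb))) => y /andP[y0 yb].
by case/andP: rb => r0 r1; apply: HK => //; rewrite !ltW.
Qed.

(** The transport equation is subtracted at two times. The difference of [gam] is controlled only
    after multiplication by r; the missing 1/r is absorbed by the bounded quotient
    [VV (u t) r / r]. *)
Lemma ut_time : exists2 K, 0 <= K & forall t t' r, 0 <= t <= T -> 0 <= t' <= T ->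
  0 < r < b -> `|ut t r - ut t' r| <= K * `|t - t'|.
Proof.
have [K1 K10 H1] := ur_lip_t; have [K2 K20 H2] := g_time; have [K3 K30 H3] := u_time.
have U0 := KU_ge0.
exists (K2 * KU + K1 + 2 * K2 * KU + KU ^+ 2 * b * (2 * K3)).
  by rewrite !addr_ge0 ?mulr_ge0 ?sqr_ge0 ?(ltW b0).
move=> t t' r tT tT' rb; have /andP[r0 rb1] := rb; have rb' : 0 < r <= b by rewrite r0 ltW.
have [au au'] := (adm_u tT, adm_u tT').
have dG : `|gt b (u t) r - gt b (u t') r| <= K2 * `|t - t'|.
  rewrite /gt -(@avg_B _ b); [|by rewrite ltW ?ltW|exact: (bmf_gg au)|exact: (bmf_gg au')].
  apply: (@avg_bound _ b) => //; first by apply: bmfB; exact: bmf_gg.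
  by move=> s /andP[s0 sb]; apply: H2 => //; rewrite !ltW.
have dgm : `|r * (gam b (u t) r - gam b (u t') r)| <= 2 * (K2 * `|t - t'|).
  have -> : r * (gam b (u t) r - gam b (u t') r) =
    (gg b (u t) r - gg b (u t') r) - (gt b (u t) r - gt b (u t') r).
    rewrite /gam; move: (gg b (u t) r) (gg b (u t') r) (gt b (u t) r) (gt b (u t') r) => p q v w'.
    by field; rewrite gt_eqF.
  rewrite (le_trans (ler_normB _ _))//.
  have : `|gg b (u t) r - gg b (u t') r| <= K2 * `|t - t'| by apply: H2 => //; rewrite !ltW.
  by lra.
have dV : `|VV (u t) r - VV (u t') r| <= 2 * (K3 * `|t - t'|).
  by apply: u_time_VV => // s sb; exact: H3.
have q1 : `|VV (u t) r / r| <= KU by exact: QQ_u.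
have [_ g1] := andP (gam_le_u tT' rb'); have g0 := gam_ge0 au' rb'.
have G1 := gt_le1 au' rb'; have G0 := gt_gt0 au' rb'.
have U1 := ur_bound tT rb; have dU := H1 _ _ _ tT tT' rb.
rewrite !u_pde//.
move: (gt b (u t) r) (gt b (u t') r) (gam b (u t) r) (gam b (u t') r) dG dgm g1 g0 G1 G0.
move: (ur t r) (ur t' r) (VV (u t) r) (VV (u t') r) dV q1 U1 dU.
move=> A A' V V' dV q1 U1 dU G G' ga ga' dG dgm g1 g0 G1 G0.
have -> : 2^-1 * G * A + 2^-1 * ga * V - (2^-1 * G' * A' + 2^-1 * ga' * V') =
  2^-1 * ((G - G') * A + G' * (A - A') + (r * (ga - ga')) * (V / r) + ga' * (V - V')).
  by field; rewrite gt_eqF.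
move: (`|t - t'|) (normr_ge0 (t - t')) dV dU dG dgm => th th0 dV dU dG dgm.
rewrite normrM gtr0_norm ?invr_gt0//.
have B1 : `|(G - G') * A| <= K2 * th * KU by rewrite normrM ler_pM.
have B2 : `|G' * (A - A')| <= 1 * (K1 * th) by rewrite normrM (gtr0_norm G0) ler_pM// ltW.
have B3 : `|(r * (ga - ga')) * (V / r)| <= 2 * (K2 * th) * KU by rewrite normrM ler_pM.
have B4 : `|ga' * (V - V')| <= KU ^+ 2 * b * (2 * (K3 * th)) by rewrite normrM (ger0_norm g0) ler_pM.
have := ler_normD ((G - G') * A + G' * (A - A') + (r * (ga - ga')) * (V / r)) (ga' * (V - V')).
have := ler_normD ((G - G') * A + G' * (A - A')) ((r * (ga - ga')) * (V / r)).
have := ler_normD ((G - G') * A) (G' * (A - A')).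
have := normr_ge0 ((G - G') * A + G' * (A - A') + r * (ga - ga') * (V / r) + ga' * (V - V')).
by lra.
Qed.

Lemma u_taylor_t : exists2 K, 0 <= K & forall t t' r, 0 <= t <= T -> 0 <= t' <= T ->
  0 < r < b -> `|u t' r - u t r - (t' - t) * ut t r| <= K * (t' - t) ^+ 2.
Proof.
have [K K0 HK] := ut_time; exists K => // t t' r tT tT' rb.
have /andP[r0 rb1] := rb.
pose lo := Num.min t t'; pose hi := Num.max t t'.
have [lt1 lt2] : lo <= t <= hi /\ lo <= t' <= hi.
  by rewrite /lo /hi !ge_min !le_max !lexx !orbT.
have [lo0 hiT] : 0 <= lo /\ hi <= T.
  by case/andP: tT => *; case/andP: tT' => *; rewrite le_min ge_max; split; apply/andP; split.
have inn s : lo <= s <= hi -> 0 <= s <= T.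
  by move=> /andP[h1 h2]; rewrite (le_trans lo0 h1) (le_trans h2 hiT).
have near s : lo <= s <= hi -> `|s - t| <= `|t' - t|.
  rewrite /lo /hi; have [h|h] := leP t t' => /andP[s1 s2].
    by rewrite !ger0_norm ?subr_ge0// lerB.
  by rewrite !ler0_norm ?subr_le0 ?(ltW h)// lerN2 lerB.
have := @mvt_lip _ lo hi (fun s => u s r - s * ut t r) (fun s => ut s r - ut t r) (K * `|t' - t|).
have e : u t' r - u t r - (t' - t) * ut t r = (u t' r - t' * ut t r) - (u t r - t * ut t r) by ring.
rewrite e -[(t' - t) ^+ 2]real_normK ?num_real// expr2 mulrA => H.
apply: H => //.
- have c1 : {within `[0, T], continuous (u^~ r)} by apply: u_cont_t; rewrite !ltW.
  have c2 : {within `[lo, hi], continuous (fun s => s * ut t r)}.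
    by apply: (@lip_within _ lo hi _ `|ut t r|) => x y _ _; rewrite -mulrBl normrM mulrC.
  move=> x; apply: cvgB; last exact: c2.
  have c3 : {within `[lo, hi], continuous (u^~ r)}.
    by apply: continuous_subspaceW c1 => y; rewrite /= !in_itv; exact: inn.
  exact: c3.
- move=> s /andP[s1 s2]; have sT : 0 < s < T by rewrite (le_lt_trans lo0 s1) (lt_le_trans s2 hiT).
  have sT' : 0 <= s <= T by case/andP: sT => /ltW -> /ltW ->.
  apply: dB; first by apply: (hd_is_derive sT); apply: (exact_ut ex) => //; rewrite r0 ltW.
  by apply: d_eq (dM (dI s) (dC s (ut t r))) _; rewrite mul1r mulr0 addr0.
- move=> s /andP[s1 s2]; have sl : lo <= s <= hi by rewrite !ltW.
  by apply: le_trans (HK _ _ _ (inn _ sl) tT rb) _; rewrite ler_wpM2l// near.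
Qed.

Lemma u_approx : exists2 K, 0 <= K & forall t a c, 0 <= t <= T -> 0 <= a -> a < c -> c <= b ->
  exists2 p : {poly R}, (size p <= k.+1)%N &
  forall s, a <= s <= c -> `|u t s - p.[s]| <= K * (c - a) ^+ k.+1.
Proof.
have [K K0 HK] := u_functional; have [C C0 HC] := @interpolation R k.
exists (C * K); first by rewrite mulr_ge0// ltW.
move=> t a c tT a0 ac cb.
have M0 : 0 <= K * (c - a) ^+ k.+1 by rewrite mulr_ge0// exprn_ge0// subr_ge0 ltW.
have [p [sp Hp]] := HC a c (u t) _ ac M0 (fun n y z' yac yan => HK t k n y z' a c tT (leqnn k) a0 ac cb yac yan).
exists p => // s sac; rewrite -mulrA.
have cp : {within `[a, c], continuous (fun s => u t s - p.[s])}.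
  have c1 : {within `[a, c], continuous (u t)}.
    apply: continuous_subspaceW (u_cont_r tT) => y; rewrite /= !in_itv /= => /andP[h1 h2].
    by rewrite (le_trans a0 h1) (le_trans h2 cb).
  have c2 : {within `[a, c], continuous (fun s => p.[s])}.
    by apply: continuous_subspaceT => x; exact: poly_cont.
  by move=> x; apply: cvgB; [exact: c1|exact: c2].
have aP : {ae mu, forall s : R, a < s < c -> True} by apply: aeW.
by apply: (dense_le ac cp aP) => // x xac _; exact: Hp.
Qed.

Lemma ut_approx : exists2 K, 0 <= K & forall t N x, 0 <= t <= T -> mesh b N x -> 0 < mesh_size N x ->
  exists (p : nat -> {poly R}) (sg : nat -> R),
  (forall i, (i < N)%N -> [/\ (size (p i) <= k.+1)%N, 0 <= sg i &
     forall s, x i < s < x i.+1 -> `|ut t s - (p i).[s]| <= sg i]) /\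
  \sum_(i < N) (x i.+1 - x i) * sg i ^+ 2 <= K * (mesh_size N x ^+ k.+1) ^+ 2.
Proof.
have [K K0 [P aP HK]] := ut_good; have [C C0 HC] := @interpolation R k.
have [L L0 HL] := ut_time.
exists (2 * C ^+ 2 * K ^+ 2 + 2 * L ^+ 2 * b).
  by rewrite addr_ge0 ?mulr_ge0 ?sqr_ge0 ?(ltW b0) ?(ltW C0).
move=> t N x tT mx h0; set h := mesh_size N x in h0 *.
have hk0 : 0 < h ^+ k.+1 by rewrite exprn_gt0.
(* The Sobolev bound on u_t is available at almost every time; moving to such a time within h^(k+1)
   costs an error of that order by [ut_time]. *)
have [t' [tT' Pt' tt']] := ae_dense T0 aP tT hk0.
have [d [md Ed] H] := HK _ k tT' Pt' (leqnn k).
have tT2 : 0 <= t' <= T by case/andP: tT' => /ltW -> /ltW ->.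
have mi i : (i < N)%N -> [/\ 0 <= x i, x i < x i.+1, x i.+1 <= b & x i.+1 - x i <= h].
  move=> iN; have [_ _ mlt] := mx; split; [|exact: mlt| |].
  - by have /andP[] := mesh_ge0 mx (ltnW iN).
  - by have /andP[] := mesh_ge0 mx iN.
  - exact: (@le_bigmax _ _ _ 0 (fun i : 'I_N => x i.+1 - x i) (Ordinal iN)).
pose E i := fine (En d (x i) (x i.+1)).
pose M i := (x i.+1 - x i) ^+ k * Num.sqrt (E i * (x i.+1 - x i)).
have exP i : exists p : {poly R}, (i < N)%N -> (size p <= k.+1)%N /\
    forall s, x i < s < x i.+1 -> `|ut t' s - p.[s]| <= C * M i.
  have [iN|] := boolP (i < N)%N; last by exists 0.
  have [x0 xi xb _] := mi i iN.
  have M0 : 0 <= M i by rewrite mulr_ge0 ?sqrtr_ge0// exprn_ge0// subr_ge0 ltW.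
  have [p [sp Hp]] := HC (x i) (x i.+1) (ut t') _ xi M0
    (fun n y z' yac yan => H n y z' _ _ x0 xi xb yac yan).
  by exists p.
have [p Hp] := boolp.choice exP.
have E0 i : (i < N)%N -> 0 <= E i.
  by move=> iN; have [x0 xi xb _] := mi i iN; have [_ /andP[]] := En_fine md Ed x0 (ltW xi) xb.
have sE j : (j <= N)%N -> \sum_(i < j) E i <= fine (En d 0 (x j)).
  elim: j => [|j ih] jN; first by rewrite big_ord0 fine_ge0// En_ge0.
  rewrite big_ord_recr /=; apply: le_trans (lerD (ih (ltnW jN)) (lexx _)) _.
  have [x0 xi xb _] := mi j jN.
  have [e1 _] := En_fine md Ed (lexx 0) x0 (le_trans (ltW xi) xb).
  have [e2 _] := En_fine md Ed x0 (ltW xi) xb.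
  have [e3 _] := En_fine md Ed (lexx 0) (le_trans x0 (ltW xi)) xb.
  have := En_split (lexx 0) x0 (ltW xi) xb md.
  by rewrite e1 e2 e3 -EFinD lee_fin.
have {}sE : \sum_(i < N) E i <= K ^+ 2.
  apply: le_trans (sE N (leqnn N)) _; have [_ -> _] := mx.
  by have [_ /andP[]] := En_fine md Ed (lexx 0) (ltW b0) (lexx b).
exists p, (fun i => C * M i + L * h ^+ k.+1); split.
  move=> i iN; have [sp Hpi] := Hp i iN; have [x0 xi xb xh] := mi i iN; split=> //.
    rewrite addr_ge0 ?mulr_ge0 ?(ltW C0) ?(ltW hk0) ?sqrtr_ge0//.
    by rewrite exprn_ge0// subr_ge0 ltW.
  move=> s sx; have -> : ut t s - (p i).[s] = (ut t' s - (p i).[s]) + (ut t s - ut t' s) by ring.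
  rewrite (le_trans (ler_normD _ _))// lerD ?Hpi//.
  have sb : 0 < s < b by case/andP: sx => s1 s2; rewrite (le_lt_trans x0 s1) (lt_le_trans s2 xb).
  apply: le_trans (HL _ _ _ tT tT2 sb) _; rewrite ler_wpM2l// distrC ltW//.
have sx := mesh_sum mx.
have bd i : (i < N)%N -> (x i.+1 - x i) * (C * M i + L * h ^+ k.+1) ^+ 2 <=
    2 * C ^+ 2 * (h ^+ k.+1) ^+ 2 * E i + 2 * L ^+ 2 * (h ^+ k.+1) ^+ 2 * (x i.+1 - x i).
  move=> iN; have [x0 xi xb xh] := mi i iN; have Ei := E0 i iN.
  move: xi xh; rewrite -subr_gt0; rewrite /M; set hi := x i.+1 - x i => hi0 hih.
  have q : (hi ^+ k * Num.sqrt (E i * hi)) ^+ 2 * hi <= (h ^+ k.+1) ^+ 2 * E i.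
    rewrite exprMn sqr_sqrtr ?mulr_ge0 ?(ltW hi0)//.
    have -> : (hi ^+ k) ^+ 2 * (E i * hi) * hi = (hi ^+ k.+1) ^+ 2 * E i by rewrite !exprS; ring.
    by rewrite ler_wpM2r// lerXn2r ?nnegrE ?exprn_ge0 ?(ltW hi0) ?(ltW h0)// lerXn2r ?nnegrE ?(ltW hi0) ?(ltW h0).
  set m := hi ^+ k * _ in q *; set H1 := h ^+ k.+1.
  have p1 : (C * m + L * H1) ^+ 2 <= 2 * (C * m) ^+ 2 + 2 * (L * H1) ^+ 2.
    by have := sqr_ge0 (C * m - L * H1); move: (C * m) (L * H1) => y w'; nra.
  apply: le_trans (ler_wpM2l (ltW hi0) p1) _.
  have -> : hi * (2 * (C * m) ^+ 2 + 2 * (L * H1) ^+ 2) =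
    2 * C ^+ 2 * (m ^+ 2 * hi) + 2 * L ^+ 2 * H1 ^+ 2 * hi by ring.
  by rewrite lerD2r -[X in _ <= X]mulrA ler_wpM2l// mulr_ge0 ?sqr_ge0.
apply: le_trans (ler_sum _ (fun (i : 'I_N) _ => bd i (ltn_ord i))) _.
rewrite big_split /= -!mulr_sumr sx.
have -> : (2 * C ^+ 2 * K ^+ 2 + 2 * L ^+ 2 * b) * (h ^+ k.+1) ^+ 2 =
  2 * C ^+ 2 * (h ^+ k.+1) ^+ 2 * K ^+ 2 + 2 * L ^+ 2 * (h ^+ k.+1) ^+ 2 * b by ring.
by rewrite lerD2r ler_wpM2l// mulr_ge0 ?sqr_ge0// mulr_ge0 ?sqr_ge0.
Qed.

Lemma mass_exact t : 0 <= t <= T ->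
  mass_aspect g z t b = b / 2 * (1 - gt b (u t) b).
Proof.
move=> tT; rewrite /mass_aspect (exact_gb ex tT) divr1 gt_state//.
by rewrite lexx ltW.
Qed.

Lemma exact_factsP : exists2 K, 1 <= K & exact_facts k b T K Ub u ut ur.
Proof.
have [K1 p1 H1] := u_lip; have [K2 p2 H2] := ut_bound; have [K3 p3 H3] := u_C11.
have [K4 p4 H4] := u_time; have [K5 p5 H5] := g_time; have [K6 p6 H6] := u_mixed.
have [K7 p7 H7] := ur_lip_t; have [K8 p8 H8] := ut_time; have [K9 p9 H9] := u_taylor_t.
have [Ka pa Ha] := u_approx; have [Kb pb Hb] := ut_approx; have p0 := KU_ge0.
exists (1 + KU + K1 + K2 + 2 * K3 + K4 + K5 + K6 + K7 + K8 + K9 + Ka + Kb); first lra.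
set K := (X in exact_facts _ _ _ X).
have [q0 q1 q2 q3] : [/\ KU <= K, K1 <= K, K2 <= K & 2 * K3 <= K] by rewrite /K; split; lra.
have [q4 q5 q6 q7] : [/\ K4 <= K, K5 <= K, K6 <= K & K7 <= K] by rewrite /K; split; lra.
have [q8 q9 qa qb] : [/\ K8 <= K, K9 <= K, Ka <= K & Kb <= K] by rewrite /K; split; lra.
have up (x y A B : R) : 0 <= y -> A <= B -> x <= A * y -> x <= B * y.
  by move=> y0 AB h; rewrite (le_trans h)// ler_wpM2r.
clearbody K; split.
- exact: (exact_ub ex).
- exact: adm_u.
- by move=> t r r' tT rb rb'; apply: (up _ _ K1) => //; exact: H1.
- exact: u_derive.
- exact: ur_cont.
- exact: ut_cont_r.
- exact: u_pde.
- by move=> t r tT rb; apply: le_trans q0; exact: ur_bound.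
- by move=> t r tT rb; apply: le_trans q2; exact: H2.
- by move=> t r tT rb; apply: le_trans q0; exact: QQ_u.
- move=> t r r' tT rb rb'; apply: (up _ _ K3) => //; [exact: sqr_ge0|lra|].
  exact: (H3 t tT).1.
- by move=> t r r' tT rb rb'; apply: (up _ _ (2 * K3)) => //; apply: (H3 t tT).2.
- by move=> t t' r tT tT' rb; apply: (up _ _ K4) => //; exact: H4.
- by move=> t t' r tT tT' rb; apply: (up _ _ K5) => //; exact: H5.
- move=> t t' r r' tT tT' rb rb'; rewrite -mulrA; apply: (up _ _ K6) => //.
  by rewrite mulrA; exact: H6.
- by move=> t t' r tT tT' rb; apply: (up _ _ K7) => //; exact: H7.
- by move=> t t' r tT tT' rb; apply: (up _ _ K8) => //; exact: H8.
- by move=> t t' r tT tT' rb; apply: (up _ _ K9) => //; [exact: sqr_ge0|exact: H9].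
- move=> t a c tT a0 ac cb; have [p sp Hp] := Ha t a c tT a0 ac cb.
  exists p => // s sac; apply: (up _ _ Ka) => //; last exact: Hp.
  by rewrite exprn_ge0// subr_ge0 ltW.
- move=> t N x tT mx h0; have [p [sg [Hp Hs]]] := Hb t N x tT mx h0.
  by exists p, sg; split=> //; apply: (up _ _ Kb) => //; exact: sqr_ge0.
Qed.

End ExactFacts.

(** * Broken polynomials as functions on (0, b) *)

Section Glue.
Context {R : realType}.
Local Notation mu := (@lebesgue_measure R).
Implicit Types (b M r s : R) (x : nat -> R) (p : nat -> {poly R}).

(** It vanishes at the nodes, which integrals do not see; node values are always read from the
    polynomial of a chosen element. *)
Definition glue N (x : nat -> R) (p : nat -> {poly R}) s : R := \sum_(i < N) (x i < s < x i.+1)%R%:R * (p i).[s].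

Lemma mesh_uniq b N x i j s : mesh b N x -> (i < N)%N -> (j < N)%N ->
  x i < s < x i.+1 -> x j < s < x j.+1 -> i = j.
Proof.
move=> mx iN jN /andP[i1 i2] /andP[j1 j2]; have [ij|ij|//] := ltngtP i j.
- by exfalso; have := mesh_mono mx ij (ltnW jN); lra.
- by exfalso; have := mesh_mono mx ij (ltnW iN); lra.
Qed.

Lemma glueE b N x p i s : mesh b N x -> (i < N)%N -> x i < s < x i.+1 ->
  glue N x p s = (p i).[s].
Proof.
move=> mx iN si; rewrite /glue (bigD1 (Ordinal iN)) //= si mul1r big1 ?addr0// => j jn.
set c := (_ && _); case: (boolP c) => [sj|nc]; last by rewrite mul0r.
by move: jn; rewrite -val_eqE /= (mesh_uniq mx (ltn_ord j) iN sj si) eqxx.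
Qed.

Lemma near_oo a c s : a < s < c -> \forall r \near s, a < r < c.
Proof.
by move=> /andP[as_ sc]; near=> r; apply/andP; split; near: r; [exact: lt_nbhsr|exact: lt_nbhsl].
Unshelve. all: by end_near. Qed.

Lemma glue_derive b N x p i s : mesh b N x -> (i < N)%N -> x i < s < x i.+1 ->
  is_derive s 1 (glue N x p) ((p i)^`()).[s].
Proof.
move=> mx iN si; apply: (d_near (poly_derive (p i) s)).
by apply: filterS (near_oo si) => r ri; rewrite (glueE p mx iN ri).
Qed.

Lemma glue_cont b N x p i s : mesh b N x -> (i < N)%N -> x i < s < x i.+1 ->
  {for s, continuous (glue N x p)}.
Proof. by move=> mx iN si; exact: (d_cont (glue_derive p mx iN si)). Qed.

Lemma bmf_ind a c a' c' : bmf a c (fun s : R => (a' < s < c')%R%:R : R).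
Proof.
split; last by exists 1 => s _; case: (_ && _); rewrite ?normr1 ?normr0.
rewrite (_ : (fun s => _) = \1_(`]a', c'[%classic : set R)); last first.
  by apply/funext => s; rewrite indicE mem_setE in_itv.
exact: measurable_indic.
Qed.

Lemma bmf_glue a c N x p : bmf a c (glue N x p).
Proof. by apply: bmf_sum => i; apply: bmfM; [exact: bmf_ind|exact: bmf_poly]. Qed.

(** Near the center the average of a Lipschitz function differs from it by O(s), and elsewhere 1/s
    is bounded; discontinuities of [u] away from 0 do no harm. *)
Lemma bmf_QQ b u M d : 0 < b -> 0 < d -> 0 <= M -> bmf 0 b u ->
  (forall r s, 0 < r < d -> 0 < s < d -> `|u r - u s| <= M * `|r - s|) -> adm b u.
Proof.
move=> b0 d0 M0 bu uL; split=> //.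
have bV := bmf_VV bu; have [K K0 HK] := bmf_bound bV.
split.
  apply: measurable_funM; first exact: bV.1.
  apply: open_continuous_measurable_fun; first exact: interval_open.
  move=> s; rewrite inE /= in_itv /= => /andP[s0 _].
  by apply: cvgV; [rewrite gt_eqF|exact: cvg_id].
exists (M + K / d) => s /andP[s0 sb].
have [sd|ds] := ltP s d.
  rewrite -[leLHS]addr0 lerD// ?divr_ge0 ?(ltW d0)//.
  rewrite /QQ normrM normfV (gtr0_norm s0) ler_pdivrMr//.
  have sb' : 0 < s <= b by rewrite s0 ltW.
  have H r : 0 < r < s -> `|u s - u r| <= M * s.
    move=> /andP[r0 rs]; apply: le_trans (uL _ _ _ _) _; rewrite ?s0 ?r0 ?(lt_trans rs)//.
    by rewrite ler_wpM2l// gtr0_norm ?subr_gt0//; lra.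
  rewrite /VV ler_norml; apply/andP; split.
    rewrite lerNl opprB lerBlDr; apply: (avg_le sb' bu) => r /H.
    by rewrite ler_norml; lra.
  rewrite lerBlDr addrC -lerBlDr; apply: (avg_ge sb' bu) => r /H.
  by rewrite ler_norml; lra.
rewrite -[leLHS]add0r lerD//.
rewrite /QQ normrM normfV (gtr0_norm s0); apply: ler_pM => //; [by rewrite invr_ge0 ltW|by apply: HK; rewrite s0|].
by rewrite lef_pV2 ?posrE.
Qed.

Lemma poly_lip (p : {poly R}) a c : exists2 M, 0 <= M &
  forall r s, a <= r <= c -> a <= s <= c -> `|p.[r] - p.[s]| <= M * `|r - s|.
Proof.
have [ca|ac] := leP c a.
  exists 0 => // r s /andP[r1 r2] /andP[s1 s2].
  have -> : r = s by lra.
  by rewrite !subrr normr0 mulr0.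
have cp : {within `[a, c], continuous (fun s => (p^`()).[s])}.
  by apply: continuous_subspaceT => y; exact: poly_cont.
have [M M0 HM] := within_bounded (ltW ac) cp.
exists M => // r s; apply: (@mvt_lip _ a c (fun s => p.[s]) (fun s => p^`().[s])).
- by apply: continuous_subspaceT => y; exact: poly_cont.
- by move=> y _; exact: poly_derive.
- by move=> y /andP[y1 y2]; apply: HM; rewrite !ltW.
Qed.

Lemma mesh_N_gt0 b N x : 0 < b -> mesh b N x -> (0 < N)%N.
Proof. by move=> b0 [x0 xN _]; case: N xN => // xN; move: b0; rewrite -xN x0 ltxx. Qed.

Lemma adm_glue b N x p : 0 < b -> mesh b N x -> adm b (glue N x p).
Proof.
move=> b0 mx; have N0 := mesh_N_gt0 b0 mx; have [x0 _ mlt] := mx.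
have x1 : 0 < x 1 by rewrite -x0 mlt.
have [M M0 HM] := poly_lip (p 0) 0 (x 1).
apply: (bmf_QQ b0 x1 M0 (bmf_glue _ _ _ _ _)) => r s rx sx.
have [rx' sx'] : x 0 < r < x 1 /\ x 0 < s < x 1 by rewrite x0.
rewrite (glueE _ mx N0 rx') (glueE _ mx N0 sx').
by apply: HM; [case/andP: rx => /ltW -> /ltW|case/andP: sx => /ltW -> /ltW].
Qed.

(* The average of [gg] extends continuously to the center, where its value is [gg b u 0]. *)
Definition gt0 b u r := if r == 0 then gg b u 0 else gt b u r.

Lemma gt0_lip b u : 0 < b -> adm b u ->
  exists M, forall r s, 0 <= r <= b -> 0 <= s <= b -> `|gt0 b u r - gt0 b u s| <= M * `|r - s|.
Proof.
move=> b0 au; have [M HM] := gg_lip au.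
have M0 : 0 <= M.
  have := HM 0 b; rewrite !lexx (ltW b0) => /(_ isT isT) /(le_trans (normr_ge0 _)).
  by rewrite sub0r normrN gtr0_norm// pmulr_lge0.
exists (Num.max M (N2 b (QQ u))).
have H0 s : 0 < s <= b -> `|gt b u s - gg b u 0| <= M * s.
  move=> sb; have /andP[s0 sb'] := sb; have bg := bmf_gg au.
  have H r : 0 < r < s -> `|gg b u r - gg b u 0| <= M * s.
    move=> /andP[r0 rs]; apply: le_trans (HM _ _ _ _) _; rewrite ?lexx ?(ltW r0) ?(ltW b0) ?(ltW (lt_le_trans rs sb'))//.
    by rewrite subr0 gtr0_norm// ler_wpM2l// ltW.
  rewrite ler_norml; apply/andP; split.
    rewrite lerBrDl; apply: (avg_ge sb bg) => r /H; rewrite ler_norml.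
    by move: (gg b u r) (gg b u 0) (M * s) => q1 q2 q3; lra.
  rewrite lerBlDl; apply: (avg_le sb bg) => r /H; rewrite ler_norml.
    by move: (gg b u r) (gg b u 0) (M * s) => q1 q2 q3; lra.
move=> r s /andP[r0 rb] /andP[s0 sb]; rewrite /gt0.
have [->|rn] := eqVneq r 0; have [->|sn] := eqVneq s 0.
- by rewrite !subrr normr0 mulr0.
- have sp : 0 < s by rewrite lt0r sn.
  rewrite distrC sub0r normrN (gtr0_norm sp); apply: le_trans (H0 s _) _; first by rewrite sp.
  by rewrite ler_wpM2r// le_max lexx.
- have rp : 0 < r by rewrite lt0r rn.
  rewrite subr0 (gtr0_norm rp); apply: le_trans (H0 r _) _; first by rewrite rp.
  by rewrite ler_wpM2r// le_max lexx.
apply: le_trans (gt_lip au _ _) _; rewrite ?lt0r ?rn ?sn//=.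
  by rewrite r0. by rewrite s0.
by rewrite ler_wpM2r// le_max lexx orbT.
Qed.

End Glue.

(** * The HDG solution in terms of u_h, and its strong form *)

Section Discrete.
Context {R : realType}.
Local Notation mu := (@lebesgue_measure R).
Variables (k N : nat) (b T : R) (x : nat -> R) (Ub : R -> R) (S : hdg_fields R).
Hypotheses (b0 : 0 < b) (mx : mesh b N x) (hS : hdg_solution T k N x Ub S).
Implicit Types (r s t : R) (i : nat).

Definition gU t := glue N x (uh S t).
Definition up t i := if (i < N)%N then (uh S t i).[x i] else Ub t.

Let xlt i : (i < N)%N -> x i < x i.+1.
Proof. by case: mx => _ _; apply. Qed.

Let x_ge0 i : (i <= N)%N -> 0 <= x i.
Proof. by move=> iN; have /andP[] := mesh_ge0 mx iN. Qed.

Let x_leb i : (i <= N)%N -> x i <= b.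
Proof. by move=> iN; have /andP[] := mesh_ge0 mx iN. Qed.

Lemma adm_gU t : adm b (gU t). Proof. exact: adm_glue. Qed.

Lemma w_gU t i r : 0 <= t <= T -> (i < N)%N -> x i <= r <= x i.+1 ->
  wh S t i r = I 0 r (gU t).
Proof.
move=> tT; have bU := (adm_gU t).1.
have step j s : (j < N)%N -> what S t j = I 0 (x j) (gU t) -> x j <= s <= x j.+1 ->
    wh S t j s = I 0 s (gU t).
  move=> jN e sj; have /andP[s1 s2] := sj; have sb := le_trans s2 (x_leb jN).
  have bUs := bmf_sub (lexx 0) sb bU.
  rewrite (hdg_w hS tT jN sj) e (I_split (x_ge0 (ltnW jN)) s1 bUs).
  rewrite (I_cc (bmf_poly _ _ _)); congr (_ + _); apply: eq_I => y /andP[y1 y2].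
  by rewrite /gU (glueE (i := j) _ mx)// y1 (lt_le_trans y2).
move=> iN; apply: (step _ _ iN); elim: i iN => [|j ih] iN.
  have [_ _ -> _] := hdg_boundary hS tT; case: mx => -> _ _; by rewrite I_xx.
have jN := ltnW iN.
have e1 : x j <= x j.+1 <= x j.+1 by rewrite lexx (ltW (xlt jN)).
have e2 : x j.+1 <= x j.+1 <= x j.+2 by rewrite lexx (ltW (xlt iN)).
have [_ ew _ _] := hdg_conforming hS tT iN.
move: ew; rewrite (hdg_w hS tT iN e2) (I_cc (bmf_poly _ _ _)) I_xx addr0 => <-.
exact: step (ih jN) e1.
Qed.

Lemma ut_gU t i s : 0 <= t <= T -> (i < N)%N -> x i < s < x i.+1 ->
  ut_h S t i s = avg (gU t) s.
Proof.
move=> tT iN /andP[s1 s2]; have s0 := le_lt_trans (x_ge0 (ltnW iN)) s1.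
by rewrite /ut_h gt_eqF// (@w_gU t i)// !ltW.
Qed.

(** The boundary value of g_h is prescribed at b, so elements are traversed from right to left,
    whereas w_h and z_h are integrated outwards from the center. *)
Lemma g_gU t i r : 0 <= t <= T -> (i < N)%N -> x i <= r <= x i.+1 ->
  gh S t i r = gg b (gU t) r.
Proof.
move=> tT; have aU := adm_gU t.
have step j s : (j < N)%N -> ghat S t j.+1 = gg b (gU t) (x j.+1) -> x j <= s <= x j.+1 ->
    gh S t j s = gg b (gU t) s.
  move=> jN e sj; have /andP[s1 s2] := sj; have s0 := le_trans (x_ge0 (ltnW jN)) s1.
  have bG := bmf_Gint aU.
  have E y : s < y < x j.+1 -> VV (gU t) y ^+ 2 / y = y^-1 * ((uh S t j).[y] - ut_h S t j y) ^+ 2.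
    move=> /andP[y1 y2]; have yj : x j < y < x j.+1 by rewrite (le_lt_trans s1).
    by rewrite (ut_gU tT jN yj) -(glueE (uh S t) mx jN yj) /VV mulrC.
  have bGs := bmf_eq E (bmf_sub s0 (x_leb jN) bG).
  by rewrite (hdg_g hS tT jN sj) (I_cc bGs) -(eq_I E) e /gg -expRD (GG_split aU s0 s2 (x_leb jN)) opprD addrC.
move=> iN; apply: (step _ _ iN).
have [m em] : exists m, (i + m).+1 = N by exists (N - i.+1)%N; rewrite -addSn subnKC.
elim: m i iN em => [|m ih] j jN em.
  have [_ eg _ _] := hdg_boundary hS tT; move: em; rewrite addn0 => ->.
  by rewrite eg; case: mx => _ -> _; rewrite gg_b.
have jN1 : (j.+1 < N)%N by rewrite -em addnS ltnS leq_addr.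
have e1 : x j <= x j.+1 <= x j.+1 by rewrite lexx (ltW (xlt jN)).
have e2 : x j.+1 <= x j.+1 <= x j.+2 by rewrite lexx (ltW (xlt jN1)).
have [_ _ _ eg] := hdg_conforming hS tT jN1.
have bGn : bmf (x j.+1) (x j.+1) (fun s => s^-1 * ((uh S t j).[s] - ut_h S t j s) ^+ 2).
  split; first by rewrite set_itv_ge ?bnd_simp ?ltxx//; exact: measurable_fun_set0.
  by exists 0 => s /andP[s1 s2]; have := lt_trans s1 s2; rewrite ltxx.
move: eg; rewrite {1}(hdg_g hS tT jN e1) (I_cc bGn) I_xx oppr0 expR0 mulr1 => ->.
apply: (step _ _ jN1 _ e2); apply: ih => //.
by rewrite addSnnS.
Qed.

Lemma z_gU t i r : 0 <= t <= T -> (i < N)%N -> x i <= r <= x i.+1 ->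
  zh S t i r = I 0 r (gg b (gU t)).
Proof.
move=> tT; have bU := bmf_gg (adm_gU t).
have bgh j s : (j < N)%N -> x j <= s <= x j.+1 -> bmf (x j) s (gh S t j).
  move=> jN /andP[s1 s2]; apply: bmf_eq (bmf_sub (x_ge0 (ltnW jN)) (le_trans s2 (x_leb jN)) bU) => y /andP[y1 y2].
  by rewrite (@g_gU t j)// (ltW y1) (ltW (lt_le_trans y2 s2)).
have step j s : (j < N)%N -> zhat S t j = I 0 (x j) (gg b (gU t)) -> x j <= s <= x j.+1 ->
    zh S t j s = I 0 s (gg b (gU t)).
  move=> jN e sj; have /andP[s1 s2] := sj; have sb := le_trans s2 (x_leb jN).
  have bUs := bmf_sub (lexx 0) sb bU.
  rewrite (hdg_z hS tT jN sj) e (I_split (x_ge0 (ltnW jN)) s1 bUs).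
  rewrite (I_cc (bgh _ _ jN sj)); congr (_ + _); apply: eq_I => y /andP[y1 y2].
  by rewrite (@g_gU t j)// (ltW y1) (ltW (lt_le_trans y2 s2)).
move=> iN; apply: (step _ _ iN); elim: i iN => [|j ih] iN.
  have [_ _ _ ->] := hdg_boundary hS tT; case: mx => -> _ _; by rewrite I_xx.
have jN := ltnW iN.
have e1 : x j <= x j.+1 <= x j.+1 by rewrite lexx (ltW (xlt jN)).
have e2 : x j.+1 <= x j.+1 <= x j.+2 by rewrite lexx (ltW (xlt iN)).
have [_ _ ez _] := hdg_conforming hS tT iN.
move: ez; rewrite (hdg_z hS tT iN e2) (I_cc (bgh _ _ iN e2)) I_xx addr0 => <-.
exact: step (ih jN) e1.
Qed.

Lemma gt_gU t i s : 0 <= t <= T -> (i < N)%N -> x i <= s <= x i.+1 ->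
  gt_h S t i s = gt0 b (gU t) s.
Proof.
move=> tT iN si; rewrite /gt_h /gt0; case: eqP => [s0|_]; first by rewrite -s0 (@g_gU t i).
by rewrite (@z_gU t i).
Qed.

Lemma gt0E (v : R -> R) s : 0 < s -> gt0 b v s = gt b v s.
Proof. by move=> s0; rewrite /gt0 gt_eqF. Qed.

(** Continuity of the flux and positivity of g~_h identify the hybrid trace with the value from the
    right: the scheme is an upwind discontinuous Galerkin method. *)
Lemma uhat_up t i : 0 <= t <= T -> (i < N)%N -> uhat S t i.+1 = up t i.+1.
Proof.
move=> tT iN; rewrite /up; case: ltnP => [iN1|Ni].
  have [ef _ _ _] := hdg_conforming hS tT iN1.
  have x1 : 0 < x i.+1 := le_lt_trans (x_ge0 (ltnW iN)) (xlt iN).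
  move: ef; rewrite /flux_right /flux_left (@gt_gU t i)//; last by rewrite lexx (ltW (xlt iN)).
  rewrite (@gt_gU t i.+1)//; last by rewrite lexx (ltW (xlt iN1)).
  rewrite gt0E// => /mulfI; apply; rewrite mulf_neq0 ?invr_neq0// gt_eqF//.
  by apply: gt_gt0 (adm_gU t) _; rewrite x1 x_leb.
have -> : i.+1 = N by apply/eqP; rewrite eqn_leq iN.
by have [] := hdg_boundary hS tT.
Qed.

(** Integration by parts on one element. The left flux uses the interior trace and cancels the
    boundary term, the right flux leaves a jump, and the two terms with g~_r combine into [VV]. *)
Lemma strong_form t i (phi : {poly R}) : 0 <= t <= T -> (i < N)%N -> in_P k phi ->
  I (x i) (x i.+1) (fun s => (uh_t S t i).[s] * phi.[s]) =
  2^-1 * I (x i) (x i.+1) (fun s => gt b (gU t) s * ((uh S t i)^`()).[s] * phi.[s])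
  + 2^-1 * gt b (gU t) (x i.+1) * (up t i.+1 - (uh S t i).[x i.+1]) * phi.[x i.+1]
  + 2^-1 * I (x i) (x i.+1) (fun s => gam b (gU t) s * VV (gU t) s * phi.[s]).
Proof.
move=> tT iN Pphi; have aU := adm_gU t; set p := uh S t i; set v := gU t.
have [x0 xb] := (x_ge0 (ltnW iN), x_leb iN).
have x1 : 0 < x i.+1 := le_lt_trans x0 (xlt iN).
have sub f : bmf 0 b f -> bmf (x i) (x i.+1) f by exact: bmf_sub.
have [bgt bga bv] := And3 (sub _ (bmf_gt aU)) (sub _ (bmf_gam aU)) (sub _ aU.1).
have [bV ba] := (sub _ (bmf_VV aU.1), sub _ (bmf_avg aU.1)).
have [bp bp' bf bf'] := And4 (bmf_poly (x i) (x i.+1) p) (bmf_poly (x i) (x i.+1) p^`())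
  (bmf_poly (x i) (x i.+1) phi) (bmf_poly (x i) (x i.+1) phi^`()).
have inn s : x i < s < x i.+1 -> 0 < s < b by exact: (mesh_itv_oo mx iN).
(* The extension [gt0] makes [F] continuous up to r = 0 on the first element. *)
pose F s := gt0 b v s * (p * phi).[s].
pose f s := gam b v s * (p * phi).[s] + gt b v s * ((p * phi)^`()).[s].
have bfn : bmf (x i) (x i.+1) f.
  by apply: bmfD; apply: bmfM => //; exact: bmf_poly.
have [M _ fM] := bmf_bound bfn.
have FTC : I (x i) (x i.+1) f = F (x i.+1) - F (x i).
  apply: (@I_FTC _ _ _ F f M) => //; first exact: ltW (xlt iN).
  - have [L HL] := gt0_lip b0 aU.
    have c1 : {within `[x i, x i.+1], continuous (gt0 b v)}.
      apply: (@lip_within _ _ _ _ L) => r s /andP[r1 r2] /andP[s1 s2]; apply: HL.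
        by rewrite (le_trans x0 r1) (le_trans r2 xb).
      by rewrite (le_trans x0 s1) (le_trans s2 xb).
    have c2 : {within `[x i, x i.+1], continuous (fun s => (p * phi).[s])}.
      by apply: continuous_subspaceT => y; exact: poly_cont.
    by move=> y; apply: cvgM; [exact: c1|exact: c2].
  - move=> s si; have sb := inn s si.
    have d1 : is_derive s 1 (gt0 b v) (gam b v s).
      apply: (d_near (gt_derive aU sb)).
      by apply: filterS (near_oo sb) => r /andP[r0 _]; rewrite gt0E.
    apply: d_eq (dM d1 (poly_derive (p * phi) s)) _.
    by rewrite /f gt0E//; case/andP: sb.
  - move=> s si; have sb := inn s si.
    apply: cvgD; apply: cvgM.
    + exact: (gam_cont aU sb).
    + exact: poly_cont.
    + exact: (gt_cont aU sb).
    + exact: poly_cont.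
have := hdg_u hS tT iN Pphi.
rewrite -/p -![\int[mu]_(_ in `]x i, x i.+1[) _]/(I (x i) (x i.+1) _).
rewrite /flux_right /flux_left (uhat_up tT iN).
rewrite (@gt_gU t i (x i.+1))//; last by rewrite lexx (ltW (xlt iN)).
rewrite (@gt_gU t i (x i))//; last by rewrite lexx (ltW (xlt iN)).
rewrite (@eq_I _ _ _ (fun s => 2^-1 * gt_h S t i s * p.[s] * _)
  (fun s => 2^-1 * (gt b v s * p.[s] * (phi^`()).[s]))); last first.
  move=> s /[dup] si /inn/andP[s0 _]; rewrite (@gt_gU t i)//; last by case/andP: si => /ltW -> /ltW.
  by rewrite gt0E// !mulrA.
rewrite (@eq_I _ _ _ (fun s => 2^-1 * derive1 (gt_h S t i) s * _ * _)
  (fun s => 2^-1 * (gam b v s * avg v s * phi.[s]))); last first.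
  move=> s /[dup] si /inn sb; rewrite (ut_gU tT iN si).
  have d1 : is_derive s 1 (gt_h S t i) (gam b v s).
    apply: (d_near (gt_derive aU sb)).
    apply: filterS (near_oo si) => r /[dup] ri /inn/andP[r0 _].
    by rewrite (@gt_gU t i)// ?gt0E//; case/andP: ri => /ltW -> /ltW.
  by rewrite derive1E (derive_val (is_derive := d1)) !mulrA.
have b1 : bmf (x i) (x i.+1) (fun s => gt b v s * p.[s] * (phi^`()).[s]) by exact: bmfM (bmfM bgt bp) bf'.
have b2 : bmf (x i) (x i.+1) (fun s => gam b v s * avg v s * phi.[s]) by exact: bmfM (bmfM bga ba) bf.
have b3 : bmf (x i) (x i.+1) (fun s => gam b v s * VV v s * phi.[s]) by exact: bmfM (bmfM bga bV) bf.
have b4 : bmf (x i) (x i.+1) (fun s => gt b v s * (p^`()).[s] * phi.[s]) by exact: bmfM (bmfM bgt bp') bf.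
rewrite !I_Z//.
have e : I (x i) (x i.+1) f = I (x i) (x i.+1) (fun s => gam b v s * VV v s * phi.[s])
  + I (x i) (x i.+1) (fun s => gam b v s * avg v s * phi.[s])
  + I (x i) (x i.+1) (fun s => gt b v s * (p^`()).[s] * phi.[s])
  + I (x i) (x i.+1) (fun s => gt b v s * p.[s] * (phi^`()).[s]).
  rewrite -(I_D b3 b2) -(I_D (bmfD b3 b2) b4) -(I_D (bmfD (bmfD b3 b2) b4) b1).
  apply: eq_I => s si; have ev : v s = p.[s] := glueE (uh S t) mx iN si.
  rewrite /f derivM hornerD !hornerM /VV ev.
  by move: (gam b v s) (gt b v s) (avg v s) (p.[s]) (phi.[s]) ((p^`()).[s]) ((phi^`()).[s]) => q1 q2 q3 q4 q5 q6 q7; ring.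
move: FTC; rewrite e /F !hornerM !(gt0E v x1) -/p -/v.
move: (I _ _ _) (I _ _ _) (I _ _ _) (I _ _ _) (I _ _ _) => J1 J2 J3 J4 J5.
move: (gt b v (x i.+1)) (gt0 b v (x i)) => a1 a2.
move: (p.[x i.+1]) (p.[x i]) (phi.[x i.+1]) (phi.[x i]) (up t i.+1) => p1 p2 f1 f2 w h1 h2; lra.
Qed.

Lemma mass_discrete t : 0 <= t <= T ->
  discrete_mass_aspect S t N.-1 b = b / 2 * (1 - gt b (gU t) b).
Proof.
move=> tT; have N0 := mesh_N_gt0 b0 mx.
have bi : x N.-1 <= b <= x N.-1.+1.
  rewrite prednK//; have [_ -> _] := mx; rewrite lexx andbT.
  by apply: x_leb; exact: leq_pred.
have iN : (N.-1 < N)%N by rewrite prednK.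
rewrite /discrete_mass_aspect (gt_gU tT iN bi) (g_gU tT iN bi) gg_b divr1.
by rewrite gt0E.
Qed.

End Discrete.

(** Regularity of the exact solution at one time, isolated so that the static estimates can be
    applied at two times side by side. *)
Record gstate {R : realType} (b K : R) (f f' : R -> R) : Prop := {
  gs_adm : adm b f;
  gs_lip : forall r s, 0 <= r <= b -> 0 <= s <= b -> `|f r - f s| <= K * `|r - s|;
  gs_der : forall s, 0 < s < b -> is_derive s 1 f (f' s);
  gs_cont : forall s, 0 < s < b -> {for s, continuous f'};
  gs_bd : forall s, 0 < s < b -> `|f' s| <= K;
  gs_Q : forall s, 0 < s <= b -> `|QQ f s| <= K;
  gs_C11 : forall r s, 0 < r < b -> 0 < s < b -> `|f s - f r - (s - r) * f' r| <= K * (s - r) ^+ 2;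
  gs_Lip' : forall r s, 0 < r < b -> 0 < s < b -> `|f' r - f' s| <= K * `|r - s|
}.

Lemma ef_state {R : realType} k (b T K : R) Ub u ut ur t : exact_facts k b T K Ub u ut ur ->
  0 <= t <= T -> gstate b K (u t) (ur t).
Proof.
move=> F tT; split.
- exact: (ef_adm F).
- by move=> r s; exact: (ef_lip F).
- by move=> s; exact: (ef_der F).
- by move=> s; exact: (ef_urc F).
- by move=> s; exact: (ef_ur F).
- by move=> s; exact: (ef_Q F).
- by move=> r s; exact: (ef_C11 F).
- by move=> r s; exact: (ef_url F).
Qed.

(** * Coefficient errors at a fixed time *)

Section Static.
Context {R : realType}.
Variables (k N : nat) (b K : R) (x : nat -> R).
Hypotheses (b0 : 0 < b) (mx : mesh b N x) (K1 : 1 <= K).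
Implicit Types (f g : R -> R) (p q : nat -> {poly R}) (r s : R) (i j : nat).

Definition hh i := x i.+1 - x i.
Definition err f p s := f s - glue N x p s.
Definition dp p i := (p i)^`().
(* Upwind trace at a node: the value from the right, or the boundary datum at the last node. *)
Definition upv p (ub : R) i := if (i < N)%N then (p i).[x i] else ub.
Definition jmp p ub i := upv p ub i.+1 - (p i).[x i.+1].
(* The broken H^1 error with weighted upwind jumps; this is the quantity kept small in time. *)
Definition XX f' p ub := N2 b (err f' (dp p)) + \sum_(i < N) jmp p ub i ^+ 2 / hh i.
(** This is (v - v_h) / r; [N2 b (del f p) <= 1] is the smallness hypothesis under which the
    discrete coefficients are controlled. *)
Definition del f p s := QQ f s - QQ (glue N x p) s.

Lemma K_ge0 : 0 <= K. Proof. exact: le_trans ler01 K1. Qed.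

Lemma mN i : (i < N)%N -> [/\ 0 <= x i, x i < x i.+1, x i.+1 <= b & 0 < hh i].
Proof.
move=> iN; have [_ _ mlt] := mx; rewrite /hh subr_gt0; split; [|exact: mlt| |exact: mlt].
- by have /andP[] := mesh_ge0 mx (ltnW iN).
- by have /andP[] := mesh_ge0 mx iN.
Qed.

Lemma bmf_gs f f' : gstate b K f f' -> bmf 0 b f'.
Proof. by move=> F; apply: (bmf_cont (gs_cont F) (gs_bd F)). Qed.

Lemma bmf_err f p : bmf 0 b f -> bmf 0 b (err f p).
Proof. by move=> bf; apply: bmfB => //; exact: bmf_glue. Qed.

Lemma N2_glue p : N2 b (glue N x p) = \sum_(i < N) I (x i) (x i.+1) (fun s => (p i).[s] ^+ 2).
Proof.
rewrite /N2 (I_mesh mx); last by apply: bmfX; exact: bmf_glue.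
by apply: eq_bigr => i _; apply: eq_I => s si; rewrite (glueE p mx (ltn_ord i) si).
Qed.

Lemma err_cont f p i s : {for s, continuous f} -> (i < N)%N -> x i < s < x i.+1 ->
  {for s, continuous (err f p)}.
Proof. by move=> cf iN si; apply: cvgB; [exact: cf|exact: (glue_cont mx iN si)]. Qed.

Lemma gs_fcont f f' : gstate b K f f' -> forall s, 0 < s < b -> {for s, continuous f}.
Proof. by move=> F s sb; exact: d_cont (gs_der F sb). Qed.

Lemma VV_err f p s : bmf 0 b f -> 0 <= s <= b ->
  VV f s - VV (glue N x p) s = VV (err f p) s.
Proof. by move=> bf sb; rewrite /err (VV_B sb bf (bmf_glue _ _ _ _ _)). Qed.

Lemma N2_dVV_le_err f f' p : gstate b K f f' ->
  N2 b (fun s => VV f s - VV (glue N x p) s) <= N2 b (err f p).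
Proof.
move=> F; have bf := (gs_adm F).1.
rewrite (_ : N2 b _ = N2 b (VV (err f p))); last first.
  by apply: eq_I => s /andP[s0 sb]; rewrite VV_err// !ltW.
apply: (hardy_sub mx); first exact: bmf_err.
by move=> i s iN si; exact: (err_cont (gs_fcont F (mesh_itv_oo mx iN si)) iN si).
Qed.

(* Integrating by parts on each element expresses [s * d(s)] through the derivative and
   the jumps of the error, both weighted by [s]; Hardy's inequality then controls [d / s]. *)
Lemma N2_del_le_XX f f' p : gstate b K f f' -> N2 b (del f p) <= 32 * XX f' p (f b).
Proof.
move=> F; have bf := (gs_adm F).1; have bf' := bmf_gs F.
set e := err f p; have be : bmf 0 b e by exact: bmf_err.
set e' := err f' (dp p); have be' : bmf 0 b e' by exact: bmf_err.
(* The jump at the right node of an element is spread over that element as a constant, so that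
   derivative and jumps enter Hardy's inequality as one function [psi]. *)
pose jc i : {poly R} := (`|jmp p (f b) i| / hh i)%:P.
pose psi s := `|e' s| + glue N x jc s.
have bpsi : bmf 0 b psi by apply: bmfD; [exact: bmf_abs|exact: bmf_glue].
have bspsi : bmf 0 b (fun s => s * psi s) by apply: bmfM => //; exact: bmf_id.
have bse : bmf 0 b (fun s => s * `|e' s|) by apply: bmfM; [exact: bmf_id|exact: bmf_abs].
have c' i s : (i < N)%N -> x i < s < x i.+1 -> {for s, continuous e'}.
  by move=> iN si; exact: (err_cont (gs_cont F (mesh_itv_oo mx iN si)) iN si).
have psiE i s : (i < N)%N -> x i < s < x i.+1 -> psi s = `|e' s| + `|jmp p (f b) i| / hh i.
  by move=> iN si; rewrite /psi (glueE jc mx iN si) hornerC.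
have psi0 s : 0 < s < b -> 0 <= psi s.
  move=> _; rewrite addr_ge0// sumr_ge0// => i _; rewrite hornerC mulr_ge0// divr_ge0//.
  by have [_ _ _ /ltW] := mN (ltn_ord i).
(* The factor 2: at a node the jump has weight [x i.+1], while the integral of s |jump| / h_i over
   the element is only |jump| (x_i + x_{i+1}) / 2. *)
pose W s := 2 * I 0 s (fun s => s * psi s).
(* This is s times e - avg e, that is s^2 times [del], with nodal values taken from within element
   i. *)
pose Fi i s := s * (f s - (p i).[s]) - I 0 s e.
have [Me Me0 HMe] := bmf_bound be.
have FTC i s : (i < N)%N -> x i <= s <= x i.+1 ->
    I (x i) s (fun s => s * e' s) = Fi i s - Fi i (x i).
  move=> iN /andP[s1 s2]; have [x0 xi xb hi] := mN iN.
  have sub y : x i < y < s -> x i < y < x i.+1 by move=> /andP[-> h]; exact: lt_le_trans h s2.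
  have [M _ HM] : exists2 M, 0 <= M & forall y, x i < y < s -> `|y * e' y| <= M.
    by apply: bmf_bound; apply: (bmf_sub x0 (le_trans s2 xb)); apply: bmfM => //; exact: bmf_id.
  apply: (@I_FTC _ _ _ (Fi i) _ M) => //.
  - have [L L0 HL] := poly_lip (p i) 0 b.
    have l1 : {within `[x i, s], continuous (fun s => s)}.
      by apply: (@lip_within _ _ _ _ 1) => y z _ _; rewrite mul1r.
    have l2 : {within `[x i, s], continuous f}.
      apply: (@lip_within _ _ _ _ K) => y z /andP[y1 y2] /andP[z1 z2]; apply: (gs_lip F).
        by rewrite (le_trans x0 y1) (le_trans y2 (le_trans s2 xb)).
      by rewrite (le_trans x0 z1) (le_trans z2 (le_trans s2 xb)).
    have l3 : {within `[x i, s], continuous (fun s => (p i).[s])}.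
      by apply: continuous_subspaceT => y; exact: poly_cont.
    have l4 : {within `[x i, s], continuous (fun s => I 0 s e)}.
      apply: (@lip_within _ _ _ _ Me) => y z /andP[y1 y2] /andP[z1 z2]; apply: (I_lip be HMe).
        by rewrite (le_trans x0 y1) (le_trans y2 (le_trans s2 xb)).
      by rewrite (le_trans x0 z1) (le_trans z2 (le_trans s2 xb)).
    by move=> y; apply: cvgB; [apply: cvgM; [exact: l1|apply: cvgB; [exact: l2|exact: l3]]|exact: l4].
  - move=> y /sub yi; have yb := mesh_itv_oo mx iN yi.
    have ce : {for y, continuous e} := err_cont (gs_fcont F yb) iN yi.
    have d1 := dM (dI y) (dB (gs_der F yb) (poly_derive (p i) y)).
    apply: d_eq (dB d1 (I_derive be HMe yb ce)) _.
    by rewrite /e /e' /err (glueE p mx iN yi) (glueE (dp p) mx iN yi) /dp; ring.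
  - by move=> y /sub yi; apply: cvgM; [exact: cvg_id|exact: (c' i)].
have step i s : (i < N)%N -> `|Fi i (x i)| <= W (x i) -> x i <= s <= x i.+1 ->
    `|Fi i s| <= W (x i) + I (x i) s (fun s => s * `|e' s|).
  move=> iN Hi si; have [x0 xi xb hi] := mN iN; have /andP[s1 s2] := si.
  have -> : Fi i s = Fi i (x i) + (Fi i s - Fi i (x i)) by ring.
  rewrite -(FTC i s iN si) (le_trans (ler_normD _ _))// lerD//.
  have bs : bmf (x i) s (fun s => s * e' s).
    by apply: (bmf_sub x0 (le_trans s2 xb)); apply: bmfM => //; exact: bmf_id.
  rewrite (le_trans (I_abs bs))//; apply: le_I; first exact: bmf_abs.
    exact: (bmf_sub x0 (le_trans s2 xb)).
  by move=> y /andP[y1 _]; rewrite normrM (gtr0_norm (x := y))// (le_lt_trans x0 y1).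
have base i : (i < N)%N -> `|Fi i (x i)| <= W (x i).
  elim: i => [|i ih] iN.
    by case: mx => x0 _ _; rewrite /Fi /W x0 !I_xx mul0r subr0 mulr0 normr0.
  have jN := ltnW iN; have [x0 xi xb hi] := mN jN.
  have := step i (x i.+1) jN (ih jN); rewrite lexx (ltW xi) => /(_ isT) h.
  have -> : Fi i.+1 (x i.+1) = Fi i (x i.+1) - x i.+1 * jmp p (f b) i.
    by rewrite /Fi /jmp /upv iN; ring.
  rewrite (le_trans (ler_normB _ _))// normrM (gtr0_norm (x := x i.+1)) ?(le_lt_trans x0 xi)//.
  rewrite /W (I_split x0 (ltW xi) (bmf_sub (lexx 0) xb bspsi)) mulrDr -/(W (x i)).
  apply: le_trans (lerD h (lexx _)) _; rewrite -addrA lerD2l.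
  set jm := `|jmp _ _ _|.
  have bi g : bmf 0 b g -> bmf (x i) (x i.+1) g by exact: bmf_sub.
  have -> : I (x i) (x i.+1) (fun s => s * psi s) =
      I (x i) (x i.+1) (fun s => s * `|e' s|) + jm / hh i * I (x i) (x i.+1) (fun s => s).
    rewrite -I_Z; last exact: bmf_id.
    rewrite -I_D; [|exact: bi|by apply: bmfZ; exact: bmf_id].
    by apply: eq_I => s si; rewrite (psiE i s jN si) -/jm mulrDr [s * (_ / _)]mulrC.
  have Is : I (x i) (x i.+1) (fun s => s) = hh i * (x i + x i.+1) / 2.
    have -> : hh i * (x i + x i.+1) / 2 = x i.+1 ^+ 2 / 2 - x i ^+ 2 / 2 by rewrite /hh; field.
    apply: (@I_FTC _ _ _ (fun s => s ^+ 2 / 2) _ b (ltW xi)).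
    - by apply: continuous_subspaceT => y; apply: cvgM; [exact: exprn_continuous|exact: cvg_cst].
    - move=> s _; apply: d_eq (dM (dM (dI s) (dI s)) (dC s 2^-1)) _; by rewrite mulr0 addr0; field.
    - by move=> s _; exact: cvg_id.
    - move=> s /andP[y1 y2]; rewrite gtr0_norm ?(le_lt_trans x0 y1)//.
      by rewrite (le_trans (ltW y2)).
  rewrite Is; have E0 : 0 <= I (x i) (x i.+1) (fun s => s * `|e' s|).
    by apply: I_ge0 => s /andP[y1 _]; rewrite mulr_ge0// (le_trans x0 (ltW y1)).
  have -> : jm / hh i * (hh i * (x i + x i.+1) / 2) = jm * (x i + x i.+1) / 2.
    by field; rewrite gt_eqF.
  have jm0 : 0 <= jm by rewrite normr_ge0.
  rewrite mulrDr; have -> : 2 * (jm * (x i + x i.+1) / 2) = jm * x i + x i.+1 * jm by field.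
  have : 0 <= jm * x i by rewrite mulr_ge0.
  by move: (I _ _ _) E0 (jm * _) (_ * jm) => *; lra.
have main i s : (i < N)%N -> x i < s < x i.+1 -> `|del f p s| <= 2 * avg psi s.
  move=> iN si; have [x0 xi xb hi] := mN iN; have /andP[s1 s2] := si.
  have sb := mesh_itv_oo mx iN si; have /andP[s0 sb1] := sb.
  have h := step i s iN (base i iN); rewrite (ltW s1) (ltW s2) in h; move: h => /(_ isT) h.
  have eD : del f p s = Fi i s / s ^+ 2.
    rewrite /del /QQ -mulrBl VV_err ?(ltW s0) ?(ltW sb1)// -/e /VV /avg /Fi.
    by rewrite /e /err (glueE p mx iN si); field; rewrite gt_eqF.
  rewrite eD normrM normfV (gtr0_norm (x := s ^+ 2)) ?exprn_gt0//.
  rewrite ler_pdivrMr ?exprn_gt0//.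
  have -> : 2 * avg psi s * s ^+ 2 = 2 * (s * I 0 s psi) by rewrite /avg; field; rewrite gt_eqF.
  apply: le_trans h _.
  have bs g : bmf 0 b g -> bmf 0 s g by exact: bmf_sub (lexx 0) (ltW sb1).
  apply: (@le_trans _ _ (W s)).
    rewrite /W (I_split x0 (ltW s1) (bs _ bspsi)) mulrDr lerD2l.
    have bis g : bmf 0 b g -> bmf (x i) s g by exact: bmf_sub x0 (ltW sb1).
    apply: (@le_trans _ _ (I (x i) s (fun s => s * psi s))).
      apply: le_I; [exact: bis|exact: bis|] => y /andP[y1 y2].
      have y0 : 0 < y := le_lt_trans x0 y1.
      rewrite ler_pM2l// (psiE i y iN) ?y1 ?(lt_trans y2)// lerDl divr_ge0//; exact: ltW.
    rewrite -[leLHS]mul1r ler_wpM2r//; last by lra.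
    apply: I_ge0 => y /andP[y1 y2]; have y0 := le_lt_trans x0 y1.
    by rewrite mulr_ge0 ?(ltW y0)// psi0// y0 (lt_trans y2).
  rewrite /W ler_pM2l// -I_Z; last exact: bs.
  apply: le_I; [exact: bs|by apply: bmfZ; exact: bs|] => y /andP[y1 y2].
  by rewrite ler_wpM2r ?(ltW y2)// psi0// y1 (lt_trans y2).
have bav := bmf_avg bpsi.
have h1 : N2 b (del f p) <= N2 b (fun s => 2 * avg psi s).
  rewrite /N2 !(I_mesh mx); last first.
  - by apply: bmfX; apply: bmfB; [exact: (gs_adm F).2|exact: (adm_glue p b0 mx).2].
  - by apply: bmfX; exact: bmfZ.
  apply: ler_sum => i _; have [x0 xi xb hi] := mN (ltn_ord i).
  apply: I_le_sqr; [|by apply: (bmf_sub x0 xb); exact: bmfZ|by move=> s; exact: main].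
  by apply: (bmf_sub x0 xb); apply: bmfB; [exact: (gs_adm F).2|exact: (adm_glue p b0 mx).2].
apply: le_trans h1 _.
(* The constant 32 collects 4 from [main], 4 from Hardy's inequality and 2 from the two parts of
   [psi]. *)
have -> : N2 b (fun s => 2 * avg psi s) = 4 * N2 b (avg psi).
  rewrite /N2 -I_Z; last exact: bmfX.
  by apply: eq_I => s _; rewrite exprMn; ring.
have h2 : N2 b (avg psi) <= 4 * N2 b psi.
  apply: (hardy mx) => // i s iN si; apply: cvgD; last exact: (glue_cont mx iN si).
  by apply: cvg_norm; exact: (c' i).
have h3 : N2 b psi <= 2 * XX f' p (f b).
  apply: le_trans (I_sqrD (bmf_abs be') (bmf_glue _ _ _ _ _)) _.
  rewrite /XX mulrDr lerD//.
    by rewrite ler_pM2l// le_eqVlt; apply/orP; left; apply/eqP; apply: eq_I => s _; rewrite real_normK ?num_real.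
  rewrite ler_pM2l// -/(N2 b _) N2_glue; apply: ler_sum => i _; have [x0 xi xb hi] := mN (ltn_ord i).
  rewrite (@eq_I _ _ _ _ (fun=> (`|jmp p (f b) i| / hh i) ^+ 2)); last by move=> s _; rewrite hornerC.
  rewrite (I_cst _ (ltW xi)) -/(hh i) exprMn real_normK ?num_real//.
  by rewrite le_eqVlt; apply/orP; left; apply/eqP; field; rewrite gt_eqF.
lra.
Qed.

Lemma bmf_del f f' p : gstate b K f f' -> bmf 0 b (del f p).
Proof. by move=> F; apply: bmfB; [exact: (gs_adm F).2|exact: (adm_glue p b0 mx).2]. Qed.

Lemma N2_Z c f : bmf 0 b f -> N2 b (fun s => c * f s) = c ^+ 2 * N2 b f.
Proof.
move=> bf; rewrite /N2 -I_Z; last exact: bmfX.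
by apply: eq_I => s _; rewrite exprMn.
Qed.

Lemma N2_D f g : bmf 0 b f -> bmf 0 b g ->
  N2 b (fun s => f s + g s) <= 2 * N2 b f + 2 * N2 b g.
Proof. exact: I_sqrD. Qed.

Lemma le_N2_abs f g : bmf 0 b f -> bmf 0 b g -> (forall s, 0 < s < b -> `|f s| <= g s) ->
  N2 b f <= N2 b g.
Proof. exact: I_le_sqr. Qed.

Lemma N2_QQ f f' : gstate b K f f' -> N2 b (QQ f) <= K ^+ 2 * b.
Proof.
move=> F; apply: N2_bound => //; [exact: K_ge0|exact: (gs_adm F).2|].
by move=> s /andP[s0 sb]; apply: (gs_Q F); rewrite s0 ltW.
Qed.

Lemma N2_QQh f f' p : gstate b K f f' -> N2 b (del f p) <= 1 ->
  N2 b (QQ (glue N x p)) <= 2 * (K ^+ 2 * b) + 2.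
Proof.
move=> F A1; have bQ := (gs_adm F).2; have bd := bmf_del p F.
have -> : N2 b (QQ (glue N x p)) = N2 b (fun s => QQ f s + - del f p s).
  by apply: eq_I => s _; rewrite /del opprB addrC subrK.
apply: le_trans (N2_D bQ (bmfN bd)) _; rewrite lerD//.
  by rewrite ler_pM2l// (N2_QQ F).
rewrite -[leRHS]mulr1 ler_pM2l//; apply: le_trans A1.
by rewrite le_eqVlt; apply/orP; left; apply/eqP; apply: eq_I => s _; rewrite sqrrN.
Qed.

(* Upper bound for [gam] and, through its exponential, lower bound for [gg] and [gt]. *)
Definition CG : R := 2 * (K ^+ 2 * b) + 2.
Definition cl : R := expR (- (b * CG)).

Lemma CG_ge0 : 0 <= CG.
Proof. by rewrite /CG addr_ge0// mulr_ge0// mulr_ge0// ?sqr_ge0 ?(ltW b0). Qed.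

Lemma cl_gt0 : 0 < cl. Proof. exact: expR_gt0. Qed.

Lemma gam_bd f f' p s : gstate b K f f' -> N2 b (del f p) <= 1 -> 0 < s <= b ->
  0 <= gam b (glue N x p) s <= CG.
Proof.
move=> F A1 sb; have aU := adm_glue p b0 mx.
by rewrite gam_ge0//= (le_trans (gam_le aU sb))// (N2_QQh F).
Qed.

Lemma gt_bd f f' p s : gstate b K f f' -> N2 b (del f p) <= 1 -> 0 < s <= b ->
  cl <= gt b (glue N x p) s <= 1.
Proof.
move=> F A1 sb; have aU := adm_glue p b0 mx.
rewrite gt_le1// andbT (le_trans _ (gt_lower aU sb))// ler_expR lerN2 ler_pM2l//.
exact: (N2_QQh F).
Qed.

(** Square root of the bound in [GG_cmp]. The constant estimates the squared norm of the sum of the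
    exact and discrete quotients, written as twice the exact one minus [del]. *)
Definition gerr f p : R := Num.sqrt (N2 b (fun s => VV f s - VV (glue N x p) s) * (8 * (K ^+ 2 * b) + 2)).

Lemma gerr_ge0 f p : 0 <= gerr f p. Proof. exact: sqrtr_ge0. Qed.

Lemma gerr_sqr f p : gerr f p ^+ 2 = N2 b (fun s => VV f s - VV (glue N x p) s) * (8 * (K ^+ 2 * b) + 2).
Proof.
rewrite sqr_sqrtr// mulr_ge0 ?N2_ge0// addr_ge0// mulr_ge0// mulr_ge0// ?sqr_ge0 ?(ltW b0)//.
Qed.

Lemma N2_QQs f f' p : gstate b K f f' -> N2 b (del f p) <= 1 ->
  N2 b (fun s => QQ f s + QQ (glue N x p) s) <= 8 * (K ^+ 2 * b) + 2.
Proof.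
move=> F A1; have bQ := (gs_adm F).2; have bd := bmf_del p F.
have -> : N2 b (fun s => QQ f s + QQ (glue N x p) s) = N2 b (fun s => 2 * QQ f s + - del f p s).
  by apply: eq_I => s _; rewrite /del; move: (QQ f s) (QQ (glue N x p) s) => y z; congr (_ ^+ 2); ring.
apply: le_trans (N2_D (bmfZ 2 bQ) (bmfN bd)) _; rewrite N2_Z// lerD//.
  by have := N2_QQ F; move: (N2 _ _) (K ^+ 2 * b) => y z; lra.
rewrite -[leRHS]mulr1 ler_pM2l//; apply: le_trans A1.
by rewrite le_eqVlt; apply/orP; left; apply/eqP; apply: eq_I => s _; rewrite sqrrN.
Qed.

Lemma gg_err f f' p s : gstate b K f f' -> N2 b (del f p) <= 1 -> 0 <= s <= b ->
  `|gg b f s - gg b (glue N x p) s| <= gerr f p.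
Proof.
move=> F A1 sb; have aU := adm_glue p b0 mx.
apply: (gg_cmp (gs_adm F) aU sb (gerr_ge0 _ _)).
by rewrite gerr_sqr ler_wpM2l ?N2_ge0// (N2_QQs F).
Qed.

Lemma GG_err f f' p s : gstate b K f f' -> N2 b (del f p) <= 1 -> 0 <= s <= b ->
  `|GG b f s - GG b (glue N x p) s| <= gerr f p.
Proof.
move=> F A1 sb; have aU := adm_glue p b0 mx.
rewrite -(ler_pXn2r (n := 2)) ?nnegrE ?gerr_ge0// real_normK ?num_real//.
apply: le_trans (GG_cmp (gs_adm F) aU sb) _.
by rewrite gerr_sqr ler_wpM2l ?N2_ge0// (N2_QQs F).
Qed.

Lemma gt_cmp f g c s : adm b f -> adm b g -> (forall s, 0 <= s <= b -> `|gg b f s - gg b g s| <= c) ->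
  0 < s <= b -> `|gt b f s - gt b g s| <= c.
Proof.
move=> af ag H /andP[s0 sb]; rewrite /gt -(@avg_B _ b); [|by rewrite ltW|exact: (bmf_gg af)|exact: (bmf_gg ag)].
apply: (@avg_bound _ b); [by apply: bmfB; exact: bmf_gg| |by rewrite s0].
by move=> y /andP[y0 yb]; apply: H; rewrite !ltW.
Qed.

Lemma gam_cmp f g c s : adm b f -> adm b g -> (forall s, 0 <= s <= b -> `|gg b f s - gg b g s| <= c) ->
  0 < s <= b -> `|s * (gam b f s - gam b g s)| <= 2 * c.
Proof.
move=> af ag H sb; have /andP[s0 sb'] := sb.
have h1 := gt_cmp af ag H sb; have h2 : `|gg b f s - gg b g s| <= c by apply: H; rewrite ltW.
have -> : s * (gam b f s - gam b g s) = (gg b f s - gg b g s) - (gt b f s - gt b g s).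
  rewrite /gam; move: (gg b f s) (gg b g s) (gt b f s) (gt b g s) => y1 y2 y3 y4.
  by field; rewrite gt_eqF.
by rewrite (le_trans (ler_normB _ _))// mulr2n mulrDl mul1r lerD.
Qed.

(* The part of the error equation that involves differences of the nonlocal coefficients. *)
Definition SS f f' p s := 2^-1 * ((gt b f s - gt b (glue N x p) s) * f' s
  + (gam b f s * VV f s - gam b (glue N x p) s * VV (glue N x p) s)).

Lemma bmf_SS f f' p : gstate b K f f' -> bmf 0 b (SS f f' p).
Proof.
move=> F; have aU := adm_glue p b0 mx; have af := gs_adm F.
apply: bmfZ; apply: bmfD.
  by apply: bmfM (bmf_gs F); apply: bmfB; exact: bmf_gt.
apply: bmfB; apply: bmfM; [exact: (bmf_gam af)|exact: (bmf_VV af.1)|exact: (bmf_gam aU)|exact: (bmf_VV aU.1)].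
Qed.

Definition CS : R := 3 * K ^+ 2 * (8 * (K ^+ 2 * b) + 2) * b + CG ^+ 2.

(** The difference of [gam] is controlled only after multiplication by s, so it is paired with the
    bounded exact quotient [QQ f]; what is left is the discrete [gam] times v - v_h. *)
Lemma N2_SS f f' p : gstate b K f f' -> N2 b (del f p) <= 1 ->
  N2 b (SS f f' p) <= 2 * CS * N2 b (fun s => VV f s - VV (glue N x p) s).
Proof.
move=> F A1; have aU := adm_glue p b0 mx; have af := gs_adm F.
have K0 := K_ge0.
set d := fun s => _; have bd : bmf 0 b d by apply: bmfB; apply: bmf_VV; [exact: af.1|exact: aU.1].
have Hg s (sb : 0 <= s <= b) := gg_err F A1 sb.
pose c1 := 3 / 2 * K * gerr f p.
have bb : bmf 0 b (fun s => c1 + CG / 2 * `|d s|).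
  by apply: bmfD; [exact: bmf_cst|apply: bmfZ; exact: bmf_abs].
apply: le_trans (le_N2_abs (bmf_SS p F) bb _) _.
  move=> s sb; have sb' : 0 < s <= b by case/andP: sb => -> /ltW.
  have /andP[s0 _] := sb'.
  have h1 := gt_cmp af aU Hg sb'; have h2 := gam_cmp af aU Hg sb'.
  have h3 := gs_bd F sb; have h4 := gs_Q F sb'; have /andP[h5 h6] := gam_bd F A1 sb'.
  have e : SS f f' p s = 2^-1 * ((gt b f s - gt b (glue N x p) s) * f' s +
     (s * (gam b f s - gam b (glue N x p) s)) * QQ f s + gam b (glue N x p) s * d s).
    rewrite /SS /d (VVE f (lt0r_neq0 s0)).
    move: (gam b f s) (gam b _ s) (VV _ s) (QQ f s) (gt b f s) (gt b _ s) => *; ring.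
  rewrite e /c1; clear e; clearbody d; move: (gt b f s - gt b (glue N x p) s) (gam b (glue N x p) s) (s * (gam b f s - gam b (glue N x p) s)) (QQ f s) (f' s) (d s) h1 h2 h3 h4 h5 h6 => y1 y3 y2 y4 y5 y6 h1 h2 h3 h4 h5 h6.
  have g0 := gerr_ge0 f p; move: (gerr f p) g0 h1 h2 => G G0 h1 h2.
  have B1 : `|y1 * y5| <= G * K by rewrite normrM ler_pM.
  have B2 : `|y2 * y4| <= 2 * G * K by rewrite normrM ler_pM.
  have B3 : `|y3 * y6| <= CG * `|y6| by rewrite normrM (ger0_norm h5) ler_wpM2r.
  rewrite normrM gtr0_norm ?invr_gt0//.
  have := ler_normD (y1 * y5 + y2 * y4) (y3 * y6); have := ler_normD (y1 * y5) (y2 * y4).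
  by move: (normr_ge0 (y1 * y5 + y2 * y4 + y3 * y6)); lra.
apply: le_trans (N2_D (bmf_cst _ _ _) (bmfZ _ (bmf_abs bd))) _.
rewrite N2_Z; last exact: bmf_abs.
rewrite {1}/N2 (I_cst _ (ltW b0)) subr0 /c1 exprMn gerr_sqr -/d.
have -> : N2 b (fun s => `|d s|) = N2 b d by apply: eq_I => s _; rewrite real_normK ?num_real.
have D0 : 0 <= N2 b d := N2_ge0 _ _; move: (N2 b d) D0 => D D0.
have -> : 2 * ((3 / 2 * K) ^+ 2 * (D * (8 * (K ^+ 2 * b) + 2)) * b) + 2 * ((CG / 2) ^+ 2 * D) =
  (9 / 2 * (K ^+ 2 * (8 * (K ^+ 2 * b) + 2) * b) + CG ^+ 2 / 2) * D by field.
rewrite ler_wpM2r// /CS.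
have : 0 <= CG ^+ 2 by exact: sqr_ge0.
have : 0 <= K ^+ 2 * (8 * (K ^+ 2 * b) + 2) * b.
  by rewrite mulr_ge0 ?(ltW b0)// mulr_ge0 ?sqr_ge0// addr_ge0// mulr_ge0// mulr_ge0 ?sqr_ge0 ?(ltW b0).
have -> : 3 * K ^+ 2 * (8 * (K ^+ 2 * b) + 2) * b = 3 * (K ^+ 2 * (8 * (K ^+ 2 * b) + 2) * b) by ring.
by move: (K ^+ 2 * _ * b) (CG ^+ 2) => y1 y2; lra.
Qed.

Lemma N2_dVV_le_del f f' p : gstate b K f f' ->
  N2 b (fun s => VV f s - VV (glue N x p) s) <= b ^+ 2 * N2 b (del f p).
Proof.
move=> F; have bd := bmf_del p F; rewrite -N2_Z//.
have aU := adm_glue p b0 mx; have af := gs_adm F.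
apply: le_trans (le_N2_abs _ (bmf_abs (bmfZ b bd)) _) _.
- by apply: bmfB; apply: bmf_VV; [exact: af.1|exact: aU.1].
- move=> s /andP[s0 sb]; rewrite !VVE ?gt_eqF// -mulrBr !normrM.
  by rewrite ler_wpM2r// !gtr0_norm// ltW.
- by rewrite le_eqVlt; apply/orP; left; apply/eqP; apply: eq_I => s _; rewrite real_normK ?num_real.
Qed.

End Static.

(** * Energy estimate for the upwind form *)

Section Energy.
Context {R : realType}.
Variables (k N : nat) (b : R) (x : nat -> R).
Hypotheses (b0 : 0 < b) (mx : mesh b N x).
Implicit Types (h a : R -> R) (p q phi : nat -> {poly R}) (r s : R) (i j : nat).

(* The upwind transport form 1/2 (a e_r, phi) with the jumps [J]. *)
Definition BB a (e' : R -> R) (J : nat -> R) phi : R :=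
  2^-1 * I 0 b (fun s => a s * e' s * glue N x phi s)
  - 2^-1 * \sum_(i < N) a (x i.+1) * J i * (phi i).[x i.+1].

Lemma I_glue (F : R -> R) phi : bmf 0 b F ->
  I 0 b (fun s => F s * glue N x phi s) =
  \sum_(i < N) I (x i) (x i.+1) (fun s => F s * (phi i).[s]).
Proof.
move=> bF; rewrite (I_mesh mx); last by apply: bmfM => //; exact: bmf_glue.
by apply: eq_bigr => i _; apply: eq_I => s si; rewrite (glueE phi mx (ltn_ord i) si).
Qed.

Lemma sum_shift (F : nat -> R) n : \sum_(i < n) F i + F n = F 0%N + \sum_(i < n) F i.+1.
Proof.
elim: n => [|n ih]; first by rewrite !big_ord0 add0r addr0.
by rewrite big_ord_recr /= ih big_ord_recr /= addrA.
Qed.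

Definition CI : R := (k%:R * dofC (R := R) false k) ^+ 2.

Lemma inverse_N2 p i : (i < N)%N -> (size (p i) <= k.+1)%N ->
  hh x i ^+ 2 * I (x i) (x i.+1) (fun s => ((p i)^`()).[s] ^+ 2) <=
  CI * I (x i) (x i.+1) (fun s => (p i).[s] ^+ 2).
Proof.
move=> iN sp; have [x0 xi xb hi] := mN mx iN.
have h := fun s (si : x i <= s <= x i.+1) => inverse_deriv xi sp si.
have {h} : I (x i) (x i.+1) (fun s => ((p i)^`()).[s] ^+ 2) <=
  CI / hh x i ^+ 3 * I (x i) (x i.+1) (fun s => (p i).[s] ^+ 2) * hh x i.
  rewrite /hh -(I_cst _ (ltW xi)); apply: le_I; [|exact: bmf_cst|].
    by apply: bmfX; exact: bmf_poly.
  by move=> s /andP[s1 s2]; apply: h; rewrite !ltW.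
move=> h; apply: le_trans (ler_wpM2l (sqr_ge0 _) h) _.
by rewrite le_eqVlt; apply/orP; left; apply/eqP; field; rewrite gt_eqF.
Qed.

(* [a (xi^2 / 2 - eta xi)] is differentiated on each element: its values at the two sides of a
   node and the jump term combine into [- a [xi]^2 / 4 + a eta^+ [xi] / 2]. *)
Lemma BB_energy Gam a a' h h' p q M :
  0 <= Gam ->
  (forall s, 0 <= s <= b -> 0 <= a s <= 1) ->
  (forall r s, 0 <= r <= b -> 0 <= s <= b -> `|a r - a s| <= Gam * `|r - s|) ->
  (forall s, 0 < s < b -> is_derive s 1 a (a' s)) ->
  (forall s, 0 < s < b -> {for s, continuous a'}) ->
  (forall s, 0 < s < b -> 0 <= a' s <= Gam) ->
  (forall r s, 0 <= r <= b -> 0 <= s <= b -> `|h r - h s| <= M * `|r - s|) ->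
  (forall s, 0 < s < b -> is_derive s 1 h (h' s)) ->
  (forall s, 0 < s < b -> {for s, continuous h'}) ->
  (forall s, 0 < s < b -> `|h' s| <= M) ->
  (forall i, (i < N)%N -> (size (p i) <= k.+1)%N /\ (size (q i) <= k.+1)%N) ->
  (forall i (v : {poly R}), (i < N)%N -> (size v <= k)%N ->
     I (x i) (x i.+1) (fun s => ((q i).[s] - h s) * v.[s]) = 0) ->
  BB a (err N x h' (dp p)) (jmp N x p (h b)) (fun i => q i - p i) <=
  Gam * (1 + CI) * (N2 b (err N x h q) + N2 b (glue N x (fun i => q i - p i)))
  + 4^-1 * \sum_(i < N) ((q i).[x i] - h (x i)) ^+ 2.
Proof.
move=> G0 a01 aL da ca' a'b hL dh ch' h'b szp orth.
pose xi_ i : {poly R} := q i - p i.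
pose et i s := (q i).[s] - h s.
have ch s (sb : 0 < s < b) : {for s, continuous h} := d_cont (dh s sb).
have bh : bmf 0 b h.
  apply: (@bmf_cont _ _ _ _ (`|h 0| + M * b)) => // s /andP[s0 sb].
  have -> : h s = h 0 + (h s - h 0) by ring.
  rewrite (le_trans (ler_normD _ _))// lerD2l (le_trans (hL _ _ _ _))// ?lexx ?(ltW s0) ?(ltW sb) ?(ltW b0)//.
  have M0 : 0 <= M by apply: le_trans (h'b s _); rewrite ?s0.
  by rewrite subr0 gtr0_norm// ler_wpM2l// ltW.
have bh' : bmf 0 b h' := bmf_cont ch' h'b.
have ba : bmf 0 b a.
  apply: (@bmf_cont _ _ _ _ 1) => s sb; first exact: d_cont (da s sb).
  by have /a01/andP[? ?] : 0 <= s <= b by [case/andP: sb => /ltW -> /ltW]; rewrite ger0_norm.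
have ba' : bmf 0 b a'.
  by apply: (@bmf_cont _ _ _ _ Gam) => // s /a'b/andP[? ?]; rewrite ger0_norm.
pose G i s := a s * ((xi_ i).[s] ^+ 2 / 2 - et i s * (xi_ i).[s]).
(* [Gp] and [Ep] are 0 at index N, so sums over left nodes turn into sums over right nodes by a
   shift. *)
pose Gp j := if (j < N)%N then G j (x j) else 0.
pose Ep j := if (j < N)%N then (et j (x j)) ^+ 2 else 0.
pose Y i := I (x i) (x i.+1) (fun s => et i s ^+ 2).
pose Z i := I (x i) (x i.+1) (fun s => (xi_ i).[s] ^+ 2).
have elt i : (i < N)%N ->
   I (x i) (x i.+1) (fun s => a s * (h' s - ((p i)^`()).[s]) * (xi_ i).[s])
   <= G i (x i.+1) - G i (x i) + Gam * (1 + CI) * (Y i + Z i).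
  move=> iN; have [x0 xi xb hi] := mN mx iN.
  have sub f : bmf 0 b f -> bmf (x i) (x i.+1) f by exact: bmf_sub.
  have inn s : x i < s < x i.+1 -> 0 < s < b by exact: (mesh_itv_oo mx iN).
  have bx : bmf (x i) (x i.+1) (fun s => (xi_ i).[s]) by exact: bmf_poly.
  have bx' : bmf (x i) (x i.+1) (fun s => ((xi_ i)^`()).[s]) by exact: bmf_poly.
  have be : bmf (x i) (x i.+1) (et i) by apply: bmfB; [exact: bmf_poly|exact: sub].
  have bd : bmf (x i) (x i.+1) (fun s => h' s - ((p i)^`()).[s]) by apply: bmfB; [exact: sub|exact: bmf_poly].
  pose f1 s := a s * (h' s - ((p i)^`()).[s]) * (xi_ i).[s].
  pose f2 s := a' s * ((xi_ i).[s] ^+ 2 / 2 - et i s * (xi_ i).[s]).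
  pose f3 s := a s * et i s * ((xi_ i)^`()).[s].
  have b1 : bmf (x i) (x i.+1) f1 := bmfM (bmfM (sub _ ba) bd) bx.
  have b2 : bmf (x i) (x i.+1) f2.
    apply: bmfM; first exact: sub.
    by apply: bmfB; [apply: bmfM; [exact: bmfX|exact: bmf_cst]|exact: bmfM].
  have b3 : bmf (x i) (x i.+1) f3 := bmfM (bmfM (sub _ ba) be) bx'.
  have FTC : I (x i) (x i.+1) (fun s => f1 s + f2 s - f3 s) = G i (x i.+1) - G i (x i).
    have [Mf _ HM] := bmf_bound (bmfB (bmfD b1 b2) b3).
    apply: (@I_FTC _ _ _ (G i) _ Mf (ltW xi)) => //.
    - have ca : {within `[x i, x i.+1], continuous a}.
        apply: (@lip_within _ _ _ _ Gam) => r s /andP[r1 r2] /andP[s1 s2]; apply: aL.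
          by rewrite (le_trans x0 r1) (le_trans r2 xb).
        by rewrite (le_trans x0 s1) (le_trans s2 xb).
      have chh : {within `[x i, x i.+1], continuous h}.
        apply: (@lip_within _ _ _ _ M) => r s /andP[r1 r2] /andP[s1 s2]; apply: hL.
          by rewrite (le_trans x0 r1) (le_trans r2 xb).
        by rewrite (le_trans x0 s1) (le_trans s2 xb).
      have cp (v : {poly R}) : {within `[x i, x i.+1], continuous (fun s => v.[s])}.
        by apply: continuous_subspaceT => y; exact: poly_cont.
      move=> y; apply: cvgM; first exact: ca.
      apply: cvgB; first by apply: cvgM; [apply: cvgM; exact: cp|exact: cvg_cst].
      by apply: cvgM; [apply: cvgB; [exact: cp|exact: chh]|exact: cp].
    - move=> s si; have sb := inn s si.
      have dx := poly_derive (xi_ i) s; have de := dB (poly_derive (q i) s) (dh s sb).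
      apply: d_eq (dM (da s sb) (dB (dM (dM dx dx) (dC s 2^-1)) (dM de dx))) _.
      rewrite /f1 /f2 /f3 /et /xi_ derivB !hornerD !hornerN.
      by field.
    - move=> s si; have sb := inn s si.
      have cx : {for s, continuous (fun s => (xi_ i).[s])} by exact: poly_cont.
      have cx' : {for s, continuous (fun s => ((xi_ i)^`()).[s])} by exact: poly_cont.
      have ce : {for s, continuous (et i)} by apply: cvgB; [exact: poly_cont|exact: ch].
      have cca : {for s, continuous a} := d_cont (da s sb).
      have cd : {for s, continuous (fun s => h' s - ((p i)^`()).[s])}.
        by apply: cvgB; [exact: ch'|exact: poly_cont].
      apply: cvgB; first apply: cvgD.
      + by apply: cvgM; [apply: cvgM; [exact: cca|exact: cd]|exact: cx].
      + apply: cvgM; first exact: ca'.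
        apply: cvgB; first by apply: cvgM; [apply: cvgM; exact: cx|exact: cvg_cst].
        by apply: cvgM; [exact: ce|exact: cx].
      + by apply: cvgM; [apply: cvgM; [exact: cca|exact: ce]|exact: cx'].
  have e1 : I (x i) (x i.+1) f1 = (G i (x i.+1) - G i (x i)) + I (x i) (x i.+1) (fun s => f3 s - f2 s).
    rewrite -FTC -I_D; [|exact: (bmfB (bmfD b1 b2) b3)|exact: bmfB].
    by apply: eq_I => s _; ring.
  rewrite -/f1 e1 lerD2l.
  (* The projection error is orthogonal to the derivative of [xi_ i], of degree below k, so the
     constant [a (x i)] may be subtracted from the speed; the remaining variation, of order h_i,
     pays for the inverse inequality. *)
  have zero : I (x i) (x i.+1) (fun s => a (x i) * (et i s * ((xi_ i)^`()).[s])) = 0.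
    rewrite I_Z ?orth ?mulr0//; last exact: bmfM.
    have [sp sq] := szp i iN.
    have sx : (size (xi_ i) <= k.+1)%N by rewrite (leq_trans (size_polyD _ _))// size_polyN geq_max sq.
    have [x_0|xn0] := eqVneq (xi_ i) 0; first by rewrite x_0 deriv0 size_poly0.
    by rewrite -ltnS (leq_trans (lt_size_deriv xn0)).
  have bz : bmf (x i) (x i.+1) (fun s => a (x i) * (et i s * ((xi_ i)^`()).[s])) by apply: bmfZ; exact: bmfM.
  rewrite -(subr0 (I _ _ _)) -[X in _ - X <= _]zero -(I_B (bmfB b3 b2) bz).
  pose r1 s := Gam * et i s ^+ 2.
  pose r2 s := Gam / 2 * hh x i ^+ 2 * ((xi_ i)^`()).[s] ^+ 2.
  apply: (@le_trans _ _ (I (x i) (x i.+1) (fun s => r1 s + r2 s))).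
    apply: le_I; [by apply: bmfB => //; exact: bmfB|by apply: bmfD; apply: bmfZ; exact: bmfX|].
    move=> s si; have sb := inn s si; have /andP[s1 s2] := si.
    have /andP[a'0 a'1] := a'b s sb.
    have ha : `|a s - a (x i)| <= Gam * hh x i.
      apply: le_trans (aL _ _ _ _) _.
      - by case/andP: sb => /ltW -> /ltW.
      - by rewrite x0 (le_trans (ltW xi)).
      - by rewrite ler_wpM2l// gtr0_norm ?subr_gt0// /hh lerD2r ltW.
    rewrite /f3 /f2 /r1 /r2; move: (et i s) (xi_ i).[s] ((xi_ i)^`()).[s] => E X X'.
    have q1 : - (a' s * (X ^+ 2 / 2 - E * X)) <= Gam / 2 * E ^+ 2.
      have h1 : E * X - X ^+ 2 / 2 <= E ^+ 2 / 2 by have := sqr_ge0 (E - X); nra.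
      have h2 : a' s * (E * X - X ^+ 2 / 2) <= a' s * (E ^+ 2 / 2) by rewrite ler_wpM2l.
      have h3 : a' s * (E ^+ 2 / 2) <= Gam * (E ^+ 2 / 2) by rewrite ler_wpM2r// divr_ge0 ?sqr_ge0.
      by move: h2 h3; lra.
    have q2 : (a s - a (x i)) * (E * X') <= Gam / 2 * (E ^+ 2 + hh x i ^+ 2 * X' ^+ 2).
      apply: le_trans (ler_norm _) _; rewrite normrM.
      apply: le_trans (ler_wpM2r (normr_ge0 _) ha) _.
      have h1 : hh x i * `|E * X'| <= (E ^+ 2 + hh x i ^+ 2 * X' ^+ 2) / 2.
        rewrite normrM -[E ^+ 2]real_normK ?num_real// -[X' ^+ 2]real_normK ?num_real//.
        by have := sqr_ge0 (`|E| - hh x i * `|X'|); move: (hh x i) `|E| `|X'| => y1 y2 y3; nra.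
      have := ler_wpM2l G0 h1; move: (`|E * X'|) => y3; lra.
    by move: q1 q2; lra.
  rewrite I_D; [|by apply: bmfZ; exact: bmfX|by apply: bmfZ; exact: bmfX].
  rewrite !I_Z; [|exact: bmfX|exact: bmfX].
  have [sp sq] := szp i iN.
  have sx : (size (xi_ i) <= k.+1)%N by rewrite (leq_trans (size_polyD _ _))// size_polyN geq_max sq.
  have inv := @inverse_N2 xi_ i iN sx.
  have Y0 : 0 <= Y i by apply: I_ge0 => s _; exact: sqr_ge0.
  have Z0 : 0 <= Z i by apply: I_ge0 => s _; exact: sqr_ge0.
  have C0 : 0 <= CI by exact: sqr_ge0.
  rewrite -/(Y i); move: inv; rewrite -/(Z i).
  move: (Y i) (Z i) Y0 Z0 CI C0 (I _ _ _) (hh x i ^+ 2) => y z' y0 z0 c c0 w v inv.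
  have h1 : Gam / 2 * v * w <= Gam * (c * z').
    rewrite -mulrA; apply: (@le_trans _ _ (Gam / 2 * (c * z'))); first by rewrite ler_wpM2l// divr_ge0.
    by rewrite ler_wpM2r ?mulr_ge0//; lra.
  have h2 : 0 <= Gam * (c * y + z') by rewrite mulr_ge0// addr_ge0// mulr_ge0.
  by lra.
(* Completing a square: the upwind jump term dissipates the square of the jump of [xi_], and only
   the projection error from the right survives. *)
have node i : (i < N)%N ->
    G i (x i.+1) - Gp i.+1 - a (x i.+1) * jmp N x p (h b) i * (xi_ i).[x i.+1] <= Ep i.+1 / 2.
  move=> iN; have [x0 xi xb hi] := mN mx iN.
  have /a01/andP[a0 a1] : 0 <= x i.+1 <= b by rewrite xb (le_trans x0 (ltW xi)).
  rewrite /Gp /Ep /jmp /upv; case: ifPn => [iN1|Ni].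
    rewrite /G; have -> : (p i.+1).[x i.+1] = (q i.+1).[x i.+1] - (xi_ i.+1).[x i.+1].
      by rewrite /xi_ hornerD hornerN; ring.
    have -> : (p i).[x i.+1] = (q i).[x i.+1] - (xi_ i).[x i.+1].
      by rewrite /xi_ hornerD hornerN; ring.
    have -> : (q i.+1).[x i.+1] = et i.+1 (x i.+1) + h (x i.+1) by rewrite /et; ring.
    have -> : (q i).[x i.+1] = et i (x i.+1) + h (x i.+1) by rewrite /et; ring.
    move: (et i.+1 _) (et i _) (xi_ i).[_] (xi_ i.+1).[_] (a _) a0 a1 (h _) => E Em X Xp A A0 A1 H.
    have h1 : A * (E * (Xp - X) - (Xp - X) ^+ 2 / 2) <= A * (E ^+ 2 / 2).
      by rewrite ler_wpM2l//; have := sqr_ge0 (E - (Xp - X)); nra.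
    have h2 : A * (E ^+ 2 / 2) <= 1 * (E ^+ 2 / 2) by rewrite ler_wpM2r// divr_ge0 ?sqr_ge0.
    by move: h1 h2; nra.
  have eN : i.+1 = N by apply/eqP; rewrite eqn_leq iN leqNgt.
  have xN : x i.+1 = b by rewrite eN; case: mx.
  rewrite /G; have -> : (p i).[x i.+1] = et i (x i.+1) + h (x i.+1) - (xi_ i).[x i.+1].
    by rewrite /xi_ /et hornerD hornerN; ring.
  rewrite xN in a0 *; move: (et i b) (xi_ i).[b] (h b) (a b) a0 => E X H A A0.
  have h1 : 0 <= A * (X ^+ 2 / 2) by rewrite mulr_ge0// divr_ge0 ?sqr_ge0.
  by move: h1; nra.
have N0 := mesh_N_gt0 b0 mx.
have g0 : - Gp 0 <= Ep 0%N / 2.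
  rewrite /Gp /Ep N0 /G; have [xx0 _ _] := mx.
  have /a01/andP[a0 a1] : 0 <= x 0 <= b by rewrite xx0 lexx ltW.
  move: (et 0%N _) (xi_ 0%N).[_] (a _) a0 a1 => E X A A0 A1.
  have h1 : A * (E * X - X ^+ 2 / 2) <= A * (E ^+ 2 / 2).
    by rewrite ler_wpM2l//; have := sqr_ge0 (E - X); nra.
  have h2 : A * (E ^+ 2 / 2) <= 1 * (E ^+ 2 / 2) by rewrite ler_wpM2r// divr_ge0 ?sqr_ge0.
  by move: h1 h2; nra.
have tel (F : nat -> R) : F N = 0 -> \sum_(i < N) F i = F 0%N + \sum_(i < N) F i.+1.
  by move=> FN; rewrite -sum_shift FN addr0.
have GN : Gp N = 0 by rewrite /Gp ltnn.
have EN : Ep N = 0 by rewrite /Ep ltnn.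
have sE : \sum_(i < N) (et i (x i)) ^+ 2 = Ep 0%N + \sum_(i < N) Ep i.+1.
  by rewrite -tel//; apply: eq_bigr => i _; rewrite /Ep ltn_ord.
have sG : \sum_(i < N) G i (x i) = Gp 0%N + \sum_(i < N) Gp i.+1.
  by rewrite -tel//; apply: eq_bigr => i _; rewrite /Gp ltn_ord.
have sY : \sum_(i < N) Y i = N2 b (err N x h q).
  rewrite /N2 (I_mesh mx); last by apply: bmfX; exact: bmf_err.
  apply: eq_bigr => i _; apply: eq_I => s si.
  by rewrite /err (glueE q mx (ltn_ord i) si) /et -sqrrN opprB.
have sZ : \sum_(i < N) Z i = N2 b (glue N x (fun i => q i - p i)) by rewrite N2_glue.
rewrite /BB I_glue; last by apply: bmfM => //; apply: bmf_err.
have -> : \sum_(i < N) I (x i) (x i.+1) (fun s => a s * err N x h' (dp p) s * (q i - p i).[s]) =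
   \sum_(i < N) I (x i) (x i.+1) (fun s => a s * (h' s - ((p i)^`()).[s]) * (xi_ i).[s]).
  by apply: eq_bigr => i _; apply: eq_I => s si; rewrite /err (glueE (dp p) mx (ltn_ord i) si).
have H1 := ler_sum (P := xpredT) _ (fun (i : 'I_N) (_ : true) => elt i (ltn_ord i)).
have H2 := ler_sum (P := xpredT) _ (fun (i : 'I_N) (_ : true) => node i (ltn_ord i)).
have {}H1 := H1 (index_enum _); have {}H2 := H2 (index_enum _).
move: H1 H2; rewrite !big_split /= !sumrN -!mulr_suml -mulr_sumr big_split /= sY sZ sG sE.
set A1 := \sum_(i < N) I _ _ _; set A2 := \sum_(i < N) a _ * _ * _; set A3 := \sum_(i < N) G _ _.
set A4 := \sum_(i < N) Gp _; set A5 := \sum_(i < N) Ep _; set A6 := N2 _ _; set A7 := N2 _ _.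
have B0 : 0 <= Gam * (1 + CI) * (A6 + A7).
  by rewrite mulr_ge0 ?addr_ge0 ?N2_ge0// mulr_ge0// addr_ge0// sqr_ge0.
move: (Gam * _ * _) B0 => B B0 H1 H2.
lra.
Qed.

End Energy.

(** * Gronwall's inequality and time derivatives of broken norms *)

Section TimeTools.
Context {R : realType}.
Implicit Types (a c t s C m : R) (f : R -> R).

(** The forcing grows at a rate [l] above [C], so it adds only [m / (l - C)] to the prefactor; a
    large [l] makes this contribution as small as desired. *)
Lemma gronwall c f f' C l m : 0 <= m -> 0 <= C -> C < l -> {within `[0, c], continuous f} ->
  (forall t, 0 < t < c -> is_derive t 1 f (f' t)) ->
  (forall t, 0 < t < c -> f' t <= C * f t + m * expR (l * t)) -> 0 <= f 0 ->
  forall t, 0 <= t <= c -> f t <= expR (l * t) * (f 0 + m / (l - C)).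
Proof.
move=> m0 C0 Cl cf df H f0 t /andP[t0 tc].
have lC : 0 < l - C by rewrite subr_gt0.
have dexp y s : is_derive s 1 (fun s => expR (y * s)) (expR (y * s) * y).
  by apply: d_comp; apply: d_eq (dZ y (dI s)) _; rewrite mulr1.
have cexp y : {within `[0, t], continuous (fun s => expR (y * s))}.
  by apply: continuous_subspaceT => s; exact: d_cont (dexp y s).
pose F s := expR (- C * s) * f s - m / (l - C) * expR ((l - C) * s).
have : F t <= F 0.
  apply: (@is_derive_nincr _ 0 t F (fun s => expR (- C * s) * - C * f s + expR (- C * s) * f' s -
     m / (l - C) * (expR ((l - C) * s) * (l - C))) t0).
  - have cf' : {within `[0, t], continuous f}.
      by apply: continuous_subspaceW cf => s; rewrite /= !in_itv /= => /andP[-> /le_trans]; apply.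
    move=> s; apply: cvgB; first by apply: cvgM; [exact: cexp|exact: cf'].
    by apply: cvgM; [exact: cvg_cst|exact: cexp].
  - move=> s /andP[s0 st]; have sc : 0 < s < c by rewrite s0 (lt_le_trans st).
    exact: dB (dM (dexp _ s) (df s sc)) (dZ _ (dexp _ s)).
  - move=> s /andP[s0 st]; have sc : 0 < s < c by rewrite s0 (lt_le_trans st).
    have -> : m / (l - C) * (expR ((l - C) * s) * (l - C)) = expR (- C * s) * (m * expR (l * s)).
      have -> : (l - C) * s = - C * s + l * s by ring.
      by rewrite expRD; field; rewrite gt_eqF.
    have -> : expR (- C * s) * - C * f s + expR (- C * s) * f' s - expR (- C * s) * (m * expR (l * s))
      = - (expR (- C * s) * (C * f s + m * expR (l * s) - f' s)) by ring.
    by rewrite oppr_le0 mulr_ge0 ?expR_ge0// subr_ge0 H.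
rewrite /F !mulr0 expR0 !mul1r !mulr1 => h.
have h1 : expR (- C * t) * f t <= f 0 + m / (l - C) * expR ((l - C) * t).
  have : 0 <= m / (l - C) by rewrite divr_ge0// ltW.
  by move: h; move: (m / (l - C)) => y; lra.
have e1 : f t = expR (C * t) * (expR (- C * t) * f t).
  by rewrite mulrA -expRD mulNr addrC addNr expR0 mul1r.
rewrite e1; apply: le_trans (ler_wpM2l (expR_ge0 _) h1) _.
rewrite mulrDr mulrDr lerD//.
  by rewrite ler_wpM2r// ler_expR ler_wpM2r// ltW.
have -> : expR (C * t) * (m / (l - C) * expR ((l - C) * t)) = (expR (C * t) * expR ((l - C) * t)) * (m / (l - C)) by ring.
by rewrite -expRD -mulrDl [C + _]addrC subrK.
Qed.

Lemma d_sum n (F G : 'I_n -> R -> R) s : (forall j, is_derive s 1 (F j) (G j s)) ->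
  is_derive s 1 (fun t => \sum_j F j t) (\sum_j G j s).
Proof.
elim: n F G => [|n ih] F G dF.
  rewrite big_ord0 (_ : (fun t => _) = fun=> 0); first exact: dC.
  by apply/funext => t; rewrite big_ord0.
rewrite big_ord_recl (_ : (fun t => _) = fun t => F ord0 t + \sum_(j < n) F (lift ord0 j) t).
  by apply: dD => //; exact: (ih (fun j => F (lift ord0 j)) (fun j => G (lift ord0 j))).
by apply/funext => t; rewrite big_ord_recl.
Qed.

Lemma I_poly2 n a c (p q : {poly R}) : (size p <= n.+1)%N -> (size q <= n.+1)%N ->
  I a c (fun s => p.[s] * q.[s]) =
  \sum_(j < n.+1) \sum_(l < n.+1) p`_j * q`_l * I a c (fun s => s ^+ j * s ^+ l).
Proof.
move=> sp sq; have bX j : bmf a c (fun s => s ^+ j) by apply: bmfX; exact: bmf_id.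
have bm j l : bmf a c (fun s => s ^+ j * s ^+ l) by exact: bmfM.
rewrite (@eq_I _ _ _ _ (fun s => \sum_(j < n.+1) \sum_(l < n.+1) p`_j * q`_l * (s ^+ j * s ^+ l))).
  rewrite I_sum; last by move=> j; apply: bmf_sum => l; exact: bmfZ.
  apply: eq_bigr => j _; rewrite I_sum; last by move=> l; exact: bmfZ.
  by apply: eq_bigr => l _; rewrite I_Z.
move=> s _; rewrite (horner_coef_wide s sp) (horner_coef_wide s sq) mulr_suml.
by apply: eq_bigr => j _; rewrite mulr_sumr; apply: eq_bigr => l _; ring.
Qed.

(** Differentiability is stated coefficientwise because the L^2 norm is a quadratic form in the
    coefficients; this avoids differentiating under the integral sign. *)
Definition pdiff n N a c (q qt : R -> nat -> {poly R}) : Prop :=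
  forall i, (i < N)%N ->
  (forall t, a <= t <= c -> (size (q t i) <= n.+1)%N /\ (size (qt t i) <= n.+1)%N) /\
  forall j, {within `[a, c], continuous (fun t => (q t i)`_j)} /\
    forall t, a < t < c -> is_derive t 1 (fun t => (q t i)`_j) (qt t i)`_j.

Lemma near_within a c f g : {within `[a, c], continuous f} ->
  (forall t, a <= t <= c -> f t = g t) -> {within `[a, c], continuous g}.
Proof.
move=> cf fg; apply: subspace_eq_continuous cf => t; rewrite inE /= in_itv /= => tT.
by rewrite /from_subspace /= fg.
Qed.

Lemma N2_pdiff n N b x a c q qt : mesh b N x -> pdiff n N a c q qt ->
  {within `[a, c], continuous (fun t => N2 b (glue N x (q t)))} /\
  forall t, a < t < c ->
    is_derive t 1 (fun t => N2 b (glue N x (q t)))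
      (2 * I 0 b (fun s => glue N x (qt t) s * glue N x (q t) s)).
Proof.
move=> mx hq.
pose M (i j l : nat) := I (x i) (x i.+1) (fun s => s ^+ j * s ^+ l).
pose E t := \sum_(i < N) \sum_(j < n.+1) \sum_(l < n.+1) (q t i)`_j * (q t i)`_l * M i j l.
have eqE t : a <= t <= c -> E t = N2 b (glue N x (q t)).
  move=> tac; rewrite (N2_glue mx); apply: eq_bigr => i _.
  have [/(_ t tac)[s1 _] _] := hq i (ltn_ord i).
  by rewrite -(I_poly2 _ _ s1 s1); apply: eq_I => s _; rewrite expr2.
split.
  apply: near_within eqE; apply: within_sum => i; apply: within_sum => j; apply: within_sum => l.
  have [_ h] := hq i (ltn_ord i); have [c1 _] := h j; have [c2 _] := h l.
  by move=> t; apply: cvgM; [apply: cvgM; [exact: c1|exact: c2]|exact: cvg_cst].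
move=> t tac; have tac' : a <= t <= c by case/andP: tac => /ltW -> /ltW ->.
have nt : \forall s \near t, E s = N2 b (glue N x (q s)).
  by apply: filterS (near_oo tac) => s /andP[s1 s2]; apply: eqE; rewrite !ltW.
apply: d_near nt.
have dE : is_derive t 1 E (\sum_(i < N) \sum_(j < n.+1) \sum_(l < n.+1)
   (((qt t i)`_j * (q t i)`_l + (q t i)`_j * (qt t i)`_l) * M i j l + (q t i)`_j * (q t i)`_l * 0)).
  apply: (d_sum (G := fun (i : 'I_N) t => \sum_(j < n.+1) \sum_(l < n.+1)
   (((qt t i)`_j * (q t i)`_l + (q t i)`_j * (qt t i)`_l) * M i j l + (q t i)`_j * (q t i)`_l * 0))) => i.
  apply: (d_sum (G := fun (j : 'I_n.+1) t => \sum_(l < n.+1)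
   (((qt t i)`_j * (q t i)`_l + (q t i)`_j * (qt t i)`_l) * M i j l + (q t i)`_j * (q t i)`_l * 0))) => j.
  apply: (d_sum (G := fun (l : 'I_n.+1) t =>
   (((qt t i)`_j * (q t i)`_l + (q t i)`_j * (qt t i)`_l) * M i j l + (q t i)`_j * (q t i)`_l * 0))) => l.
  have [_ h] := hq i (ltn_ord i); have [_ /(_ t tac) d1] := h j; have [_ /(_ t tac) d2] := h l.
  exact: dM (dM d1 d2) (dC t _).
apply: d_eq dE _; rewrite (I_glue mx); last exact: bmf_glue.
rewrite mulr_sumr; apply: eq_bigr => i _.
have [/(_ t tac')[s1 s2] _] := hq i (ltn_ord i).
rewrite (@eq_I _ _ _ _ (fun s => (qt t i).[s] * (q t i).[s])); last first.
  by move=> s si; rewrite (glueE (qt t) mx (ltn_ord i) si).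
rewrite (I_poly2 _ _ s2 s1).
have sw : \sum_(j < n.+1) \sum_(l < n.+1) (q t i)`_j * (qt t i)`_l * M i j l =
  \sum_(j < n.+1) \sum_(l < n.+1) (qt t i)`_j * (q t i)`_l * M i j l.
  rewrite exchange_big; apply: eq_bigr => j _; apply: eq_bigr => l _.
  rewrite [_ * (qt t i)`_j]mulrC; congr (_ * _); apply: eq_I => s _; exact: mulrC.
rewrite mulr2n mulrDl mul1r -{1}sw -big_split; apply: eq_bigr => j _.
rewrite -big_split; apply: eq_bigr => l _ /=; rewrite -/(M i j l); ring.
Qed.

(** The coefficients are fixed combinations of the degrees of freedom, so regularity in time of a
    projection reduces to that of moments and point values. *)
Lemma proj_coef gr k a c : exists W : nat -> 'I_k.+1 -> R, forall f l,
  (proj gr k a c f)`_l = \sum_(j < k.+1) W l j * dof gr k a c f j.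
Proof.
exists (fun l j => (unhat a c (\poly_(i < k.+1) dofB gr j (inord i)))`_l) => f l.
rewrite /proj.
have -> : \poly_(i < k.+1) \sum_(j < k.+1) @dofB R gr k j (inord i) * dof gr k a c f j =
   \sum_(j < k.+1) dof gr k a c f j *: \poly_(i < k.+1) @dofB R gr k j (inord i).
  apply/polyP => i; rewrite coef_poly coef_sum; case: ifP => ik.
    by apply: eq_bigr => j _; rewrite coefZ coef_poly ik mulrC.
  by rewrite big1// => j _; rewrite coefZ coef_poly ik mulr0.
rewrite /unhat raddf_sum /= coef_sum; apply: eq_bigr => j _.
by rewrite comp_polyZ coefZ mulrC.
Qed.

End TimeTools.

(** * The error equation and projection errors *)

Section ErrorEstimate.
Context {R : realType}.
Variables (k N : nat) (b T K : R) (x : nat -> R) (Ub : R -> R) (S : hdg_fields R).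
Variables (u ut ur : R -> R -> R).
Hypotheses (k1 : (1 <= k)%N) (b0 : 0 < b) (T0 : 0 < T) (K1 : 1 <= K) (mx : mesh b N x).
Hypotheses (hS : hdg_solution T k N x Ub S) (F : exact_facts k b T K Ub u ut ur).
Implicit Types (t s r : R) (i : nat) (p q phi : nat -> {poly R}) (gr : nat -> bool) (v : R -> R).

Let h := mesh_size N x.
Hypothesis h0 : 0 < h.

Let K0 : 0 <= K. Proof. exact: le_trans ler01 K1. Qed.

Lemma hh_h i : (i < N)%N -> hh x i <= h.
Proof. by move=> iN; exact: (@le_bigmax _ _ _ 0 (fun i : 'I_N => x i.+1 - x i) (Ordinal iN)). Qed.

Lemma sum_hh : \sum_(i < N) hh x i = b. Proof. exact: mesh_sum. Qed.

Lemma in_b t : 0 < t < T -> 0 <= t <= T.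
Proof. by case/andP => /ltW -> /ltW ->. Qed.

Lemma bmf_ef_ut t : 0 <= t <= T -> bmf 0 b (ut t).
Proof. by move=> tT; apply: (bmf_cont (fun s sb => ef_utc F tT sb) (fun s sb => ef_ut F tT sb)). Qed.

Lemma bmf_u' t : 0 <= t <= T -> bmf 0 b (u t).
Proof. by move=> tT; exact: (ef_adm F tT).1. Qed.

Definition st t (tT : 0 <= t <= T) := ef_state F tT.

Lemma upE t i : 0 <= t <= T -> up N x Ub S t i = upv N x (uh S t) (u t b) i.
Proof. by move=> tT; rewrite /up /upv (ef_Ub F tT). Qed.

(** The transport equation of u holds pointwise, so its moments can be subtracted from the strong
    form of the scheme; keeping g~_h as the speed leaves all coefficient differences in [SS]. *)
Lemma err_eq t phi : 0 <= t <= T -> (forall i, (i < N)%N -> (size (phi i) <= k.+1)%N) ->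
  I 0 b (fun s => err N x (ut t) (uh_t S t) s * glue N x phi s) =
  BB N b x (gt b (glue N x (uh S t))) (err N x (ur t) (dp (uh S t))) (jmp N x (uh S t) (u t b)) phi
  + I 0 b (fun s => SS N b x (u t) (ur t) (uh S t) s * glue N x phi s).
Proof.
move=> tT sphi; have fs := st tT; have aU := adm_glue (uh S t) b0 mx; have au := ef_adm F tT.
have [bt bur] := (bmf_ef_ut tT, bmf_gs fs).
have bSS := bmf_SS b0 mx (uh S t) fs.
rewrite /BB !(I_glue mx)//; last first.
- exact: bmf_err.
- by apply: bmfM; [exact: bmf_gt|exact: bmf_err].
rewrite !mulr_sumr -sumrB -big_split; apply: eq_bigr => i _ /=.
have iN := ltn_ord i; have [x0 xi xb hi] := mN mx iN.
have sub f : bmf 0 b f -> bmf (x i) (x i.+1) f by exact: bmf_sub.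
have bf : bmf (x i) (x i.+1) (fun s => (phi i).[s]) by exact: bmf_poly.
have sf := strong_form b0 mx hS tT iN (sphi i iN).
pose G1 := fun s => gt b (u t) s * ur t s * (phi i).[s].
have bgU := sub _ (bmf_gt aU); have bgu := sub _ (bmf_gt au).
have bgaU := sub _ (bmf_gam aU); have bgau := sub _ (bmf_gam au).
have bVU := sub _ (bmf_VV aU.1); have bVu := sub _ (bmf_VV au.1).
have bpt : bmf (x i) (x i.+1) (fun s => (uh_t S t i).[s]) by exact: bmf_poly.
have bp' : bmf (x i) (x i.+1) (fun s => ((uh S t i)^`()).[s]) by exact: bmf_poly.
have bur' := sub _ bur; have but := sub _ bt.
have e1 : I (x i) (x i.+1) (fun s => err N x (ut t) (uh_t S t) s * (phi i).[s]) =
   I (x i) (x i.+1) (fun s => ut t s * (phi i).[s]) - I (x i) (x i.+1) (fun s => (uh_t S t i).[s] * (phi i).[s]).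
  rewrite -I_B; [|exact: bmfM|exact: bmfM].
  by apply: eq_I => s si; rewrite /err (glueE (uh_t S t) mx iN si) mulrBl.
rewrite e1 sf /jmp upE// /gU.
set U := glue N x (uh S t) in aU bgU bgaU bVU *.
set J := (upv N x _ _ _ - _).
pose g1 s := gt b U s * err N x (ur t) (dp (uh S t)) s * (phi i).[s].
pose g2 s := SS N b x (u t) (ur t) (uh S t) s * (phi i).[s].
pose g3 s := gt b U s * ((uh S t i)^`()).[s] * (phi i).[s].
pose g4 s := gam b U s * VV U s * (phi i).[s].
have be : bmf (x i) (x i.+1) (err N x (ur t) (dp (uh S t))) by apply: sub; exact: bmf_err.
have b1 : bmf (x i) (x i.+1) g1 := bmfM (bmfM bgU be) bf.
have b2 : bmf (x i) (x i.+1) g2 := bmfM (sub _ bSS) bf.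
have b3 : bmf (x i) (x i.+1) g3 := bmfM (bmfM bgU bp') bf.
have b4 : bmf (x i) (x i.+1) g4 := bmfM (bmfM bgaU bVU) bf.
have e2 : I (x i) (x i.+1) (fun s => ut t s * (phi i).[s]) =
   2^-1 * I (x i) (x i.+1) g1 + I (x i) (x i.+1) g2 + (2^-1 * I (x i) (x i.+1) g3 + 2^-1 * I (x i) (x i.+1) g4).
  rewrite -!I_Z// -(I_D (bmfZ _ b1) b2) -(I_D (bmfZ _ b3) (bmfZ _ b4)).
  rewrite -(I_D (bmfD (bmfZ _ b1) b2) (bmfD (bmfZ _ b3) (bmfZ _ b4))).
  apply: eq_I => s si; have sb := mesh_itv_oo mx iN si.
  rewrite (ef_pde F tT sb) /g1 /g2 /g3 /g4 /err /SS (glueE (dp (uh S t)) mx iN si) /dp -/U.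
  move: (gt b (u t) s) (gt b U s) (gam b (u t) s) (gam b U s) (VV (u t) s) (VV U s) => *; ring.
rewrite e2 -/g1 -/g2 -/g3 -/g4.
move: (I _ _ g1) (I _ _ g2) (I _ _ g3) (I _ _ g4) (gt b U _) ((phi i).[_]) J => y1 y2 y3 y4 y5 y6 y7; ring.
Qed.

Definition PF gr v i : {poly R} := proj (gr i) k (x i) (x i.+1) v.

Lemma size_PF gr v i : (size (PF gr v i) <= k.+1)%N. Proof. exact: size_proj. Qed.

Lemma dof_time gr i j t t' : (i < N)%N -> (gr i -> (0 < i)%N) -> 0 <= t <= T -> 0 <= t' <= T ->
  `|dof (gr i) k (x i) (x i.+1) (u t') j - dof (gr i) k (x i) (x i.+1) (u t) j
    - (t' - t) * dof (gr i) k (x i) (x i.+1) (ut t) j| <= K * (t' - t) ^+ 2.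
Proof.
move=> iN gri tT tT'; have [x0 xi xb hi] := mN mx iN.
have sub f : bmf 0 b f -> bmf (x i) (x i.+1) f by exact: bmf_sub.
have [bu bu' bt] := And3 (sub _ (bmf_u' tT)) (sub _ (bmf_u' tT')) (sub _ (bmf_ef_ut tT)).
have -> : dof (gr i) k (x i) (x i.+1) (u t') j - dof (gr i) k (x i) (x i.+1) (u t) j
    - (t' - t) * dof (gr i) k (x i) (x i.+1) (ut t) j =
  dof (gr i) k (x i) (x i.+1) (fun s => u t' s + -1 * u t s + (t - t') * ut t s) j.
  rewrite dofD; [|by apply: bmfD => //; exact: bmfZ|exact: bmfZ].
  rewrite dofD//; last exact: bmfZ.
  by rewrite !dofZ//; ring.
apply: dof_le => //.
- by apply: bmfD; [apply: bmfD => //; exact: bmfZ|exact: bmfZ].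
- move=> s si; have := ef_tt F tT tT' (mesh_itv_oo mx iN si).
  by congr (`|_| <= _); ring.
- move=> /gri i0; have xx : 0 < x i < b.
    rewrite (lt_le_trans xi xb) andbT; have := mesh_mono mx i0 (ltnW iN).
    by apply: lt_le_trans; have [<- _ ->//] := mx; exact: ltn_trans i0 iN.
  have := ef_tt F tT tT' xx.
  by congr (`|_| <= _); ring.
Qed.

Lemma PF_pdiff gr : (forall i, gr i -> (0 < i)%N) ->
  pdiff k N 0 T (fun t => PF gr (u t)) (fun t => PF gr (ut t)).
Proof.
move=> gri i iN; split; first by move=> t _; split; exact: size_PF.
move=> l; have [W HW] := proj_coef (gr i) k (x i) (x i.+1).
have E v : (PF gr v i)`_l = \sum_(j < k.+1) W l j * dof (gr i) k (x i) (x i.+1) v j by exact: HW.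
have [x0 xi xb hi] := mN mx iN.
split.
  apply: near_within (fun t _ => esym (E (u t))).
  apply: within_sum => j; apply: within_Z.
  apply: (@lip_within _ _ _ _ K) => t t' tT tT'.
  have sub f : bmf 0 b f -> bmf (x i) (x i.+1) f by exact: bmf_sub.
  have [bu bu'] := (sub _ (bmf_u' tT), sub _ (bmf_u' tT')).
  have -> : dof (gr i) k (x i) (x i.+1) (u t) j - dof (gr i) k (x i) (x i.+1) (u t') j =
    dof (gr i) k (x i) (x i.+1) (fun s => u t s + -1 * u t' s) j.
    by rewrite dofD//; [rewrite dofZ//; ring|exact: bmfZ].
  apply: dof_le => //; first by apply: bmfD => //; exact: bmfZ.
    by move=> s /andP[s1 s2]; rewrite mulN1r; apply: (ef_Du F) => //; rewrite (le_trans x0 (ltW s1)) (le_trans (ltW s2) xb).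
  by move=> _; rewrite mulN1r; apply: (ef_Du F) => //; rewrite x0 (le_trans (ltW xi) xb).
move=> t tT.
rewrite (_ : (fun t => _) = fun t => \sum_(j < k.+1) W l j * dof (gr i) k (x i) (x i.+1) (u t) j); last first.
  by apply/funext => s; exact: E.
rewrite E; apply: (d_sum (G := fun j t => W l j * dof (gr i) k (x i) (x i.+1) (ut t) j)) => j.
apply: dZ; apply: eps_is_derive => e e0.
exists (Num.min (e / K) (Num.min t (T - t))).
  have [t1 t2] := andP tT.
  have Kp : 0 < K := lt_le_trans ltr01 K1.
  by rewrite !lt_min t1 subr_gt0 t2 divr_gt0.
move=> y; rewrite !lt_min => /and3P[y1 y2 y3].
have yT : 0 <= y <= T by move: y2 y3; rewrite !ltr_norml => /andP[? ?] /andP[? ?]; apply/andP; split; lra.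
rewrite [_ * (y - t)]mulrC; apply: le_trans (dof_time j iN (gri i) (in_b tT) yT) _.
rewrite -[(y - t) ^+ 2]real_normK ?num_real// expr2 mulrA ler_wpM2r//.
by move: y1; rewrite ltr_pdivlMr ?(lt_le_trans ltr01)// mulrC => /ltW.
Qed.

Lemma uh_pdiff : pdiff k N 0 T (uh S) (uh_t S).
Proof.
move=> i iN; split; first by move=> t tT; exact: (hdg_P hS).
move=> j; have [hd _] := hdg_C1 hS j iN.
split=> [|t tT]; first exact: (hd_within hd).
by apply: (hd_is_derive tT); apply: hd; exact: in_b.
Qed.

Lemma pdiffB a c (q qt q' qt' : R -> nat -> {poly R}) : pdiff k N a c q qt -> pdiff k N a c q' qt' ->
  pdiff k N a c (fun t i => q t i - q' t i) (fun t i => qt t i - qt' t i).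
Proof.
move=> h1 h2 i iN; have [s1 d1] := h1 i iN; have [s2 d2] := h2 i iN; split.
  move=> t tac; have [p1 p2] := s1 t tac; have [p3 p4] := s2 t tac.
  by rewrite !(leq_trans (size_polyD _ _))// !size_polyN geq_max ?p1 ?p2.
move=> j; have [c1 e1] := d1 j; have [c2 e2] := d2 j; split.
  apply: (near_within (f := fun t => (q t i)`_j - (q' t i)`_j)); last by move=> t _; rewrite coefB.
  by move=> t; apply: cvgB; [exact: c1|exact: c2].
move=> t tac; rewrite coefB (_ : (fun t => _) = fun t => (q t i)`_j - (q' t i)`_j).
  by apply: dB; [exact: e1|exact: e2].
by apply/funext => s; rewrite coefB.
Qed.

Definition DC : R := dofC true k + dofC false k.

Lemma DC_ge (g : bool) : dofC (R := R) g k <= DC.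
Proof. by rewrite /DC; case: g; rewrite ?lerDl ?lerDr ltW// dofC_gt0. Qed.

Lemma DC_ge0 : 0 <= DC. Proof. by rewrite addr_ge0// ltW// dofC_gt0. Qed.

Lemma PF_near gr v i (q : {poly R}) M s : (i < N)%N -> (size q <= k.+1)%N -> bmf 0 b v -> 0 <= M ->
  (forall s, x i < s < x i.+1 -> `|v s - q.[s]| <= M) -> (gr i -> `|v (x i) - q.[x i]| <= M) ->
  x i <= s <= x i.+1 -> `|(PF gr v i).[s] - q.[s]| <= DC * M.
Proof.
move=> iN sq bv M0 H1 H2 si; have [x0 xi xb hi] := mN mx iN.
apply: le_trans (proj_near xi (size_proj _ _ _ _ _) sq (bmf_sub x0 xb bv) _ H1 H2 si) _.
  by move=> j jk; exact: dof_proj.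
by rewrite ler_wpM2r// DC_ge.
Qed.

Lemma PF_err gr v i (q : {poly R}) M s : (i < N)%N -> (size q <= k.+1)%N -> bmf 0 b v -> 0 <= M ->
  (forall s, x i < s < x i.+1 -> `|v s - q.[s]| <= M) -> (gr i -> `|v (x i) - q.[x i]| <= M) ->
  x i < s < x i.+1 -> `|v s - (PF gr v i).[s]| <= (1 + DC) * M.
Proof.
move=> iN sq bv M0 H1 H2 si.
have -> : v s - (PF gr v i).[s] = (v s - q.[s]) - ((PF gr v i).[s] - q.[s]) by ring.
rewrite mulrDl mul1r (le_trans (ler_normB _ _))// lerD ?H1//.
by apply: PF_near => //; case/andP: si => /ltW -> /ltW ->.
Qed.

Lemma N2_err v p (M : nat -> R) : bmf 0 b v ->
  (forall i s, (i < N)%N -> x i < s < x i.+1 -> `|v s - (p i).[s]| <= M i) ->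
  N2 b (err N x v p) <= \sum_(i < N) hh x i * M i ^+ 2.
Proof.
move=> bv H; rewrite /N2 (I_mesh mx); last by apply: bmfX; exact: bmf_err.
apply: ler_sum => i _; have iN := ltn_ord i; have [x0 xi xb hi] := mN mx iN.
rewrite mulrC /hh -(I_cst _ (ltW xi)); apply: le_I; [|exact: bmf_cst|].
  by apply: bmfX; apply: (bmf_sub x0 xb); exact: bmf_err.
move=> s si; rewrite /err (glueE p mx iN si) -[X in X <= _]real_normK ?num_real//.
have h1 := H i s iN si.
by rewrite lerXn2r ?nnegrE ?normr_ge0// (le_trans _ h1).
Qed.

Lemma N2_PF_u gr t : 0 <= t <= T ->
  N2 b (err N x (u t) (PF gr (u t))) <= ((1 + DC) * K) ^+ 2 * b * (h ^+ k.+1) ^+ 2.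
Proof.
move=> tT; have D0 := DC_ge0.
apply: le_trans (N2_err (M := fun=> (1 + DC) * (K * h ^+ k.+1)) (bmf_u' tT) _) _.
  move=> i s iN si; have [x0 xi xb hi] := mN mx iN.
  have [q sq Hq] := ef_ap F tT x0 xi xb.
  have kk : K * (x i.+1 - x i) ^+ k.+1 <= K * h ^+ k.+1.
    by rewrite ler_wpM2l// lerXn2r ?nnegrE ?(ltW h0) ?(ltW hi)// hh_h.
  have Mk : 0 <= K * h ^+ k.+1 by rewrite mulr_ge0// exprn_ge0// ltW.
  apply: (PF_err iN sq (bmf_u' tT) Mk _ _ si).
    by move=> y /andP[y1 y2]; apply: le_trans kk; apply: Hq; rewrite !ltW.
  by move=> _; apply: le_trans kk; apply: Hq; rewrite lexx ltW.
rewrite -mulr_suml sum_hh le_eqVlt; apply/orP; left; apply/eqP; ring.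
Qed.

Lemma PF_node gr t i : 0 <= t <= T -> (i < N)%N ->
  ((PF gr (u t) i).[x i] - u t (x i)) ^+ 2 <= ((1 + DC) * K) ^+ 2 * (h ^+ k.+1) ^+ 2.
Proof.
move=> tT iN; have [x0 xi xb hi] := mN mx iN; have D0 := DC_ge0.
have [q sq Hq] := ef_ap F tT x0 xi xb.
have kk : K * (x i.+1 - x i) ^+ k.+1 <= K * h ^+ k.+1.
  by rewrite ler_wpM2l// lerXn2r ?nnegrE ?(ltW h0) ?(ltW hi)// hh_h.
have Mk : 0 <= K * h ^+ k.+1 by rewrite mulr_ge0// exprn_ge0// ltW.
have h1 : `|(PF gr (u t) i).[x i] - q.[x i]| <= DC * (K * h ^+ k.+1).
  apply: (PF_near iN sq (bmf_u' tT) Mk); last by rewrite lexx ltW.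
    by move=> y /andP[y1 y2]; apply: le_trans kk; apply: Hq; rewrite !ltW.
  by move=> _; apply: le_trans kk; apply: Hq; rewrite lexx ltW.
have h2 : `|u t (x i) - q.[x i]| <= K * h ^+ k.+1.
  by apply: le_trans kk; apply: Hq; rewrite lexx ltW.
rewrite -exprMn -mulrA -[leLHS]real_normK ?num_real// lerXn2r ?nnegrE//.
  by rewrite mulr_ge0// addr_ge0.
have -> : (PF gr (u t) i).[x i] - u t (x i) = ((PF gr (u t) i).[x i] - q.[x i]) - (u t (x i) - q.[x i]) by ring.
by rewrite (le_trans (ler_normB _ _))// mulrDl mul1r addrC lerD.
Qed.

Lemma N2_PF_ut gr t : (forall i, gr i -> (0 < i)%N) -> 0 <= t <= T ->
  N2 b (err N x (ut t) (PF gr (ut t))) <= (1 + DC) ^+ 2 * K * (h ^+ k.+1) ^+ 2.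
Proof.
move=> gri tT; have [q [sg [Hq Hs]]] := ef_apt F tT mx h0.
apply: le_trans (N2_err (M := fun i => (1 + DC) * sg i) (bmf_ef_ut tT) _) _.
  move=> i s iN si; have [sq sg0 Hqi] := Hq i iN; have [x0 xi xb hi] := mN mx iN.
  apply: (PF_err iN sq (bmf_ef_ut tT) sg0 Hqi _ si) => /gri i0.
  have xx : 0 < x i < b.
    rewrite (lt_le_trans xi xb) andbT; have := mesh_mono mx i0 (ltnW iN).
    by apply: lt_le_trans; have [<- _ ->//] := mx; exact: ltn_trans i0 iN.
  (* The approximation bound holds on the open element; continuity of u_t inside (0, b) carries it
     to the left node. *)
  have c : {for x i, continuous (fun s => `|ut t s - (q i).[s]|)}.
    by apply: cvg_norm; apply: cvgB; [exact: (ef_utc F tT xx)|exact: poly_cont].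
  apply/ler_addgt0Pr => e e0; move/cvgrPdist_le: c => /(_ e e0)/nbhs_ballP[d /= d0 H].
  pose y := x i + Num.min (d / 2) (hh x i / 2).
  have m0 : 0 < Num.min (d / 2) (hh x i / 2) by rewrite lt_min !divr_gt0.
  have [m1 m2] : Num.min (d / 2) (hh x i / 2) <= d / 2 /\ Num.min (d / 2) (hh x i / 2) <= hh x i / 2.
    by rewrite !ge_min !lexx orbT.
  have yi : x i < y < x i.+1 by rewrite /y; move: m2 hi; rewrite /hh => *; apply/andP; split; lra.
  have /H : ball (x i) d y.
    by rewrite /ball /= /y opprD addrA subrr sub0r normrN gtr0_norm//; lra.
  have := Hqi y yi; move: (`|_|) (`|_|) => z1 z2 hz; rewrite ler_norml; lra.
under eq_bigr do rewrite exprMn mulrCA.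
rewrite -mulr_sumr -mulrA ler_wpM2l ?sqr_ge0//.
Qed.

End ErrorEstimate.

(** * The L^2 error estimate under the smallness hypothesis *)

Section L2Estimate.
Context {R : realType}.
Variables (k N : nat) (b T K : R) (x : nat -> R) (Ub : R -> R) (S : hdg_fields R).
Variables (u ut ur : R -> R -> R).
Hypotheses (k1 : (1 <= k)%N) (b0 : 0 < b) (T0 : 0 < T) (K1 : 1 <= K) (mx : mesh b N x).
Hypotheses (hS : hdg_solution T k N x Ub S) (F : exact_facts k b T K Ub u ut ur).
Implicit Types (t s r : R) (i : nat) (p q phi : nat -> {poly R}) (v f : R -> R).

Let h := mesh_size N x.
Hypothesis h0 : 0 < h.

Let K0 : 0 <= K. Proof. exact: le_trans ler01 K1. Qed.

Lemma eq_BB (a a' e' : R -> R) J phi : (forall s, 0 < s <= b -> a s = a' s) ->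
  BB N b x a e' J phi = BB N b x a' e' J phi.
Proof.
move=> H; rewrite /BB; congr (_ * _ - _ * _).
  by apply: eq_I => s /andP[s0 sb]; rewrite H// s0 ltW.
apply: eq_bigr => i _; have [x0 xi xb _] := mN mx (ltn_ord i).
by rewrite H// (le_lt_trans x0 xi).
Qed.

Lemma gt0_lip_CG f f' p : gstate b K f f' -> N2 b (del N x f p) <= 1 ->
  forall r s, 0 <= r <= b -> 0 <= s <= b ->
  `|gt0 b (glue N x p) r - gt0 b (glue N x p) s| <= CG b K * `|r - s|.
Proof.
move=> G A1; have aU := adm_glue p b0 mx; have [M HM] := gt0_lip b0 aU.
apply: (lip_closure b0 (CG_ge0 _ b0) (lip_within HM)) => r s /andP[r0 rb] /andP[s0 sb].
have [r1 s1] : 0 < r <= b /\ 0 < s <= b by rewrite r0 s0 !ltW.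
rewrite !gt0E//; apply: le_trans (gt_lip aU r1 s1) _.
by rewrite ler_wpM2r// (N2_QQh b0 mx K1 G).
Qed.

Lemma BB_energy_gt f f' p v v' q q' M : gstate b K f f' -> N2 b (del N x f p) <= 1 ->
  (forall r s, 0 <= r <= b -> 0 <= s <= b -> `|v r - v s| <= M * `|r - s|) ->
  (forall s, 0 < s < b -> is_derive s 1 v (v' s)) ->
  (forall s, 0 < s < b -> {for s, continuous v'}) ->
  (forall s, 0 < s < b -> `|v' s| <= M) ->
  (forall i, (i < N)%N -> (size (q i) <= k.+1)%N /\ (size (q' i) <= k.+1)%N) ->
  (forall i (w : {poly R}), (i < N)%N -> (size w <= k)%N ->
     I (x i) (x i.+1) (fun s => ((q' i).[s] - v s) * w.[s]) = 0) ->
  BB N b x (gt b (glue N x p)) (err N x v' (dp q)) (jmp N x q (v b)) (fun i => q' i - q i) <=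
  CG b K * (1 + CI k) * (N2 b (err N x v q') + N2 b (glue N x (fun i => q' i - q i)))
  + 4^-1 * \sum_(i < N) ((q' i).[x i] - v (x i)) ^+ 2.
Proof.
move=> G A1 vL dv cv vb sz orth; have aU := adm_glue p b0 mx.
rewrite (@eq_BB _ (gt0 b (glue N x p))); last by move=> s /andP[s0 _]; rewrite gt0E.
apply: (BB_energy b0 mx (a' := gam b (glue N x p)) _ _ _ _ _ _ vL dv cv vb sz orth).
- exact: CG_ge0.
- move=> s /andP[s0 sb]; rewrite /gt0; case: eqVneq => [_|sn].
    by rewrite gg_le1// ltW// gg_gt0.
  have sb' : 0 < s <= b by rewrite lt0r sn s0.
  by rewrite gt_le1// ltW// gt_gt0.
- exact: (gt0_lip_CG G A1).
- move=> s sb; apply: (d_near (gt_derive aU sb)).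
  by apply: filterS (near_oo sb) => y /andP[y0 _]; rewrite gt0E.
- by move=> s sb; exact: gam_cont.
- by move=> s /andP[s0 sb]; apply: (gam_bd b0 mx K1 G A1); rewrite s0 ltW.
Qed.

Lemma I_half f v : bmf 0 b f -> bmf 0 b v ->
  I 0 b (fun s => f s * v s) <= 2^-1 * N2 b f + 2^-1 * N2 b v.
Proof.
move=> bf bv; have h2 : (0 : R) < 2^-1 by rewrite invr_gt0.
apply: le_trans (I_young h2 bf bv) _; rewrite lerD2l le_eqVlt; apply/orP; left; apply/eqP.
congr (_ * _); by field.
Qed.

(* The Gauss-Radau projection is used only where its node is not the center, as u_t has no
   point value at r = 0. *)
Definition grQ i := (0 < i)%N.
Definition xi t i : {poly R} := PF k x grQ (u t) i - uh S t i.
Definition xit t i : {poly R} := PF k x grQ (ut t) i - uh_t S t i.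

Lemma size_uh t i : 0 <= t <= T -> (i < N)%N -> (size (uh S t i) <= k.+1)%N.
Proof. by move=> tT iN; have [] := hdg_P hS tT iN. Qed.

Lemma size_xi t i : 0 <= t <= T -> (i < N)%N -> (size (xi t i) <= k.+1)%N.
Proof.
move=> tT iN; rewrite (leq_trans (size_polyD _ _))// size_polyN geq_max size_PF//.
exact: size_uh.
Qed.

Lemma xi_pdiff : pdiff k N 0 T xi xit.
Proof.
apply: pdiffB; last exact: (uh_pdiff hS).
by apply: (PF_pdiff K1 mx F) => i.
Qed.

Lemma eq_N2 f v : (forall i s, (i < N)%N -> x i < s < x i.+1 -> f s = v s) ->
  bmf 0 b f -> bmf 0 b v -> N2 b f = N2 b v.
Proof.
move=> H bf bv; rewrite /N2 !(I_mesh mx); [|exact: bmfX|exact: bmfX].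
by apply: eq_bigr => i _; apply: eq_I => s si; rewrite (H i s (ltn_ord i) si).
Qed.

Lemma N2_err_split v p q : bmf 0 b v ->
  N2 b (err N x v p) <= 2 * N2 b (err N x v q) + 2 * N2 b (glue N x (fun i => q i - p i)).
Proof.
move=> bv; have be := bmf_err N x q bv; have bg := bmf_glue 0 b N x (fun i => q i - p i).
apply: le_trans (N2_D be bg); rewrite le_eqVlt; apply/orP; left; apply/eqP; apply: eq_N2.
- move=> i s iN si; rewrite /err !(glueE _ mx iN si) hornerD hornerN; ring.
- exact: bmf_err.
- by apply: bmfD; [exact: bmf_err|exact: bmf_glue].
Qed.

Definition C1 : R := 2 * CG b K * (1 + CI k) + 4 * CS b K + 2.
Definition EU : R := ((1 + DC k) * K) ^+ 2 * b.
Definition C2 : R := (2 * CG b K * (1 + CI k) + 4 * CS b K) * EU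
  + 2^-1 * ((1 + DC k) * K) ^+ 2 + (1 + DC k) ^+ 2 * K.

Lemma CS_ge0 : 0 <= CS b K.
Proof.
rewrite /CS addr_ge0 ?sqr_ge0// mulr_ge0 ?(ltW b0)// mulr_ge0//.
  by rewrite mulr_ge0 ?sqr_ge0.
by rewrite addr_ge0// mulr_ge0// mulr_ge0 ?sqr_ge0 ?(ltW b0).
Qed.

Lemma CI_ge0 : 0 <= CI k :> R. Proof. exact: sqr_ge0. Qed.

Lemma EU_ge0 : 0 <= EU. Proof. by rewrite mulr_ge0 ?sqr_ge0 ?(ltW b0). Qed.

Lemma C1_ge0 : 0 <= C1.
Proof.
have := CG_ge0 K b0; have := CS_ge0; have := CI_ge0; rewrite /C1.
by move: (CG b K) (CS b K) (CI k) => y1 y2 y3 ? ? ?; rewrite !addr_ge0 ?mulr_ge0 ?addr_ge0.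
Qed.

Lemma C2_ge0 : 0 <= C2.
Proof.
have := CG_ge0 K b0; have := CS_ge0; have := CI_ge0; have := EU_ge0; rewrite /C2.
move: (CG b K) (CS b K) (CI k) EU => y1 y2 y3 y4 ? ? ? ?.
have : 0 <= ((1 + DC k) * K) ^+ 2 :> R by exact: sqr_ge0.
have : 0 <= (1 + DC k) ^+ 2 :> R by exact: sqr_ge0.
by move: ((1 + DC k) ^+ 2) (((1 + DC k) * K) ^+ 2) => y5 y6 ? ?; rewrite !addr_ge0 ?mulr_ge0 ?addr_ge0 ?mulr_ge0 ?addr_ge0 ?invr_ge0.
Qed.

Lemma PFQ_orth t i (w : {poly R}) : 0 <= t <= T -> (i < N)%N -> (size w <= k)%N ->
  I (x i) (x i.+1) (fun s => ((PF k x grQ (u t) i).[s] - u t s) * w.[s]) = 0.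
Proof.
move=> tT iN sw; have [x0 xi xb hi] := mN mx iN.
apply: (proj_orth (gr := grQ i) xi (size_PF _ _ _ _ _) (bmf_sub x0 xb (bmf_u' F tT))).
  by move=> j jk; exact: dof_proj.
rewrite (leq_trans sw)//; case: (grQ i); by rewrite ?subn1 ?subn0//= leqW.
Qed.

(** Gauss-Radau matches u at the left nodes, so only the center contributes, where the L^2
    projection is used. *)
Lemma PFQ_node t : 0 <= t <= T ->
  \sum_(i < N) ((PF k x grQ (u t) i).[x i] - u t (x i)) ^+ 2 <= ((1 + DC k) * K) ^+ 2 * (h ^+ k.+1) ^+ 2.
Proof.
move=> tT; have N0 := mesh_N_gt0 b0 mx.
rewrite (bigD1 (Ordinal N0))//= [X in _ + X]big1 ?addr0; last first.
  move=> i i0; have [x0 xi xb hi] := mN mx (ltn_ord i).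
  have gi : grQ i by rewrite /grQ lt0n; apply: contraNneq i0 => e; apply/eqP/val_inj.
  by rewrite /PF gi proj_left// subrr expr0n.
exact: (PF_node K1 mx F h0).
Qed.

(** The time derivative of [xi] is that of the error minus the projection error of u_t. Testing the
    error equation with [xi] leaves the upwind form, the coefficient term and that projection
    error. *)
Lemma xi_energy_ineq t : 0 < t < T -> N2 b (del N x (u t) (uh S t)) <= 1 ->
  2 * I 0 b (fun s => glue N x (xit t) s * glue N x (xi t) s) <=
  C1 * N2 b (glue N x (xi t)) + C2 * (h ^+ k.+1) ^+ 2.
Proof.
move=> t0 A1; have tT := in_b t0; have G := ef_state F tT.
have [bu bt] := (bmf_u' F tT, bmf_ef_ut F tT).
have bx := bmf_glue 0 b N x (xi t).
set f := N2 b (glue N x (xi t)); set H := (h ^+ k.+1) ^+ 2.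
set E := N2 b (err N x (u t) (PF k x grQ (u t))).
have sx i : (i < N)%N -> (size (xi t i) <= k.+1)%N by exact: size_xi.
have e1 : I 0 b (fun s => glue N x (xit t) s * glue N x (xi t) s) =
   I 0 b (fun s => err N x (ut t) (uh_t S t) s * glue N x (xi t) s)
   + I 0 b (fun s => - err N x (ut t) (PF k x grQ (ut t)) s * glue N x (xi t) s).
  have b1 := bmfM (bmf_err N x (uh_t S t) bt) bx.
  have b2 := bmfM (bmfN (bmf_err N x (PF k x grQ (ut t)) bt)) bx.
  rewrite -(I_D b1 b2) !(I_mesh mx); [|exact: bmfD|by apply: bmfM => //; exact: bmf_glue].
  apply: eq_bigr => i _; apply: eq_I => s si; rewrite /err /xit !(glueE _ mx (ltn_ord i) si) hornerD hornerN.
  by ring.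
have h1 : BB N b x (gt b (glue N x (uh S t))) (err N x (ur t) (dp (uh S t))) (jmp N x (uh S t) (u t b)) (xi t)
   <= CG b K * (1 + CI k) * (E + f) + 4^-1 * (((1 + DC k) * K) ^+ 2 * H).
  apply: le_trans (BB_energy_gt (M := K) G A1 _ _ _ _ _ _) _.
  - by move=> r s; exact: (ef_lip F).
  - by move=> s; exact: (ef_der F).
  - by move=> s; exact: (ef_urc F).
  - by move=> s; exact: (ef_ur F).
  - by move=> i iN; rewrite size_PF size_uh.
  - by move=> i w iN sw; exact: PFQ_orth.
  - by rewrite lerD2l ler_wpM2l ?invr_ge0// PFQ_node.
have h2 : I 0 b (fun s => SS N b x (u t) (ur t) (uh S t) s * glue N x (xi t) s) <= 2 * CS b K * (E + f) + 2^-1 * f.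
  have bS := bmf_SS b0 mx (uh S t) G.
  apply: le_trans (I_half bS bx) _; rewrite lerD2r.
  have q1 := N2_SS b0 mx K1 G A1; have q2 := N2_dVV_le_err mx (uh S t) G.
  have q3 := N2_err_split (uh S t) (PF k x grQ (u t)) bu; rewrite -/E -/(N2 b _) in q3.
  have C0 := CS_ge0.
  move: q3; rewrite -[N2 b (glue N x (fun i => _ - _))]/f => q3.
  have q4 : 2 * CS b K * N2 b (fun s => VV (u t) s - VV (glue N x (uh S t)) s) <= 2 * CS b K * (2 * E + 2 * f).
    by rewrite ler_wpM2l ?mulr_ge0// (le_trans q2).
  by have := le_trans q1 q4; move: (N2 b (SS _ _ _ _ _ _)) => y; lra.
have h3 : I 0 b (fun s => - err N x (ut t) (PF k x grQ (ut t)) s * glue N x (xi t) s) <=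
    2^-1 * ((1 + DC k) ^+ 2 * K * H) + 2^-1 * f.
  have bE := bmf_err N x (PF k x grQ (ut t)) bt.
  apply: le_trans (I_half (bmfN bE) bx) _; rewrite lerD2r ler_wpM2l ?invr_ge0//.
  apply: le_trans (N2_PF_ut mx F h0 (gr := grQ) _ tT) => //.
  by rewrite le_eqVlt; apply/orP; left; apply/eqP; apply: eq_I => s _; rewrite sqrrN.
have h4 : E <= EU * H := N2_PF_u K1 mx F h0 grQ tT.
rewrite e1 (err_eq b0 mx hS F tT sx).
have c1 := CG_ge0 K b0; have c2 := CS_ge0; have c3 := CI_ge0.
rewrite /C1 /C2.
move: (BB _ _ _ _ _ _ _) (I _ _ _) (I _ _ _) h1 h2 h3 => y1 y2 y3 h1 h2 h3.
have h5 : (2 * CG b K * (1 + CI k) + 4 * CS b K) * E <= (2 * CG b K * (1 + CI k) + 4 * CS b K) * (EU * H).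
  apply: ler_wpM2l h4; move: (CG b K) (CI k) (CS b K) c1 c2 c3 => z1 z2 z3 ? ? ?.
  by rewrite !addr_ge0 ?mulr_ge0 ?addr_ge0.
clear h4 c1 c2 c3; move: (CG b K) (CI k) (CS b K) EU (((1 + DC k) * K) ^+ 2) ((1 + DC k) ^+ 2) E f H h1 h2 h3 h5 => *; lra.
Qed.

Lemma gr_dof a c (f : R -> R) (p : {poly R}) j : a < c -> gauss_radau k a c f p -> bmf a c f ->
  (j <= k)%N -> dof true k a c (fun s => p.[s]) j = dof true k a c f j.
Proof.
move=> ac [sp orth pa] bf jk; rewrite /dof /=; case: eqP => [//|/eqP jn]; congr (_ * _).
have bm := bmf_mono a c j.
apply/eqP; rewrite -subr_eq0 -I_B; [|by apply: bmfM => //; exact: bmf_poly|exact: bmfM].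
have e : I a c (fun s => p.[s] * ((s - a) / (c - a)) ^+ j - f s * ((s - a) / (c - a)) ^+ j) =
    I a c (fun s => (p.[s] - f s) * (unhat a c 'X^j).[s]).
  by apply: eq_I => s _; rewrite unhatE hornerXn [RHS]mulrBl.
rewrite e; apply/eqP; apply: orth.
by rewrite /in_P prednK//; apply: leq_trans (size_unhat (n := j) a c _) _; [by rewrite size_polyXn|by rewrite ltn_neqAle jn].
Qed.

Hypothesis init : forall i, (i < N)%N -> gauss_radau k (x i) (x i.+1) (u 0) (uh S 0 i).

Lemma uh0_near i (q : {poly R}) M s : (i < N)%N -> (size q <= k.+1)%N ->
  (forall s, x i <= s <= x i.+1 -> `|u 0 s - q.[s]| <= M) ->
  x i <= s <= x i.+1 -> `|(uh S 0 i).[s] - q.[s]| <= DC k * M.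
Proof.
move=> iN sq H si; have [x0 xi xb hi] := mN mx iN.
have tT : 0 <= (0 : R) <= T by rewrite lexx ltW.
have bu := bmf_sub x0 xb (bmf_u' F tT).
have M0 : 0 <= M by apply: le_trans (H (x i) _); rewrite ?lexx ?(ltW xi).
apply: (@le_trans _ _ (dofC true k * M)); last by rewrite ler_wpM2r// DC_ge.
apply: (proj_near xi (size_uh tT iN) sq bu _ _ _ si).
- by move=> j jk; exact: (gr_dof xi (init iN) bu jk).
- by move=> y /andP[y1 y2]; apply: H; rewrite !ltW.
- by move=> _; apply: H; rewrite lexx ltW.
Qed.

(** [xi 0] need not vanish: the initial datum is the Gauss-Radau projection on every element, but
    [xi] uses the L^2 projection on the first. Both are close to the same polynomial. *)
Lemma N2_xi0 : N2 b (glue N x (xi 0)) <= (2 * DC k * K) ^+ 2 * b * (h ^+ k.+1) ^+ 2.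
Proof.
have tT : 0 <= (0 : R) <= T by rewrite lexx ltW.
have D0 : 0 <= DC k :> R := DC_ge0 _.
have bz : bmf 0 b (fun=> 0 : R) by exact: bmf_cst.
have -> : N2 b (glue N x (xi 0)) = N2 b (err N x (fun=> 0) (xi 0)).
  by apply: eq_I => s _; rewrite /err sub0r sqrrN.
apply: le_trans (N2_err mx (M := fun=> 2 * (DC k * (K * h ^+ k.+1))) bz _) _.
  move=> i s iN /andP[s1 s2]; have [x0 xi_ xb hi] := mN mx iN.
  have [q sq Hq] := ef_ap F tT x0 xi_ xb.
  have kk : K * (x i.+1 - x i) ^+ k.+1 <= K * h ^+ k.+1.
    by rewrite ler_wpM2l// lerXn2r ?nnegrE ?(ltW h0) ?(ltW hi)// hh_h.
  have Mk : 0 <= K * h ^+ k.+1 by rewrite mulr_ge0// exprn_ge0// ltW.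
  have Hq' y : x i <= y <= x i.+1 -> `|u 0 y - q.[y]| <= K * h ^+ k.+1.
    by move=> yi; apply: le_trans kk; exact: Hq.
  have si : x i <= s <= x i.+1 by rewrite !ltW.
  have h1 := uh0_near iN sq Hq' si.
  have h2 : `|(PF k x grQ (u 0) i).[s] - q.[s]| <= DC k * (K * h ^+ k.+1).
    apply: (PF_near mx iN sq (bmf_u' F tT) Mk _ _ si).
      by move=> y /andP[y1 y2]; apply: Hq'; rewrite !ltW.
    by move=> _; apply: Hq'; rewrite lexx ltW.
  rewrite /xi hornerD hornerN.
  have -> : 0 - ((PF k x grQ (u 0) i).[s] - (uh S 0 i).[s]) =
    ((uh S 0 i).[s] - q.[s]) - ((PF k x grQ (u 0) i).[s] - q.[s]) by ring.
  by rewrite (le_trans (ler_normB _ _))// mulr2n mulrDl mul1r lerD.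
rewrite -mulr_suml (sum_hh mx) le_eqVlt; apply/orP; left; apply/eqP; ring.
Qed.

(** The rate [C1 + 1] makes the denominator in [gronwall] equal to 1. *)
Definition CL : R := expR ((C1 + 1) * T) * ((2 * DC k * K) ^+ 2 * b + C2).

Lemma CL_ge0 : 0 <= CL.
Proof. by rewrite mulr_ge0 ?expR_ge0// addr_ge0 ?C2_ge0// mulr_ge0 ?sqr_ge0 ?(ltW b0). Qed.

(** Smallness is assumed on [0, tau) only, so the estimate is available while smallness is still
    being proved. *)
Lemma L2_xi tau : 0 <= tau <= T ->
  (forall t, 0 <= t < tau -> N2 b (del N x (u t) (uh S t)) <= 1) ->
  forall t, 0 <= t <= tau -> N2 b (glue N x (xi t)) <= CL * (h ^+ k.+1) ^+ 2.
Proof.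
move=> /andP[tau0 tauT] A1 t /andP[t0 tt].
have [cf df] := N2_pdiff mx xi_pdiff; set H := (h ^+ k.+1) ^+ 2.
have H0 : 0 <= H by exact: sqr_ge0.
have C10 := C1_ge0; have C20 := C2_ge0.
have l0 : C1 < C1 + 1 by rewrite ltrDl.
have cf' : {within `[0, tau], continuous (fun t => N2 b (glue N x (xi t)))}.
  by apply: continuous_subspaceW cf => s; rewrite /= !in_itv /= => /andP[-> /le_trans]; apply.
have sub s : 0 < s < tau -> 0 < s < T by move=> /andP[-> /lt_le_trans]; apply.
have m0 : 0 <= C2 * H by rewrite mulr_ge0.
have tt' : 0 <= t <= tau by rewrite t0.
have := gronwall m0 C10 l0 cf' (fun s hs => df s (sub s hs)) _ (N2_ge0 _ _) tt'.
rewrite [C1 + 1 - C1]addrAC subrr add0r divr1 => G.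
apply: le_trans (G _) _.
  move=> s hs; have sT := sub s hs; have /andP[s0 st] := hs.
  apply: le_trans (xi_energy_ineq sT (A1 s _)) _; first by rewrite ltW.
  rewrite lerD2l ler_peMr//.
  by rewrite -expR0 ler_expR mulr_ge0 ?(ltW s0)// addr_ge0.
rewrite /CL -mulrA; apply: ler_pM; [exact: expR_ge0|by rewrite addr_ge0 ?N2_ge0| |].
  by rewrite ler_expR; apply: ler_wpM2l (le_trans tt tauT); rewrite addr_ge0.
by rewrite [leRHS]mulrDl; apply: lerD => //; exact: N2_xi0.
Qed.

Definition CE : R := 2 * EU + 2 * CL.

Lemma CE_ge0 : 0 <= CE.
Proof. exact: addr_ge0 (mulr_ge0 (ler0n _ 2) EU_ge0) (mulr_ge0 (ler0n _ 2) CL_ge0). Qed.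

Lemma L2_error tau : 0 <= tau <= T ->
  (forall t, 0 <= t < tau -> N2 b (del N x (u t) (uh S t)) <= 1) ->
  forall t, 0 <= t <= tau -> N2 b (err N x (u t) (uh S t)) <= CE * (h ^+ k.+1) ^+ 2.
Proof.
move=> tauT A1 t tt; have /andP[t0 t1] := tt; have /andP[_ t2] := tauT.
have tT : 0 <= t <= T by rewrite t0 (le_trans t1).
apply: le_trans (N2_err_split _ (PF k x grQ (u t)) (bmf_u' F tT)) _.
rewrite [leRHS](mulrDl (2 * EU) (2 * CL)) -2!mulrA; apply: lerD; rewrite ler_pM2l//.
  exact: (N2_PF_u K1 mx F h0).
exact: (L2_xi tauT A1).
Qed.

End L2Estimate.

(** * The broken H^1 error recovered from the time derivative *)

Section Recovery.
Context {R : realType}.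
Variables (k N : nat) (b T K : R) (x : nat -> R) (Ub : R -> R) (S : hdg_fields R).
Variables (u ut ur : R -> R -> R).
Hypotheses (k1 : (1 <= k)%N) (b0 : 0 < b) (K1 : 1 <= K) (mx : mesh b N x).
Hypotheses (hS : hdg_solution T k N x Ub S) (F : exact_facts k b T K Ub u ut ur).
Implicit Types (t s r : R) (i : nat) (p q phi : nat -> {poly R}) (v f : R -> R).

Let h := mesh_size N x.
Hypothesis h0 : 0 < h.

Let K0 : 0 <= K. Proof. exact: le_trans ler01 K1. Qed.

Definition gr0 (i : nat) := false.
(* The time derivative of P u - u_h, with P the elementwise L^2 projection. *)
Definition pit t i : {poly R} := PF k x gr0 (ut t) i - uh_t S t i.

Lemma size_pit t i : 0 <= t <= T -> (i < N)%N -> (size (pit t i) <= k.+1)%N.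
Proof.
move=> tT iN; rewrite (leq_trans (size_polyD _ _))// size_polyN geq_max size_PF//.
by have [] := hdg_P hS tT iN.
Qed.

Lemma PF_L2 v (w : {poly R}) i : bmf 0 b v -> (i < N)%N -> (size w <= k.+1)%N ->
  I (x i) (x i.+1) (fun s => ((PF k x gr0 v i).[s] - v s) * w.[s]) = 0.
Proof.
move=> bv iN sw; have [x0 xi xb hi] := mN mx iN.
apply: (proj_orth (gr := false) xi (size_PF _ _ _ _ _) (bmf_sub x0 xb bv)).
  by move=> j jk; exact: dof_proj.
by rewrite subn0.
Qed.

(** The reason for the full L^2 projection: against every test function of degree at most k the
    error may be replaced by a polynomial. *)
Lemma pit_orth v p phi : bmf 0 b v -> (forall i, (i < N)%N -> (size (phi i) <= k.+1)%N) ->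
  I 0 b (fun s => err N x v p s * glue N x phi s) =
  I 0 b (fun s => glue N x (fun i => PF k x gr0 v i - p i) s * glue N x phi s).
Proof.
move=> bv sp; rewrite !(I_glue mx); [|exact: bmf_glue|exact: bmf_err].
apply: eq_bigr => i _; have iN := ltn_ord i; have [x0 xi xb hi] := mN mx iN.
have bf : bmf (x i) (x i.+1) (fun s => (phi i).[s]) by exact: bmf_poly.
have b1 : bmf (x i) (x i.+1) (fun s => err N x v p s * (phi i).[s]).
  by apply: bmfM => //; apply: (bmf_sub x0 xb); exact: bmf_err.
have b2 : bmf (x i) (x i.+1) (fun s => ((PF k x gr0 v i).[s] - v s) * (phi i).[s]).
  by apply: bmfM => //; apply: bmfB; [exact: bmf_poly|exact: (bmf_sub x0 xb)].
rewrite -[LHS]addr0 -(PF_L2 bv iN (sp i iN)) -(I_D b1 b2); apply: eq_I => s si.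
by rewrite /err !(glueE _ mx iN si) hornerD hornerN; ring.
Qed.

Lemma pit_eq t phi : 0 <= t <= T -> (forall i, (i < N)%N -> (size (phi i) <= k.+1)%N) ->
  I 0 b (fun s => glue N x (pit t) s * glue N x phi s) =
  BB N b x (gt b (glue N x (uh S t))) (err N x (ur t) (dp (uh S t))) (jmp N x (uh S t) (u t b)) phi
  + I 0 b (fun s => SS N b x (u t) (ur t) (uh S t) s * glue N x phi s).
Proof. by move=> tT sp; rewrite -(err_eq b0 mx hS F tT sp) (pit_orth _ (bmf_ef_ut F tT)). Qed.

Lemma pit_local t i (v : {poly R}) : 0 <= t <= T -> (i < N)%N -> (size v <= k.+1)%N ->
  I (x i) (x i.+1) (fun s => (pit t i).[s] * v.[s]) =
  2^-1 * I (x i) (x i.+1) (fun s => gt b (glue N x (uh S t)) s * (ur t s - ((uh S t i)^`()).[s]) * v.[s])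
  - 2^-1 * (gt b (glue N x (uh S t)) (x i.+1) * jmp N x (uh S t) (u t b) i * v.[x i.+1])
  + I (x i) (x i.+1) (fun s => SS N b x (u t) (ur t) (uh S t) s * v.[s]).
Proof.
move=> tT iN sv; have G := ef_state F tT; have aU := adm_glue (uh S t) b0 mx.
pose phi j := if j == i then v else 0.
have sp j : (j < N)%N -> (size (phi j) <= k.+1)%N.
  by move=> jN; rewrite /phi; case: ifP => _ //; rewrite size_poly0.
have one (f : R -> R) : bmf 0 b f -> I 0 b (fun s => f s * glue N x phi s) = I (x i) (x i.+1) (fun s => f s * v.[s]).
  move=> bf; rewrite (I_glue mx)// (bigD1 (Ordinal iN))//= /phi eqxx big1 ?addr0// => j jn.
  rewrite -val_eqE /= in jn; rewrite (negbTE jn) (@eq_I _ _ _ _ (fun=> 0)).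
    by rewrite I_cst ?mul0r//; have [_ /ltW] := mN mx (ltn_ord j).
  by move=> s _; rewrite horner0 mulr0.
have := pit_eq tT sp; rewrite /BB !one.
- rewrite (bigD1 (Ordinal iN))//= {1}/phi eqxx [X in _ * (_ + X)]big1 ?addr0; last first.
    by move=> j jn; rewrite -val_eqE /= in jn; rewrite /phi (negbTE jn) horner0 mulr0.
  rewrite (@eq_I _ _ _ (fun s => glue N x (pit t) s * _) (fun s => (pit t i).[s] * v.[s])); last first.
    by move=> s si; rewrite (glueE _ mx iN si).
  rewrite (@eq_I _ _ _ (fun s => gt b _ s * err _ _ _ _ s * _)
     (fun s => gt b (glue N x (uh S t)) s * (ur t s - ((uh S t i)^`()).[s]) * v.[s])) //.
  by move=> s si; rewrite /err (glueE (dp (uh S t)) mx iN si).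
- exact: bmf_SS G.
- by apply: bmfM; [exact: bmf_gt|apply: bmf_err; exact: bmf_gs G].
- exact: bmf_glue.
Qed.

Definition Dk : R := dofC false k ^+ 2.

Lemma Dk_ge1 : 1 <= Dk.
Proof.
rewrite /Dk exprn_ege1// /dofC lerDl; apply: sumr_ge0 => i _; exact: sumr_ge0.
Qed.

(* A polynomial cannot concentrate near the right end of the element. *)
Lemma weighted_lower a c (q : {poly R}) : a < c -> (size q <= k.+1)%N ->
  I a c (fun s => q.[s] ^+ 2) / (4 * Dk) <= I a c (fun s => q.[s] ^+ 2 * ((c - s) / (c - a))).
Proof.
move=> ac sq; have D1 := Dk_ge1; have D0 : 0 < Dk := lt_le_trans ltr01 D1.
(* On the last fraction [e] of the element the sup bound leaves at most half of the L^2 mass; on the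
   rest the weight is at least [e]. *)
pose e := (2 * Dk)^-1; have e0 : 0 < e by rewrite invr_gt0 mulr_gt0.
have e1 : e <= 1.
  have D2 : 1 <= 2 * Dk by move: D1; lra.
  by rewrite /e -[leRHS]invr1 lef_pV2 ?posrE// mulr_gt0.
have ca : 0 < c - a by rewrite subr_gt0.
pose m := c - e * (c - a).
have am : a <= m by rewrite /m; have := ler_wpM2r (ltW ca) e1; move: (e * _) => y; lra.
have mc : m <= c by rewrite /m gerBl mulr_ge0 ?ltW.
have bq : bmf a c (fun s => q.[s] ^+ 2) by apply: bmfX; exact: bmf_poly.
have bw : bmf a c (fun s => (c - s) / (c - a)).
  by apply: bmfM; [apply: bmfB; [exact: bmf_cst|exact: bmf_id]|exact: bmf_cst].
have bqw := bmfM bq bw.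
set Q := I a c (fun s => q.[s] ^+ 2).
have Q0 : 0 <= Q by apply: I_ge0 => s _; exact: sqr_ge0.
have h1 : I m c (fun s => q.[s] ^+ 2) <= Q / 2.
  have -> : Q / 2 = (Dk / (c - a) * Q) * (c - m).
    by rewrite /m opprB addrCA subrr addr0 /e; field; rewrite !gt_eqF.
  rewrite -(I_cst _ mc); apply: le_I; [exact: (bmf_sub am (lexx c))|exact: bmf_cst|] => s /andP[s1 s2].
  by apply: (inverse_sup ac sq); rewrite (le_trans am (ltW s1)) ltW.
have h2 : Q = I a m (fun s => q.[s] ^+ 2) + I m c (fun s => q.[s] ^+ 2) := I_split am mc bq.
have h3 : 0 <= I m c (fun s => q.[s] ^+ 2 * ((c - s) / (c - a))).
  by apply: I_ge0 => s /andP[s1 s2]; rewrite mulr_ge0 ?sqr_ge0// divr_ge0 ?(ltW ca)// subr_ge0 ltW.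
have h4 : e * I a m (fun s => q.[s] ^+ 2) <= I a m (fun s => q.[s] ^+ 2 * ((c - s) / (c - a))).
  rewrite -I_Z; last exact: (bmf_sub (lexx a) mc).
  apply: le_I; [by apply: bmfZ; exact: (bmf_sub (lexx a) mc)|exact: (bmf_sub (lexx a) mc)|] => s /andP[s1 s2].
  rewrite mulrC ler_wpM2l ?sqr_ge0// ler_pdivlMr//.
  by rewrite /m in s2; move: (e * (c - a)) s2 => y; lra.
rewrite (I_split am mc bqw).
have -> : Q / (4 * Dk) = e * (Q / 2) by rewrite /e; field; rewrite gt_eqF.
have h5 : e * (Q / 2) <= e * I a m (fun s => q.[s] ^+ 2) by rewrite ler_pM2l//; lra.
by move: h3 h4 h5; move: (e * (Q / 2)) => y; lra.
Qed.

Definition cw : R := cl b K / (4 * Dk).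
Definition CQ : R := 12 / cw ^+ 2.
Definition W1 : R := 2 * CQ + 2.
Definition CX0 : R := W1 + 12 / cl b K ^+ 2 * (1 + W1).

Lemma cw_gt0 : 0 < cw.
Proof. by rewrite divr_gt0 ?cl_gt0// mulr_gt0// (lt_le_trans ltr01 Dk_ge1). Qed.

Lemma CQ_ge0 : 0 <= CQ. Proof. by rewrite divr_ge0 ?sqr_ge0. Qed.

Lemma W1_ge0 : 0 <= W1. Proof. by rewrite addr_ge0// mulr_ge0// CQ_ge0. Qed.

Lemma CX0_ge0 : 0 <= CX0.
Proof.
have w := W1_ge0; rewrite /CX0; move: W1 w => w w0.
by rewrite addr_ge0// mulr_ge0 ?addr_ge0// divr_ge0// sqr_ge0.
Qed.

Lemma I_sq_le a c f : a < c -> bmf a c f -> I a c f ^+ 2 <= (c - a) * I a c (fun s => f s ^+ 2).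
Proof.
move=> ac bf; have := I_CS bf (bmf_cst a c 1).
rewrite (@eq_I _ _ _ (fun s => f s * 1) f); last by move=> s _; rewrite mulr1.
rewrite (@eq_I _ _ _ (fun=> 1 ^+ 2) (fun=> 1)); last by move=> s _; rewrite expr1n.
by rewrite (I_cst _ (ltW ac)) mul1r mulrC.
Qed.

Definition ZZ t i : R := I (x i) (x i.+1) (fun s => (pit t i).[s] ^+ 2) + K ^+ 2 * hh x i ^+ 3
  + I (x i) (x i.+1) (fun s => SS N b x (u t) (ur t) (uh S t) s ^+ 2).

(** Two test functions are used. The derivative of the error with u_r frozen at the midpoint, times
    a weight vanishing at the right node, removes the jump term and yields the derivative; the
    constant 1 then yields the jump. Freezing u_r costs K^2 h_i^3. *)
Lemma recover_elt t i : 0 <= t <= T -> N2 b (del N x (u t) (uh S t)) <= 1 -> (i < N)%N ->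
  I (x i) (x i.+1) (fun s => (ur t s - ((uh S t i)^`()).[s]) ^+ 2)
  + jmp N x (uh S t) (u t b) i ^+ 2 / hh x i <= CX0 * ZZ t i.
Proof.
move=> tT A1 iN; have [x0 xi xb hi] := mN mx iN; have G := ef_state F tT.
have aU := adm_glue (uh S t) b0 mx.
have inn s : x i < s < x i.+1 -> 0 < s < b by exact: (mesh_itv_oo mx iN).
have sub f : bmf 0 b f -> bmf (x i) (x i.+1) f by exact: bmf_sub.
have bP (v : {poly R}) : bmf (x i) (x i.+1) (fun s => v.[s]) by exact: bmf_poly.
have loc (v : {poly R}) (sv : (size v <= k.+1)%N) := pit_local tT iN sv.
set a := gt b (glue N x (uh S t)) in loc; have ba : bmf (x i) (x i.+1) a by apply: sub; exact: bmf_gt.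
have ab s : 0 < s <= b -> cl b K <= a s <= 1 by exact: (gt_bd b0 mx K1 G A1).
have c0 : 0 < cl b K := cl_gt0 b K.
have aub s : x i < s < x i.+1 -> cl b K <= a s <= 1.
  by move=> /inn/andP[s0 s1]; apply: ab; rewrite s0 ltW.
have ax : cl b K <= a (x i.+1) <= 1 by apply: ab; rewrite xb (le_lt_trans x0 xi).
clearbody a; clear ab.
have bS : bmf (x i) (x i.+1) (SS N b x (u t) (ur t) (uh S t)) := sub _ (bmf_SS b0 mx (uh S t) G).
rewrite /ZZ; set sS := SS N b x (u t) (ur t) (uh S t) in loc bS *; clearbody sS.
pose m := (x i + x i.+1) / 2; have mi : x i < m < x i.+1 by rewrite /m; apply/andP; split; lra.
pose q : {poly R} := (ur t m)%:P - (uh S t i)^`().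
pose w : {poly R} := (hh x i)^-1 *: ((x i.+1)%:P - 'X).
have wE s : w.[s] = (x i.+1 - s) / hh x i by rewrite hornerZ hornerD hornerN hornerC hornerX mulrC.
have sq : (size q <= k)%N.
  rewrite (leq_trans (size_polyD _ _))// size_polyN geq_max (leq_trans (size_polyC_leq1 _))//=.
  have [p0|pn0] := eqVneq (uh S t i) 0; first by rewrite p0 deriv0 size_poly0.
  by rewrite -ltnS (leq_trans (lt_size_deriv pn0))//; have [] := hdg_P hS tT iN.
have sw : (size w <= 2)%N.
  rewrite (leq_trans (size_scale_leq _ _))// (leq_trans (size_polyD _ _))// size_polyN size_polyX.
  by rewrite geq_max (leq_trans (size_polyC_leq1 _)).
have sv : (size (q * w)%R <= k.+1)%N.
  rewrite (leq_trans (size_polyMleq _ _))// -ltnS; have := leq_add sq sw; rewrite addn2; by case: (size q + size w)%N.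
have vx : (q * w).[x i.+1] = 0 by rewrite hornerM wE subrr mul0r mulr0.
pose rho s := ur t s - ur t m.
have bur : bmf (x i) (x i.+1) (ur t) := sub _ (bmf_gs G).
have brho : bmf (x i) (x i.+1) rho by apply: bmfB => //; exact: bmf_cst.
have rhob s : x i < s < x i.+1 -> `|rho s| <= K * hh x i.
  move=> si; apply: le_trans (ef_url F tT (inn s si) (inn m mi)) _; rewrite ler_wpM2l//.
  rewrite /hh /m ler_norml; case/andP: si => s1 s2; apply/andP; split; lra.
have e'E s : ur t s - ((uh S t i)^`()).[s] = q.[s] + rho s.
  by rewrite /q /rho hornerD hornerN hornerC; ring.
have Irho : I (x i) (x i.+1) (fun s => rho s ^+ 2) <= K ^+ 2 * hh x i ^+ 3.
  have -> : K ^+ 2 * hh x i ^+ 3 = (K * hh x i) ^+ 2 * hh x i by ring.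
  rewrite -[X in _ <= _ * X]/(x i.+1 - x i) -(I_cst _ (ltW xi)).
  by apply: (I_le_sqr brho (bmf_cst _ _ (K * hh x i))).
set Q := I (x i) (x i.+1) (fun s => q.[s] ^+ 2).
set P := I (x i) (x i.+1) (fun s => (pit t i).[s] ^+ 2).
set E3 := I (x i) (x i.+1) (fun s => sS s ^+ 2).
have Q0 : 0 <= Q by apply: I_ge0 => s _; exact: sqr_ge0.
have P0 : 0 <= P by apply: I_ge0 => s _; exact: sqr_ge0.
have E0 : 0 <= E3 by apply: I_ge0 => s _; exact: sqr_ge0.
have Kh0 : 0 <= K ^+ 2 * hh x i ^+ 3 by rewrite mulr_ge0 ?sqr_ge0// exprn_ge0// ltW.
have Iv : I (x i) (x i.+1) (fun s => (q * w).[s] ^+ 2) <= Q.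
  apply: le_I; [by apply: bmfX|by apply: bmfX|] => s /andP[s1 s2].
  rewrite hornerM exprMn -[leRHS]mulr1 ler_wpM2l ?sqr_ge0// wE.
  have w0 : 0 <= (x i.+1 - s) / hh x i by rewrite divr_ge0 ?(ltW hi)// subr_ge0 ltW.
  by rewrite expr_le1// ler_pdivrMr// mul1r /hh lerD2l lerN2 ltW.
have young k0 f : 0 < k0 -> bmf (x i) (x i.+1) f ->
    I (x i) (x i.+1) (fun s => f s * (q * w).[s]) <= k0 * Q + (4 * k0)^-1 * I (x i) (x i.+1) (fun s => f s ^+ 2).
  move=> kp bf; rewrite (@eq_I _ _ _ _ (fun s => (q * w).[s] * f s)); last by move=> s _; rewrite mulrC.
  apply: le_trans (I_young kp (bP _) bf) _; rewrite lerD2r ler_pM2l//.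
have step1 : Q <= CQ * (P + K ^+ 2 * hh x i ^+ 3 + E3).
  have sq1 : (size q <= k.+1)%N by rewrite ltnW.
  have wl := weighted_lower xi sq1.
  have := loc _ sv; rewrite vx mulr0 mulr0 subr0 => eq1.
  have bq2 : bmf (x i) (x i.+1) (fun s => a s * (q.[s] * (q * w).[s])) by apply: bmfM => //; exact: bmfM.
  have br2 : bmf (x i) (x i.+1) (fun s => a s * rho s * (q * w).[s]) by apply: bmfM => //; exact: bmfM.
  have eq2 : I (x i) (x i.+1) (fun s => a s * (ur t s - ((uh S t i)^`()).[s]) * (q * w).[s]) =
    I (x i) (x i.+1) (fun s => a s * (q.[s] * (q * w).[s])) + I (x i) (x i.+1) (fun s => a s * rho s * (q * w).[s]).
    by rewrite -(I_D bq2 br2); apply: eq_I => s _; rewrite e'E; ring.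
  have low : cw * Q <= I (x i) (x i.+1) (fun s => a s * (q.[s] * (q * w).[s])).
    apply: (@le_trans _ _ (cl b K * I (x i) (x i.+1) (fun s => q.[s] ^+ 2 * ((x i.+1 - s) / (x i.+1 - x i))))).
      by rewrite /cw mulrAC -mulrA ler_pM2l.
    have bqw : bmf (x i) (x i.+1) (fun s => q.[s] ^+ 2 * ((x i.+1 - s) / (x i.+1 - x i))).
      apply: bmfM; first by apply: bmfX.
      by apply: bmfM; [apply: bmfB; [exact: bmf_cst|exact: bmf_id]|exact: bmf_cst].
    rewrite -I_Z//; apply: le_I; [exact: bmfZ|by []|] => s si.
    have /andP[a1 a2] := aub s si; case/andP: si => s1 s2.
    have -> : q.[s] * (q * w).[s] = q.[s] ^+ 2 * ((x i.+1 - s) / (x i.+1 - x i)) by rewrite hornerM wE expr2 -mulrA.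
    rewrite ler_wpM2r//.
    by rewrite mulr_ge0 ?sqr_ge0// divr_ge0 ?(ltW hi)// subr_ge0 ltW.
  (* Three Young inequalities, each giving up [cw / 12] of [Q], leave half of [cw * Q] on the
     left. *)
  have cw0 := cw_gt0; have k0p : 0 < cw / 12 by rewrite divr_gt0.
  have y1 := young (cw / 12) _ k0p (bP (pit t i)).
  have bar : bmf (x i) (x i.+1) (fun s => - (a s * rho s)) by apply: bmfN; exact: bmfM.
  have y2 := young (cw / 12) _ k0p bar.
  have y3 := young (cw / 12) _ k0p (bmfN bS).
  have n2 : I (x i) (x i.+1) (fun s => - (a s * rho s) * (q * w).[s]) = - I (x i) (x i.+1) (fun s => a s * rho s * (q * w).[s]).
    by rewrite -I_N//; apply: eq_I => s _; rewrite mulNr.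
  have n3 : I (x i) (x i.+1) (fun s => - sS s * (q * w).[s]) = - I (x i) (x i.+1) (fun s => sS s * (q * w).[s]).
    by rewrite -I_N; [apply: eq_I => s _; rewrite mulNr|exact: bmfM].
  have m2 : I (x i) (x i.+1) (fun s => (- (a s * rho s)) ^+ 2) <= K ^+ 2 * hh x i ^+ 3.
    apply: le_trans Irho; apply: le_I; [exact: bmfX|exact: bmfX|] => s si.
    have /andP[a1 a2] := aub s si.
    rewrite sqrrN exprMn -[leRHS]mul1r ler_wpM2r ?sqr_ge0// expr_le1// (le_trans _ a1)// ltW//; exact: cl_gt0.
  have m3 : I (x i) (x i.+1) (fun s => (- sS s) ^+ 2) = E3 by apply: eq_I => s _; rewrite sqrrN.
  rewrite n2 in y2; rewrite n3 m3 in y3; rewrite -/P in y1.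
  have {}y2 := le_trans y2 (lerD (lexx _) (ler_wpM2l _ m2)).
  have i0 : 0 <= (4 * (cw / 12))^-1 by rewrite invr_ge0 mulr_ge0// ltW.
  have {}y2 := y2 i0.
  have key : cw * Q <= 12 * (cw / 12) * Q / 2 + (4 * (cw / 12))^-1 * 2 * (P + K ^+ 2 * hh x i ^+ 3 + E3).
    move: eq1 eq2 low y1 y2 y3.
    have : 0 <= cw * Q by rewrite mulr_ge0 ?(ltW cw0).
    have : 0 <= (4 * (cw / 12))^-1 * (K ^+ 2 * hh x i ^+ 3) by rewrite mulr_ge0.
    move: (I _ _ _) (I _ _ _) (I _ _ _) (I _ _ _) (I _ _ _) => z1 z2 z3 z4 z5.
    move: (4 * (cw / 12))^-1 (K ^+ 2 * _) => z6 z7.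
    move: (cw) => z8; lra.
  have e12 : 12 * (cw / 12) * Q / 2 = cw * Q / 2 by field.
  have e13 : (4 * (cw / 12))^-1 * 2 = 6 / cw by field; rewrite gt_eqF.
  rewrite e12 e13 in key.
  have key2 : cw * Q <= 12 / cw * (P + K ^+ 2 * hh x i ^+ 3 + E3).
    by move: key; move: (P + _ + E3) (cw * Q) => y z2; move: (cw^-1) => z1; lra.
  have -> : CQ * (P + K ^+ 2 * hh x i ^+ 3 + E3) = (12 / cw * (P + K ^+ 2 * hh x i ^+ 3 + E3)) / cw.
    by rewrite /CQ; field; rewrite gt_eqF.
  by rewrite ler_pdivlMr// mulrC.
set Z := P + K ^+ 2 * hh x i ^+ 3 + E3 in step1 *.
set E' := I (x i) (x i.+1) (fun s => (ur t s - ((uh S t i)^`()).[s]) ^+ 2).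
have bE : bmf (x i) (x i.+1) (fun s => ur t s - ((uh S t i)^`()).[s]) by exact: bmfB.
have E'0 : 0 <= E' by apply: I_ge0 => s _; exact: sqr_ge0.
have Z0 : 0 <= Z by rewrite !addr_ge0.
have step2 : E' <= W1 * Z.
  rewrite /E' (@eq_I _ _ _ _ (fun s => (q.[s] + rho s) ^+ 2)); last by move=> s _; rewrite e'E.
  apply: le_trans (I_sqrD (bP q) brho) _.
  have -> : W1 * Z = 2 * (CQ * Z) + 2 * Z by rewrite /W1; ring.
  have hZ : I (x i) (x i.+1) (fun s => rho s ^+ 2) <= Z.
    by rewrite (le_trans Irho)// /Z addrAC lerDr addr_ge0.
  by apply: lerD; rewrite ler_pM2l.
set J := jmp N x (uh S t) (u t b) i.
have step3 : J ^+ 2 / hh x i <= 12 / cl b K ^+ 2 * (Z + E').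
  have s1 : (size (1%:P : {poly R}) <= k.+1)%N by rewrite size_polyC (leq_trans (leq_b1 _)).
  have := loc _ s1; rewrite hornerC mulr1 => eq1.
  have bpt := bP (pit t i); have bae : bmf (x i) (x i.+1) (fun s => a s * (ur t s - ((uh S t i)^`()).[s])) by exact: bmfM.
  have m1 (f : R -> R) : I (x i) (x i.+1) (fun s => f s * (1%:P : {poly R}).[s]) = I (x i) (x i.+1) f.
    by apply: eq_I => s _; rewrite hornerC mulr1.
  rewrite (m1 (fun s => (pit t i).[s])) (m1 (fun s => a s * (ur t s - ((uh S t i)^`()).[s]))) (m1 sS) in eq1.
  have q1 := I_sq_le xi bpt; have q2 := I_sq_le xi bae; have q3 := I_sq_le xi bS.
  rewrite -/(hh x i) -/P in q1; rewrite -/(hh x i) in q2; rewrite -/(hh x i) -/E3 in q3.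
  have q4 : I (x i) (x i.+1) (fun s => (a s * (ur t s - ((uh S t i)^`()).[s])) ^+ 2) <= E'.
    apply: le_I; [exact: bmfX|exact: bmfX|] => s si; have /andP[a1 a2] := aub s si.
    rewrite exprMn -[leRHS]mul1r ler_wpM2r ?sqr_ge0// expr_le1// (le_trans _ a1)// ltW//; exact: cl_gt0.
  have {}q2 := le_trans q2 (ler_wpM2l (ltW hi) q4).
  move: eq1 q1 q2 q3; rewrite -/J.
  move: (I _ _ _) (I _ _ _) (I _ _ _) => z1 z2 z3 eq1 q1 q2 q3.
  have eJ : a (x i.+1) * J = 2 * (z1 - z3) + z2 by move: eq1; move: (a _ * J) => y; lra.
  have qJ : (a (x i.+1) * J) ^+ 2 <= 12 * (z1 ^+ 2 + z3 ^+ 2 + z2 ^+ 2).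
    rewrite eJ; have := sqr_ge0 (z1 + z3); have := sqr_ge0 (2 * z3 + z2); have := sqr_ge0 (2 * z1 - z2).
    by have := sqr_ge0 z2; nra.
  have qJ2 : cl b K ^+ 2 * J ^+ 2 <= 12 * (hh x i * (Z + E')).
    apply: (@le_trans _ _ ((a (x i.+1) * J) ^+ 2)).
      rewrite exprMn ler_wpM2r ?sqr_ge0// lerXn2r ?nnegrE ?(ltW c0)//; first by rewrite (le_trans (ltW c0))//; case/andP: ax.
      by case/andP: ax.
    apply: le_trans qJ _; rewrite ler_pM2l//.
    have : 0 <= hh x i * (K ^+ 2 * hh x i ^+ 3) by rewrite mulr_ge0// ltW.
    by rewrite /Z !mulrDr; move: q1 q2 q3; move: (hh x i * _) (hh x i * _) (hh x i * _) (hh x i * _) => *; lra.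
  rewrite ler_pdivrMr//.
  have -> : 12 / cl b K ^+ 2 * (Z + E') * hh x i = 12 * (hh x i * (Z + E')) / cl b K ^+ 2 by field; rewrite gt_eqF.
  by rewrite ler_pdivlMr ?exprn_gt0// mulrC.
have cl2 : 0 <= 12 / cl b K ^+ 2 by rewrite divr_ge0 ?sqr_ge0.
have h4 := le_trans step3 (ler_wpM2l cl2 (lerD (lexx Z) step2)).
have -> : CX0 * Z = W1 * Z + 12 / cl b K ^+ 2 * (Z + W1 * Z) by rewrite /CX0; ring.
exact: lerD.
Qed.

Lemma sum_hh3 : \sum_(i < N) hh x i ^+ 3 <= b * h ^+ 2.
Proof.
rewrite -(sum_hh mx) mulr_suml; apply: ler_sum => i _; have [_ _ _ hi] := mN mx (ltn_ord i).
rewrite exprS ler_pM2l//; have := hh_h x (ltn_ord i) => hih.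
by rewrite lerXn2r ?nnegrE ?(ltW hi) ?(ltW h0).
Qed.

Lemma N2_err_sum v p : bmf 0 b v ->
  N2 b (err N x v p) = \sum_(i < N) I (x i) (x i.+1) (fun s => (v s - (p i).[s]) ^+ 2).
Proof.
move=> bv; rewrite /N2 (I_mesh mx); last by apply: bmfX; exact: bmf_err.
by apply: eq_bigr => i _; apply: eq_I => s si; rewrite /err (glueE p mx (ltn_ord i) si).
Qed.

Definition CR : R := CX0 * (1 + K ^+ 2 * b + 2 * CS b K).

(** Sum of the local recoveries: the freezing errors add up to order h^2, and the coefficient term
    is controlled by the L^2 error. *)
Lemma XX_recovery t : 0 <= t <= T -> N2 b (del N x (u t) (uh S t)) <= 1 ->
  XX N b x (ur t) (uh S t) (u t b) <=
  CR * (N2 b (glue N x (pit t)) + h ^+ 2 + N2 b (err N x (u t) (uh S t))).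
Proof.
move=> tT A1; have G := ef_state F tT.
have bS := bmf_SS b0 mx (uh S t) G.
rewrite /XX (N2_err_sum _ (bmf_gs G)) -big_split /=.
apply: le_trans (ler_sum _ (fun (i : 'I_N) (_ : true) => recover_elt tT A1 (ltn_ord i))) _.
rewrite -mulr_sumr /CR -mulrA; apply: ler_wpM2l; first exact: CX0_ge0.
rewrite /ZZ !big_split /= -(N2_glue mx) -mulr_sumr -(I_mesh mx (bmfX 2 bS)) -/(N2 b _).
have n1 : N2 b (SS N b x (u t) (ur t) (uh S t)) <= 2 * CS b K * N2 b (err N x (u t) (uh S t)).
  apply: le_trans (N2_SS b0 mx K1 G A1) _; apply: ler_wpM2l (N2_dVV_le_err mx (uh S t) G).
  by rewrite mulr_ge0// CS_ge0.
have n2 : K ^+ 2 * (\sum_(i < N) hh x i ^+ 3) <= K ^+ 2 * b * h ^+ 2.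
  by rewrite -mulrA ler_wpM2l ?sqr_ge0// sum_hh3.
have p1 := N2_ge0 b (glue N x (pit t)); have p2 := N2_ge0 b (err N x (u t) (uh S t)).
have p3 : 0 <= h ^+ 2 by exact: sqr_ge0.
have p4 : 0 <= K ^+ 2 * b by rewrite mulr_ge0 ?sqr_ge0 ?(ltW b0).
have p5 : 0 <= CS b K := CS_ge0 K b0.
move: (N2 b _) (N2 b _) (N2 b _) (h ^+ 2) (K ^+ 2 * b) (CS b K) (K ^+ 2 * _) n1 n2 p1 p2 p3 p4 p5.
move=> y1 y2 y3 y4 y5 y6 y7 n1 n2 p1 p2 p3 p4 p5.
have q1 : 0 <= y5 * y1 by rewrite mulr_ge0. have q2 : 0 <= y6 * y1 by rewrite mulr_ge0.
have q3 : 0 <= y5 * y2 by rewrite mulr_ge0. have q4 : 0 <= y6 * y4 by rewrite mulr_ge0.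
by lra.
Qed.

(** Only the size of [a] is used, no sign. The squared trace of [phi] costs 1/h_i by the inverse
    inequality, which the weight 1/h_i of the squared jumps compensates. *)
Lemma BB_small a e' J phi d : 0 <= d -> bmf 0 b a -> bmf 0 b e' ->
  (forall s, 0 < s <= b -> `|a s| <= d) -> (forall i, (i < N)%N -> (size (phi i) <= k.+1)%N) ->
  BB N b x a e' J phi <= 4^-1 * N2 b (glue N x phi) + 2^-1 * (Dk * (d ^+ 2 *
    (N2 b e' + \sum_(i < N) J i ^+ 2 / hh x i))).
Proof.
move=> d0 ba be ab sp; have bp := bmf_glue 0 b N x phi.
have h4 : (0 : R) < 4^-1 by rewrite invr_gt0.
set P := N2 b (glue N x phi).
have y1 : I 0 b (fun s => a s * e' s * glue N x phi s) <= 4^-1 * P + d ^+ 2 * N2 b e'.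
  rewrite (@eq_I _ _ _ _ (fun s => glue N x phi s * (a s * e' s))); last by move=> s _; rewrite mulrC.
  apply: le_trans (I_young h4 bp (bmfM ba be)) _; rewrite lerD2l.
  have -> : (4 * 4^-1)^-1 = 1 :> R by field.
  rewrite mul1r -(N2_Z _ be); apply: le_I; [apply: bmfX; exact: bmfM|apply: bmfX; exact: bmfZ|] => s /andP[s0 sb].
  have as_ : `|a s| <= d by apply: ab; rewrite s0 ltW.
  by rewrite !exprMn ler_wpM2r ?sqr_ge0// -[a s ^+ 2]real_normK ?num_real// lerXn2r ?nnegrE.
have y2 : - \sum_(i < N) a (x i.+1) * J i * (phi i).[x i.+1] <=
    Dk * (d ^+ 2 * \sum_(i < N) J i ^+ 2 / hh x i) + 4^-1 * P.
  rewrite /P (N2_glue mx) !mulr_sumr -big_split -sumrN; apply: ler_sum => i _ /=.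
  have iN := ltn_ord i; have [x0 xi xb hi] := mN mx iN.
  have ai : `|a (x i.+1)| <= d by apply: ab; rewrite xb (le_lt_trans x0 xi).
  have inv := inverse_sup (s := x i.+1) xi (sp i iN); rewrite lexx (ltW xi) -/(hh x i) -/Dk in inv.
  have {}inv := inv isT.
  have D0 : 0 < Dk := lt_le_trans ltr01 Dk_ge1.
  move: (J i) (phi i).[_] (I _ _ _) (a _) ai inv => Ji v y A A1' inv.
  have inv2 : hh x i * v ^+ 2 / Dk <= y.
    rewrite ler_pdivrMr//; move: inv; rewrite mulrAC ler_pdivlMr//.
    by rewrite mulrC [y * _]mulrC.
  have s1 : - (A * Ji * v) <= d * `|Ji| * `|v|.
    by rewrite (le_trans (ler_norm _))// normrN !normrM ler_wpM2r// ler_wpM2r.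
  have s2 : d * `|Ji| * `|v| <= Dk * (d ^+ 2 * (Ji ^+ 2 / hh x i)) + 4^-1 * (hh x i * v ^+ 2 / Dk).
    have := sqr_ge0 (2 * Dk * (d * `|Ji|) - hh x i * `|v|).
    rewrite -[Ji ^+ 2]real_normK ?num_real// -[v ^+ 2]real_normK ?num_real//.
    move: (`|Ji|) (`|v|) => j w.
    have -> : Dk * (d ^+ 2 * (j ^+ 2 / hh x i)) + 4^-1 * (hh x i * w ^+ 2 / Dk) =
      d * j * w + (2 * Dk * (d * j) - hh x i * w) ^+ 2 / (4 * Dk * hh x i) by field; rewrite !gt_eqF.
    by move=> q; rewrite lerDl divr_ge0// mulr_ge0 ?(ltW hi)// mulr_ge0// ltW.
  by move: s1 s2 inv2; move: (_ * _ * `|v|) (Dk * _) (_ / Dk) => *; lra.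
have m0 : 0 <= d ^+ 2 * N2 b e' by rewrite mulr_ge0 ?sqr_ge0 ?N2_ge0.
have y3 := ler_wpM2r m0 Dk_ge1; rewrite mul1r in y3.
rewrite /BB [d ^+ 2 * _]mulrDr [Dk * _]mulrDr; move: y1 y2 y3.
have real5 (z1 z2 z3 z4 z5 z6 : R) : z1 <= 4^-1 * z6 + z2 -> - z3 <= z4 + 4^-1 * z6 -> z2 <= z5 ->
  2^-1 * z1 - 2^-1 * z3 <= 4^-1 * z6 + 2^-1 * (z5 + z4) by lra.
exact: real5.
Qed.

Definition CB : R := 1 + Dk + 128 * CS b K * b ^+ 2.

Lemma CB_ge0 : 0 <= CB.
Proof.
have d := le_trans ler01 Dk_ge1; have c := CS_ge0 K b0; rewrite /CB; move: (Dk) d (CS b K) c => *.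
by rewrite !addr_ge0// mulr_ge0 ?sqr_ge0// mulr_ge0.
Qed.

Lemma XX_ge0 f' p ub : 0 <= XX N b x f' p ub.
Proof.
apply: addr_ge0; first exact: N2_ge0.
by apply: sumr_ge0 => i _; rewrite divr_ge0 ?sqr_ge0//; have [_ _ _ /ltW] := mN mx (ltn_ord i).
Qed.

(** A converse of the recovery; it serves at time 0, where it starts the estimate of the time
    derivative. *)
Lemma N2_pit_le_XX t : 0 <= t <= T -> N2 b (del N x (u t) (uh S t)) <= 1 ->
  N2 b (glue N x (pit t)) <= CB * XX N b x (ur t) (uh S t) (u t b).
Proof.
move=> tT A1; have G := ef_state F tT; have aU := adm_glue (uh S t) b0 mx.
have bS := bmf_SS b0 mx (uh S t) G.
have bp := bmf_glue 0 b N x (pit t).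
have sp i : (i < N)%N -> (size (pit t i) <= k.+1)%N by exact: size_pit.
have := pit_eq tT sp; rewrite -(@eq_I _ _ _ (fun s => glue N x (pit t) s ^+ 2)); last by move=> s _; rewrite expr2.
rewrite -/(N2 b _); set P := N2 b (glue N x (pit t)).
set a := gt b (glue N x (uh S t)); set e' := err N x (ur t) (dp (uh S t)).
have be' : bmf 0 b e' by apply: bmf_err; exact: bmf_gs G.
have y1 : BB N b x a e' (jmp N x (uh S t) (u t b)) (pit t) <=
    4^-1 * P + 2^-1 * (Dk * (1 ^+ 2 * XX N b x (ur t) (uh S t) (u t b))).
  apply: BB_small => //; first exact: bmf_gt.
  move=> s sb; have /andP[a1 a2] := gt_bd b0 mx K1 G A1 sb.
  by rewrite ger0_norm// (le_trans _ a1)// ltW// cl_gt0.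
have h4 : (0 : R) < 4^-1 by rewrite invr_gt0.
have y3 : I 0 b (fun s => SS N b x (u t) (ur t) (uh S t) s * glue N x (pit t) s) <= 4^-1 * P + N2 b (SS N b x (u t) (ur t) (uh S t)).
  rewrite (@eq_I _ _ _ _ (fun s => glue N x (pit t) s * SS N b x (u t) (ur t) (uh S t) s)); last by move=> s _; rewrite mulrC.
  apply: le_trans (I_young h4 bp bS) _; rewrite lerD2l.
  have -> : (4 * 4^-1)^-1 = 1 :> R by field.
  by rewrite mul1r.
have n1 : N2 b (SS N b x (u t) (ur t) (uh S t)) <= 2 * CS b K * (b ^+ 2 * (32 * XX N b x (ur t) (uh S t) (u t b))).
  apply: le_trans (N2_SS b0 mx K1 G A1) _; apply: ler_wpM2l; first by rewrite mulr_ge0// CS_ge0.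
  apply: le_trans (N2_dVV_le_del b0 mx (uh S t) G) _; rewrite ler_wpM2l ?sqr_ge0//.
  exact: (N2_del_le_XX b0 mx _ G).
have x0 := XX_ge0 (ur t) (uh S t) (u t b).
rewrite /CB; move: y1 y3 n1 x0; rewrite expr1n mul1r.
move: (BB _ _ _ _ _ _ _) (I _ _ _) (N2 b (SS _ _ _ _ _ _)) (P) (XX _ _ _ _ _ _) => z1 z2 z3 z4 z5 y1 y3 n1 x0 eq.
have -> : (1 + Dk + 128 * CS b K * b ^+ 2) * z5 = z5 + Dk * z5 + 2 * (2 * CS b K * (b ^+ 2 * (32 * z5))) by ring.
by move: y1 y3 n1 eq; move: (Dk * z5) (2 * CS b K * _) => *; lra.
Qed.

End Recovery.

Lemma avg_cmp4 {R : realType} (b c : R) (g1 g2 g3 g4 : R -> R) (s : R) :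
  bmf 0 b g1 -> bmf 0 b g2 -> bmf 0 b g3 -> bmf 0 b g4 ->
  (forall s, 0 <= s <= b -> `|(g2 s - g4 s) - (g1 s - g3 s)| <= c) -> 0 < s <= b ->
  `|(avg g2 s - avg g4 s) - (avg g1 s - avg g3 s)| <= c.
Proof.
move=> b1 b2 b3 b4 H /andP[s0 sb]; have s0b : 0 <= s <= b by rewrite ltW.
rewrite -(avg_B s0b b2 b4) -(avg_B s0b b1 b3) -(avg_B s0b (bmfB b2 b4) (bmfB b1 b3)).
apply: (avg_bound (bmfB (bmfB b2 b4) (bmfB b1 b3))); last by rewrite s0.
by move=> r /andP[r0 rb]; apply: H; rewrite !ltW.
Qed.

(** The six products in the second difference of [SS]. The factors [z11] and [z12] stand for [ddif]
    and [del], which are controlled in L^2 only and are therefore kept. *)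
Lemma six_terms {R : realFieldType} (z1 z2 z3 z4 z5 z6 z7 z8 z9 z10 z11 z12 D g K C th : R) :
  0 <= g -> 0 <= D ->
  `|z1| <= D -> `|z2| <= g -> `|z4| <= K -> `|z3| <= K * th -> `|z5| <= 2 * D -> `|z6| <= 2 * g ->
  `|z10| <= K -> `|z9| <= K * th -> 0 <= z8 -> z8 <= C -> `|z7| <= 2 * (D + K * th) ->
  `|2^-1 * (z1 * z4 + z2 * z3 + z5 * z10 + z6 * z9 + z8 * z11 + z7 * z12)| <=
  (3 * K / 2 * D + 3 * K / 2 * th * g) + (C / 2 * `|z11| + (D + K * th) * `|z12|).
Proof.
move=> g0 D0 q1 q2 q3 q4 q5 q6 q7 q8 q9 q10 q11.
have B1 : `|z1 * z4| <= D * K by rewrite normrM ler_pM.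
have B2 : `|z2 * z3| <= g * (K * th) by rewrite normrM ler_pM.
have B3 : `|z5 * z10| <= 2 * D * K by rewrite normrM ler_pM.
have B4 : `|z6 * z9| <= 2 * g * (K * th) by rewrite normrM ler_pM.
have B5 : `|z8 * z11| <= C * `|z11| by rewrite normrM (ger0_norm q9) ler_wpM2r.
have B6 : `|z7 * z12| <= 2 * (D + K * th) * `|z12| by rewrite normrM ler_wpM2r.
rewrite normrM gtr0_norm ?invr_gt0//.
have := ler_normD (z1 * z4 + z2 * z3 + z5 * z10 + z6 * z9 + z8 * z11) (z7 * z12).
have := ler_normD (z1 * z4 + z2 * z3 + z5 * z10 + z6 * z9) (z8 * z11).
have := ler_normD (z1 * z4 + z2 * z3 + z5 * z10) (z6 * z9).
have := ler_normD (z1 * z4 + z2 * z3) (z5 * z10).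
have := ler_normD (z1 * z4) (z2 * z3).
have : 0 <= `|z1 * z4 + z2 * z3 + z5 * z10 + z6 * z9 + z8 * z11 + z7 * z12| by [].
lra.
Qed.

Lemma DSS_square_bound {R : realFieldType} (b K2 t M CD e n y C c c1 c2 d D Y : R) :
  0 <= b -> 0 <= K2 -> 0 <= t -> 0 <= M -> 0 <= CD -> 0 <= e -> 0 <= y -> e <= 1 ->
  c ^+ 2 <= 2 * c1 ^+ 2 + 2 * c2 ^+ 2 -> 2 * c1 ^+ 2 = 9 / 2 * K2 * D ^+ 2 ->
  2 * c2 ^+ 2 = 9 / 2 * K2 * (t * (n * M)) -> d ^+ 2 <= 2 * D ^+ 2 + 2 * (K2 * t) ->
  D ^+ 2 <= CD * (y + t * e) -> n <= b ^+ 2 * e ->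
  Y <= 2 * ((C / 2) ^+ 2 * y) + 2 * (d ^+ 2 * e) ->
  2 * (c ^+ 2 * b) + 2 * Y <=
  ((9 * K2 * b + 8) * CD + 9 * K2 * b * (b ^+ 2 * M) + C ^+ 2 + 8 * K2) * (y + t * e).
Proof.
move=> b0 K0 t0 M0 CD0 e0 y0 e1 hc hc1 hc2 hd hD hn hY.
have [te0 Kb0] : 0 <= t * e /\ 0 <= K2 * b by rewrite !mulr_ge0.
have s1 : c ^+ 2 * b <= (9 / 2 * K2 * D ^+ 2 + 9 / 2 * K2 * (t * (n * M))) * b.
  by rewrite ler_wpM2r// -hc1 -hc2.
have s2 : d ^+ 2 * e <= 2 * D ^+ 2 + 2 * (K2 * (t * e)).
  apply: le_trans (ler_wpM2r e0 hd) _.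
  by have := ler_wpM2l (sqr_ge0 D) e1; move: (D ^+ 2) => D2; lra.
have s3 : (9 * (K2 * b) + 8) * D ^+ 2 <= (9 * (K2 * b) + 8) * (CD * (y + t * e)).
  by apply: ler_wpM2l => //; lra.
have s4 : 9 * (K2 * b) * (t * M) * n <= 9 * (K2 * b) * (t * M) * (b ^+ 2 * e).
  by apply: ler_wpM2l => //; rewrite !mulr_ge0.
have s5 : 0 <= 9 * (K2 * b) * (b ^+ 2 * M) * y by rewrite !mulr_ge0 ?sqr_ge0.
have s6 : 0 <= C ^+ 2 * (t * e) by rewrite mulr_ge0 ?sqr_ge0.
have s7 : 0 <= K2 * y by rewrite mulr_ge0.
move: s1 s2 s3 s4 hY; lra.
Qed.

(** * Coefficient errors compared at two times *)

Section Pair.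
Context {R : realType}.
Variables (N : nat) (b K th : R) (x : nat -> R) (f1 f1' f2 f2' : R -> R) (p1 p2 : nat -> {poly R}).
Hypotheses (b0 : 0 < b) (K1 : 1 <= K) (th0 : 0 <= th) (mx : mesh b N x).
Hypotheses (G1 : gstate b K f1 f1') (G2 : gstate b K f2 f2').
Hypothesis mix : forall r s, 0 <= r <= b -> 0 <= s <= b ->
  `|(f2 r - f1 r) - (f2 s - f1 s)| <= K * th * `|r - s|.
Hypothesis hg : forall s, 0 <= s <= b -> `|gg b f2 s - gg b f1 s| <= K * th.
Hypothesis hf' : forall s, 0 < s < b -> `|f2' s - f1' s| <= K * th.
Hypotheses (A1 : N2 b (del N x f1 p1) <= 1) (A2 : N2 b (del N x f2 p2) <= 1).
Implicit Types (s r : R).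

Let U1 := glue N x p1.
Let U2 := glue N x p2.
Let a1 : adm b f1 := gs_adm G1.
Let a2 : adm b f2 := gs_adm G2.
Let aU1 : adm b U1 := adm_glue p1 b0 mx.
Let aU2 : adm b U2 := adm_glue p2 b0 mx.
Let K0 : 0 <= K. Proof. exact: le_trans ler01 K1. Qed.

Definition dif s := VV f1 s - VV (glue N x p1) s.
Definition ddif s := (VV f2 s - VV (glue N x p2) s) - (VV f1 s - VV (glue N x p1) s).
Definition M3 : R := 8 * (K ^+ 2 * b) + 2.
Definition M4 : R := 8 * (K ^+ 2 * b) + 8 * CG b K.
(** A bound on the difference of the exact and discrete [GG] that depends on neither mesh nor time;
    its exponential is the constant in [gg_cmp4]. *)
Definition m0 : R := Num.sqrt (b ^+ 2 * M3).
(** From [GG_cmp4]: [M4] bounds the quotient factor that multiplies [ddif], and [(K * th) ^+ 2 * b]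
    the time difference of the exact quotient. *)
Definition cD : R := Num.sqrt (2 * N2 b ddif * M4 + 8 * N2 b dif * ((K * th) ^+ 2 * b)).
(* Bounds the change of g - g_h between the two states. *)
Definition Delta : R := expR m0 * (cD + K * th * gerr N b K x f1 p1).
Definition M5 : R := 2 * M4 + 8 * (K ^+ 2 * b) + K ^+ 2 * M3.
Definition CDl : R := 2 * expR m0 ^+ 2 * M5.

Lemma Kb_ge0 : 0 <= K ^+ 2 * b. Proof. by rewrite mulr_ge0 ?sqr_ge0 ?(ltW b0). Qed.

Lemma M3_ge0 : 0 <= M3. Proof. by rewrite addr_ge0// mulr_ge0// Kb_ge0. Qed.

Lemma M4_ge0 : 0 <= M4.
Proof. by apply: addr_ge0; apply: mulr_ge0 => //; [exact: Kb_ge0|exact: CG_ge0]. Qed.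

Lemma M5_ge0 : 0 <= M5.
Proof.
apply: addr_ge0; first apply: addr_ge0.
- by apply: mulr_ge0 => //; exact: M4_ge0.
- by apply: mulr_ge0 => //; exact: Kb_ge0.
- by apply: mulr_ge0; [exact: sqr_ge0|exact: M3_ge0].
Qed.

Lemma CDl_ge0 : 0 <= CDl.
Proof. by apply: mulr_ge0; [rewrite mulr_ge0 ?sqr_ge0|exact: M5_ge0]. Qed.

Lemma cD_sqr : cD ^+ 2 = 2 * N2 b ddif * M4 + 8 * N2 b dif * ((K * th) ^+ 2 * b).
Proof.
rewrite sqr_sqrtr//; apply: addr_ge0; apply: mulr_ge0.
- by rewrite mulr_ge0 ?N2_ge0.
- exact: M4_ge0.
- by rewrite mulr_ge0 ?N2_ge0.
- by rewrite mulr_ge0 ?sqr_ge0 ?(ltW b0).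
Qed.

(** The mixed Lipschitz bound makes the time difference of u - u~ small in both variables; the
    factor s is what the quotient [QQ] consumes. *)
Lemma DVV s : 0 < s <= b -> `|VV f2 s - VV f1 s| <= K * th * s.
Proof.
move=> sb; have /andP[s0 sb'] := sb.
have s0b : 0 <= s <= b by rewrite ltW.
rewrite -(VV_B s0b a2.1 a1.1).
have bd := bmfB a2.1 a1.1.
have H r : 0 < r < s -> `|(f2 s - f1 s) - (f2 r - f1 r)| <= K * th * s.
  move=> /andP[r0 rs]; apply: le_trans (mix s0b _) _; first by rewrite ltW//= ltW// (lt_le_trans rs).
  by rewrite ler_wpM2l ?mulr_ge0// gtr0_norm ?subr_gt0//; lra.
rewrite /VV ler_norml; apply/andP; split.
  rewrite lerNl opprB lerBlDr; apply: (avg_le sb bd) => r /H.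
  by rewrite ler_norml; lra.
rewrite lerBlDr -lerBlDl; apply: (avg_ge sb bd) => r /H.
by rewrite ler_norml; lra.
Qed.

Lemma DQQ s : 0 < s <= b -> `|QQ f2 s - QQ f1 s| <= K * th.
Proof.
move=> sb; have /andP[s0 _] := sb.
by rewrite /QQ -mulrBl normrM normfV (gtr0_norm s0) ler_pdivrMr// DVV.
Qed.

Lemma gerr_m0 f f' p : gstate b K f f' -> N2 b (del N x f p) <= 1 -> gerr N b K x f p <= m0.
Proof.
move=> G A; rewrite /gerr /m0 ler_sqrt; last by rewrite mulr_ge0 ?sqr_ge0 ?M3_ge0.
rewrite ler_wpM2r ?M3_ge0//; apply: le_trans (N2_dVV_le_del b0 mx p G) _.
by rewrite ler_piMr ?sqr_ge0.
Qed.

Lemma gg_D s : 0 <= s <= b ->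
  `|(gg b f2 s - gg b U2 s) - (gg b f1 s - gg b U1 s)| <= Delta.
Proof.
move=> sb; apply: (gg_cmp4 a1 a2 aU1 aU2 sb (m := m0) (c := gerr N b K x f1 p1)).
- exact: (GG_err b0 mx K1 G1 A1 sb).
- exact: gerr_m0 G1 A1.
- apply: le_trans (GG_err b0 mx K1 G2 A2 sb) _; exact: gerr_m0 G2 A2.
- exact: hg.
rewrite -(ler_pXn2r (n := 2)) ?nnegrE ?sqrtr_ge0// real_normK ?num_real//.
apply: le_trans (GG_cmp4 a1 a2 aU1 aU2 sb) _; rewrite cD_sqr; apply: lerD.
  apply: ler_pM; [by rewrite mulr_ge0 ?N2_ge0|exact: N2_ge0|by []|].
  have bs := bmfB a2.2 a1.2; have bU := bmfD aU2.2 aU1.2.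
  rewrite (_ : N2 b _ = N2 b (fun s => (QQ f2 s - QQ f1 s) + (QQ U2 s + QQ U1 s))); last first.
    by apply: eq_I => r _; congr (_ ^+ 2); ring.
  apply: le_trans (N2_D bs bU) _; rewrite /M4; apply: lerD.
    have h1 : N2 b (fun s => QQ f2 s - QQ f1 s) <= (2 * K) ^+ 2 * b.
      apply: N2_bound => //; first by rewrite mulr_ge0.
      move=> r /andP[r0 rb]; have rb' : 0 < r <= b by rewrite r0 ltW.
      have := gs_Q G1 rb'; have := gs_Q G2 rb'; have := ler_normB (QQ f2 r) (QQ f1 r); lra.
    by move: h1; move: (N2 _ _) => y; rewrite exprMn; lra.
  have h2 : N2 b (fun s => QQ U2 s + QQ U1 s) <= 2 * CG b K + 2 * CG b K.
    apply: le_trans (N2_D aU2.2 aU1.2) _; apply: lerD; rewrite ler_pM2l//.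
      exact: (N2_QQh b0 mx K1 G2 A2).
    exact: (N2_QQh b0 mx K1 G1 A1).
  by move: h2; move: (N2 _ _) (CG b K) => *; lra.
apply: ler_wpM2l; first by rewrite mulr_ge0 ?N2_ge0.
apply: N2_bound => //; [by rewrite mulr_ge0|exact: bmfB a2.2 a1.2|].
by move=> r /andP[r0 rb]; apply: DQQ; rewrite r0 ltW.
Qed.

Lemma Delta_ge0 : 0 <= Delta.
Proof.
apply: mulr_ge0; [exact: expR_ge0|apply: addr_ge0; [exact: sqrtr_ge0|]].
by apply: mulr_ge0; [exact: mulr_ge0|exact: gerr_ge0].
Qed.

Lemma Delta_sqr : Delta ^+ 2 <= CDl * (N2 b ddif + th ^+ 2 * N2 b dif).
Proof.
have -> : CDl * (N2 b ddif + th ^+ 2 * N2 b dif) =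
  expR m0 ^+ 2 * (2 * (M5 * (N2 b ddif + th ^+ 2 * N2 b dif))) by rewrite /CDl; ring.
rewrite /Delta exprMn; apply: ler_wpM2l; first exact: sqr_ge0.
have e1 : (cD + K * th * gerr N b K x f1 p1) ^+ 2 <= 2 * cD ^+ 2 + 2 * ((K * th) ^+ 2 * gerr N b K x f1 p1 ^+ 2).
  by move: cD (gerr _ _ _ _ _ _) => y1 y2; rewrite -exprMn; have := sqr_ge0 (y1 - K * th * y2); nra.
apply: le_trans e1 _; rewrite cD_sqr (gerr_sqr _ _ _ b0) -/M3.
have n1 := N2_ge0 b ddif; have n2 := N2_ge0 b dif.
have -> : N2 b (fun s => VV f1 s - VV (glue N x p1) s) = N2 b dif by [].
have m3 := M3_ge0; have m4 := M4_ge0; have kb := Kb_ge0; have t2 : 0 <= th ^+ 2 by exact: sqr_ge0.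
have k2 : 0 <= K ^+ 2 by exact: sqr_ge0.
have -> : 8 * N2 b dif * ((K * th) ^+ 2 * b) = 8 * (K ^+ 2 * b) * (th ^+ 2 * N2 b dif) by ring.
have -> : (K * th) ^+ 2 * (N2 b dif * M3) = K ^+ 2 * M3 * (th ^+ 2 * N2 b dif) by ring.
rewrite /M5; have t3 : 0 <= th ^+ 2 * N2 b dif by rewrite mulr_ge0.
have q1 : 0 <= K ^+ 2 * M3 by rewrite mulr_ge0.
move: (N2 b ddif) (th ^+ 2 * N2 b dif) (M4) (K ^+ 2 * b) (K ^+ 2 * M3) n1 t3 m4 kb q1 => y1 y2 y3 y4 y5 *.
have r1 : 0 <= y4 * y1 by rewrite mulr_ge0. have r2 : 0 <= y5 * y1 by rewrite mulr_ge0.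
have r3 : 0 <= y3 * y2 by rewrite mulr_ge0. by lra.
Qed.

Lemma gU_D s : 0 <= s <= b -> `|gg b U2 s - gg b U1 s| <= Delta + K * th.
Proof.
move=> sb; have h1 := gg_D sb; have h2 := hg sb.
have -> : gg b U2 s - gg b U1 s = (gg b f2 s - gg b f1 s) - ((gg b f2 s - gg b U2 s) - (gg b f1 s - gg b U1 s)).
  by move: (gg b f2 s) (gg b U2 s) (gg b f1 s) (gg b U1 s) => *; ring.
by rewrite (le_trans (ler_normB _ _))// addrC lerD.
Qed.

Lemma gtU_D s : 0 < s <= b -> `|gt b U2 s - gt b U1 s| <= Delta + K * th.
Proof. exact: gt_cmp aU2 aU1 gU_D. Qed.

Lemma avg_D4 s : 0 < s <= b ->
  `|(gt b f2 s - gt b U2 s) - (gt b f1 s - gt b U1 s)| <= Delta.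
Proof.
move=> sb; exact: (avg_cmp4 (bmf_gg a1) (bmf_gg a2) (bmf_gg aU1) (bmf_gg aU2) gg_D).
Qed.

Lemma gam_D4 s : 0 < s <= b ->
  `|s * ((gam b f2 s - gam b U2 s) - (gam b f1 s - gam b U1 s))| <= 2 * Delta.
Proof.
move=> sb; have /andP[s0 sb'] := sb; have h1 := avg_D4 sb.
have h2 : `|(gg b f2 s - gg b U2 s) - (gg b f1 s - gg b U1 s)| <= Delta by apply: gg_D; rewrite ltW.
have -> : s * ((gam b f2 s - gam b U2 s) - (gam b f1 s - gam b U1 s)) =
  ((gg b f2 s - gg b U2 s) - (gg b f1 s - gg b U1 s)) - ((gt b f2 s - gt b U2 s) - (gt b f1 s - gt b U1 s)).
  rewrite /gam; move: (gg b f2 s) (gg b U2 s) (gg b f1 s) (gg b U1 s) (gt b f2 s) (gt b U2 s) (gt b f1 s) (gt b U1 s).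
  by move=> *; field; rewrite gt_eqF.
by rewrite (le_trans (ler_normB _ _))// mulr2n mulrDl mul1r lerD.
Qed.

Definition DSS s := SS N b x f2 f2' p2 s - SS N b x f1 f1' p1 s.

Lemma DSS_pt s : 0 < s < b ->
  `|DSS s| <= (3 * K / 2 * Delta + 3 * K / 2 * th * gerr N b K x f1 p1)
     + (CG b K / 2 * `|ddif s| + (Delta + K * th) * `|del N x f1 p1 s|).
Proof.
move=> sb; have sb' : 0 < s <= b by case/andP: sb => -> /ltW.
have /andP[s0 _] := sb.
have q1 := avg_D4 sb'.
have q2 : `|gt b f1 s - gt b U1 s| <= gerr N b K x f1 p1.
  by apply: (gt_cmp a1 aU1 _ sb') => r rb; exact: (gg_err b0 mx K1 G1 A1 rb).
have q3 := gs_bd G2 sb; have q4 := hf' sb; have q5 := gam_D4 sb'.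
have q6 : `|s * (gam b f1 s - gam b U1 s)| <= 2 * gerr N b K x f1 p1.
  by apply: (gam_cmp a1 aU1 _ sb') => r rb; exact: (gg_err b0 mx K1 G1 A1 rb).
have q7 := gs_Q G2 sb'; have q8 := DQQ sb'.
have /andP[q9 q10] := gam_bd b0 mx K1 G2 A2 sb'.
have q11 : `|s * (gam b U2 s - gam b U1 s)| <= 2 * (Delta + K * th) := gam_cmp aU2 aU1 gU_D sb'.
have e : DSS s = 2^-1 * (((gt b f2 s - gt b U2 s) - (gt b f1 s - gt b U1 s)) * f2' s
   + (gt b f1 s - gt b U1 s) * (f2' s - f1' s)
   + (s * ((gam b f2 s - gam b U2 s) - (gam b f1 s - gam b U1 s))) * QQ f2 s
   + (s * (gam b f1 s - gam b U1 s)) * (QQ f2 s - QQ f1 s)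
   + gam b U2 s * ddif s + (s * (gam b U2 s - gam b U1 s)) * del N x f1 p1 s).
  rewrite /DSS /SS /ddif /del -/U1 -/U2 !(VVE _ (lt0r_neq0 s0)).
  move: (gam b f2 s) (gam b U2 s) (gam b f1 s) (gam b U1 s) (gt b f2 s) (gt b U2 s) (gt b f1 s) (gt b U1 s).
  move: (QQ f1 s) (QQ f2 s) (QQ U1 s) (QQ U2 s) (f1' s) (f2' s) => *; ring.
have g0 := gerr_ge0 N b K x f1 p1; have D0 := Delta_ge0.
by rewrite e; apply: six_terms.
Qed.

Definition De s := err N x (fun r => f2 r - f1 r) (fun i => p2 i - p1 i) s.

Lemma bmf_DSS : bmf 0 b DSS.
Proof. exact: bmfB (bmf_SS b0 mx p2 G2) (bmf_SS b0 mx p1 G1). Qed.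

Lemma bmf_ddif : bmf 0 b ddif.
Proof. by apply: bmfB; apply: bmfB; apply: bmf_VV; [exact: a2.1|exact: aU2.1|exact: a1.1|exact: aU1.1]. Qed.

Lemma N2_dif : N2 b dif <= b ^+ 2 * N2 b (del N x f1 p1).
Proof. exact: (N2_dVV_le_del b0 mx p1 G1). Qed.

Lemma N2_ddif : N2 b ddif <= N2 b De.
Proof.
have bf := bmfB a2.1 a1.1.
have bD : bmf 0 b De by exact: bmf_err.
have DeE s : 0 < s < b -> ddif s = De s - avg De s.
  move=> /andP[s0 sb]; have s0b : 0 <= s <= b by rewrite !ltW.
  have E r : De r = (f2 r - U2 r) - (f1 r - U1 r).
    rewrite /De /err /U1 /U2 (_ : glue N x (fun i => p2 i - p1 i) r = glue N x p2 r - glue N x p1 r); first ring.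
    by rewrite /glue -sumrB; apply: eq_bigr => i _; rewrite hornerD hornerN mulrBr.
  have b2 := bmfB a2.1 aU2.1; have b1 := bmfB a1.1 aU1.1.
  rewrite /ddif -/U1 -/U2 -(VV_B s0b a2.1 aU2.1) -(VV_B s0b a1.1 aU1.1) -(VV_B s0b b2 b1).
  by rewrite -/(VV De s) /VV (_ : De = fun r => (f2 r - U2 r) - (f1 r - U1 r))//; apply/funext.
rewrite (_ : N2 b ddif = N2 b (fun s => De s - avg De s)); last first.
  by apply: eq_I => s sb; rewrite DeE.
apply: (hardy_sub mx bD) => i s iN si; have sb := mesh_itv_oo mx iN si.
apply: (err_cont mx _ iN si); apply: cvgB; [exact: (gs_fcont G2 sb)|exact: (gs_fcont G1 sb)].
Qed.

Definition CSS : R := (9 * K ^+ 2 * b + 8) * (CDl * (1 + b ^+ 2)) + 9 * K ^+ 2 * b * (b ^+ 2 * M3)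
  + CG b K ^+ 2 + 8 * K ^+ 2.

Lemma CSS_ge0 : 0 <= CSS.
Proof.
have := CDl_ge0; have := M3_ge0; have := Kb_ge0; have := sqr_ge0 (CG b K); have := sqr_ge0 K; have := sqr_ge0 b.
rewrite /CSS -(mulrA 9 (K ^+ 2) b); move: (CDl) (M3) (b ^+ 2) (K ^+ 2) (CG b K ^+ 2) (K ^+ 2 * b) => y1 y2 y6 y5 y4 y3 *.
have : 0 <= y3 * y1 by rewrite mulr_ge0.
have : 0 <= y1 * y6 by rewrite mulr_ge0.
have : 0 <= y3 * (y1 * y6) by rewrite !mulr_ge0.
have : 0 <= y3 * (y6 * y2) by rewrite !mulr_ge0.
by lra.
Qed.

Lemma Delta_sqr_del : Delta ^+ 2 <= CDl * (1 + b ^+ 2) * (N2 b ddif + th ^+ 2 * N2 b (del N x f1 p1)).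
Proof.
apply: le_trans Delta_sqr _; rewrite -mulrA; apply: ler_wpM2l; first exact: CDl_ge0.
have := ler_wpM2l (sqr_ge0 th) N2_dif; have := N2_ge0 b ddif; have := N2_ge0 b (del N x f1 p1).
have := sqr_ge0 b; have := sqr_ge0 th; move: (N2 b _) (N2 b _) (N2 b _) (b ^+ 2) (th ^+ 2) => y1 y2 y3 y4 y5 *.
have : 0 <= y4 * y2 by rewrite mulr_ge0.
have : 0 <= y5 * y3 by rewrite mulr_ge0.
have : 0 <= y4 * (y5 * y3) by rewrite !mulr_ge0.
by lra.
Qed.

Lemma N2_DSS : N2 b DSS <= CSS * (N2 b ddif + th ^+ 2 * N2 b (del N x f1 p1)).
Proof.
set c1 := 3 * K / 2 * Delta; set c2 := 3 * K / 2 * th * gerr N b K x f1 p1; set d := Delta + K * th.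
have bd := bmf_abs bmf_ddif; have be := bmf_abs (bmf_del b0 mx p1 G1).
apply: le_trans (le_N2_abs bmf_DSS _ DSS_pt) _.
  by apply: bmfD; [exact: bmf_cst|apply: bmfD; exact: bmfZ].
apply: le_trans (N2_D (bmf_cst _ _ _) (bmfD (bmfZ _ bd) (bmfZ _ be))) _.
have h1 := N2_D (bmfZ (CG b K / 2) bd) (bmfZ d be); rewrite !N2_Z// in h1.
rewrite {1}/N2 (I_cst _ (ltW b0)) subr0 -/c1 -/c2 -/d.
have nE f : N2 b (fun s => `|f s|) = N2 b f by apply: eq_I => s _; rewrite real_normK ?num_real.
rewrite !nE in h1.
have h2 : (c1 + c2) ^+ 2 <= 2 * c1 ^+ 2 + 2 * c2 ^+ 2.
  by move: c1 c2 => y1 y2; have := sqr_ge0 (y1 - y2); nra.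
have e1 : 2 * c1 ^+ 2 = 9 / 2 * K ^+ 2 * Delta ^+ 2 by rewrite /c1; field.
have e2 : 2 * c2 ^+ 2 = 9 / 2 * K ^+ 2 * (th ^+ 2 * (N2 b dif * M3)).
  by rewrite /c2 exprMn (gerr_sqr _ _ _ b0) -/M3 -/dif; field.
have h3 : d ^+ 2 <= 2 * Delta ^+ 2 + 2 * (K ^+ 2 * th ^+ 2).
  by rewrite /d -exprMn; move: Delta (K * th) => y1 y2; have := sqr_ge0 (y1 - y2); nra.
have h4 := Delta_sqr_del; have h5 := N2_dif.
apply: (DSS_square_bound (ltW b0) (sqr_ge0 K) (sqr_ge0 th) M3_ge0 _ _ _ A1 h2 e1 e2 h3 h4 h5 h1); [|exact: N2_ge0..].
by rewrite mulr_ge0 ?CDl_ge0// addr_ge0 ?sqr_ge0.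
Qed.

(** The change of speed, at most [Delta + K * th], multiplies the broken H^1 error of the earlier
    time. Smallness of X keeps the part with [Delta] at the size of [Delta ^+ 2]; the other part, of
    order [th ^+ 2] times X, joins the forcing. *)
Lemma BB_speed_difference k (phi : nat -> {poly R}) : (forall i, (i < N)%N -> (size (phi i) <= k.+1)%N) ->
  XX N b x f1' p1 (f1 b) <= 32^-1 ->
  BB N b x (fun s => gt b U2 s - gt b U1 s) (err N x f1' (dp p1)) (jmp N x p1 (f1 b)) phi <=
  4^-1 * N2 b (glue N x phi) + Dk k * (CDl * (1 + b ^+ 2) * (N2 b ddif + th ^+ 2 * N2 b (del N x f1 p1))
     + K ^+ 2 * (th ^+ 2 * XX N b x f1' p1 (f1 b))).
Proof.
move=> sp X1; set X := XX _ _ _ _ _ _.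
have X0 : 0 <= X := XX_ge0 mx _ _ _.
have D0 : 0 <= Dk k :> R := le_trans ler01 (Dk_ge1 k).
apply: le_trans (BB_small mx (d := Delta + K * th) _ _ _ _ _ sp) _.
- by rewrite addr_ge0 ?Delta_ge0// mulr_ge0.
- by apply: bmfB; apply: bmf_gt.
- by apply: bmf_err; exact: bmf_gs G1.
- exact: gtU_D.
rewrite lerD2l -/X mulrCA; apply: ler_wpM2l => //.
have h4 := Delta_sqr_del; move: h4; move: (_ * (N2 b ddif + _)) => Y h4.
have h3 : (Delta + K * th) ^+ 2 <= 2 * Delta ^+ 2 + 2 * (K ^+ 2 * th ^+ 2).
  by rewrite -exprMn; move: Delta (K * th) => y1 y2; have := sqr_ge0 (y1 - y2); nra.
have h5 := ler_wpM2r X0 h3.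
have X2 : X <= 1 by apply: le_trans X1 _; lra.
have h6 : Delta ^+ 2 * X <= Delta ^+ 2 by rewrite ler_piMr ?sqr_ge0.
rewrite -[N2 b _ + _]/X; move: h4 h5 h6.
have fin (a D2 K2 t2 : R) : D2 <= Y -> a * X <= (2 * D2 + 2 * (K2 * t2)) * X -> D2 * X <= D2 ->
  2^-1 * (a * X) <= Y + K2 * (t2 * X) by lra.
exact: fin.
Qed.

End Pair.

Lemma eps_within {R : realType} (a c : R) (f : R -> R) :
  (forall t e, a <= t <= c -> 0 < e ->
    exists2 d, 0 < d & forall s, a <= s <= c -> `|s - t| < d -> `|f s - f t| <= e) ->
  {within `[a, c], continuous f}.
Proof.
move=> H; apply/subspace_continuousP => t; rewrite /= in_itv /= => tac.
apply/cvgrPdist_le => e e0; have [d d0 Hd] := H t e tac e0.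
near=> y; rewrite distrC; apply: Hd.
  have : (`[a, c]%classic : set R) y by near: y; exact: withinT.
  by rewrite /= in_itv.
near: y; apply: cvg_within; apply/nbhs_ballP; exists d => // y.
by rewrite /ball /= distrC.
Unshelve. all: by end_near. Qed.

Lemma within_shift {R : realType} (c th : R) (f : R -> R) : 0 <= th -> {within `[0, c], continuous f} ->
  {within `[0, c - th], continuous (fun s => f (s + th))}.
Proof.
move=> th0 cf; apply: eps_within => t e /andP[t0 tc] e0.
have tT : 0 <= t + th <= c by rewrite addr_ge0//= -lerBrDr.
have [d d0 Hd] := within_eps cf tT e0; exists d => // s /andP[s0 sc] sd.
by apply: Hd; [rewrite addr_ge0//= -lerBrDr|rewrite opprD addrACA subrr addr0].
Qed.

Lemma time_difference_bound {R : realFieldType} (g dk cd cs K2 t h X y E nd W e Bf Bd Nd D E0 : R) :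
  0 <= g -> 0 <= dk -> 0 <= cd -> 0 <= cs -> 0 <= t ->
  Bf <= g * (E + y) + 4^-1 * nd -> E <= E0 * (t * h) -> nd <= E0 * (t * h) ->
  Bd <= 4^-1 * y + dk * (cd * (W + t * e) + K2 * (t * X)) ->
  D <= 2^-1 * Nd + 2^-1 * y -> Nd <= cs * (W + t * e) -> W <= 2 * E + 2 * y -> e <= 32 * X -> 0 <= y ->
  0 <= E0 -> 0 <= t * h -> 0 <= t * X -> 0 <= K2 ->
  2 * (Bf + Bd + D) <= (2 * g + 2 + 4 * (dk * cd + 2^-1 * cs)) * y +
   (2 * g * E0 + E0 + 4 * (dk * cd + 2^-1 * cs) * E0 + 64 * (dk * cd + 2^-1 * cs) + 2 * (dk * K2)) * (t * (h + X)).
Proof.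
move=> g0 dk0 cd0 cs0 t0 h1 h2 h3 h4 h5 h6 h7 h8 y0 E00 H0 X0 K20.
set P := dk * cd + 2^-1 * cs.
have P0 : 0 <= P by rewrite addr_ge0// mulr_ge0// invr_ge0.
set Z := W + t * e.
have hZ : Z <= 2 * (E0 * (t * h)) + 2 * y + 32 * (t * X).
  by have := ler_wpM2l t0 h8; rewrite /Z; lra.
have s1 := ler_wpM2l P0 hZ.
have s2 : g * E <= g * (E0 * (t * h)) by rewrite ler_wpM2l.
have s3 : Bd + D <= 3/4 * y + P * Z + dk * (K2 * (t * X)).
  by move: h4 h5 h6; rewrite -/Z /P; lra.
have H1 : 0 <= g * (E0 * (t * h)) by rewrite mulr_ge0// mulr_ge0.
have s4 : 0 <= P * (t * X) by rewrite mulr_ge0.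
have s5 : 0 <= E0 * (t * X) by rewrite mulr_ge0.
have s6 : 0 <= P * (E0 * (t * X)) by rewrite mulr_ge0.
have s7 : 0 <= g * (E0 * (t * X)) by rewrite mulr_ge0.
have s8 : 0 <= dk * (K2 * (t * h)) by rewrite mulr_ge0// mulr_ge0.
have s9 : 0 <= P * (t * h) by rewrite mulr_ge0.
have s10 : 0 <= E0 * (t * h) by rewrite mulr_ge0.
rewrite -/P; clearbody P Z; clear hZ h4 h5 h6; lra.
Qed.

(** From a2 e2 - a1 e1 = a2 (e2 - e1) + (a2 - a1) e1: the energy estimate applies to the increment
    with the speed of the later time, and the change of speed meets only the earlier error. *)
Lemma BB_split {R : realType} N (b : R) x (a1 a2 e1 e2 e : R -> R) J1 J2 J phi :
  bmf 0 b a1 -> bmf 0 b a2 -> bmf 0 b e1 -> bmf 0 b e2 ->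
  (forall r, e r = e2 r - e1 r) -> (forall i, J i = J2 i - J1 i) ->
  BB N b x a2 e2 J2 phi - BB N b x a1 e1 J1 phi =
  BB N b x a2 e J phi + BB N b x (fun r => a2 r - a1 r) e1 J1 phi.
Proof.
move=> b1 b2 be1 be2 eE JE; have bp := bmf_glue 0 b N x phi.
have [m22 m21 m11] := And3 (bmfM (bmfM b2 be2) bp) (bmfM (bmfM b2 be1) bp) (bmfM (bmfM b1 be1) bp).
rewrite /BB.
rewrite (@eq_I _ _ _ (fun r => a2 r * e r * glue N x phi r)
  (fun r => a2 r * e2 r * glue N x phi r - a2 r * e1 r * glue N x phi r)); last first.
  by move=> r _; rewrite eE mulrBr mulrBl.
rewrite (@eq_I _ _ _ (fun r => (a2 r - a1 r) * e1 r * glue N x phi r)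
  (fun r => a2 r * e1 r * glue N x phi r - a1 r * e1 r * glue N x phi r)); last first.
  by move=> r _; rewrite !mulrBl.
rewrite (I_B m22 m21) (I_B m21 m11).
have -> : \sum_(i < N) a2 (x i.+1) * J i * (phi i).[x i.+1] =
  \sum_(i < N) a2 (x i.+1) * J2 i * (phi i).[x i.+1] - \sum_(i < N) a2 (x i.+1) * J1 i * (phi i).[x i.+1].
  by rewrite -sumrB; apply: eq_bigr => i _; rewrite JE mulrBr mulrBl.
have -> : \sum_(i < N) (a2 (x i.+1) - a1 (x i.+1)) * J1 i * (phi i).[x i.+1] =
  \sum_(i < N) a2 (x i.+1) * J1 i * (phi i).[x i.+1] - \sum_(i < N) a1 (x i.+1) * J1 i * (phi i).[x i.+1].
  by rewrite -sumrB; apply: eq_bigr => i _; rewrite !mulrBl.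
have id6 (c z1 z2 z3 z4 z5 z6 : R) : c * z1 - c * z4 - (c * z3 - c * z6) =
  c * (z1 - z2) - c * (z4 - z5) + (c * (z2 - z3) - c * (z5 - z6)) by ring.
exact: id6.
Qed.

(** * Energy inequality for time increments *)

Section TimeDifference.
Context {R : realType}.
Variables (k N : nat) (b T K : R) (x : nat -> R) (Ub : R -> R) (S : hdg_fields R).
Variables (u ut ur : R -> R -> R).
Hypotheses (k1 : (1 <= k)%N) (b0 : 0 < b) (T0 : 0 < T) (K1 : 1 <= K) (mx : mesh b N x).
Hypotheses (hS : hdg_solution T k N x Ub S) (F : exact_facts k b T K Ub u ut ur).
Implicit Types (t s r : R) (i : nat) (p q phi : nat -> {poly R}) (v f : R -> R).

Let h := mesh_size N x.
Hypotheses (h0 : 0 < h) (h1 : h <= 1).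

Let K0 : 0 <= K. Proof. exact: le_trans ler01 K1. Qed.

Lemma PF_sub gr v f i : (i < N)%N -> bmf 0 b v -> bmf 0 b f ->
  PF k x gr (fun s => v s - f s) i = PF k x gr v i - PF k x gr f i.
Proof.
move=> iN bv bf; have [x0 xi xb hi] := mN mx iN.
have sub w : bmf 0 b w -> bmf (x i) (x i.+1) w by exact: bmf_sub.
have [W HW] := proj_coef (gr i) k (x i) (x i.+1).
apply/polyP => l; rewrite coefB /PF !HW -sumrB; apply: eq_bigr => j _.
rewrite (_ : (fun s => v s - f s) = fun s => v s + -1 * f s); last by apply/funext => s; rewrite mulN1r.
rewrite dofD; [|exact: sub|by apply: bmfZ; exact: sub].
by rewrite dofZ; [ring|exact: sub].
Qed.

Definition Xt t : R := XX N b x (ur t) (uh S t) (u t b).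

Lemma Xt_del t : 0 <= t <= T -> Xt t <= 32^-1 -> N2 b (del N x (u t) (uh S t)) <= 1.
Proof.
move=> tT X1; apply: le_trans (N2_del_le_XX b0 mx _ (ef_state F tT)) _.
by rewrite -/(Xt t); move: X1; move: (Xt t) => X; lra.
Qed.

Section Step.
Variable th : R.
Hypothesis th0 : 0 <= th.

(* The increment of P u - u_h over a time step [th]. *)
Definition Dpi s i : {poly R} :=
  (PF k x gr0 (u (s + th)) i - PF k x gr0 (u s) i) - (uh S (s + th) i - uh S s i).
Definition Dpit s i : {poly R} :=
  (PF k x gr0 (ut (s + th)) i - PF k x gr0 (ut s) i) - (uh_t S (s + th) i - uh_t S s i).

Lemma pdiff_shift (q qt : R -> nat -> {poly R}) : pdiff k N 0 T q qt ->
  pdiff k N 0 (T - th) (fun s => q (s + th)) (fun s => qt (s + th)).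
Proof.
move=> hq i iN; have [sz d] := hq i iN; split.
  by move=> t /andP[t0 tT]; apply: sz; rewrite addr_ge0//= -lerBrDr.
move=> j; have [cj dj] := d j; split.
  exact: (within_shift th0 cj).
move=> t /andP[t0 tT]; have tT' : 0 < t + th < T by rewrite ltr_wpDr//= -ltrBrDr.
apply: d_eq (d_comp (g := fun s => s + th) (dj _ tT') (dD (dI t) (dC t th))) _.
by rewrite addr0 mulr1.
Qed.

Lemma pdiff_sub (q qt : R -> nat -> {poly R}) : pdiff k N 0 T q qt -> pdiff k N 0 (T - th) q qt.
Proof.
move=> hq i iN; have [sz d] := hq i iN; split.
  by move=> t /andP[t0 tT]; apply: sz; rewrite t0 (le_trans tT)// gerBl.
move=> j; have [cj dj] := d j; split.
  apply: continuous_subspaceW cj => s; rewrite /= !in_itv /= => /andP[-> /le_trans]; apply.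
  by rewrite gerBl.
by move=> t /andP[t0 tT]; apply: dj; rewrite t0 (lt_le_trans tT)// gerBl.
Qed.

Lemma Dpi_pdiff : pdiff k N 0 (T - th) Dpi Dpit.
Proof.
have hP := PF_pdiff K1 mx F (gr := gr0) (fun i => False_ind _ \o (@notF)).
have hU := uh_pdiff hS.
exact: pdiffB (pdiffB (pdiff_shift hP) (pdiff_sub hP)) (pdiffB (pdiff_shift hU) (pdiff_sub hU)).
Qed.

Definition E0 : R := ((1 + DC k) * K) ^+ 2 * b.
Definition PP : R := Dk k * (CDl b K * (1 + b ^+ 2)) + 2^-1 * CSS b K.
Definition C3 : R := 2 * (CG b K * (1 + CI k)) + 2 + 4 * PP.
Definition C4 : R := 2 * (CG b K * (1 + CI k)) * E0 + E0 + 4 * PP * E0 + 64 * PP + 2 * (Dk k * K ^+ 2).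

Lemma bmf_Du s : 0 <= s <= T -> 0 <= s + th <= T -> bmf 0 b (fun r => u (s + th) r - u s r).
Proof. by move=> sT sT'; apply: bmfB; exact: (bmf_u' F). Qed.

Lemma Du_lip s r r' : 0 <= s <= T -> 0 <= s + th <= T -> 0 <= r <= b -> 0 <= r' <= b ->
  `|(u (s + th) r - u s r) - (u (s + th) r' - u s r')| <= K * th * `|r - r'|.
Proof.
move=> sT sT' rb rb'; have := ef_mix F sT' sT rb rb'.
by rewrite [s + th - s]addrAC subrr add0r (ger0_norm th0).
Qed.

(** Increments of u are Lipschitz in r with constant [K * th], so comparison with a constant on the
    element already gives the order [th * h_i], which is enough here. *)
Lemma PFD_near s i y : 0 <= s <= T -> 0 <= s + th <= T -> (i < N)%N -> x i <= y <= x i.+1 ->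
  `|(u (s + th) y - u s y) - (PF k x gr0 (u (s + th)) i - PF k x gr0 (u s) i).[y]| <=
  (1 + DC k) * (K * th * hh x i).
Proof.
move=> sT sT' iN yi; have [x0 xi xb hi] := mN mx iN.
rewrite -(PF_sub gr0 iN (bmf_u' F sT') (bmf_u' F sT)).
set v := fun r => u (s + th) r - u s r; set q := (v (x i))%:P.
have M0 : 0 <= K * th * hh x i by rewrite !mulr_ge0// ltW.
have near z : x i <= z <= x i.+1 -> `|v z - q.[z]| <= K * th * hh x i.
  move=> /andP[z1 z2]; rewrite hornerC; apply: le_trans (Du_lip sT sT' _ _) _.
  - by rewrite (le_trans x0)// (le_trans z2).
  - by rewrite x0 (le_trans (ltW xi)).
  by rewrite ler_wpM2l ?mulr_ge0// ger0_norm ?subr_ge0// /hh lerB.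
have -> : u (s + th) y - u s y - (PF k x gr0 v i).[y] = (v y - q.[y]) - ((PF k x gr0 v i).[y] - q.[y]).
  by rewrite /v; ring.
rewrite mulrDl mul1r (le_trans (ler_normB _ _))// lerD ?near//.
apply: (PF_near mx iN _ (bmf_Du sT sT') M0) => //.
- by rewrite (leq_trans (size_polyC_leq1 _)).
- by move=> z /andP[z1 z2]; apply: near; rewrite !ltW.
Qed.

Lemma sum_hh2 : \sum_(i < N) hh x i ^+ 2 <= b * h.
Proof.
rewrite -(sum_hh mx) mulr_suml; apply: ler_sum => i _; have [_ _ _ hi] := mN mx (ltn_ord i).
by rewrite expr2 ler_pM2l// hh_h.
Qed.

Lemma PFD_N2 s : 0 <= s <= T -> 0 <= s + th <= T ->
  N2 b (err N x (fun r => u (s + th) r - u s r)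
    (fun i => PF k x gr0 (u (s + th)) i - PF k x gr0 (u s) i)) <= E0 * (th ^+ 2 * h).
Proof.
move=> sT sT'; apply: le_trans (N2_err mx (M := fun i => (1 + DC k) * (K * th * hh x i)) (bmf_Du sT sT') _) _.
  by move=> i y iN /andP[y1 y2]; apply: PFD_near => //; rewrite !ltW.
have -> : \sum_(i < N) hh x i * ((1 + DC k) * (K * th * hh x i)) ^+ 2 =
  ((1 + DC k) * K) ^+ 2 * th ^+ 2 * \sum_(i < N) hh x i ^+ 3.
  by rewrite mulr_sumr; apply: eq_bigr => i _; ring.
have -> : E0 * (th ^+ 2 * h) = ((1 + DC k) * K) ^+ 2 * th ^+ 2 * (b * h) by rewrite /E0; ring.
apply: ler_wpM2l; first by rewrite mulr_ge0 ?sqr_ge0.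
apply: le_trans (sum_hh3 mx h0) _; rewrite ler_pM2l// -/h expr2.
by rewrite ler_piMr// ltW.
Qed.

(** The L^2 projection is not exact at the nodes, and one squared error of order h_i^2 per element
    sums only to [b * h]: this is the origin of the O(h) bound on X. *)
Lemma PFD_node s : 0 <= s <= T -> 0 <= s + th <= T ->
  \sum_(i < N) ((PF k x gr0 (u (s + th)) i - PF k x gr0 (u s) i).[x i] - (u (s + th) (x i) - u s (x i))) ^+ 2
  <= E0 * (th ^+ 2 * h).
Proof.
move=> sT sT'; apply: le_trans (_ : _ <= ((1 + DC k) * K) ^+ 2 * th ^+ 2 * \sum_(i < N) hh x i ^+ 2) _.
  rewrite mulr_sumr; apply: ler_sum => i _; have [x0 xi xb hi] := mN mx (ltn_ord i).
  have -> : ((1 + DC k) * K) ^+ 2 * th ^+ 2 * hh x i ^+ 2 = ((1 + DC k) * (K * th * hh x i)) ^+ 2 by ring.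
  have M0 : 0 <= (1 + DC k) * (K * th * hh x i).
    by rewrite mulr_ge0//; [rewrite addr_ge0// DC_ge0|rewrite !mulr_ge0// ltW].
  rewrite -[leLHS]real_normK ?num_real// lerXn2r ?nnegrE// distrC.
  by apply: PFD_near => //; rewrite lexx ltW.
have -> : E0 * (th ^+ 2 * h) = ((1 + DC k) * K) ^+ 2 * th ^+ 2 * (b * h) by rewrite /E0; ring.
apply: ler_wpM2l; first by rewrite mulr_ge0 ?sqr_ge0.
exact: sum_hh2.
Qed.

(** The equations for [pit] at two times are subtracted and tested with the increment [Dpi].
    Coefficient and speed terms bring in [del] of the earlier time, hence X by Hardy's inequality,
    always with a factor [th ^+ 2]. *)
Lemma time_difference_ineq s : 0 <= s -> s + th <= T -> Xt s <= 32^-1 -> Xt (s + th) <= 32^-1 ->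
  2 * I 0 b (fun r => glue N x (Dpit s) r * glue N x (Dpi s) r) <=
  C3 * N2 b (glue N x (Dpi s)) + C4 * (th ^+ 2 * (h + Xt s)).
Proof.
move=> s0 sT1 X1 X2.
have sT : 0 <= s <= T by rewrite s0 (le_trans _ sT1)// lerDl.
have sT' : 0 <= s + th <= T by rewrite addr_ge0.
have [A1 A2] := (Xt_del sT X1, Xt_del sT' X2).
have [G1 G2] := (ef_state F sT, ef_state F sT').
set p1 := uh S s; set p2 := uh S (s + th); set phi := Dpi s.
have sphi i : (i < N)%N -> (size (phi i) <= k.+1)%N.
  move=> iN; have [sz _] := Dpi_pdiff iN.
  by have [] : _ /\ _ := sz s _; rewrite ?s0 ?lerBrDr.
have mix r r' : 0 <= r <= b -> 0 <= r' <= b ->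
  `|(u (s + th) r - u s r) - (u (s + th) r' - u s r')| <= K * th * `|r - r'| by exact: Du_lip.
have thE : `|s + th - s| = th by rewrite addrAC subrr add0r ger0_norm.
have hg r : 0 <= r <= b -> `|gg b (u (s + th)) r - gg b (u s) r| <= K * th.
  by move=> rb; rewrite -[X in K * X]thE; exact: (ef_Dg F).
have hf r : 0 < r < b -> `|ur (s + th) r - ur s r| <= K * th.
  by move=> rb; rewrite -[X in K * X]thE; exact: (ef_Dur F).
set U1 := glue N x p1; set U2 := glue N x p2.
set e1 := err N x (ur s) (dp p1); set e2 := err N x (ur (s + th)) (dp p2).
set J1 := jmp N x p1 (u s b); set J2 := jmp N x p2 (u (s + th) b).
have bp := bmf_glue 0 b N x phi.
have [be1 be2] : bmf 0 b e1 /\ bmf 0 b e2.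
  by split; apply: bmf_err; [exact: bmf_gs G1|exact: bmf_gs G2].
have [bg1 bg2] : bmf 0 b (gt b U1) /\ bmf 0 b (gt b U2) by split; apply: bmf_gt; exact: adm_glue.
have bD := bmf_DSS p1 p2 b0 mx G1 G2.
have eq1 : I 0 b (fun r => glue N x (Dpit s) r * glue N x phi r) =
    (BB N b x (gt b U2) e2 J2 phi - BB N b x (gt b U1) e1 J1 phi)
    + I 0 b (fun r => DSS N b x (u s) (ur s) (u (s + th)) (ur (s + th)) p1 p2 r * glue N x phi r).
  have q1 := pit_eq b0 mx hS F sT sphi; have q2 := pit_eq b0 mx hS F sT' sphi.
  have bS1 := bmf_SS b0 mx p1 G1; have bS2 := bmf_SS b0 mx p2 G2.
  rewrite (@eq_I _ _ _ (fun r => DSS _ _ _ _ _ _ _ _ _ r * _) (fun r => SS N b x (u (s + th)) (ur (s + th)) p2 r * glue N x phi r - SS N b x (u s) (ur s) p1 r * glue N x phi r)); last first.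
    by move=> r _; rewrite /DSS mulrBl.
  rewrite (I_B (bmfM bS2 bp) (bmfM bS1 bp)).
  rewrite (@eq_I _ _ _ _ (fun r => glue N x (pit k x S ut (s + th)) r * glue N x phi r - glue N x (pit k x S ut s) r * glue N x phi r)); last first.
    move=> r _; rewrite -mulrBl; congr (_ * _); rewrite /glue -sumrB; apply: eq_bigr => i _.
    by rewrite -mulrBr /Dpit /pit !hornerD !hornerN !hornerD !hornerN; congr (_ * _); ring.
  rewrite I_B; [|by apply: bmfM => //; exact: bmf_glue..].
  by rewrite q1 q2 opprD addrACA.
set q := fun i => p2 i - p1 i; set v := fun r => u (s + th) r - u s r; set v' := fun r => ur (s + th) r - ur s r.
have eq2 : BB N b x (gt b U2) e2 J2 phi - BB N b x (gt b U1) e1 J1 phi =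
    BB N b x (gt b U2) (err N x v' (dp q)) (jmp N x q (v b)) phi
    + BB N b x (fun r => gt b U2 r - gt b U1 r) e1 J1 phi.
  have e21 r : err N x v' (dp q) r = e2 r - e1 r.
    rewrite /err /e2 /e1 /err (_ : glue N x (dp q) r = glue N x (dp p2) r - glue N x (dp p1) r).
      by rewrite /v'; ring.
    by rewrite /glue -sumrB; apply: eq_bigr => i _; rewrite /dp /q derivB hornerD hornerN mulrBr.
  have J21 i : jmp N x q (v b) i = J2 i - J1 i.
    by rewrite /J1 /J2 /jmp /upv /q; case: ifP => _; rewrite !hornerD !hornerN /v; ring.
  have zz := BB_split N x phi bg1 bg2 be1 be2 e21 J21.
  exact: zz.
set qp := fun i => PF k x gr0 (u (s + th)) i - PF k x gr0 (u s) i.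
have bf : BB N b x (gt b U2) (err N x v' (dp q)) (jmp N x q (v b)) phi <=
    CG b K * (1 + CI k) * (N2 b (err N x v qp) + N2 b (glue N x phi))
    + 4^-1 * \sum_(i < N) ((qp i).[x i] - v (x i)) ^+ 2.
  apply: (BB_energy_gt (M := K * th) b0 K1 mx G2 A2).
  - exact: mix.
  - by move=> r rb; apply: dB; apply: (ef_der F).
  - by move=> r rb; apply: cvgB; apply: (ef_urc F).
  - exact: hf.
  - move=> i iN; split; rewrite (leq_trans (size_polyD _ _))// size_polyN geq_max.
      by rewrite (size_uh hS sT iN) (size_uh hS sT' iN).
    by rewrite !size_PF.
  - move=> i w iN sw; rewrite /qp -(PF_sub gr0 iN (bmf_u' F sT') (bmf_u' F sT)).
    by apply: (PF_L2 mx (bmf_Du sT sT') iN); rewrite leqW.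
have bd := BB_speed_difference b0 K1 th0 mx G1 G2 mix hg A1 A2 sphi X1.
have dss := I_half bD bp.
have n1 := N2_DSS b0 K1 th0 mx G1 G2 mix hg hf A1 A2.
have n2 : N2 b (ddif N x (u s) (u (s + th)) p1 p2) <= 2 * N2 b (err N x v qp) + 2 * N2 b (glue N x phi).
  apply: le_trans (N2_ddif p1 p2 b0 mx G1 G2) _; exact: (N2_err_split mx q qp (bmf_Du sT sT')).
have n3 := N2_del_le_XX b0 mx p1 G1.
rewrite eq1 eq2.
apply: (time_difference_bound _ _ _ _ _ bf (PFD_N2 sT sT') (PFD_node sT sT') bd dss n1 n2 n3).
- by rewrite mulr_ge0 ?CG_ge0// addr_ge0// CI_ge0.
- exact: le_trans ler01 (Dk_ge1 k).
- by rewrite mulr_ge0 ?CDl_ge0// addr_ge0 ?sqr_ge0.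
- exact: CSS_ge0.
- exact: sqr_ge0.
- exact: N2_ge0.
- by rewrite mulr_ge0 ?sqr_ge0 ?(ltW b0).
- by rewrite mulr_ge0 ?sqr_ge0 ?(ltW h0).
- by rewrite mulr_ge0 ?sqr_ge0 ?XX_ge0.
- exact: sqr_ge0.
Qed.

End Step.
End TimeDifference.

(** * One-sided difference quotients *)

Section Quotient.
Context {R : realType}.
Implicit Types (s t e : R) (f : R -> R).

(** The quotient is taken from the right so that time 0 is included. *)
Lemma eps_quot T f s l : s < T ->
  (forall e, 0 < e -> exists2 d, 0 < d & forall y, s <= y <= T -> `|y - s| < d ->
    `|f y - f s - l * (y - s)| <= e * `|y - s|) ->
  (f (s + th) - f s) / th @[th --> 0^'+] --> l.
Proof.
move=> sT H; apply/cvgrPdist_le => e e0; have [d d0 Hd] := H e e0.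
near=> th; have th0 : 0 < th by [].
have thd : th < d by near: th; exact: nbhs_right_lt.
have thT : th < T - s by near: th; apply: nbhs_right_lt; rewrite subr_gt0.
have := Hd (s + th); rewrite [s + th - s]addrAC subrr add0r (gtr0_norm th0) lerDl (ltW th0) /=.
rewrite -lerBrDl (ltW thT) => /(_ isT thd) h1.
have -> : l - (f (s + th) - f s) / th = - ((f (s + th) - f s - l * th) / th).
  by field; rewrite gt_eqF.
by rewrite normrN normrM normfV (gtr0_norm th0) ler_pdivrMr.
Unshelve. all: by end_near. Qed.

Lemma cvg_sum_ord n (Fl : 'I_n -> R -> R) (l : 'I_n -> R) (G : set_system R) {FG : Filter G} :
  (forall j, Fl j t @[t --> G] --> l j) -> \sum_j Fl j t @[t --> G] --> \sum_j l j.
Proof.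
elim: n Fl l => [|n ih] Fl l cF.
  rewrite big_ord0 (_ : (fun t => _) = fun=> 0); first exact: cvg_cst.
  by apply/funext => t; rewrite big_ord0.
rewrite big_ord_recl (_ : (fun t => _) = fun t => Fl ord0 t + \sum_(j < n) Fl (lift ord0 j) t).
  by apply: cvgD; [exact: cF|exact: ih].
by apply/funext => t; rewrite big_ord_recl.
Qed.

End Quotient.

(** * Time increments divided by a vanishing step *)

Section Limit.
Context {R : realType}.
Variables (k N : nat) (b T K : R) (x : nat -> R) (Ub : R -> R) (S : hdg_fields R).
Variables (u ut ur : R -> R -> R).
Hypotheses (k1 : (1 <= k)%N) (b0 : 0 < b) (T0 : 0 < T) (K1 : 1 <= K) (mx : mesh b N x).
Hypotheses (hS : hdg_solution T k N x Ub S) (F : exact_facts k b T K Ub u ut ur).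
Implicit Types (t s r th : R) (i : nat) (p q phi : nat -> {poly R}) (v f : R -> R).

Let K0 : 0 <= K. Proof. exact: le_trans ler01 K1. Qed.

Lemma dof_quot i s j : (i < N)%N -> 0 <= s < T ->
  (dof false k (x i) (x i.+1) (u (s + th)) j - dof false k (x i) (x i.+1) (u s) j) / th
    @[th --> 0^'+] --> dof false k (x i) (x i.+1) (ut s) j.
Proof.
move=> iN /andP[s0 sT].
apply: (eps_quot (f := fun t => dof false k (x i) (x i.+1) (u t) j) sT) => e e0.
have Kp : 0 < K := lt_le_trans ltr01 K1.
exists (e / K); first by rewrite divr_gt0.
move=> y /andP[sy yT] ys; rewrite mulrC.
have sT' : 0 <= s <= T by rewrite s0 ltW.
have yT' : 0 <= y <= T by rewrite (le_trans s0).
apply: le_trans (dof_time (gr := fun=> false) mx F j iN _ sT' yT') _ => //.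
rewrite -[(y - s) ^+ 2]real_normK ?num_real// expr2 mulrA ler_wpM2r//.
by move: ys; rewrite ltr_pdivlMr// mulrC => /ltW.
Qed.

Lemma quot_coef i s j : (i < N)%N -> 0 <= s < T ->
  (Dpi k x S u th s i)`_j / th @[th --> 0^'+] --> (pit k x S ut s i)`_j.
Proof.
move=> iN sT; have [W HW] := proj_coef false k (x i) (x i.+1).
rewrite /pit coefB; rewrite (_ : (fun th => _) = fun th =>
   \sum_(l < k.+1) W j l * ((dof false k (x i) (x i.+1) (u (s + th)) l - dof false k (x i) (x i.+1) (u s) l) / th)
   - ((uh S (s + th) i)`_j - (uh S s i)`_j) / th); last first.
  apply/funext => th; rewrite /Dpi !coefB mulrBl; congr (_ - _).
  rewrite /PF !HW -sumrB mulr_suml; apply: eq_bigr => l _.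
  by rewrite -mulrBr mulrA.
apply: cvgB.
  rewrite /PF HW; apply: cvg_sum_ord => l.
  by apply: cvgM; [exact: cvg_cst|exact: dof_quot].
have /andP[s0 sT'] := sT.
apply: (eps_quot (f := fun t => (uh S t i)`_j) sT') => e e0.
have [hd _] := hdg_C1 hS j iN.
have [|d d0 Hd] := hd_eps (hd s _) e0; first by rewrite s0 ltW.
exists d => // y /andP[y1 y2] yd; apply: Hd => //=.
by rewrite in_itv /= y2 (le_trans s0).
Qed.

Lemma N2_coef p : (forall i, (i < N)%N -> (size (p i) <= k.+1)%N) ->
  N2 b (glue N x p) = \sum_(i < N) \sum_(j < k.+1) \sum_(l < k.+1) (p i)`_j * (p i)`_l *
     I (x i) (x i.+1) (fun s => s ^+ j * s ^+ l).
Proof.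
move=> sp; rewrite (N2_glue mx); apply: eq_bigr => i _.
by rewrite -(I_poly2 _ _ (sp i (ltn_ord i)) (sp i (ltn_ord i))); apply: eq_I => s _; rewrite expr2.
Qed.

(** Increments divided by the step recover the norm of the time derivative, so bounds on increments
    pass to [pit] without any second derivative in time. *)
Lemma N2_quot s : 0 <= s < T ->
  N2 b (glue N x (Dpi k x S u th s)) / th ^+ 2 @[th --> 0^'+] --> N2 b (glue N x (pit k x S ut s)).
Proof.
move=> sT; have /andP[s0 sT'] := sT.
rewrite N2_coef; last by move=> i; apply: (size_pit ut hS); rewrite s0 ltW.
apply: (@cvg_trans _ ((fun th => \sum_(i < N) \sum_(j < k.+1) \sum_(l < k.+1)
   ((Dpi k x S u th s i)`_j / th) * ((Dpi k x S u th s i)`_l / th) *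
     I (x i) (x i.+1) (fun s => s ^+ j * s ^+ l)) @ 0^'+)); last first.
  apply: cvg_sum_ord => i; apply: cvg_sum_ord => j; apply: cvg_sum_ord => l.
  apply: cvgM; last exact: cvg_cst.
  by apply: cvgM; exact: quot_coef.
apply: near_eq_cvg; near=> th.
have th0 : 0 < th by [].
have thT : th < T - s by near: th; apply: nbhs_right_lt; rewrite subr_gt0.
rewrite N2_coef; last first.
  move=> i iN; have [sz _] := Dpi_pdiff K1 mx hS F (ltW th0) iN.
  by have [] : _ /\ _ := sz s _; rewrite ?s0 ?lerBrDr// -lerBrDl ltW.
rewrite mulr_suml; apply: eq_bigr => i _; rewrite mulr_suml; apply: eq_bigr => j _.
rewrite mulr_suml; apply: eq_bigr => l _; by field; rewrite gt_eqF.
Unshelve. all: by end_near. Qed.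

End Limit.

(** * Continuity in time of the broken H^1 error *)

Section Continuity.
Context {R : realType}.
Variables (k N : nat) (b T K : R) (x : nat -> R) (Ub : R -> R) (S : hdg_fields R).
Variables (u ut ur : R -> R -> R).
Hypotheses (k1 : (1 <= k)%N) (b0 : 0 < b) (T0 : 0 < T) (K1 : 1 <= K) (mx : mesh b N x).
Hypotheses (hS : hdg_solution T k N x Ub S) (F : exact_facts k b T K Ub u ut ur).
Implicit Types (t s r th : R) (i : nat) (p q phi : nat -> {poly R}) (v f : R -> R).

Let K0 : 0 <= K. Proof. exact: le_trans ler01 K1. Qed.

Lemma N2_close f v M D : bmf 0 b f -> bmf 0 b v -> 0 <= D ->
  (forall s, 0 < s < b -> `|v s| <= M) -> (forall s, 0 < s < b -> `|f s - v s| <= D) ->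
  `|N2 b f - N2 b v| <= D * (2 * M + D) * b.
Proof.
move=> bf bv D0 vM fD; have b2 : 0 < b / 2 < b by rewrite divr_gt0//= ltr_pdivrMr// ltr_pMr// ltr1n.
have M0 : 0 <= M by apply: le_trans (vM _ b2).
have e c : I 0 b (fun=> c) = c * b by rewrite (I_cst _ (ltW b0)) subr0.
rewrite -I_B; [|exact: bmfX..].
have bd := bmfB (bmfX 2 bf) (bmfX 2 bv).
have pt s : 0 < s < b -> `|f s ^+ 2 - v s ^+ 2| <= D * (2 * M + D).
  move=> sb; have h1 := vM s sb; have h2 := fD s sb.
  have -> : f s ^+ 2 - v s ^+ 2 = (f s - v s) * (2 * v s + (f s - v s)) by ring.
  rewrite normrM ler_pM// (le_trans (ler_normD _ _))// normrM (ger0_norm (_ : 0 <= 2))//.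
  by rewrite lerD// ler_wpM2l.
rewrite ler_norml -mulNr -!e; apply/andP; split; apply: le_I => //; try exact: bmf_cst.
  by move=> s /pt; rewrite ler_norml => /andP[].
by move=> s /pt; rewrite ler_norml => /andP[].
Qed.

Lemma coef_cont i j : (i < N)%N -> {within `[0, T], continuous (fun t => (uh S t i)`_j)}.
Proof. by move=> iN; have [_ /(_ j)[]] := uh_pdiff hS iN. Qed.

Lemma uh_cont i r : (i < N)%N -> {within `[0, T], continuous (fun t => (uh S t i).[r])}.
Proof.
move=> iN; apply: (near_within (f := fun t => \sum_(j < k.+1) r ^+ j * (uh S t i)`_j)).
  by apply: within_sum => j; apply: within_Z; exact: coef_cont.
move=> t tT; rewrite (horner_coef_wide _ (size_uh hS tT iN)).
by apply: eq_bigr => j _; rewrite mulrC.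
Qed.

Lemma duh_cont i t e : (i < N)%N -> 0 <= t <= T -> 0 < e ->
  exists2 d, 0 < d & forall s, 0 <= s <= T -> `|s - t| < d ->
    forall r, 0 <= r <= b -> `|((uh S s i)^`()).[r] - ((uh S t i)^`()).[r]| <= e.
Proof.
move=> iN tT e0.
pose G s := \sum_(j < k.+1) `|((uh S s i)`_j.+1 - (uh S t i)`_j.+1) *+ j.+1| * b ^+ j.
have cG : {within `[0, T], continuous G}.
  apply: within_sum => j y; apply: cvgM; last exact: cvg_cst.
  have cc := coef_cont (j := j.+1) iN.
  by apply: cvg_norm; apply: cvgMn; apply: cvgB; [exact: cc|exact: cvg_cst].
have [d d0 Hd] := within_eps cG tT e0; exists d => // s sT st r /andP[r0 rb].
have := Hd s sT st; have -> : G t = 0.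
  by rewrite /G big1// => j _; rewrite subrr mul0rn normr0 mul0r.
rewrite subr0 => h; apply: le_trans (le_trans (ler_norm _) h).
have sz y : 0 <= y <= T -> (size (uh S y i)^`() <= k.+1)%N.
  move=> yT; apply: leq_trans (leq_trans (size_poly _ _) (leq_pred _)) _.
  exact: (size_uh hS yT iN).
rewrite (horner_coef_wide _ (sz s sT)) (horner_coef_wide _ (sz t tT)) -sumrB.
apply: le_trans (ler_norm_sum _ _ _) _; apply: ler_sum => j _.
rewrite !coef_deriv -mulrBl -mulrnBl normrM ler_wpM2l// normrX (ger0_norm r0).
by rewrite lerXn2r ?nnegrE// (le_trans r0).
Qed.

Lemma duh_cont_all n t e : (n <= N)%N -> 0 <= t <= T -> 0 < e ->
  exists2 d, 0 < d & forall s i, (i < n)%N -> 0 <= s <= T -> `|s - t| < d ->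
    forall r, 0 <= r <= b -> `|((uh S s i)^`()).[r] - ((uh S t i)^`()).[r]| <= e.
Proof.
move=> nN tT e0; elim: n nN => [|n ih] nN; first by exists 1.
have [d1 d10 H1] := ih (ltnW nN); have [d2 d20 H2] := duh_cont nN tT e0.
exists (Num.min d1 d2); first by rewrite lt_min d10.
move=> s i; rewrite ltnS leq_eqVlt => /orP[/eqP->|ii] sT; rewrite lt_min => /andP[s1 s2].
  exact: H2.
exact: H1.
Qed.

(** The mesh is fixed and finitely many coefficients are involved; the modulus of continuity may
    depend on the mesh, since the continuity argument is qualitative. *)
Lemma Xt_cont : {within `[0, T], continuous (Xt N b x S u ur)}.
Proof.
have c2 : {within `[0, T], continuous (fun t => \sum_(i < N) jmp N x (uh S t) (u t b) i ^+ 2 / hh x i)}.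
  apply: within_sum => i.
  have iN := ltn_ord i.
  have cj : {within `[0, T], continuous (fun t => jmp N x (uh S t) (u t b) i)}.
    have c1 := uh_cont (r := x i.+1) iN.
    move=> y; apply: cvgB; last exact: c1.
    rewrite /upv; case: ifP => [iN'|_]; first by have c2 := uh_cont (r := x i.+1) iN'; exact: c2.
    move: y; apply: (lip_within (M := K)) => t s tT sT.
    by apply: (ef_Du F) => //; rewrite lexx ltW.
  by move=> y; apply: cvgM; [apply: cvgM; exact: cj|exact: cvg_cst].
suff c1 : {within `[0, T], continuous (fun t => N2 b (err N x (ur t) (dp (uh S t))))}.
  by move=> y; apply: cvgD; [exact: c1|exact: c2].
apply: eps_within => t e tT e0.
have bt t' : 0 <= t' <= T -> bmf 0 b (err N x (ur t') (dp (uh S t'))).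
  by move=> tT'; apply: bmf_err; exact: bmf_gs (ef_state F tT').
have [M M0 HM] := bmf_bound (bt t tT).
have [e1 e10 He1] : exists2 e1, 0 < e1 & forall D, 0 <= D -> D <= e1 -> D * (2 * M + D) * b <= e.
  exists (Num.min 1 (e / ((2 * M + 1) * b))); first by rewrite lt_min ltr01 divr_gt0// mulr_gt0// ltr_wpDl// mulr_ge0.
  move=> D D0; rewrite le_min => /andP[D1 D2]; rewrite -mulrA.
  have q : 0 < (2 * M + 1) * b by rewrite mulr_gt0// ltr_wpDl// mulr_ge0.
  move: D2; rewrite ler_pdivlMr//; apply: le_trans.
  by rewrite ler_wpM2l// ler_wpM2r ?(ltW b0)// lerD2l.
have e20 : 0 < e1 / 2 by rewrite divr_gt0.
have [d d0 Hd] := duh_cont_all (leqnn N) tT e20.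
have Kp : 0 < K := lt_le_trans ltr01 K1.
exists (Num.min d (e1 / 2 / K)); first by rewrite lt_min d0 divr_gt0.
move=> s sT; rewrite lt_min => /andP[s1 s2].
apply: le_trans (N2_close (bt s sT) (bt t tT) (ltW e10) HM _) (He1 _ (ltW e10) (lexx _)).
move=> r rb; rewrite /err.
have -> : ur s r - glue N x (dp (uh S s)) r - (ur t r - glue N x (dp (uh S t)) r) =
  (ur s r - ur t r) - (glue N x (dp (uh S s)) r - glue N x (dp (uh S t)) r) by ring.
rewrite (le_trans (ler_normB _ _))// [leRHS](splitr e1) lerD//.
  apply: le_trans (ef_Dur F sT tT rb) _.
  by move: s2; rewrite ltr_pdivlMr// mulrC => /ltW.
case: (pickP [pred i : 'I_N | x i < r < x i.+1]) => [i /= ri|no].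
  rewrite !(glueE _ mx (ltn_ord i) ri); apply: Hd => //.
  by case/andP: rb => /ltW -> /ltW ->.
rewrite /glue !big1 ?subrr ?normr0 ?(ltW e20)// => i _; by have /= -> := no i; rewrite mul0r.
Qed.

End Continuity.

(** * The broken H^1 error at the initial time *)

Section Initial.
Context {R : realType}.
Variables (k N : nat) (b T K : R) (x : nat -> R) (Ub : R -> R) (S : hdg_fields R).
Variables (u ut ur : R -> R -> R).
Hypotheses (k1 : (1 <= k)%N) (b0 : 0 < b) (T0 : 0 < T) (K1 : 1 <= K) (mx : mesh b N x).
Hypotheses (hS : hdg_solution T k N x Ub S) (F : exact_facts k b T K Ub u ut ur).
Hypothesis init : forall i, (i < N)%N -> gauss_radau k (x i) (x i.+1) (u 0) (uh S 0 i).
Implicit Types (t s r th : R) (i : nat) (p q phi : nat -> {poly R}) (v f : R -> R).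

Let h := mesh_size N x.
Hypothesis h0 : 0 < h.

Let K0 : 0 <= K. Proof. exact: le_trans ler01 K1. Qed.

Lemma taylor_closed t r s : 0 <= t <= T -> 0 < r < b -> 0 <= s <= b ->
  `|u t s - u t r - (s - r) * ur t r| <= K * (s - r) ^+ 2.
Proof.
move=> tT rb sb.
have cf : {within `[0, b], continuous (fun y => u t y - u t r - (y - r) * ur t r)}.
  have cu := lip_within (fun y z yb zb => ef_lip F tT yb zb).
  have ci : {within `[0, b], continuous (fun y : R => y)}.
    by apply: (lip_within (M := 1)) => y z _ _; rewrite mul1r.
  move=> y; apply: cvgB; first by apply: cvgB; [exact: cu|exact: cvg_cst].
  by apply: cvgM; [apply: cvgB; [exact: ci|exact: cvg_cst]|exact: cvg_cst].
have cG : {within `[0, b], continuous (fun y => `|u t y - u t r - (y - r) * ur t r| - K * (y - r) ^+ 2)}.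
  have cq : {within `[0, b], continuous (fun y => (y - r) ^+ 2)}.
    apply: (lip_within (M := 2 * b)) => y z /andP[y0 yb] /andP[z0 zb].
    have -> : (y - r) ^+ 2 - (z - r) ^+ 2 = (y + z - 2 * r) * (y - z) by ring.
    by rewrite normrM ler_wpM2r// ler_norml; case/andP: rb => *; apply/andP; split; lra.
  have cK := within_Z (y := K) cq.
  by move=> y; apply: cvgB; [apply: cvg_norm; exact: cf|exact: cK].
rewrite -subr_le0; apply/ler_addgt0Pr => e e0; rewrite add0r.
have [d d0 Hd] := within_eps cG sb e0.
have [y yb ys] := near_interior b0 sb d0.
have yb' : 0 <= y <= b by case/andP: yb => /ltW -> /ltW ->.
have := Hd y yb' ys; have := ef_C11 F tT rb yb.
have aux (A B C D : R) : A <= B -> `|A - B - (C - D)| <= e -> C - D <= e.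
  by rewrite ler_norml; lra.
exact: aux.
Qed.

Definition C0 : R := b * (2 * K ^+ 2 + 2 * (CI k * (DC k * K) ^+ 2) + ((1 + DC k) * K) ^+ 2).

(** On each element the datum is compared with the Taylor polynomial of degree 1 at the midpoint,
    which [1 <= k] admits; an inverse inequality on the element handles the derivative of the
    difference. *)
Lemma XX_initial : Xt N b x S u ur 0 <= C0 * h ^+ 2.
Proof.
have tT : 0 <= (0 : R) <= T by rewrite lexx ltW.
have G := ef_state F tT; have D0 : 0 <= DC k :> R := DC_ge0 k.
have loc i : (i < N)%N ->
   I (x i) (x i.+1) (fun s => (ur 0 s - ((uh S 0 i)^`()).[s]) ^+ 2)
   + jmp N x (uh S 0) (u 0 b) i ^+ 2 / hh x i <=
   (2 * K ^+ 2 + 2 * (CI k * (DC k * K) ^+ 2) + ((1 + DC k) * K) ^+ 2) * hh x i ^+ 3.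
  move=> iN; have [x0 xi xb hi] := mN mx iN.
  pose r := (x i + x i.+1) / 2.
  have ri : x i < r < x i.+1 by rewrite /r; apply/andP; split; lra.
  have rb : 0 < r < b := mesh_itv_oo mx iN ri.
  pose q : {poly R} := (u 0 r)%:P + (ur 0 r) *: ('X - r%:P).
  have qE s : q.[s] = u 0 r + (s - r) * ur 0 r by rewrite /q !hornerE mulrC.
  have q'E : q^`() = (ur 0 r)%:P by rewrite /q derivD derivC derivZ derivXsubC add0r alg_polyC.
  have sq : (size q <= k.+1)%N.
    apply: leq_trans (_ : 2 <= _)%N; last by [].
    rewrite (leq_trans (size_polyD _ _))// geq_max (leq_trans (size_polyC_leq1 _))//=.
    by rewrite (leq_trans (size_scale_leq _ _))// size_XsubC.
  have near s : x i <= s <= x i.+1 -> `|u 0 s - q.[s]| <= K * hh x i ^+ 2.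
    move=> /andP[s1 s2]; rewrite qE opprD addrA; apply: le_trans (taylor_closed tT rb _) _.
      by rewrite (le_trans x0)// (le_trans s2).
    rewrite ler_wpM2l// -[leLHS]real_normK ?num_real// lerXn2r ?nnegrE ?(ltW hi)//.
    by move: ri => /andP[r1 r2]; rewrite /hh ler_norml; apply/andP; split; lra.
  have nuh s : x i <= s <= x i.+1 -> `|(uh S 0 i).[s] - q.[s]| <= DC k * (K * hh x i ^+ 2).
    by move=> si; exact: (uh0_near k1 T0 mx hS F init iN sq near si).
  have hn0 : hh x i != 0 by rewrite gt_eqF.
  have M0 : 0 <= DC k * (K * hh x i ^+ 2) := mulr_ge0 D0 (mulr_ge0 K0 (sqr_ge0 _)).
  have sp := size_uh hS tT iN.
  have jm : jmp N x (uh S 0) (u 0 b) i ^+ 2 / hh x i <= ((1 + DC k) * K) ^+ 2 * hh x i ^+ 3.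
    (* The Gauss-Radau datum equals u at every left node, and at b the exact boundary value is used,
       so the upwind trace is exact. *)
    have e : upv N x (uh S 0) (u 0 b) i.+1 = u 0 (x i.+1).
      rewrite /upv; case: ifP => [iN'|/negbT]; first by have [_ _ ->] := init iN'.
      rewrite -leqNgt => Ni; have [_ xN _] := mx.
      by rewrite (_ : i.+1 = N) ?xN//; apply/eqP; rewrite eqn_leq iN.
    have hj : `|jmp N x (uh S 0) (u 0 b) i| <= (1 + DC k) * K * hh x i ^+ 2.
      have si : x i <= x i.+1 <= x i.+1 by rewrite lexx ltW.
      rewrite /jmp e (_ : u 0 (x i.+1) - (uh S 0 i).[x i.+1] =
        (u 0 (x i.+1) - q.[x i.+1]) - ((uh S 0 i).[x i.+1] - q.[x i.+1])); last by ring.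
      rewrite (le_trans (ler_normB _ _))// mulrDl mul1r mulrDl lerD ?near//.
      by rewrite -mulrA nuh.
    have -> : ((1 + DC k) * K) ^+ 2 * hh x i ^+ 3 = ((1 + DC k) * K * hh x i ^+ 2) ^+ 2 / hh x i.
      by field.
    rewrite ler_pM2r ?invr_gt0// -[leLHS]real_normK ?num_real// lerXn2r ?nnegrE ?normr_ge0//.
    by rewrite (le_trans _ hj).
  have bd : bmf (x i) (x i.+1) (ur 0) := bmf_sub x0 xb (bmf_gs G).
  have bp (v : {poly R}) : bmf (x i) (x i.+1) (fun s => v.[s]) by exact: bmf_poly.
  pose w := uh S 0 i - q.
  have sw : (size w <= k.+1)%N.
    by rewrite (leq_trans (size_polyD _ _))// size_polyN geq_max sp.
  have Iw : I (x i) (x i.+1) (fun s => w.[s] ^+ 2) <= (DC k * K) ^+ 2 * hh x i ^+ 5.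
    have -> : (DC k * K) ^+ 2 * hh x i ^+ 5 = I (x i) (x i.+1) (fun=> (DC k * (K * hh x i ^+ 2)) ^+ 2).
      by rewrite (I_cst _ (ltW xi)) -/(hh x i); ring.
    apply: le_I; [exact: bmfX|exact: bmf_cst|] => s /andP[s1 s2].
    rewrite /w hornerD hornerN -[leLHS]real_normK ?num_real// lerXn2r ?nnegrE//.
    by apply: nuh; rewrite !ltW.
  have Iw' : hh x i ^+ 2 * I (x i) (x i.+1) (fun s => (w^`()).[s] ^+ 2) <= CI k * I (x i) (x i.+1) (fun s => w.[s] ^+ 2).
    by exact: (inverse_N2 (k := k) mx (p := fun=> w) iN sw).
  have Iw2 : I (x i) (x i.+1) (fun s => (w^`()).[s] ^+ 2) <= CI k * (DC k * K) ^+ 2 * hh x i ^+ 3.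
    have h2 : 0 < hh x i ^+ 2 by rewrite exprn_gt0.
    rewrite -(ler_pM2l h2); apply: le_trans Iw' _.
    have -> : hh x i ^+ 2 * (CI k * (DC k * K) ^+ 2 * hh x i ^+ 3) = CI k * ((DC k * K) ^+ 2 * hh x i ^+ 5) by ring.
    by rewrite ler_wpM2l// CI_ge0.
  have Iu : I (x i) (x i.+1) (fun s => (ur 0 s - ur 0 r) ^+ 2) <= K ^+ 2 * hh x i ^+ 3.
    have -> : K ^+ 2 * hh x i ^+ 3 = I (x i) (x i.+1) (fun=> (K * hh x i) ^+ 2).
      by rewrite (I_cst _ (ltW xi)) -/(hh x i); ring.
    apply: le_I; [by apply: bmfX; apply: bmfB => //; exact: bmf_cst|exact: bmf_cst|] => s si.
    rewrite -[leLHS]real_normK ?num_real// lerXn2r ?nnegrE ?mulr_ge0 ?(ltW hi)//.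
    apply: le_trans (ef_url F tT (mesh_itv_oo mx iN si) rb) _; rewrite ler_wpM2l//.
    by move: si ri => /andP[s1 s2] /andP[r1 r2]; rewrite /hh ler_norml; apply/andP; split; lra.
  have b1 : bmf (x i) (x i.+1) (fun s => ur 0 s - ur 0 r) by apply: bmfB => //; exact: bmf_cst.
  have split : I (x i) (x i.+1) (fun s => (ur 0 s - ((uh S 0 i)^`()).[s]) ^+ 2) <=
      2 * I (x i) (x i.+1) (fun s => (ur 0 s - ur 0 r) ^+ 2) + 2 * I (x i) (x i.+1) (fun s => (w^`()).[s] ^+ 2).
    have -> : I (x i) (x i.+1) (fun s => (w^`()).[s] ^+ 2) = I (x i) (x i.+1) (fun s => (- (w^`()).[s]) ^+ 2).
      by apply: eq_I => s _; rewrite sqrrN.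
    rewrite (@eq_I _ _ _ _ (fun s => ((ur 0 s - ur 0 r) + - (w^`()).[s]) ^+ 2)); last first.
      by move=> s _; rewrite /w derivB q'E hornerD hornerN hornerC; congr (_ ^+ 2); ring.
    by apply: I_sqrD => //; apply: bmfN.
  move: jm Iw2 Iu split; move: (_ / hh x i) (I _ _ _) (I _ _ _) (I _ _ _) (hh x i ^+ 3) (CI k * _ ^+ 2) ((_ * K) ^+ 2) (K ^+ 2) => *; lra.
rewrite /Xt /XX (N2_err_sum mx _ (bmf_gs G)) -big_split /=.
apply: le_trans (ler_sum _ (fun (i : 'I_N) (_ : true) => loc i (ltn_ord i))) _.
rewrite -mulr_sumr /C0 [b * _]mulrC -[leRHS]mulrA; apply: ler_wpM2l; last exact: (sum_hh3 mx h0).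
by rewrite addr_ge0 ?sqr_ge0// addr_ge0// mulr_ge0 ?sqr_ge0// mulr_ge0 ?sqr_ge0 ?CI_ge0.
Qed.

End Initial.

(** At the infimum of the times of failure the inequality holds by continuity from the left, the
    hypothesis makes it strict, and continuity from the right contradicts the choice of the
    infimum. *)
Lemma continuation {R : realType} (T : R) (f g : R -> R) :
  {within `[0, T], continuous f} -> {within `[0, T], continuous g} -> f 0 <= g 0 ->
  (forall t, 0 <= t <= T -> (forall s, 0 <= s <= t -> f s <= g s) -> f t < g t) ->
  forall t, 0 <= t <= T -> f t <= g t.
Proof.
move=> cf cg fg0 H t tT; have [//|ft] := leP (f t) (g t); exfalso.
have cD : {within `[0, T], continuous (fun s => g s - f s)}.
  by move=> y; apply: cvgB; [exact: cg|exact: cf].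
pose E := [set s | 0 <= s <= T /\ g s < f s].
have Et : E t by [].
have lE : lbound E 0 by move=> s [/andP[]].
have hE : has_inf E by split; [exists t|exists 0].
pose tau := inf E.
have tau0 : 0 <= tau by exact: (lb_le_inf hE.1 lE).
have tauE s : E s -> tau <= s by move=> Es; apply: ge_inf => //; exists 0.
have tauT : tau <= T by apply: le_trans (tauE _ Et) _; case/andP: tT.
have tT' : 0 <= tau <= T by rewrite tau0.
have below s : 0 <= s < tau -> f s <= g s.
  move=> /andP[s0 st]; have [//|fs] := leP (f s) (g s); exfalso.
  have /tauE : E s by split=> //; rewrite s0 (le_trans (ltW st)).
  by rewrite leNgt st.
have ftau : f tau <= g tau.
  have [//|fs] := leP (f tau) (g tau); exfalso.
  have tp : 0 < tau.
    by rewrite lt0r tau0 andbT; apply/eqP => e; move: fs; rewrite e ltNge fg0.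
  have e0 : 0 < (f tau - g tau) / 2 by rewrite divr_gt0// subr_gt0.
  have [d d0 Hd] := within_eps cD tT' e0.
  pose m := Num.min d tau; have m0 : 0 < m by rewrite lt_min d0.
  have [md mt] : m <= d /\ m <= tau by rewrite /m !ge_min !lexx orbT.
  have sb : 0 <= tau - m / 2 < tau by apply/andP; split; lra.
  have h2 := below _ sb; have := Hd (tau - m / 2).
  have -> : tau - m / 2 - tau = - (m / 2) by ring.
  rewrite normrN gtr0_norm ?divr_gt0// ler_norml => h1.
  have h3 : 0 <= tau - m / 2 <= T /\ m / 2 < d.
    by case/andP: sb => q1 q2; split; [rewrite q1 (le_trans (ltW q2))|lra].
  by have /andP[_] := h1 h3.1 h3.2; lra.
have flt : f tau < g tau.
  apply: H => // s /andP[s0]; rewrite le_eqVlt => /orP[/eqP-> //|st].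
  by apply: below; rewrite s0.
have e0 : 0 < (g tau - f tau) / 2 by rewrite divr_gt0// subr_gt0.
have [d d0 Hd] := within_eps cD tT' e0.
have [s [sT fs] sd] := inf_adherent d0 hE.
have st : tau <= s by exact: tauE.
have := Hd s sT; rewrite ger0_norm ?subr_ge0// ltrBlDl => /(_ sd).
by rewrite ler_norml; lra.
Qed.

(** * The continuity argument in time and the mass error *)

Section Bootstrap.
Context {R : realType}.
Variables (k N : nat) (b T K : R) (x : nat -> R) (Ub : R -> R) (S : hdg_fields R).
Variables (u ut ur : R -> R -> R).
Hypotheses (k1 : (1 <= k)%N) (b0 : 0 < b) (T0 : 0 < T) (K1 : 1 <= K).

Let K0 : 0 <= K. Proof. exact: le_trans ler01 K1. Qed.

(** [LL] dominates the initial value and twice the constant of the improved bound. [lam] is fixed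
    afterwards and exceeds the rate [C3] by more than the forcing constant [C4 k b K * (1 + LL)].
    [h_max] makes the bound at most 1/32 up to T, so that [del] has norm at most 1. *)
Definition LL : R := 2 * (CR k b K * (CB k b K * C0 k b K + 2 + CE k b T K)) + 2 * C0 k b K + 1.
Definition lam : R := C3 k b K + (C4 k b K * (1 + LL) + 1).
Definition h_max : R := Num.min 1 ((32 * LL * expR (lam * T))^-1).

Lemma PP_ge0 : 0 <= PP k b K.
Proof.
rewrite addr_ge0// mulr_ge0 ?(le_trans ler01 (Dk_ge1 k))//.
  by rewrite mulr_ge0 ?CDl_ge0// addr_ge0 ?sqr_ge0.
exact: CSS_ge0.
Qed.

Lemma g_ge0 : 0 <= CG b K * (1 + CI k).
Proof. by rewrite mulr_ge0 ?CG_ge0// addr_ge0 ?CI_ge0. Qed.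

Lemma C3_ge0 : 0 <= C3 k b K.
Proof. by rewrite !addr_ge0// mulr_ge0 ?PP_ge0 ?g_ge0. Qed.

Lemma C4_ge0 : 0 <= C4 k b K.
Proof.
have e0 : 0 <= E0 k b K by rewrite mulr_ge0 ?sqr_ge0 ?(ltW b0).
have d0 : 0 <= Dk k * K ^+ 2 by rewrite mulr_ge0 ?sqr_ge0 ?(le_trans ler01 (Dk_ge1 k)).
have := g_ge0; have := PP_ge0; rewrite /C4; move: (E0 _ _ _) (Dk k * _) (CG b K * _) (PP _ _ _) e0 d0 => e d p g *.
by rewrite !addr_ge0// !mulr_ge0.
Qed.

Lemma C0_ge0 : 0 <= C0 k b K.
Proof.
by rewrite mulr_ge0 ?(ltW b0)// addr_ge0 ?sqr_ge0// addr_ge0// mulr_ge0 ?sqr_ge0// mulr_ge0 ?sqr_ge0 ?CI_ge0.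
Qed.

Lemma CR_ge0 : 0 <= CR k b K.
Proof.
rewrite mulr_ge0 ?CX0_ge0// addr_ge0//; first by rewrite addr_ge0// mulr_ge0 ?sqr_ge0 ?(ltW b0).
by rewrite mulr_ge0// CS_ge0.
Qed.

Lemma rhs_ge0 : 0 <= CR k b K * (CB k b K * C0 k b K + 2 + CE k b T K).
Proof.
rewrite mulr_ge0 ?CR_ge0// addr_ge0 ?CE_ge0// addr_ge0// mulr_ge0 ?C0_ge0// CB_ge0//.
Qed.

Lemma LL_ge1 : 1 <= LL.
Proof. have := rhs_ge0; have := C0_ge0; rewrite /LL; lra. Qed.

Lemma h_max_gt0 : 0 < h_max.
Proof.
by rewrite lt_min ltr01 invr_gt0 !mulr_gt0 ?expR_gt0// (lt_le_trans ltr01 LL_ge1).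
Qed.

Hypotheses (mx : mesh b N x).
Hypotheses (hS : hdg_solution T k N x Ub S) (F : exact_facts k b T K Ub u ut ur).
Hypothesis init : forall i, (i < N)%N -> gauss_radau k (x i) (x i.+1) (u 0) (uh S 0 i).
Implicit Types (t s r th : R) (i : nat) (p q phi : nat -> {poly R}) (v f : R -> R).

Let h := mesh_size N x.
Hypotheses (h0 : 0 < h) (hm : h <= h_max).

Definition bound t : R := LL * h * expR (lam * t).

Let h1 : h <= 1.
Proof. by move: hm; rewrite le_min => /andP[]. Qed.

Let lam_ge0 : 0 <= lam.
Proof.
have := C3_ge0; have := C4_ge0; have := LL_ge1 => l c4 c3.
by rewrite addr_ge0// addr_ge0// mulr_ge0// addr_ge0// (le_trans ler01 l).
Qed.

Lemma bound_small t : t <= T -> bound t <= 32^-1.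
Proof.
move=> tT; have L0 := lt_le_trans ltr01 LL_ge1.
have e0 : 0 < LL * expR (lam * T) by rewrite mulr_gt0 ?expR_gt0.
apply: (@le_trans _ _ (LL * h * expR (lam * T))).
  by rewrite ler_wpM2l ?ler_expR ?ler_wpM2l// mulr_ge0 ?(ltW L0) ?(ltW h0).
move: hm; rewrite le_min => /andP[_]; rewrite -mulrA invfM => hh.
rewrite ler_pdivlMr// in hh; apply: le_trans hh.
by rewrite -mulrA mulrCA.
Qed.

Section Improve.
Variable t : R.
Hypothesis tT : 0 <= t <= T.
Hypothesis Xb : forall s, 0 <= s <= t -> Xt N b x S u ur s <= bound s.

Let Xs s : 0 <= s <= t -> Xt N b x S u ur s <= 32^-1.
Proof.
move=> st; apply: le_trans (Xb st) _; apply: bound_small.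
by case/andP: st tT => _ h2 /andP[_]; exact: le_trans h2.
Qed.

Let sub s : 0 <= s <= t -> 0 <= s <= T.
Proof. by move=> /andP[-> /le_trans]; apply; case/andP: tT. Qed.

(** Gronwall for squared increments over the squared step; the constants do not depend on the step,
    so it may tend to 0. *)
Lemma Dpi_bound th s : 0 < th -> 0 <= s -> s + th <= t ->
  N2 b (glue N x (Dpi k x S u th s)) / th ^+ 2 <=
  expR (lam * s) * (N2 b (glue N x (Dpi k x S u th 0)) / th ^+ 2 + h).
Proof.
move=> th0 s0 st; have L1 := LL_ge1; have [t0 tT'] := andP tT.
have [cf df] := N2_pdiff mx (Dpi_pdiff K1 mx hS F (ltW th0)).
have sub1 : t - th <= T - th by rewrite lerB.
have cf' : {within `[0, t - th], continuous (fun s => N2 b (glue N x (Dpi k x S u th s)))}.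
  by apply: continuous_subspaceW cf => y; rewrite /= !in_itv /= => /andP[-> /le_trans]; apply.
have th2 : 0 < th ^+ 2 by rewrite exprn_gt0.
have c4L : 0 <= C4 k b K * (1 + LL) by rewrite mulr_ge0 ?C4_ge0// addr_ge0// (le_trans ler01).
have m0 : 0 <= C4 k b K * (1 + LL) * h * th ^+ 2 := mulr_ge0 (mulr_ge0 c4L (ltW h0)) (ltW th2).
have lC : C3 k b K < lam by rewrite /lam ltrDl ltr_wpDl.
have st' : 0 <= s <= t - th by rewrite s0 lerBrDr.
have G := gronwall m0 C3_ge0 lC cf' _ _ (N2_ge0 _ _) st'.
rewrite ler_pdivrMr//; apply: le_trans (G _ _ _) _.
- move=> y /andP[y0 yt]; apply: df; rewrite y0 (lt_le_trans yt)//.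
- move=> y /andP[y0 yt]; rewrite ltrBrDr in yt.
  have yt' : y <= t by rewrite (le_trans _ (ltW yt))// lerDl ltW.
  have X1 : 0 <= y <= t by rewrite (ltW y0).
  apply: le_trans (time_difference_ineq b0 K1 mx hS F h0 h1 (ltW th0) (ltW y0) _ (Xs X1) (Xs _)) _.
  + by rewrite (le_trans (ltW yt)).
  + by rewrite addr_ge0 ?(ltW y0) ?(ltW th0)//= ltW.
  have -> : C4 k b K * (1 + LL) * h * th ^+ 2 * expR (lam * y) =
    C4 k b K * (th ^+ 2 * ((1 + LL) * (h * expR (lam * y)))) by ring.
  rewrite lerD2l; apply: ler_wpM2l; first exact: C4_ge0.
  apply: ler_wpM2l; first exact: ltW.
  have e1 : 1 <= expR (lam * y) by rewrite -expR0 ler_expR mulr_ge0// ltW.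
  have := Xb X1; have := ler_wpM2l (ltW h0) e1; rewrite /bound mulr1 -/h.
  by move: (expR _) (Xt _ _ _ _ _ _ _) => z X; lra.
rewrite -[leRHS]mulrA; apply: ler_wpM2l; first exact: expR_ge0.
rewrite [leRHS]mulrDl divfK ?gt_eqF// lerD2l.
(* By this choice of [lam] the forcing contributes at most h, whatever the size of [LL]. *)
have -> : lam - C3 k b K = C4 k b K * (1 + LL) + 1 by rewrite /lam addrC addKr.
have ht : 0 <= h * th ^+ 2 := mulr_ge0 (ltW h0) (ltW th2).
move: (C4 k b K * (1 + LL)) c4L => c c4L; rewrite ler_pdivrMr ?ltr_wpDl//.
by rewrite mulrDr mulr1 -mulrA mulrC lerDl.
Qed.

(** The limit of [Dpi_bound] for a vanishing step; the strict inequality leaves room for the step,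
    and the value at time 0 comes from the initial X. *)
Lemma pit_bound s : 0 <= s < t ->
  N2 b (glue N x (pit k x S ut s)) <= expR (lam * s) * (CB k b K * C0 k b K + 1) * h.
Proof.
move=> /andP[s0 st]; have [t0 tT'] := andP tT; have tp : 0 < t := le_lt_trans s0 st.
have sT : 0 <= s < T by rewrite s0 (lt_le_trans st).
have zT : 0 <= (0 : R) < T by rewrite lexx.
have c1 := N2_quot K1 mx hS F sT.
have c2 : expR (lam * s) * (N2 b (glue N x (Dpi k x S u th 0)) / th ^+ 2 + h) @[th --> 0^'+]
    --> expR (lam * s) * (N2 b (glue N x (pit k x S ut 0)) + h).
  apply: cvgM; first exact: cvg_cst.
  by apply: cvgD; [exact: (N2_quot K1 mx hS F zT)|exact: cvg_cst].
apply: (@le_trans _ _ (expR (lam * s) * (N2 b (glue N x (pit k x S ut 0)) + h))).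
  apply: (ler_cvg_to c1 c2); near=> th.
  have th0 : 0 < th by [].
  have tht : th < t - s by near: th; apply: nbhs_right_lt; rewrite subr_gt0.
  by apply: Dpi_bound => //; rewrite -lerBrDl ltW.
rewrite -mulrA; apply: ler_wpM2l; first exact: expR_ge0.
rewrite [leRHS]mulrDl mul1r lerD2r -mulrA.
have z0 : 0 <= (0 : R) <= t by rewrite lexx.
apply: le_trans (N2_pit_le_XX b0 K1 mx hS F (sub z0) (Xt_del b0 mx F (sub z0) (Xs z0))) _.
apply: ler_wpM2l; first exact: CB_ge0.
apply: le_trans (XX_initial k1 b0 T0 K1 mx hS F init h0) _; apply: ler_wpM2l; first exact: C0_ge0.
by rewrite -/h expr2 ler_piMl// ltW.
Unshelve. all: by end_near. Qed.

(** Recovery turns the bounds on the time derivative and on the L^2 error into one on X whose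
    constant does not contain [LL]; [LL] is more than twice that constant. *)
Lemma XX_improved s : 0 <= s < t -> Xt N b x S u ur s <= 2^-1 * bound s.
Proof.
move=> st; have /andP[s0 st'] := st; have s0t : 0 <= s <= t by rewrite s0 ltW.
apply: le_trans (XX_recovery k1 b0 K1 mx hS F h0 (sub s0t) (Xt_del b0 mx F (sub s0t) (Xs s0t))) _.
have e1 : N2 b (err N x (u s) (uh S s)) <= CE k b T K * h.
  apply: le_trans (L2_error k1 b0 T0 K1 mx hS F h0 init tT _ s0t) _.
    move=> y /andP[y0 yt]; have y0t : 0 <= y <= t by rewrite y0 ltW.
    exact: (Xt_del b0 mx F (sub y0t) (Xs y0t)).
  apply: ler_wpM2l; first exact: CE_ge0.
  have hk : h ^+ k.+1 <= h by rewrite exprS ler_piMr ?(ltW h0)// exprn_ile1// ltW.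
  have hk0 : 0 <= h ^+ k.+1 by rewrite exprn_ge0// ltW.
  by rewrite -/h expr2 (le_trans (ler_pM hk0 hk0 hk (le_trans hk h1)))// mulr1.
have e2 : h ^+ 2 <= h by rewrite expr2 ler_piMr// ltW.
have e3 := pit_bound st.
have e4 : 1 <= expR (lam * s) by rewrite -expR0 ler_expR mulr_ge0.
apply: (@le_trans _ _ (CR k b K * (expR (lam * s) * ((CB k b K * C0 k b K + 2 + CE k b T K) * h)))).
  apply: ler_wpM2l; first exact: CR_ge0.
  have c0 : 0 <= CE k b T K by exact: CE_ge0.
  have q1 : (1 + CE k b T K) * h <= expR (lam * s) * ((1 + CE k b T K) * h).
    by rewrite ler_peMl// mulr_ge0 ?(ltW h0)// addr_ge0.
  move: e1 e2 e3 q1; rewrite -/h; move: (N2 _ _) (N2 _ _) (h ^+ 2) (expR _) (CE _ _ _ _) (CB _ _ _ * _) => *; lra.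
have q2 : 0 <= h * expR (lam * s) by rewrite mulr_ge0 ?expR_ge0// ltW.
rewrite /bound /LL; have := C0_ge0; move: (C0 k b K) (CR k b K) (CB k b K * _ + _ + _) => c r z c0.
have := mulr_ge0 c0 q2; move: (expR _) q2 => e; lra.
Qed.

(** The improved bound holds before t and passes to t by continuity; at t = 0, where there is no
    earlier time, the initial estimate takes its place. *)
Lemma XX_strict : Xt N b x S u ur t < bound t.
Proof.
have B0 : 0 < bound t by rewrite !mulr_gt0 ?expR_gt0// (lt_le_trans ltr01 LL_ge1).
have [t0 tT'] := andP tT.
move: (t0); rewrite le_eqVlt => /orP[/eqP te|tp].
  rewrite -te; apply: le_lt_trans (XX_initial k1 b0 T0 K1 mx hS F init h0) _.
  rewrite /bound mulr0 expR0 mulr1; apply: (@le_lt_trans _ _ (C0 k b K * h)).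
    by apply: ler_wpM2l; [exact: C0_ge0|rewrite -/h expr2 ler_piMl// ltW].
  rewrite ltr_pM2r// /LL; have := rhs_ge0; have := C0_ge0; move: (C0 _ _ _) (CR _ _ _ * _) => *; lra.
suff : Xt N b x S u ur t <= 2^-1 * bound t by move=> h2; apply: le_lt_trans h2 _; lra.
apply/ler_addgt0Pr => e e0.
have [d d0 Hd] := within_eps (Xt_cont b0 K1 mx hS F) tT e0.
pose m := Num.min d t; have m0 : 0 < m by rewrite lt_min d0.
have [md mt] : m <= d /\ m <= t by rewrite /m !ge_min !lexx orbT.
have sb : 0 <= t - m / 2 < t by apply/andP; split; lra.
have sT : 0 <= t - m / 2 <= T by case/andP: sb => q1 q2; rewrite q1 (le_trans (ltW q2)).
have := Hd _ sT; have -> : t - m / 2 - t = - (m / 2) by ring.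
rewrite normrN gtr0_norm ?divr_gt0// ler_norml => h2.
have md2 : m / 2 < d by lra.
have h3 := XX_improved sb.
have h4 : bound (t - m / 2) <= bound t.
  rewrite /bound ler_wpM2l ?ler_expR ?ler_wpM2l//; last by lra.
  by rewrite mulr_ge0 ?(ltW h0)// (le_trans ler01 LL_ge1).
have /andP[h5 _] := h2 md2; move: h3 h4 h5; move: (Xt _ _ _ _ _ _ _) (Xt _ _ _ _ _ _ _) (bound _) (bound _) => *; lra.
Qed.

End Improve.

Lemma N2_del_le1 t : 0 <= t <= T -> N2 b (del N x (u t) (uh S t)) <= 1.
Proof.
move=> tT; apply: (Xt_del b0 mx F tT).
apply: (@le_trans _ _ (bound t)); last by apply: bound_small; case/andP: tT.
apply: (continuation (f := Xt N b x S u ur) (g := bound) (Xt_cont b0 K1 mx hS F) _ _ XX_strict tT).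
  apply: continuous_subspaceT => y; apply: cvgM; first exact: cvg_cst.
  apply: (@continuous_comp _ _ _ (fun s => lam * s) expR); last exact: continuous_expR.
  by apply: cvgM; [exact: cvg_cst|exact: cvg_id].
apply: le_trans (XX_initial k1 b0 T0 K1 mx hS F init h0) _.
rewrite /bound mulr0 expR0 mulr1; apply: (@le_trans _ _ (C0 k b K * h)).
  by apply: ler_wpM2l; [exact: C0_ge0|rewrite -/h expr2 ler_piMl// ltW].
rewrite ler_pM2r// /LL; have := rhs_ge0; have := C0_ge0; move: (C0 _ _ _) (CR _ _ _ * _) => *; lra.
Qed.

Definition CM : R := b / 2 * Num.sqrt (CE k b T K * (8 * (K ^+ 2 * b) + 2)).

Lemma mass_error t : 0 <= t <= T ->
  `|b / 2 * (1 - gt b (u t) b) - b / 2 * (1 - gt b (glue N x (uh S t)) b)| <= CM * h ^+ k.+1.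
Proof.
move=> tT; have G := ef_state F tT; have A1 := N2_del_le1 tT.
have bb : 0 < b <= b by rewrite b0 lexx.
have hk0 : 0 <= h ^+ k.+1 by rewrite exprn_ge0// ltW.
have M0 : 0 <= 8 * (K ^+ 2 * b) + 2 by rewrite addr_ge0// mulr_ge0// mulr_ge0 ?sqr_ge0// ltW.
have g1 : `|gt b (u t) b - gt b (glue N x (uh S t)) b| <= gerr N b K x (u t) (uh S t).
  apply: (gt_cmp (gs_adm G) (adm_glue _ b0 mx) _ bb) => r rb.
  exact: (gg_err b0 mx K1 G A1 rb).
have -> : b / 2 * (1 - gt b (u t) b) - b / 2 * (1 - gt b (glue N x (uh S t)) b) =
  - (b / 2) * (gt b (u t) b - gt b (glue N x (uh S t)) b).
  by move: (gt _ _ _) (gt _ _ _) => *; ring.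
rewrite normrM normrN (gtr0_norm (_ : 0 < b / 2)) ?divr_gt0// /CM -mulrA.
apply: ler_wpM2l; first by rewrite divr_ge0// ltW.
apply: le_trans g1 _; rewrite /gerr.
have -> : h ^+ k.+1 = Num.sqrt ((h ^+ k.+1) ^+ 2) by rewrite sqrtr_sqr ger0_norm.
rewrite -sqrtrM; last first.
  by rewrite mulr_ge0 ?CE_ge0.
rewrite ler_sqrt; last by rewrite mulr_ge0 ?sqr_ge0// mulr_ge0 ?CE_ge0.
rewrite [leRHS]mulrAC; apply: ler_wpM2r => //.
apply: le_trans (N2_dVV_le_err mx (uh S t) G) _.
(* Smallness now holds on all of [0, T], so the L^2 estimate applies up to the final time. *)
have TT : 0 <= T <= T by rewrite lexx ltW.
apply: (L2_error k1 b0 T0 K1 mx hS F h0 init TT _ tT) => y /andP[y0 yT].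
by apply: N2_del_le1; rewrite y0 ltW.
Qed.

End Bootstrap.

Theorem corollary4p6 (R : realType) (k : nat) (b T : R) (Ub : R -> R)
    (u ut w g z : R -> R -> R) :
  (1 <= k)%N -> 0 < b -> 0 < T ->
  exact_solution T b Ub u ut w g z ->
  Linfty_sobolev T b k.+1 +oo%E u ->
  Linfty_sobolev T b k.+1 2%:E ut ->
  exists h0 C : R, 0 < h0 /\ 0 < C /\
    forall (N : nat) (x : nat -> R) (S : hdg_fields R),
      mesh b N x ->
      0 < mesh_size N x <= h0 ->
      hdg_solution T k N x Ub S ->
      (forall i, (i < N)%N ->
         gauss_radau k (x i) (x i.+1) (u 0) (uh S 0 i)) ->
      (ereal_sup [set `|mass_aspect g z t b
                        - discrete_mass_aspect S t N.-1 b|%:E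
                     | t in [set t | (0 <= t <= T)%R]]
        <= (C * mesh_size N x ^+ k.+1)%:E)%E.
Proof.
move=> k1 b0 T0 ex hu hut; have [K K1 F] := exact_factsP k1 b0 T0 ex hu hut.
exists (h_max k b T K), (CM k b T K + 1); split; first exact: h_max_gt0.
have CM0 : 0 <= CM k b T K by rewrite mulr_ge0 ?sqrtr_ge0// divr_ge0// ltW.
split; first by rewrite ltr_wpDl.
move=> N x S mx /andP[h0 hm] hS init.
apply: ge_ereal_sup => _ [t tT <-]; rewrite lee_fin.
rewrite (mass_exact b0 T0 ex hu tT) (mass_discrete b0 mx hS tT).
apply: le_trans (mass_error k1 b0 T0 K1 mx hS F init h0 hm tT) _.
by rewrite ler_wpM2r ?exprn_ge0 ?(ltW h0)// lerDl.
Qed.
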